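(* Let $\mathcal{F}$ be a foliation on a manifold $M$ endowed with a transverse generalized complex structure $\mathcal{J}$. The following conditions are equivalent: 1. $\mathcal{F}$ satisfies the basic $dd^{\mathcal{J}}$-lemma. 2. The canonical spectral sequence degenerates at the first page and the subbundles $U^k$ induce a decomposition in cohomology.
   Context: Foliations. $M$ is a smooth $n$-manifold with a foliation $\mathcal{F}$ of dimension $n-2q$ (codimension $2q$), given by an open cover $\{V_i\}_{i\in I}$ of $M$, a $2q$-dimensional smooth manifold $T_0$, submersions $f_i:V_i\to T_0$ with connected fibres, and, whenever $V_i\cap V_j\neq\emptyset$, a local diffeomorphism $\gamma_{ij}$ of $T_0$ with $f_j=\gamma_{ij}\circ f_i$. The transverse manifold is $T=\coprod_i f_i(V_i)$, and the holonomy pseudogroup $\mathcal{H}$ is the pseudogroup on $T$ generated by the $\gamma_{ij}$. A form $\omega$ on $M$ is basic if $i_X\omega=i_Xd\omega=0$ for all vector fields $X$ tangent to the leaves. Basic forms correspond bijectively to $\mathcal{H}$-invariant forms on $T$. $\Omega^\bullet(M/\mathcal{F},\mathbb{C})$ denotes the complex-valued basic forms, a subcomplex of the de Rham complex, and $H^\bullet(M/\mathcal{F},\mathbb{C})$ is its cohomology with respect to $d$. Generalized complex structures. On $T$, the bundle $TT\oplus T^*T$ carries the pairing $(X_1+\alpha_1,X_2+\alpha_2)=\frac12(\alpha_1(X_2)+\alpha_2(X_1))$ and the Courant bracket $$[X_1+\alpha_1,X_2+\alpha_2]=[X_1,X_2]+i_{X_1}d\alpha_2-i_{X_2}d\alpha_1+\tfrac12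 d(\alpha_2(X_1)-\alpha_1(X_2)).$$ A generalized complex structure on $T$ is an almost complex structure $\mathcal{J}$ on the bundle $TT\oplus T^*T$, orthogonal for the pairing, such that $[\mathcal{J}Y_1,\mathcal{J}Y_2]-\mathcal{J}[Y_1,\mathcal{J}Y_2]-\mathcal{J}[\mathcal{J}Y_1,Y_2]+\mathcal{J}^2[Y_1,Y_2]=0$ for all sections $Y_1,Y_2$. A transverse generalized complex structure on $(M,\mathcal{F})$ is a generalized complex structure on $T$ invariant under $\mathcal{H}$. The operators. Let $L\subset(TT\oplus T^*T)\otimes\mathbb{C}$ be the $i$-eigenbundle of $\mathcal{J}$. The Clifford algebra of $(TT\oplus T^*T)\otimes\mathbb{C}$ acts on forms by $(X+\alpha)\bullet\beta=i_X\beta+\alpha\wedge\beta$. There is a unique complex line subbundle $\Phi$ of $\bigoplus_i\wedge^iT^*T\otimes\mathbb{C}$ with $L_x=\{v\in(T_xT\oplus T_x^*T)\otimes\mathbb{C}\mid v\bullet\Phi_x=0\}$ for all $x\in T$. Set $U^{q-k}_x=(\wedge^k\bar L_x)\bullet\Phi_x$ for $0\le k\le 2q$, and $U^j=0$ for $|j|>q$. Then $\bigoplus_i\wedge^iT^*T\otimes\mathbb{C}=\bigoplus_{j=-q}^{q}U^j$, and integrability of $\mathcal{J}$ gives $d=\partial+\bar\partial$ with $\partial:\Gamma(U^j)\to\Gamma(U^{j+1})$ and $\bar\partial:\Gamma(U^j)\to\Gamma(U^{j-1})$. The bundles $U^j$ are $\mathcal{H}$-invariant, so $\partial$ and $\bar\partial$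 preserve $\mathcal{H}$-invariant forms and hence act on basic forms. $\Gamma_b(U^j)$ denotes the space of basic (i.e. $\mathcal{H}$-invariant) sections of $U^j$, so that $\Omega^\bullet(M/\mathcal{F},\mathbb{C})=\bigoplus_j\Gamma_b(U^j)$. Define $d^{\mathcal{J}}=i(\bar\partial-\partial)$. All of $d,d^{\mathcal{J}},\partial,\bar\partial$, and their kernels and images, are taken on $\Omega^\bullet(M/\mathcal{F},\mathbb{C})$. The basic $dd^{\mathcal{J}}$-lemma. $\mathcal{F}$ satisfies the basic $dd^{\mathcal{J}}$-lemma if $$\mathrm{Im}(dd^{\mathcal{J}})=\mathrm{Im}(d)\cap\mathrm{Ker}(d^{\mathcal{J}})=\mathrm{Ker}(d)\cap\mathrm{Im}(d^{\mathcal{J}}).$$ Canonical spectral sequence. This is the spectral sequence associated to the double complex $K^{a,b}=\Gamma_b(U^{a-b})$ ($a,b\in\mathbb{Z}$), with differentials $\bar\partial:K^{a,b}\to K^{a,b+1}$ and $\partial:K^{a,b}\to K^{a+1,b}$, for the filtration whose first page is the cohomology of the double complex with respect to $\partial$. It degenerates at the first page if all differentials on the first and later pages vanish. Decomposition in cohomology. The subbundles $U^k$ induce a decomposition in cohomology if $H^\bullet(M/\mathcal{F},\mathbb{C})=\bigoplus_{k=-q}^{q}H_{U^k}$, where $H_{U^k}$ is the subspace of classes that can be represented by $d$-closed forms in $\Gamma_b(U^k)$. *)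

(* Defs.v *)
From mathcomp Require Import all_boot all_order all_algebra.
From mathcomp Require Import all_classical all_reals all_analysis.
From mathcomp Require Import complex.

Set Implicit Arguments.
Unset Strict Implicit.
Unset Printing Implicit Defensive.

Import Order.TTheory GRing.Theory Num.Theory numFieldNormedType.Exports.

Local Open Scope classical_set_scope.
Local Open Scope ring_scope.

(** * Calculus on open subsets of R^n *)

Section Calculus.
Variables (R : realType) (n : nat).
Implicit Types (W : set 'rV[R]_n) (u : 'rV[R]_n).

Definition pderiv (i : 'I_n) (g : 'rV[R]_n -> R) : 'rV[R]_n -> R :=
  fun u => 'D_(delta_mx 0 i) g u.

Fixpoint iter_pderiv (s : seq 'I_n) (g : 'rV[R]_n -> R) : 'rV[R]_n -> R :=
  if s is i :: s' then pderiv i (iter_pderiv s' g) else g.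

(* [g] is C^oo on the open set [W]; values of [g] outside [W] are irrelevant *)
Definition smooth_on W (g : 'rV[R]_n -> R) : Prop :=
  forall s u, W u -> differentiable (iter_pderiv s g) u.

Definition smooth_mx_on p r W (g : 'rV[R]_n -> 'M[R]_(p, r)) : Prop :=
  forall i j, smooth_on W (fun u => g u i j).

(* The Courant bracket of sections of TT + T*T over an open set of R^n; a
   section is a row vector (X, alpha), with coefficients in the bases d/dx_i
   and dx_i. *)
Definition courant_coord (Y1 Y2 : 'rV[R]_n -> 'rV[R]_(n + n)) u
    : 'rV[R]_(n + n) :=
  let X1 i v := lsubmx (Y1 v) 0 i in let X2 i v := lsubmx (Y2 v) 0 i in
  let a1 i v := rsubmx (Y1 v) 0 i in let a2 i v := rsubmx (Y2 v) 0 i in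
  row_mx
    (\row_j \sum_i (X1 i u * pderiv i (X2 j) u - X2 i u * pderiv i (X1 j) u))
    (\row_j (\sum_i X1 i u * (pderiv i (a2 j) u - pderiv j (a2 i) u)
           - \sum_i X2 i u * (pderiv i (a1 j) u - pderiv j (a1 i) u)
           + 2^-1 * pderiv j
               (fun v => \sum_i (a2 i v * X1 i v - a1 i v * X2 i v)) u)).

End Calculus.

(** * Complex exterior algebra of (R^m)^*  *)

(* [w S] is the coefficient of dx_{i1} /\ ... /\ dx_{ik}, for
   S = {i1 < ... < ik}. *)
Definition ext (R : realType) (m : nat) := {ffun {set 'I_m} -> R[i]^o}.

Section Exterior.
Variables (R : realType) (m : nat).
Local Notation C := R[i].
Local Notation ext := (ext R m).

Definition ext_sign (i : 'I_m) (S : {set 'I_m}) : C :=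
  (-1) ^+ #|[pred j in S | (j < i)%N]|.

Definition iprod (X : 'rV[C]_m) (w : ext) : ext :=
  [ffun S : {set 'I_m} =>
     \sum_(i | i \notin S) X 0 i * ext_sign i S * w (i |: S)].

Definition wedge1 (a : 'rV[C]_m) (w : ext) : ext :=
  [ffun S : {set 'I_m} =>
     \sum_(i | i \in S) a 0 i * ext_sign i S * w (S :\ i)].

Definition ext1 : ext := [ffun S : {set 'I_m} => (S == finset.set0)%:R].

Definition clifford (v : 'rV[C]_(m + m)) (w : ext) : ext :=
  iprod (lsubmx v) w + wedge1 (rsubmx v) w.

Definition gen_pairing (v w : 'rV[R]_(m + m)) : R :=
  2^-1 * ((rsubmx v *m (lsubmx w)^T) 0 0 + (rsubmx w *m (lsubmx v)^T) 0 0).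

(* J acts on row vectors on the right *)
Definition i_eigenspace (J : 'M[R]_(m + m)) : set 'rV[C]_(m + m) :=
  [set v | v *m map_mx (real_complex R) J = 'i%C *: v].

Definition conj_i_eigenspace (J : 'M[R]_(m + m)) : set 'rV[C]_(m + m) :=
  [set map_mx (@conjc R) v | v in i_eigenspace J].

(* (/\^k Lbar) . Phi: as Lbar is isotropic, /\^k Lbar sits in the Clifford
   algebra as the span of the products of k elements of Lbar. Coefficients in
   the sum are not needed when Phi is stable by scaling. *)
Definition spinor_level (J : 'M[R]_(m + m)) (Phi : set ext) (k : nat) : set ext :=
  [set w | exists N (v : 'I_N -> k.-tuple 'rV[C]_(m + m)) (phi : 'I_N -> ext),
    [/\ forall a b, conj_i_eigenspace J (tnth (v a) b),
        forall a, Phi (phi a)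
      & w = \sum_a foldr clifford (phi a) (v a)]].

End Exterior.

Arguments ext1 {R m}.

(* U^j = (/\^(q - j) Lbar) . Phi for |j| <= q, and U^j = 0 otherwise *)
Definition Ufiber (R : realType) (q : nat) (J : 'M[R]_(2 * q + 2 * q))
    (Phi : set (ext R (2 * q))) (j : int) : set (ext R (2 * q)) :=
  if (`|j| <= q%:Z)%R then spinor_level J Phi `|(q%:Z - j)%R|%N else [set 0].

(* Pullback along v |-> v *m A, the linear map of matrix A: it is the algebra
   morphism sending dy_j to \sum_i A i j dx_i. *)
Definition pullback (R : realType) n m (A : 'M[R]_(n, m)) (w : ext R m)
    : ext R n :=
  \sum_(S : {set 'I_m})
    w S *: foldr (fun j => wedge1 (map_mx (real_complex R) (col j A)^T))
                 ext1 (enum S).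

(* The exterior derivative \sum_i dx_i /\ d/dx_i over an open set of R^n *)
Definition d_coord (R : realType) n (g : 'rV[R]_n -> ext R n) (u : 'rV[R]_n)
    : ext R n :=
  \sum_i wedge1 (delta_mx 0 i)
    [ffun S => ((pderiv i (fun v => complex.Re (g v S)) u)
              +i* (pderiv i (fun v => complex.Im (g v S)) u))%C].

(** * Smooth manifolds *)

(* The atlas is indexed by the points, [chart x] being a chart around [x],
   defined on [mdom x], with inverse [param x]; [chart x] is meaningless outside
   [mdom x], and [param x] outside of [chart x @` mdom x]. Thus [chart x]
   identifies the tangent space at x with R^n: tensor fields below are plain
   functions, whose value at x has coefficients in the basis given by
   [chart x]. *)
Record manifold (R : realType) (n : nat) := Manifold {
  mpoint :> topologicalType;
  mdom : mpoint -> set mpoint;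
  chart : mpoint -> mpoint -> 'rV[R]_n;
  param : mpoint -> 'rV[R]_n -> mpoint;
  manifold_hausdorff : hausdorff_space mpoint;
  manifold_second_countable : @second_countable mpoint;
  mdom_open : forall x, open (mdom x);
  mdom_center : forall x, mdom x x;
  chart_open : forall x, open (chart x @` mdom x);
  chartK : forall x y, mdom x y -> param x (chart x y) = y;
  chart_continuous : forall x y, mdom x y -> {for y, continuous (chart x)};
  param_continuous : forall x u, (chart x @` mdom x) u ->
    {for u, continuous (param x)};
  chart_smooth : forall x y,
    smooth_mx_on (chart x @` (mdom x `&` mdom y)) (chart y \o param x) }.

Section ManifoldTheory.
Variables (R : realType) (n : nat) (X : manifold R n).
Implicit Types (x y : X) (W : set X).

(* Jacobian, at the point of coordinates [u] in the chart at [x], of the change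
   of coordinates from the chart at [x] to the chart at [y] *)
Definition transition_mx x y (u : 'rV[R]_n) : 'M[R]_n :=
  jacobian (chart y \o param x) u.

Definition vector_rep x (v : X -> 'rV[R]_n) (u : 'rV[R]_n) : 'rV[R]_n :=
  let y := param x u in v y *m transition_mx y x (chart y y).

Definition smooth_vector_field_on W (v : X -> 'rV[R]_n) : Prop :=
  forall x, smooth_mx_on (chart x @` (mdom x `&` W)) (vector_rep x v).

Definition form_rep x (w : X -> ext R n) (u : 'rV[R]_n) : ext R n :=
  let y := param x u in pullback (transition_mx x y u) (w y).

Definition smooth_form_on W (w : X -> ext R n) : Prop :=
  forall x S,
    smooth_on (chart x @` (mdom x `&` W)) (fun u => complex.Re (form_rep x w u S)) /\
    smooth_on (chart x @` (mdom x `&` W)) (fun u => complex.Im (form_rep x w u S)).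

Definition ext_d (w : X -> ext R n) : X -> ext R n :=
  fun x => d_coord (form_rep x w) (chart x x).

(* The action of an invertible tangent map on TX + T*X *)
Definition gen_tangent_mx (A : 'M[R]_n) : 'M[R]_(n + n) :=
  block_mx A 0 0 (invmx A)^T.

Definition gen_rep x (Y : X -> 'rV[R]_(n + n)) (u : 'rV[R]_n)
    : 'rV[R]_(n + n) :=
  let y := param x u in Y y *m gen_tangent_mx (transition_mx y x (chart y y)).

Definition smooth_gen_section_on W (Y : X -> 'rV[R]_(n + n)) : Prop :=
  forall x, smooth_mx_on (chart x @` (mdom x `&` W)) (gen_rep x Y).

Definition courant (Y1 Y2 : X -> 'rV[R]_(n + n)) : X -> 'rV[R]_(n + n) :=
  fun x => courant_coord (gen_rep x Y1) (gen_rep x Y2) (chart x x).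

Definition gen_endo_rep x (J : X -> 'M[R]_(n + n)) (u : 'rV[R]_n)
    : 'M[R]_(n + n) :=
  let y := param x u in
  let G := gen_tangent_mx (transition_mx y x (chart y y)) in
  invmx G *m J y *m G.

Definition gen_act (J : X -> 'M[R]_(n + n)) (Y : X -> 'rV[R]_(n + n))
    : X -> 'rV[R]_(n + n) := fun x => Y x *m J x.

(* [J] is a generalized complex structure on the open submanifold [W] *)
Definition gen_complex_on W (J : X -> 'M[R]_(n + n)) : Prop :=
  [/\ forall x, smooth_mx_on (chart x @` (mdom x `&` W)) (gen_endo_rep x J),
      forall x, W x -> J x *m J x = - 1%:M,
      forall x, W x -> forall v w,
        gen_pairing (v *m J x) (w *m J x) = gen_pairing v w
    & forall W', open W' -> W' `<=` W -> forall Y1 Y2,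
        smooth_gen_section_on W' Y1 -> smooth_gen_section_on W' Y2 ->
        forall x, W' x ->
          courant (gen_act J Y1) (gen_act J Y2) x
          - gen_act J (courant Y1 (gen_act J Y2)) x
          - gen_act J (courant (gen_act J Y1) Y2) x
          + gen_act J (gen_act J (courant Y1 Y2)) x = 0].

(* [Phi] is a smooth complex line subbundle of the bundle of forms on [W] *)
Definition line_subbundle_on W (Phi : X -> set (ext R n)) : Prop :=
  forall x, W x -> exists W' s,
    [/\ open W', W' x, smooth_form_on (W' `&` W) s
      & forall y, (W' `&` W) y ->
          s y <> 0 /\ Phi y = [set c *: s y | c in [set: R[i]]]].

End ManifoldTheory.

Section Maps.
Variables (R : realType) (n m : nat) (X : manifold R n) (Y : manifold R m).
Implicit Types (W : set X) (f : X -> Y).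

Definition smooth_map_on W f : Prop :=
  (forall x, W x -> {for x, continuous f}) /\
  forall x y, smooth_mx_on (chart x @` (mdom x `&` W `&` f @^-1` mdom y))
                           (chart y \o f \o param x).

(* the matrix of the differential, acting on row vectors on the right *)
Definition tangent_mx f (x : X) : 'M[R]_(n, m) :=
  jacobian (chart (f x) \o f \o param x) (chart x x).

Definition submersion_on W f : Prop :=
  smooth_map_on W f /\ forall x, W x -> row_full (tangent_mx f x).

Definition form_pullback f (w : Y -> ext R m) : X -> ext R n :=
  fun x => pullback (tangent_mx f x) (w (f x)).

End Maps.

Definition local_diffeo_on (R : realType) m (X Y : manifold R m)
    (D : set X) (h : X -> Y) : Prop :=
  forall x, D x -> exists W (g : Y -> X),
    [/\ open W, W x, W `<=` D, open (h @` W) &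
        [/\ smooth_map_on W h, smooth_map_on (h @` W) g
          & forall y, W y -> g (h y) = y]].

(** * Foliations *)

Record foliation (R : realType) (n m : nat) (M : manifold R n)
    (T0 : manifold R m) := Foliation {
  fidx : Type;
  fopen : fidx -> set M;
  fsub : fidx -> M -> T0;
  fgamma : fidx -> fidx -> T0 -> T0;
  fopen_open : forall i, open (fopen i);
  fopen_cover : forall x, exists i, fopen i x;
  fsub_submersion : forall i, submersion_on (fopen i) (fsub i);
  fsub_connected : forall i y,
    connected (fopen i `&` fsub i @^-1` [set y]);
  fgamma_diffeo : forall i j,
    local_diffeo_on (fsub i @` (fopen i `&` fopen j)) (fgamma i j);
  fgammaE : forall i j x, fopen i x -> fopen j x ->
    fsub j x = fgamma i j (fsub i x) }.

Section Foliation.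
Variables (R : realType) (n m : nat) (M : manifold R n) (T0 : manifold R m).
Variable F : foliation M T0.

(* T is the disjoint union of the [transv i]; a field on T is a family of
   fields indexed by i, the i-th one being relevant on [transv i] only. *)
Definition transv (i : fidx F) : set T0 := fsub i @` fopen i.

(* [holonomy i j D h]: the restriction of [h] to the open subset [D] of
   [transv i] belongs to the holonomy pseudogroup, as a diffeomorphism
   onto an open subset of [transv j]. An arbitrary element of the
   pseudogroup is a union of such pieces. *)
Inductive holonomy : fidx F -> fidx F -> set T0 -> (T0 -> T0) -> Prop :=
| hol_gamma i j :
    holonomy i j (fsub i @` (fopen i `&` fopen j)) (fgamma i j)
| hol_id i : holonomy i i (transv i) id
| hol_restrict i j D D' h :
    holonomy i j D h -> open D' -> D' `<=` D -> holonomy i j D' h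
| hol_comp i j k D D' h h' :
    holonomy i j D h -> holonomy j k D' h' ->
    holonomy i k (D `&` h @^-1` D') (h' \o h)
| hol_inv i j D h g :
    holonomy i j D h -> (forall y, D y -> g (h y) = y) ->
    holonomy j i (h @` D) g
| hol_glue i j (K : Type) (D : K -> set T0) (hK : K -> T0 -> T0) h :
    (forall k, holonomy i j (D k) (hK k)) ->
    (forall k y, D k y -> h y = hK k y) ->
    set_inj (\bigcup_k D k) h ->
    holonomy i j (\bigcup_k D k) h.

Definition invariant_form (t : fidx F -> T0 -> ext R m) : Prop :=
  forall i j D h, holonomy i j D h ->
    forall y, D y -> form_pullback h (t j) y = t i y.

Definition invariant_gen_endo (J : fidx F -> T0 -> 'M[R]_(m + m)) : Prop :=
  forall i j D h, holonomy i j D h -> forall y, D y ->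
    let G := gen_tangent_mx (tangent_mx h y) in
    J i y *m G = G *m J j (h y).

Definition tangent_to_leaves (W : set M) (v : M -> 'rV[R]_n) : Prop :=
  forall i x, W x -> fopen i x -> v x *m tangent_mx (@fsub _ _ _ _ _ F i) x = 0.

Definition basic_form : set (M -> ext R n) :=
  [set w | smooth_form_on setT w /\
    forall W v, open W -> smooth_vector_field_on W v -> tangent_to_leaves W v ->
      forall x, W x ->
        iprod (map_mx (real_complex R) (v x)) (w x) = 0 /\
        iprod (map_mx (real_complex R) (v x)) (ext_d w x) = 0].

(* the form on M corresponds to the invariant form on T *)
Definition corresponds (w : M -> ext R n) (t : fidx F -> T0 -> ext R m) : Prop :=
  forall i x, fopen i x -> w x = form_pullback (@fsub _ _ _ _ _ F i) (t i) x.

Record transverse_gen_complex := TransverseGenComplex {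
  tgc_endo :> fidx F -> T0 -> 'M[R]_(m + m);
  tgc_gen_complex : forall i, gen_complex_on (transv i) (tgc_endo i);
  tgc_invariant : invariant_gen_endo tgc_endo }.

(* [Phi] is the complex line bundle on T whose annihilator is L *)
Definition is_spinor_line (J : transverse_gen_complex)
    (Phi : fidx F -> T0 -> set (ext R m)) : Prop :=
  forall i, line_subbundle_on (transv i) (Phi i) /\
    forall y, transv i y ->
      i_eigenspace (J i y) = [set v | forall phi, Phi i y phi -> clifford v phi = 0].

End Foliation.

(** * The spectral sequence of a double complex *)

Section DoubleComplex.
Variables (V : zmodType) (K : int -> int -> set V) (dh dv : V -> V).

(* [dh : K a b -> K (a + 1) b] and [dv : K a b -> K a (b + 1)] are assumed to
   anticommute. An element of total degree [k] is a finitely supported family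
   [x] with [x b] in K (k - b) b. *)
Definition tot (k : int) : set (int -> V) :=
  [set x | (forall b, K (k - b) b (x b)) /\ finite_set [set b | x b != 0]].

Definition tot_d (x : int -> V) : int -> V :=
  fun b => dh (x b) + dv (x (b - 1)).

(* filtration by [b], so that the differential of the 0-th page is [dh] *)
Definition filt (p k : int) : set (int -> V) :=
  [set x | tot k x /\ forall b, b < p -> x b = 0].

(* E_r^p = ss_cycle r p / ss_boundary r p, for r >= 1 *)
Definition ss_cycle (r : nat) (p k : int) : set (int -> V) :=
  [set x | filt p k x /\ filt (p + r%:Z) (k + 1) (tot_d x)].

Definition ss_boundary (r : nat) (p k : int) : set (int -> V) :=
  [set y + tot_d z | y in ss_cycle r.-1 (p + 1) k
                   & z in ss_cycle r.-1 (p - r%:Z + 1) (k - 1)].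

(* d_r : E_r^p -> E_r^(p + r), induced by [tot_d], vanishes for all r >= 1 *)
Definition degenerates_at_first_page : Prop :=
  forall r p k, (0 < r)%N -> forall x, ss_cycle r p k x ->
    ss_boundary r (p + r%:Z) (k + 1) (tot_d x).

End DoubleComplex.

(** * The operators on basic forms *)

Section Operators.
Variables (R : realType) (n q : nat) (M : manifold R n).
Variables (T0 : manifold R (2 * q)) (F : foliation M T0).
Variables (J : transverse_gen_complex F).
Variable Phi : fidx F -> T0 -> set (ext R (2 * q)).
Local Notation form := (M -> ext R n).

(* the basic forms which are sections of U^j *)
Definition basicU (j : int) : set form :=
  [set w | basic_form F w /\ exists t,
    [/\ forall i, smooth_form_on (transv i) (t i),
        invariant_form t,
        forall i y, transv i y -> Ufiber (J i y) (Phi i y) j (t i y)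
      & corresponds w t]].

Definition sumU (c : int -> form) : form :=
  \sum_(a < (2 * q).+1) c (a%:Z - q%:Z).

(* the components of [w] in the direct sum of the [basicU j] *)
Definition components (w : form) : int -> form :=
  xget (fun=> 0) [set c | (forall j, basicU j (c j)) /\ w = sumU c].

(* the component of degree 1 (resp. -1) of [ext_d] *)
Definition del (w : form) : form :=
  sumU (fun j => components (ext_d (components w j)) (j + 1)).

Definition delbar (w : form) : form :=
  sumU (fun j => components (ext_d (components w j)) (j - 1)).

Definition dJ (w : form) : form := 'i%C *: (delbar w - del w).

Definition ddJ_lemma : Prop :=
  let Omega := basic_form F in
  let Im op : set form := op @` Omega in
  let Ker op : set form := Omega `&` op @^-1` [set 0] in
  Im (@ext_d _ _ M \o dJ) = Im (@ext_d _ _ M) `&` Ker dJ /\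
  Im (@ext_d _ _ M) `&` Ker dJ = Ker (@ext_d _ _ M) `&` Im dJ.

Definition canonical_ss_degenerates : Prop :=
  degenerates_at_first_page (fun a b => basicU (a - b)) del delbar.

Definition basic_exact : set form := @ext_d _ _ M @` basic_form F.

(* representatives of the classes in H_{U^j} *)
Definition closedU (j : int) : set form :=
  basicU j `&` @ext_d _ _ M @^-1` [set 0].

(* H is the direct sum of the H_{U^j}, -q <= j <= q: existence and uniqueness
   of the decomposition of a class, in terms of representatives *)
Definition U_decomposes_cohomology : Prop :=
  (forall w, basic_form F w -> ext_d w = 0 ->
     exists2 c, forall j, closedU j (c j) & basic_exact (w - sumU c)) /\
  (forall c, (forall j, closedU j (c j)) -> basic_exact (sumU c) ->
     forall j, basic_exact (c j)).

End Operators.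

(* Main.v *)
(* A basic form is locally the pullback of an invariant form on the transverse
   manifold. There U^j is the eigenspace, for the eigenvalue i j, of the action of
   J in the spin representation; the Lagrangian L moves these eigenvalues by
   steps of i, and they exhaust the forms. Integrability of J says that the
   commutators of d with this action vanish to the appropriate order, so that d
   maps U^j to U^(j+1) + U^(j-1); only partial derivatives at a point enter.

   What remains is algebra in a double complex of bounded diagonals, together
   with the complex conjugation, which maps U^j to U^(-j) and exchanges del and
   delbar. If the spectral sequence degenerates, d is strict for the filtration:
   an exact w in U^j has a primitive u in degrees < j and, by conjugation, another
   one u' in degrees > j. Decomposing the class of u - u' and comparing the
   components of degree j - 1 gives w = del delbar v. Conversely, the
   dd^J-lemma applied to delbar x_p, for x_p the leading term of a cycle x,
   replaces x by x minus a total cycle with the same leading term, and applied to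
   d^J w it replaces a closed form w by a cohomologous one with closed components. *)

From HB Require Import structures.
Require Import Defs.
From mathcomp Require Import all_boot all_order all_algebra.
From mathcomp Require Import all_classical all_reals all_analysis.
From mathcomp Require Import complex ring lra zify.

Set Implicit Arguments.
Unset Strict Implicit.
Unset Printing Implicit Defensive.

Import Order.TTheory GRing.Theory Num.Theory numFieldNormedType.Exports.

Local Open Scope classical_set_scope.
Local Open Scope ring_scope.

(** * Exterior algebra and pullbacks *)

(** Integrability speaks of sections of TT + T*T, the splitting of d of forms. The bridge is the
    commutator algebra of d with T, the spin action of [J]: as J^2 = -1, the first-order parts of
    [T, [T, d]] and d cancel, and [P], minus their sum, is a pointwise operator in the 1-jet of [J].
    The commutator with [cl b] of the anticommutator of [P] with [cl a] is -2 times Clifford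
    multiplication by the Nijenhuis tensor of a and b, hence 0. Schur's argument on the irreducible
    spinor module and the parity of degrees then leave only P = [cl v] for some vector v. Without
    computing v, [v *m J *m J = - v] shows that (f^2 + 1)^2 kills d t, where T t = lam t and f = T -
    lam: only the eigenvalues lam + i and lam - i remain.

    The other obstacle is regularity. A basic form is defined by vector fields on M, so the
    transverse form must be constructed, by straightening the submersions and using the
    connectedness of their fibres. Its components in the U^j are interpolation polynomials in T
    applied to it, and are therefore smooth and invariant without any choice of frames. *)

Lemma ffunDE (aT : finType) (V : nmodType) (f g : {ffun aT -> V}) x :
  (f + g) x = f x + g x.
Proof. by rewrite ffunE. Qed.

Lemma ffunNE (aT : finType) (V : zmodType) (f : {ffun aT -> V}) x :
  (- f) x = - f x.
Proof. by rewrite ffunE. Qed.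

Lemma ffun0E (aT : finType) (V : nmodType) x : (0 : {ffun aT -> V}) x = 0.
Proof. by rewrite ffunE. Qed.

Lemma ffunZE (aT : finType) (K : pzRingType) c (f : {ffun aT -> K^o}) x :
  (c *: f) x = c * f x.
Proof. by rewrite ffunE. Qed.

(* The Clifford action is sealed: being a sum, it would otherwise be unfolded
   when unified with sums. *)
HB.lock Definition cl (R : realType) (m : nat) (v : 'rV[R[i]]_(m + m))
  (w : ext R m) : ext R m := clifford v w.

Section ExteriorAlgebra.
Variables (R : realType) (m : nat).
Local Notation C := R[i].
Implicit Types (u w : ext R m) (S : {set 'I_m}) (i j : 'I_m) (X a : 'rV[C]_m).

Lemma extP (u w : ext R m) : (forall S, u S = w S) -> u = w.
Proof. by move=> h; apply/ffunP. Qed.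

Lemma extDE (u w : ext R m) S : (u + w) S = u S + w S.
Proof. exact: ffunDE. Qed.

Lemma extNE w S : (- w) S = - w S.
Proof. exact: ffunNE. Qed.

Lemma extZE (c : C) w S : (c *: w) S = c * w S.
Proof. exact: ffunZE. Qed.

Lemma ext0E S : (0 : ext R m) S = 0.
Proof. exact: ffun0E. Qed.

Lemma ext_sumE (I : Type) (r : seq I) (P : pred I) (F : I -> ext R m) S :
  (\sum_(i <- r | P i) F i) S = \sum_(i <- r | P i) F i S.
Proof. exact: sum_ffunE. Qed.

(** Sum-free form of the contraction with a basis vector; [ewedge] does the same for basis
    covectors. The Clifford relations are checked on these coefficient by coefficient and then
    extended by bilinearity. *)
Definition contr i w : ext R m :=
  [ffun S : {set 'I_m} =>
     if i \in S then 0 else ext_sign R i S * w (i |: S)].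

Definition ewedge i w : ext R m :=
  [ffun S : {set 'I_m} =>
     if i \in S then ext_sign R i S * w (S :\ i) else 0].

Lemma iprodE X w : iprod X w = \sum_i X 0 i *: contr i w.
Proof.
apply: extP => S; rewrite ext_sumE ffunE big_mkcond /=; apply: eq_bigr => i _.
by rewrite extZE ffunE; case: (i \in S) => //=; rewrite ?mulr0 ?mulrA.
Qed.

Lemma wedge1E a w : wedge1 a w = \sum_i a 0 i *: ewedge i w.
Proof.
apply: extP => S; rewrite ext_sumE ffunE big_mkcond /=; apply: eq_bigr => i _.
by rewrite extZE ffunE; case: (i \in S) => //=; rewrite ?mulr0 ?mulrA.
Qed.

Lemma contr_linear i : linear (contr i).
Proof.
suff H c (u v : ext R m) : contr i (c *: u + v) = c *: contr i u + contr i v by exact: H.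
apply: extP => S; rewrite extDE extZE /contr /ewedge !ffunE.
by case: ifP => _; rewrite ?mulr0 ?addr0 //= /GRing.scale /=; ring.
Qed.

Lemma ewedge_linear i : linear (ewedge i).
Proof.
suff H c (u v : ext R m) : ewedge i (c *: u + v) = c *: ewedge i u + ewedge i v by exact: H.
apply: extP => S; rewrite extDE extZE /contr /ewedge !ffunE.
by case: ifP => _; rewrite ?mulr0 ?addr0 //= /GRing.scale /=; ring.
Qed.

HB.instance Definition _ i :=
  GRing.isLinear.Build C (ext R m) (ext R m) _ (contr i) (contr_linear i).
HB.instance Definition _ i :=
  GRing.isLinear.Build C (ext R m) (ext R m) _ (ewedge i) (ewedge_linear i).

Lemma iprod_linear X : linear (iprod X : ext R m -> ext R m).
Proof.
move=> c u v; rewrite !iprodE scaler_sumr -big_split /=; apply: eq_bigr => i _.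
by rewrite linearP scalerDr !scalerA mulrC.
Qed.

Lemma wedge1_linear X : linear (wedge1 X : ext R m -> ext R m).
Proof.
move=> c u v; rewrite !wedge1E scaler_sumr -big_split /=; apply: eq_bigr => i _.
by rewrite linearP scalerDr !scalerA mulrC.
Qed.

HB.instance Definition _ X :=
  GRing.isLinear.Build C (ext R m) (ext R m) _ (iprod X) (iprod_linear X).
HB.instance Definition _ X :=
  GRing.isLinear.Build C (ext R m) (ext R m) _ (wedge1 X) (wedge1_linear X).

Lemma cl_linear v : linear (cl v : ext R m -> ext R m).
Proof. by move=> c u w; rewrite !cl.unlock /clifford !linearP scalerDr addrACA. Qed.

HB.instance Definition _ v :=
  GRing.isLinear.Build C (ext R m) (ext R m) _ (cl v) (cl_linear v).

Lemma iprodD (X : 'rV[C]_m) u w : iprod X (u + w) = iprod X u + iprod X w.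
Proof. exact: linearD. Qed.

Lemma iprodZ (X : 'rV[C]_m) (c : C) w : iprod X (c *: w) = c *: iprod X w.
Proof. exact: linearZ. Qed.

Lemma iprod0 (X : 'rV[C]_m) : iprod X 0 = 0 :> ext R m.
Proof. exact: linear0. Qed.

Lemma iprod_sum (X : 'rV[C]_m) (I : Type) (r : seq I) (P : pred I) (F : I -> ext R m) :
  iprod X (\sum_(i <- r | P i) F i) = \sum_(i <- r | P i) iprod X (F i).
Proof. exact: linear_sum. Qed.

Lemma wedge1D (X : 'rV[C]_m) u w : wedge1 X (u + w) = wedge1 X u + wedge1 X w.
Proof. exact: linearD. Qed.

Lemma wedge1Z (X : 'rV[C]_m) (c : C) w : wedge1 X (c *: w) = c *: wedge1 X w.
Proof. exact: linearZ. Qed.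

Lemma wedge10 (X : 'rV[C]_m) : wedge1 X 0 = 0 :> ext R m.
Proof. exact: linear0. Qed.

Lemma wedge1_sum (X : 'rV[C]_m) (I : Type) (r : seq I) (P : pred I) (F : I -> ext R m) :
  wedge1 X (\sum_(i <- r | P i) F i) = \sum_(i <- r | P i) wedge1 X (F i).
Proof. exact: linear_sum. Qed.

Lemma clD (v : ('rV[C]_(m + m))) u w : cl v (u + w) = cl v u + cl v w.
Proof. exact: linearD. Qed.

Lemma clZ (v : ('rV[C]_(m + m))) (c : C) w : cl v (c *: w) = c *: cl v w.
Proof. exact: linearZ. Qed.

Lemma clN (v : ('rV[C]_(m + m))) w : cl v (- w) = - cl v w.
Proof. exact: linearN. Qed.

Lemma cl0 (v : ('rV[C]_(m + m))) : cl v 0 = 0 :> ext R m.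
Proof. exact: linear0. Qed.

Lemma cl_sum (v : ('rV[C]_(m + m))) (I : Type) (r : seq I) (P : pred I) (F : I -> ext R m) :
  cl v (\sum_(i <- r | P i) F i) = \sum_(i <- r | P i) cl v (F i).
Proof. exact: linear_sum. Qed.

Lemma ewedgeZ (i : 'I_m) (c : C) w : ewedge i (c *: w) = c *: ewedge i w.
Proof. exact: linearZ. Qed.

Lemma ewedge_sum (i : 'I_m) (I : Type) (r : seq I) (P : pred I) (F : I -> ext R m) :
  ewedge i (\sum_(k <- r | P k) F k) = \sum_(k <- r | P k) ewedge i (F k).
Proof. exact: linear_sum. Qed.

Lemma iprod_linearl w : linear (fun X => iprod X w).
Proof.
move=> c u v; rewrite !iprodE scaler_sumr -big_split /=; apply: eq_bigr => i _.
by rewrite !mxE scalerDl scalerA.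
Qed.

Lemma wedge1_linearl w : linear (fun X => wedge1 X w).
Proof.
move=> c u v; rewrite !wedge1E scaler_sumr -big_split /=; apply: eq_bigr => i _.
by rewrite !mxE scalerDl scalerA.
Qed.

Lemma cl_linearl w : linear (fun v => cl v w).
Proof.
by move=> c u v; rewrite !cl.unlock /clifford !linearP /= iprod_linearl wedge1_linearl
  scalerDr addrACA.
Qed.

Lemma iprodDl X Y w : iprod (X + Y) w = iprod X w + iprod Y w.
Proof. by have := iprod_linearl w 1 X Y; rewrite !scale1r. Qed.

Lemma iprod0l w : iprod 0 w = 0.
Proof. by rewrite iprodE big1 // => i _; rewrite mxE scale0r. Qed.

Lemma iprodZl c X w : iprod (c *: X) w = c *: iprod X w.
Proof. by have := iprod_linearl w c X 0; rewrite !addr0 iprod0l addr0. Qed.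

Lemma wedge1Dl X Y w : wedge1 (X + Y) w = wedge1 X w + wedge1 Y w.
Proof. by have := wedge1_linearl w 1 X Y; rewrite !scale1r. Qed.

Lemma wedge10l w : wedge1 0 w = 0.
Proof. by rewrite wedge1E big1 // => i _; rewrite mxE scale0r. Qed.

Lemma wedge1Zl c X w : wedge1 (c *: X) w = c *: wedge1 X w.
Proof. by have := wedge1_linearl w c X 0; rewrite !addr0 wedge10l addr0. Qed.

Lemma wedge1_suml (I : Type) (r : seq I) (P : pred I) (F : I -> 'rV[C]_m) w :
  wedge1 (\sum_(i <- r | P i) F i) w = \sum_(i <- r | P i) wedge1 (F i) w.
Proof.
by apply: (big_morph (fun X => wedge1 X w)) => [X Y|]; rewrite ?wedge1Dl ?wedge10l.
Qed.

Lemma clDl (X Y : 'rV[C]_(m + m)) w : cl (X + Y) w = cl X w + cl Y w.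
Proof. by have := cl_linearl w 1 X Y; rewrite !scale1r. Qed.

Lemma cl0l w : cl 0 w = 0.
Proof. by rewrite cl.unlock /clifford !linear0 /= iprod0l wedge10l addr0. Qed.

Lemma clZl c (X : 'rV[C]_(m + m)) w : cl (c *: X) w = c *: cl X w.
Proof. by have := cl_linearl w c X 0; rewrite !addr0 cl0l addr0. Qed.

Lemma clBl (X Y : 'rV[C]_(m + m)) w : cl (X - Y) w = cl X w - cl Y w.
Proof. by rewrite -scaleN1r clDl clZl scaleN1r. Qed.

Lemma clNl (X : 'rV[C]_(m + m)) w : cl (- X) w = - cl X w.
Proof. by rewrite -scaleN1r clZl scaleN1r. Qed.

Lemma cl_suml (I : Type) (r : seq I) (P : pred I) (F : I -> 'rV[C]_(m + m)) w :
  cl (\sum_(i <- r | P i) F i) w = \sum_(i <- r | P i) cl (F i) w.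
Proof.
by apply: (big_morph (fun X : 'rV_(m + m) => cl X w)) => [X Y|];
  rewrite ?clDl ?cl0l.
Qed.

Lemma iprod_delta i w : iprod (delta_mx 0 i) w = contr i w.
Proof.
rewrite iprodE (bigD1 i) //= big1 => [|j /negPf ji]; rewrite !mxE ?eqxx ?ji /=.
  by rewrite scale1r addr0.
by rewrite scale0r.
Qed.

Lemma wedge1_delta i w : wedge1 (delta_mx 0 i) w = ewedge i w.
Proof.
rewrite wedge1E (bigD1 i) //= big1 => [|j /negPf ji]; rewrite !mxE ?eqxx ?ji /=.
  by rewrite scale1r addr0.
by rewrite scale0r.
Qed.

(** The sign records how many elements of the set lie below [i], so inserting [j] matters only when
    [j < i]. *)
Lemma ext_signU1 i j S : j \notin S ->
  ext_sign R i (j |: S) = (-1) ^+ (j < i)%N * ext_sign R i S.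
Proof.
move=> jS; rewrite /ext_sign -exprD; congr (_ ^+ _).
by rewrite -!sum1_card !big_mkcondr /= big_setU1 //=; case: (j < i)%N.
Qed.

Lemma ext_signD1 i j S : j \in S ->
  ext_sign R i (S :\ j) = (-1) ^+ (j < i)%N * ext_sign R i S.
Proof.
move=> jS; rewrite -{2}(finset.setD1K jS) ext_signU1 ?finset.setD11 //.
by rewrite mulrA -signr_addb addbb mul1r.
Qed.

Lemma ext_sign_sqr i S : ext_sign R i S * ext_sign R i S = 1.
Proof. by rewrite /ext_sign -exprD addnn -signr_odd odd_double. Qed.

Lemma sign_ltn i j : i != j ->
  (-1) ^+ (i < j)%N = - (-1) ^+ (j < i)%N :> C.
Proof. by move=> ij; case: (ltngtP i j) ij => [||/val_inj ->]; rewrite ?eqxx ?opprK. Qed.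

(** For distinct indices both composites read the same coefficient; the signs are opposite because
    exactly one of [i < j] and [j < i] holds. *)
Lemma contr_anticomm i j w : contr i (contr j w) + contr j (contr i w) = 0.
Proof.
apply: extP => S; rewrite extDE ext0E !ffunE !finset.in_setU1.
have [->|ij] := eqVneq i j; first by rewrite /= mulr0; case: ifP; rewrite addr0.
case: (boolP (i \in S)) => iS; case: (boolP (j \in S)) => jS;
  rewrite /= ?mulr0 ?add0r ?addr0 //.
rewrite !ext_signU1 // (sign_ltn ij) finset.setUCA; ring.
Qed.

Lemma ewedge_anticomm i j w : ewedge i (ewedge j w) + ewedge j (ewedge i w) = 0.
Proof.
apply: extP => S; rewrite extDE ext0E !ffunE !finset.in_setD1.
have [->|ij] := eqVneq i j; first by rewrite /= mulr0; case: ifP; rewrite addr0.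
case: (boolP (i \in S)) => iS; case: (boolP (j \in S)) => jS;
  rewrite /= ?mulr0 ?add0r ?addr0 //.
have -> : S :\ i :\ j = S :\ j :\ i by rewrite !finset.setDDl finset.setUC.
rewrite !ext_signD1 // (sign_ltn ij); ring.
Qed.

(** On the diagonal exactly one of the two terms survives, according to whether the index lies in
    [S], and its two signs multiply to 1. Off the diagonal the two terms cancel. *)
Lemma contr_ewedge i j w :
  contr i (ewedge j w) + ewedge j (contr i w) = (i == j)%:R *: w.
Proof.
apply: extP => S; rewrite extDE extZE !ffunE !(finset.in_setU1, finset.in_setD1).
have [->|ij] := eqVneq i j; rewrite /= ?mul1r ?mul0r.
  case: ifPn => jS.
    by rewrite add0r ext_signD1 // ltnn mul1r finset.setD1K // mulrA
      ext_sign_sqr mul1r.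
  by rewrite addr0 ext_signU1 // ltnn mul1r finset.setU1K // mulrA
    ext_sign_sqr mul1r.
case: (boolP (i \in S)) => iS; case: (boolP (j \in S)) => jS;
  rewrite /= ?mulr0 ?add0r ?addr0 //.
rewrite ext_signU1 // ext_signD1 // (sign_ltn ij).
have -> : (i |: S) :\ j = i |: S :\ j.
  by apply/finset.setP => k; rewrite !inE; have [->|//] := eqVneq k j;
    rewrite eq_sym (negPf ij).
ring.
Qed.

Lemma iprod_anticomm X Y w : iprod X (iprod Y w) + iprod Y (iprod X w) = 0.
Proof.
have E U V : iprod U (iprod V w)
    = \sum_i \sum_j (U 0 i * V 0 j) *: contr i (contr j w).
  rewrite iprodE; apply: eq_bigr => i _; rewrite iprodE linear_sum scaler_sumr.
  by apply: eq_bigr => j _; rewrite linearZ scalerA.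
rewrite !E [X in _ + X]exchange_big -big_split big1 //= => i _.
rewrite -big_split big1 //= => j _.
by rewrite [Y 0 j * _]mulrC -scalerDr contr_anticomm scaler0.
Qed.

Lemma wedge1_anticomm X Y w : wedge1 X (wedge1 Y w) + wedge1 Y (wedge1 X w) = 0.
Proof.
have E U V : wedge1 U (wedge1 V w)
    = \sum_i \sum_j (U 0 i * V 0 j) *: ewedge i (ewedge j w).
  rewrite wedge1E; apply: eq_bigr => i _; rewrite wedge1E linear_sum scaler_sumr.
  by apply: eq_bigr => j _; rewrite linearZ scalerA.
rewrite !E [X in _ + X]exchange_big -big_split big1 //= => i _.
rewrite -big_split big1 //= => j _.
by rewrite [Y 0 j * _]mulrC -scalerDr ewedge_anticomm scaler0.
Qed.

Lemma iprod_wedge1 X a w :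
  iprod X (wedge1 a w) + wedge1 a (iprod X w) = (\sum_i X 0 i * a 0 i) *: w.
Proof.
have -> : iprod X (wedge1 a w)
    = \sum_i \sum_j (X 0 i * a 0 j) *: contr i (ewedge j w).
  rewrite iprodE; apply: eq_bigr => i _; rewrite wedge1E linear_sum scaler_sumr.
  by apply: eq_bigr => j _; rewrite linearZ scalerA.
have -> : wedge1 a (iprod X w)
    = \sum_i \sum_j (X 0 i * a 0 j) *: ewedge j (contr i w).
  rewrite wedge1E exchange_big; apply: eq_bigr => j _.
  rewrite iprodE linear_sum scaler_sumr.
  by apply: eq_bigr => i _; rewrite linearZ scalerA mulrC.
rewrite -big_split scaler_suml; apply: eq_bigr => i _ /=.
rewrite -big_split (bigD1 i) //= -scalerDr contr_ewedge eqxx scale1r.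
rewrite big1 ?addr0 // => j /negPf ji.
by rewrite -scalerDr contr_ewedge eq_sym ji scale0r scaler0.
Qed.

Lemma wedge1_sqr a w : wedge1 a (wedge1 a w) = 0.
Proof.
have /eqP := wedge1_anticomm a a w; rewrite -mulr2n -scaler_nat scaler_eq0.
by rewrite pnatr_eq0 /= => /eqP.
Qed.

(** Twice the complex-bilinear extension of the pairing on TT + T*T; with this normalisation the
    Clifford relation carries no factor. *)
Definition hform (v u : 'rV[C]_(m + m)) : C :=
  \sum_i (lsubmx v 0 i * rsubmx u 0 i + rsubmx v 0 i * lsubmx u 0 i).

Lemma cl_anticomm (v u : 'rV[C]_(m + m)) w :
  cl v (cl u w) + cl u (cl v w) = hform v u *: w.
Proof.
rewrite !cl.unlock /clifford !linearD /= /hform big_split /= scalerDl.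
rewrite -[X in _ = X + _](iprod_wedge1 _ _ w).
rewrite (_ : \sum_i rsubmx v 0 i * lsubmx u 0 i
           = \sum_i lsubmx u 0 i * rsubmx v 0 i); last first.
  by apply: eq_bigr => i _; rewrite mulrC.
rewrite -(iprod_wedge1 _ _ w).
have e1 := iprod_anticomm (lsubmx v) (lsubmx u) w.
have e2 := wedge1_anticomm (rsubmx v) (rsubmx u) w.
set a1 := iprod _ (iprod _ w) in e1 *; set a2 := iprod _ (iprod _ w) in e1 *.
set b1 := wedge1 _ (wedge1 _ w) in e2 *; set b2 := wedge1 _ (wedge1 _ w) in e2 *.
(* The eight terms of the expansion are two anticommutators that vanish and two mixed ones that give
   the two halves of [hform]. *)
rewrite (_ : _ + _ = (a1 + a2) + (b1 + b2) +
  (iprod (lsubmx v) (wedge1 (rsubmx u) w) + wedge1 (rsubmx u) (iprod (lsubmx v) w) +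
  (iprod (lsubmx u) (wedge1 (rsubmx v) w) + wedge1 (rsubmx v) (iprod (lsubmx u) w)))).
  by rewrite e1 e2 !add0r.
set c1 := iprod _ (wedge1 _ w); set c2 := wedge1 _ (iprod _ w).
set c3 := iprod _ (wedge1 _ w); set c4 := wedge1 _ (iprod _ w).
by rewrite [LHS](AC (2*2*(2*2)) ((1*5)*(4*8)*((2*7)*(6*3)))).
Qed.

Lemma hformC (v u : 'rV[C]_(m + m)) : hform v u = hform u v.
Proof. by apply: eq_bigr => i _; rewrite addrC; congr (_ + _); rewrite mulrC. Qed.

Definition basis_form S : ext R m := [ffun T => (T == S)%:R].

Lemma ext_basis w : w = \sum_S w S *: basis_form S.
Proof.
apply: extP => T; rewrite ext_sumE.
transitivity (\sum_(S : {set 'I_m}) (w S * (T == S)%:R : C)).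
  rewrite (bigD1 T) //= eqxx mulr1 big1 ?addr0 // => S /negPf ST.
  by rewrite eq_sym ST mulr0.
by apply: eq_bigr => S _; rewrite extZE ffunE.
Qed.

Lemma ext1_basis : ext1 = basis_form finset.set0.
Proof. by apply: extP => S; rewrite !ffunE. Qed.

Lemma ewedge_basis j S : ewedge j (basis_form S)
  = if j \in S then 0 else ext_sign R j S *: basis_form (j |: S).
Proof.
apply: extP => T; rewrite ffunE.
case: (boolP (j \in S)) => jS.
  rewrite ffunE; case: ifPn => jT; rewrite ?ffunE //.
  by case: eqP => [e|_]; rewrite ?mulr0 //; rewrite -e finset.setD11 in jS.
rewrite extZE !ffunE.
case: ifPn => jT; last first.
  case: eqP => [e|_]; rewrite ?mulr0 //.
  by rewrite e finset.setU11 in jT.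
have -> : (T == j |: S) = (T :\ j == S).
  apply/eqP/eqP => [->|<-]; first by rewrite finset.setU1K.
  by rewrite finset.setD1K.
case: eqP => [e|_]; rewrite ?mulr0 // !mulr1.
by rewrite -e ext_signD1 // ltnn mul1r.
Qed.

(** Forms are generated from [ext1] by wedges with basis covectors. As pullback is compatible with
    each of these operations, its properties are proved along this induction. *)
Lemma ext_ind (P : ext R m -> Prop) :
  (forall u w, P u -> P w -> P (u + w)) -> (forall (c : C) w, P w -> P (c *: w)) ->
  P ext1 -> (forall j w, P w -> P (ewedge j w)) -> forall w, P w.
Proof.
move=> PD PZ P1 PW w; have P0 : P 0 by rewrite -(scale0r ext1); exact: (PZ 0 _ P1).
rewrite (ext_basis w); apply: (big_ind P) => // S _; apply: (PZ (w S)).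
have [k] := ubnP #|S|; elim: k S => // k IH S.
have [->|[j jS]] := finset.set_0Vmem S; first by rewrite -ext1_basis.
rewrite ltnS (finset.cardsD1 j) jS => Sk.
have -> : basis_form S = ext_sign R j (S :\ j) *: ewedge j (basis_form (S :\ j)).
  by rewrite ewedge_basis finset.setD11 scalerA ext_sign_sqr scale1r finset.setD1K.
by apply: (PZ (ext_sign R j (S :\ j))); apply: PW; exact: IH.
Qed.

Lemma contr_ext1 i : contr i ext1 = 0 :> ext R m.
Proof.
apply: extP => S; rewrite !ffunE; case: ifP => // _.
case: eqP => [e|]; rewrite ?mulr0 //.
by have := finset.setU11 i S; rewrite e finset.in_set0.
Qed.

Lemma iprod_ext1 X : iprod X ext1 = 0 :> ext R m.
Proof. by rewrite iprodE big1 // => i _; rewrite contr_ext1 scaler0. Qed.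

(** Each factor of [l1] that the new covector crosses costs one sign. The list form is adapted to
    [pullback], which multiplies covectors along the enumeration of the index set. *)
Lemma foldr_anticomm (K : Type) (f : K -> 'rV[C]_m) (j : K) l1 l2 w :
  wedge1 (f j) (foldr (fun k => wedge1 (f k)) w (l1 ++ l2))
  = (-1) ^+ size l1 *: foldr (fun k => wedge1 (f k)) w (l1 ++ j :: l2).
Proof.
elim: l1 => [|k l1 IH] /=; first by rewrite scale1r.
have /eqP := wedge1_anticomm (f j) (f k) (foldr (fun k => wedge1 (f k)) w (l1 ++ l2)).
rewrite addr_eq0 => /eqP ->; rewrite IH linearZ /= exprS mulN1r scaleNr.
by [].
Qed.
End ExteriorAlgebra.

Section EnumSet.
Variable m : nat.
Implicit Types (S : {set 'I_m}) (j : 'I_m).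

Let lto := relpre (@nat_of_ord m) ltn.

Lemma enum_set_sorted S : sorted lto (enum S).
Proof.
rewrite -sorted_map; apply: (subseq_sorted ltn_trans) (iota_ltn_sorted 0 m).
rewrite -val_enum_ord; apply: map_subseq.
by rewrite {1}/enum_mem -enumT; exact: filter_subseq.
Qed.

(** Locates [j] in the increasing enumeration: the part of [S] in the first block is what [ext_sign]
    counts, so the signs of the coefficient description and of the product description can be
    compared. *)
Lemma enum_set_split S j :
  enum S = [seq k : 'I_m <- enum S | (k < j)%N] ++
           (if j \in S then [:: j] else [::]) ++ [seq k : 'I_m <- enum S | (j < k)%N].
Proof.
have lto_trans : transitive lto by move=> a b c; exact: ltn_trans.
apply: (irr_sorted_eq lto_trans) (enum_set_sorted S) _ _.
- by move=> a; rewrite /lto /= ltnn.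
- rewrite (sorted_pairwise lto_trans) !pairwise_cat -!(sorted_pairwise lto_trans).
  apply/and3P; split; last first.
  + apply/and3P; split; [|by case: ifP|
      by rewrite (sorted_filter lto_trans) ?enum_set_sorted].
    apply/allrelP => a b; case: ifP => // _; rewrite inE => /eqP ->.
    by rewrite mem_filter => /andP[].
  + by rewrite (sorted_filter lto_trans) ?enum_set_sorted.
  + apply/allrelP => a b; rewrite mem_filter mem_cat => /andP[aj _] /orP[].
      by case: ifP => // _; rewrite inE => /eqP ->.
    by rewrite mem_filter => /andP[jb _]; exact: ltn_trans aj jb.
- move=> k; have fE (P : pred 'I_m) : (k \in [seq a <- enum S | P a]) = P k && (k \in S).
    by rewrite mem_filter mem_enum.
  rewrite !mem_cat !fE mem_enum.
  have [->|kj] := eqVneq k j.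
    by rewrite ltnn /=; case: ifP => jS; rewrite ?inE ?eqxx ?in_nil.
  have -> : (k \in if j \in S then [:: j] else [::]) = false.
    by case: ifP => _; rewrite ?inE ?in_nil // (negPf kj).
  by case: (ltngtP k j) kj => //= [_|/val_inj ->]; rewrite ?orbF ?eqxx.
Qed.
End EnumSet.

Notation toC := (map_mx (real_complex _)).

Section Pullback.
Variable R : realType.
Local Notation C := R[i].

Lemma pullback_linear n m (A : 'M[R]_(n, m)) : linear (pullback A).
Proof.
move=> c u v; rewrite /pullback scaler_sumr -big_split; apply: eq_bigr => S _ /=.
by rewrite extDE extZE scalerDl scalerA.
Qed.

HB.instance Definition _ n m (A : 'M[R]_(n, m)) :=
  GRing.isLinear.Build C (ext R m) (ext R n) _ (pullback A) (pullback_linear A).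

Lemma pullbackD n m (A : 'M[R]_(n, m)) u w :
  pullback A (u + w) = pullback A u + pullback A w.
Proof. exact: linearD. Qed.

Lemma pullback0 n m (A : 'M[R]_(n, m)) : pullback A 0 = 0.
Proof. exact: linear0. Qed.

Lemma pullbackB n m (A : 'M[R]_(n, m)) u w :
  pullback A (u - w) = pullback A u - pullback A w.
Proof. exact: linearB. Qed.

Lemma pullbackZ n m (A : 'M[R]_(n, m)) (c : C) w :
  pullback A (c *: w) = c *: pullback A w.
Proof. exact: linearZ. Qed.

Lemma pullback_sum n m (A : 'M[R]_(n, m)) I (r : seq I) (P : pred I)
    (F : I -> ext R m) :
  pullback A (\sum_(i <- r | P i) F i) = \sum_(i <- r | P i) pullback A (F i).
Proof. exact: linear_sum. Qed.

Section Fixed.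
Variables (n m : nat) (A : 'M[R]_(n, m)).
Implicit Type w : ext R m.

Lemma pullback_basis (S : {set 'I_m}) : pullback A (basis_form R S)
  = foldr (fun j => wedge1 (map_mx (real_complex R) (col j A)^T)) ext1 (enum S).
Proof.
rewrite /pullback (bigD1 S) //= ffunE eqxx scale1r big1 ?addr0 // => T /negPf TS.
by rewrite ffunE TS scale0r.
Qed.

Lemma pullback_ext1 : pullback A ext1 = ext1.
Proof. by rewrite ext1_basis pullback_basis finset.enum_set0. Qed.

Opaque pullback iprod wedge1.

Let f k := map_mx (real_complex R) (col k A)^T.

(** If [j] already belongs to [S], its covector occurs twice and the product vanishes; otherwise
    bringing it to its place past the smaller indices costs precisely [ext_sign]. *)
Lemma pullback_ewedge_basis j (S : {set 'I_m}) :
  pullback A (ewedge j (basis_form R S))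
  = wedge1 (f j) (pullback A (basis_form R S)).
Proof.
rewrite ewedge_basis pullback_basis -/f.
set l1 := [seq k : 'I_m <- enum S | (k < j)%N].
set l2 := [seq k : 'I_m <- enum S | (j < k)%N].
have eS := enum_set_split S j; rewrite -/l1 -/l2 in eS.
case: ifPn eS => jS eS.
  rewrite pullback0 eS (foldr_anticomm f) foldr_cat.
  rewrite (_ : foldr _ ext1 _ = 0) /=; last by rewrite wedge1_sqr.
  suff -> : foldr (fun k => wedge1 (f k)) 0 l1 = 0 by rewrite scaler0.
  by elim: l1 {eS} => //= k l ->; rewrite wedge10.
rewrite pullbackZ pullback_basis eS /= (foldr_anticomm f).
have el1 : [seq k : 'I_m <- enum (j |: S) | (k < j)%N] = l1.
  rewrite /l1 !/(enum _) -!filter_predI; apply: eq_filter => k /=.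
  by rewrite !inE; case: eqVneq => // ->; rewrite ltnn.
have el2 : [seq k : 'I_m <- enum (j |: S) | (j < k)%N] = l2.
  rewrite /l2 !/(enum _) -!filter_predI; apply: eq_filter => k /=.
  by rewrite !inE; case: eqVneq => // ->; rewrite ltnn.
rewrite (enum_set_split (j |: S) j) finset.setU11 el1 el2.
congr (_ *: _); rewrite /ext_sign; congr (_ ^+ _).
rewrite cardE; congr size; rewrite /l1 !/(enum _) -filter_predI.
by apply: eq_filter => k /=; rewrite !inE andbC.
Qed.

Lemma pullback_ewedge j w :
  pullback A (ewedge j w) = wedge1 (f j) (pullback A w).
Proof.
rewrite (ext_basis w) ewedge_sum !pullback_sum wedge1_sum; apply: eq_bigr => S _.
by rewrite ewedgeZ !pullbackZ pullback_ewedge_basis wedge1Z.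
Qed.

Lemma pullback_wedge1 a w :
  pullback A (wedge1 a w) = wedge1 (a *m (toC A)^T) (pullback A w).
Proof.
rewrite wedge1E pullback_sum.
have -> : a *m (toC A)^T = \sum_j a 0 j *: f j.
  apply/rowP => i; rewrite mxE summxE; apply: eq_bigr => j _.
  by rewrite !mxE.
rewrite wedge1_suml; apply: eq_bigr => j _.
by rewrite pullbackZ pullback_ewedge wedge1Zl.
Qed.

(** Contraction is an antiderivation killing [ext1]: both sides follow the same rule when a covector
    is wedged on, and they agree at the start. *)
Lemma iprod_pullback X w :
  iprod X (pullback A w) = pullback A (iprod (X *m toC A) w).
Proof.
move: X; elim/ext_ind: w => [u w IHu IHw|c w IH||j w IH] X.
- by rewrite pullbackD !iprodD IHu IHw pullbackD.
- by rewrite pullbackZ !iprodZ IH pullbackZ.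
- by rewrite pullback_ext1 !iprod_ext1 pullback0.
rewrite pullback_ewedge -wedge1_delta.
have /(canRL (addrK _)) -> := iprod_wedge1 X (f j) (pullback A w); rewrite IH.
have /(canRL (addrK _)) -> := iprod_wedge1 (X *m toC A) (delta_mx 0 j) w.
rewrite pullbackB pullbackZ wedge1_delta pullback_ewedge.
suff -> : \sum_i (X *m toC A) 0 i * delta_mx 0 j 0 i = \sum_i X 0 i * f j 0 i by [].
transitivity ((X *m toC A) 0 j); last first.
  by rewrite mxE; apply: eq_bigr => k _; rewrite !mxE.
rewrite (bigD1 j) //= [delta_mx _ _ _ _]mxE !eqxx mulr1 big1 ?addr0 // => k /negPf kj.
by rewrite [delta_mx _ _ _ _]mxE kj andbF mulr0.
Qed.
End Fixed.

Lemma toCM n m p (A : 'M[R]_(n, m)) (B : 'M[R]_(m, p)) :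
  toC (A *m B) = toC A *m toC B :> 'M[C]_(n, p).
Proof. exact: map_mxM. Qed.

Lemma pullback_mulmx n m p (A : 'M[R]_(n, m)) (B : 'M[R]_(m, p)) w :
  pullback (A *m B) w = pullback A (pullback B w).
Proof.
elim/ext_ind: w => [u w IHu IHw|c w IH||j w IH].
- by rewrite !pullbackD IHu IHw.
- by rewrite !pullbackZ IH.
- by rewrite !pullback_ext1.
by rewrite -wedge1_delta !pullback_wedge1 IH toCM trmx_mul mulmxA.
Qed.

Lemma pullback1 n w : pullback (1%:M : 'M[R]_n) w = w.
Proof.
elim/ext_ind: w => [u w IHu IHw|c w IH||j w IH].
- by rewrite pullbackD IHu IHw.
- by rewrite pullbackZ IH.
- by rewrite pullback_ext1.
by rewrite -wedge1_delta pullback_wedge1 IH map_mx1 trmx1 mulmx1.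
Qed.

(** Up to sign, the coefficient on a nonempty [S] is a coefficient of the contraction by any element
    of [S]. *)
Lemma ext_scalar n (w : ext R n) : (forall i, contr i w = 0) -> w = w finset.set0 *: ext1.
Proof.
move=> h; apply: extP => S; rewrite extZE ffunE.
have [->|[i iS]] := finset.set_0Vmem S; first by rewrite eqxx mulr1.
have := congr1 (fun u : ext R n => u (S :\ i)) (h i).
rewrite ext0E ffunE finset.setD11 finset.setD1K //= => /eqP.
rewrite mulf_eq0 => /orP[/eqP e|/eqP ->].
  by have := ext_sign_sqr R i (S :\ i); rewrite e mul0r => /esym/eqP; rewrite oner_eq0.
by case: eqP => [e|_]; rewrite ?mulr0 //; rewrite e finset.in_set0 in iS.
Qed.

Lemma pullback_coef0 n m (A : 'M[R]_(n, m)) w :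
  pullback A w finset.set0 = w finset.set0.
Proof.
elim/ext_ind: w => [u w IHu IHw|c w IH||j w IH].
- by rewrite pullbackD !extDE IHu IHw.
- by rewrite pullbackZ (extZE c (pullback A w)) (extZE c w) IH.
- by rewrite pullback_ext1 /ext1 !ffunE !eqxx.
rewrite pullback_ewedge [in RHS]ffunE finset.in_set0 wedge1E ext_sumE big1 // => i _.
by rewrite extZE ffunE finset.in_set0 mulr0.
Qed.

(* The coefficients of a form are iterated contractions of it, whence the
   induction on the number of contractions. *)
Lemma pullback_idem n (E : 'M[R]_n) w :
  (forall X, iprod (X *m toC E) w = iprod X w) -> pullback E w = w.
Proof.
move=> hw; apply: extP => S.
have [k] := ubnP #|S|; elim: k S w hw => // k IH S w hw.
have [->|[j jS]] := finset.set_0Vmem S.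
  by rewrite pullback_coef0.
rewrite ltnS (finset.cardsD1 j) jS => Sk.
have co (u : ext R n) : u S = ext_sign R j (S :\ j) * contr j u (S :\ j).
  by rewrite ffunE finset.setD11 finset.setD1K // mulrA ext_sign_sqr mul1r.
rewrite co [RHS]co; congr (_ * _).
rewrite -!iprod_delta iprod_pullback hw.
apply: IH => // X; set e := delta_mx 0 j.
have /eqP := iprod_anticomm (X *m toC E) e w; rewrite addr_eq0 => /eqP ->.
have /eqP := iprod_anticomm X e w; rewrite addr_eq0 => /eqP ->.
by rewrite hw.
Qed.

End Pullback.

Section Horizontal.
Variables (R : realType) (n m : nat) (A : 'M[R]_(n, m)).

(** [A *m B] is a projection along the kernel of [A]: a vector and its image differ by a vector of
    that kernel, which [w] does not see. *)
Lemma pullback_horizontal (B : 'M[R]_(m, n)) (w : ext R n) : B *m A = 1%:M ->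
  (forall X, X *m toC A = 0 -> iprod X w = 0) -> pullback (A *m B) w = w.
Proof.
move=> BA hw; apply: pullback_idem => X.
apply/eqP; rewrite -subr_eq0; apply/eqP.
rewrite -[- iprod X w]scaleN1r -iprodZl -iprodDl scaleN1r; apply: hw.
rewrite mulmxBl -mulmxA -toCM -mulmxA BA mulmx1 subrr.
by [].
Qed.

Lemma pullback_inj : row_full A -> injective (@pullback R n m A).
Proof.
move=> /row_fullP[B BA]; apply: (can_inj (g := pullback B)) => w.
by rewrite -pullback_mulmx BA pullback1.
Qed.
End Horizontal.

Lemma linear_scale (K : pzRingType) (V W : lmodType K) (T : V -> W) :
  linear T -> forall a v, T (a *: v) = a *: T v.
Proof.
move=> Tl a v; have T0 : T 0 = 0.
  by have := Tl (-1) 0 0; rewrite scaler0 addr0 scaleN1r addNr.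
by have := Tl a v 0; rewrite T0 !addr0.
Qed.

Lemma scaler_half (K : numFieldType) (V : lmodType K) (x : V) :
  2^-1 *: (x *+ 2) = x.
Proof. by rewrite -(scaler_nat 2 x) scalerA mulVf ?scale1r // pnatr_eq0. Qed.

Lemma mulmx_row_diag (K : pzRingType) k (Z Y : 'M[K]_k) a :
  (row a Z *m (row a Y)^T) 0 0 = (Z *m Y^T) a a.
Proof. by rewrite !mxE; apply: eq_bigr => b _; rewrite !mxE. Qed.

(** * Spectral projections as interpolation polynomials *)

Section EigenProj.
Variables (K : fieldType) (V : lmodType K) (T : V -> V) (I : eqType) (lam : I -> K).
Hypothesis T_linear : linear T.

(** Lagrange's interpolation polynomial in [T], equal to 1 at [lam j] and 0 at the other values. A
    polynomial in [T] is smooth where [T] is and commutes with every map intertwining [T]; this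
    makes the components of a smooth invariant form smooth and invariant. *)
Definition eigproj (s : seq I) (j : I) (w : V) : V :=
  foldr (fun l u => (lam j - lam l)^-1 *: (T u - lam l *: u)) w
        [seq l <- s | l != j].

Lemma eigproj_linear s j : linear (eigproj s j).
Proof.
move=> c u v; rewrite /eigproj; elim: [seq l <- s | l != j] => //= l r ->.
rewrite T_linear [c *: (_ *: _)]scalerA [c * _]mulrC -scalerA -scalerDr.
congr (_ *: _).
rewrite scalerDr opprD addrACA scalerBr; congr (_ - _ + _).
by rewrite !scalerA mulrC.
Qed.

Lemma eigproj0 s j : eigproj s j 0 = 0.
Proof. by have := linear_scale (eigproj_linear s j) 0 0; rewrite !scale0r. Qed.

Lemma eigproj_eigen s j mu c : T c = mu *: c ->
  eigproj s j c = (\prod_(l <- s | l != j) ((mu - lam l) / (lam j - lam l))) *: c.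
Proof.
move=> Tc; rewrite /eigproj -big_filter.
have TZ := linear_scale T_linear.
elim: [seq l <- s | l != j] => [|l r IH] /=; first by rewrite big_nil scale1r.
rewrite IH TZ Tc big_cons !scalerA -scalerBl scalerA; congr (_ *: _).
ring.
Qed.

Hypothesis lam_inj : injective lam.

Lemma eigproj_id s j c : T c = lam j *: c -> eigproj s j c = c.
Proof.
move=> Tc; rewrite (eigproj_eigen _ _ Tc) big1 ?scale1r // => l lj.
by rewrite divff // subr_eq0 (inj_eq lam_inj) eq_sym.
Qed.

Lemma eigproj_0 s j k c : T c = lam k *: c -> k \in s -> k != j ->
  eigproj s j c = 0.
Proof.
move=> Tc ks kj; rewrite (eigproj_eigen _ _ Tc) (big_rem k) //= kj subrr.
by rewrite !mul0r scale0r.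
Qed.

Lemma eigproj_sum s j (c : I -> V) : uniq s -> j \in s ->
  (forall k, T (c k) = lam k *: c k) -> eigproj s j (\sum_(k <- s) c k) = c j.
Proof.
move=> us js Tc.
have eD : {morph eigproj s j : u v / u + v}.
  by move=> u v; have := eigproj_linear s j 1 u v; rewrite !scale1r.
rewrite (big_morph _ eD (eigproj0 s j)) (bigD1_seq j) //= eigproj_id //.
rewrite big_seq_cond big1 ?addr0 // => k /andP[ks kj].
exact: eigproj_0 (Tc k) ks kj.
Qed.
End EigenProj.

(** Otherwise there would be [dim V + 1] nonzero vectors with distinct eigenvalues, and these are
    linearly independent. *)
Lemma eigenvalues_bounded (K : fieldType) (V : vectType K) (T : V -> V)
    (lam : nat -> K) (c : nat -> V) : linear T -> injective lam ->
  (forall k, T (c k) = lam k *: c k) -> exists2 k, (k <= dim V)%N & c k = 0.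
Proof.
move=> Tl lam_inj Tc.
have TZ := linear_scale Tl.
have [/existsP[k /eqP ck0]|] :=
  boolP [exists k : 'I_(dim V).+1, c (k : nat) == 0 :> V].
  by exists k => //; rewrite -ltnS.
move=> /existsPn nz; exfalso.
pose X := [tuple c (k : nat) | k < (dim V).+1].
have fX : free X.
  apply/freeP => a a0 i.
  (* The coefficients are extended by 0 beyond the family, so that [eigproj] can isolate the i-th
     term of the linear relation. *)
  pose b k := (if insub k is Some j then a j else 0) *: c k.
  have be (j : 'I_(dim V).+1) : b j = a j *: c j by rewrite /b valK.
  have : b i = 0.
    rewrite -(eigproj_sum Tl lam_inj (s := iota 0 (dim V).+1) (j := i) (c := b)).
    - rewrite -[iota _ _]/(index_iota 0 (dim V).+1) big_mkord.
      rewrite (eq_bigr (fun j : 'I__ => a j *: X`_j)) ?a0; last first.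
        by move=> j _; rewrite be -tnth_nth tnth_mktuple.
      exact: eigproj0.
    - exact: iota_uniq.
    - by rewrite mem_iota /= add0n ltn_ord.
    - by move=> k; rewrite /b TZ Tc !scalerA mulrC.
  by rewrite be => /eqP; rewrite scaler_eq0 (negPf (nz i)) orbF => /eqP.
have := dimvS (subvf <<X>>%VS); rewrite dimvf.
move: fX; rewrite /free size_tuple => /eqP ->.
by rewrite ltnn.
Qed.

(** * The spin action and the irreducibility of the spinor module *)

Definition swap_mx (R : realType) (m : nat) : 'M[R[i]]_(m + m) :=
  block_mx 0 1%:M 1%:M 0.

(* [spinop J] is the action of [J], seen as an element of the orthogonal Lie
   algebra of TT + T*T, in the spin representation; the rows of [J] and of
   [swap_mx] are the images under [J] of a basis, and the dual basis. *)
HB.lock Definition spinop (R : realType) (m : nat) (J : 'M[R[i]]_(m + m))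
    (w : ext R m) : ext R m :=
  2^-1 *: \sum_a cl (row a J) (cl (row a (swap_mx R m)) w).

Section Spinors.
Variables (R : realType) (m : nat).
Local Notation C := R[i].
Implicit Types (u w phi : ext R m) (v : 'rV[C]_(m + m)).

Local Notation H := (swap_mx R m).

Lemma swap_mx_sqr : H *m H = 1%:M.
Proof.
rewrite mulmx_block !mul0mx !mul1mx ?mulmx0 !add0r ?addr0.
by rewrite -scalar_mx_block.
Qed.

Lemma tr_swap_mx : H^T = H.
Proof. by rewrite tr_block_mx !trmx0 !trmx1. Qed.

Lemma hformE (v u : 'rV[C]_(m + m)) : hform v u = (v *m H *m u^T) 0 0.
Proof.
rewrite /hform -[in RHS](hsubmxK v) -[in RHS](hsubmxK u) mul_row_block tr_row_mx mul_row_col.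
rewrite !mulmx0 !mulmx1 add0r addr0 !mxE -big_split.
by apply: eq_bigr => i _; rewrite !mxE addrC.
Qed.

Lemma hformNl (v u : 'rV[C]_(m + m)) : hform (- v) u = - hform v u.
Proof. by rewrite !hformE !mulNmx [LHS]mxE. Qed.

Lemma hformNr (v u : 'rV[C]_(m + m)) : hform v (- u) = - hform v u.
Proof. by rewrite hformC hformNl hformC. Qed.

Lemma spinop_linear J : linear (spinop J : ext R m -> ext R m).
Proof.
suff h c u w : spinop J (c *: u + w) = c *: spinop J u + spinop J w by exact: h.
rewrite spinop.unlock [c *: (_ *: _)]scalerA [c * _]mulrC -scalerA -scalerDr.
congr (_ *: _); rewrite scaler_sumr -big_split; apply: eq_bigr => a _ /=.
by rewrite !(clD, clZ).
Qed.

HB.instance Definition _ J :=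
  GRing.isLinear.Build C (ext R m) (ext R m) _ (spinop J) (spinop_linear J).

Lemma spinopD J u w : spinop J (u + w) = spinop J u + spinop J w.
Proof. exact: linearD. Qed.

Lemma spinopZ J (c : C) w : spinop J (c *: w) = c *: spinop J w.
Proof. exact: linearZ. Qed.

Lemma spinop_sum J I (r : seq I) (P : pred I) (F : I -> ext R m) :
  spinop J (\sum_(i <- r | P i) F i) = \sum_(i <- r | P i) spinop J (F i).
Proof. exact: linear_sum. Qed.

Lemma clC (v u : 'rV[C]_(m + m)) w :
  cl v (cl u w) = hform v u *: w - cl u (cl v w).
Proof. by rewrite -cl_anticomm addrK. Qed.

(** Membership in the orthogonal Lie algebra of [hform], whose Gram matrix is [H]. An orthogonal [J]
    with [J *m J = - 1] satisfies it, and so do its partial derivatives, by differentiation. *)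
Definition so_mx (J : 'M[C]_(m + m)) := J *m H = - (H *m J^T).

Lemma so_mx_tr J : so_mx J -> J^T *m H = - (H *m J).
Proof.
move=> hJ; have := congr1 (fun A => H *m A *m H) hJ.
rewrite mulmxN mulNmx !mulmxA swap_mx_sqr mul1mx -!mulmxA swap_mx_sqr mulmx1.
by move=> ->; rewrite opprK.
Qed.

(** The commutation rule that characterises a spin action. Moving [v] across the two Clifford
    factors leaves two sums, each contributing [cl (v *m J) w]; this is what the factor 1/2
    compensates. Eigenvectors of [J] thereby shift the eigenvalues of [spinop J]. *)
Lemma spinop_cl J v w : so_mx J ->
  spinop J (cl v w) = cl v (spinop J w) + cl (v *m J) w.
Proof.
move=> hJ; rewrite spinop.unlock clZ cl_sum.
have E a : cl (row a J) (cl (row a H) (cl v w))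
   = cl v (cl (row a J) (cl (row a H) w))
   + (hform (row a H) v *: cl (row a J) w
      - hform (row a J) v *: cl (row a H) w).
  rewrite (clC (row a H) v) clD clN clZ.
  rewrite (clC (row a J) v) opprB addrCA.
  by [].
rewrite (eq_bigr _ (fun a _ => E a)) big_split /= scalerDr; congr (_ + _).
rewrite sumrB.
have e1 : \sum_a hform (row a H) v *: cl (row a J) w = cl (v *m J) w.
  rewrite mulmx_sum_row cl_suml; apply: eq_bigr => a _.
  rewrite clZl hformE -row_mul swap_mx_sqr.
  by rewrite -row_mul mul1mx !mxE.
have e2 : \sum_a hform (row a J) v *: cl (row a H) w = - cl (v *m J) w.
  rewrite -scaleN1r -clZl scaleN1r.
  have -> : - (v *m J) = (J *m H *m v^T)^T *m H.
    rewrite !trmx_mul trmxK tr_swap_mx -!mulmxA so_mx_tr // !mulmxN.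
    by rewrite (mulmxA H H) swap_mx_sqr mul1mx.
  rewrite mulmx_sum_row cl_suml; apply: eq_bigr => a _.
  by rewrite clZl hformE -!row_mul !mxE.
by rewrite e1 e2 opprK -mulr2n scaler_half.
Qed.

Definition qop (A : 'M[C]_(m + m)) w : ext R m :=
  \sum_a \sum_b A a b *: cl (delta_mx 0 a) (cl (delta_mx 0 b) w).

(** A sum of products of rows depends on the two matrices only through [X^T *m Y], so the basis in
    which a quadratic Clifford operator is written can be changed. *)
Lemma qop_mul (X Y : 'M[C]_(m + m)) w :
  \sum_a cl (row a X) (cl (row a Y) w) = qop (X^T *m Y) w.
Proof.
have rE (Z : 'M[C]_(m + m)) a u :
    cl (row a Z) u = \sum_b Z a b *: cl (delta_mx 0 b) u.
  by rewrite {1}[row a Z]row_sum_delta cl_suml; apply: eq_bigr => b _;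
    rewrite clZl mxE.
transitivity (\sum_a \sum_b \sum_c
   (X a b * Y a c) *: cl (delta_mx 0 b) (cl (delta_mx 0 c) w)).
  apply: eq_bigr => a _; rewrite rE; apply: eq_bigr => b _.
  rewrite rE cl_sum scaler_sumr; apply: eq_bigr => c _.
  by rewrite clZ scalerA.
rewrite exchange_big; apply: eq_bigr => b _.
rewrite exchange_big; apply: eq_bigr => c _.
rewrite -scaler_suml mxE; congr (_ *: _).
by apply: eq_bigr => a _; rewrite mxE.
Qed.

(** Write J = z (p - p') with p, p' the projections on the eigenspaces of z and -z. In the p part
    the Clifford relation moves the annihilating factor next to [phi] and leaves the trace of p,
    which is m; the p' part vanishes. It serves twice: z = i on the spinor line, z = -i on the last
    level. *)
Lemma spinop_vacuum (J : 'M[C]_(m + m)) (z : C) phi : so_mx J -> J *m J = - 1%:M ->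
  z * z = -1 -> (forall v, v *m J = z *: v -> cl v phi = 0) ->
  spinop J phi = (z * m%:R / 2) *: phi.
Proof.
move=> hJ J2 z2 Lphi.
pose p := 2^-1 *: (1%:M - z *: J); pose p' := 2^-1 *: (1%:M + z *: J).
have two : (2 : C) != 0 by rewrite pnatr_eq0.
have pL a : cl (row a p) phi = 0.
  apply: Lphi; rewrite -row_mul -linearZ /=; congr (row _ _).
  rewrite -scalemxAl mulmxBl mul1mx -scalemxAl J2 scalerN opprK scalerA mulrC.
  rewrite -[RHS]scalerA; congr (_ *: _).
  by rewrite scalerBr scalerA z2 scaleN1r opprK addrC.
have Jp : J = z *: (p - p').
  rewrite /p /p' -scalerBr opprD addrACA subrr add0r -mulr2n.
  rewrite scaler_half scalerN scalerA z2.
  by rewrite scaleN1r opprK.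
rewrite spinop.unlock (eq_bigr (fun a => z *: (cl (row a p) (cl (row a H) phi)
    - cl (row a p') (cl (row a H) phi)))); last first.
  move=> a _; rewrite {1}Jp linearZ /= linearB /= clZl clBl.
  by [].
rewrite -scaler_sumr sumrB qop_mul [qop _ _](_ : _ = (\tr p) *: phi); last first.
  rewrite -qop_mul /mxtrace scaler_suml; apply: eq_bigr => a _.
  rewrite clC pL cl0 subr0 hformE; congr (_ *: _).
  transitivity ((p *m H *m H^T) a a); last first.
    by rewrite tr_swap_mx -mulmxA swap_mx_sqr mulmx1.
  by rewrite -row_mul mulmx_row_diag.
rewrite qop_mul [qop _ _](_ : _ = 0); last first.
  (* Skewness of [J] turns p' on the left factor into p on the right one, which kills [phi]. *)
  have -> : p'^T *m H = H^T *m p.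
    rewrite tr_swap_mx /p /p' linearZ /= linearD /= trmx1 linearZ /=.
    rewrite -scalemxAl -scalemxAr mulmxDl mulmxBr mul1mx mulmx1; congr (_ *: (_ + _)).
    by rewrite -scalemxAl so_mx_tr // scalerN -scalemxAr.
  by rewrite -qop_mul big1 // => a _; rewrite pL cl0.
(* [J] is conjugate by [H] to minus its transpose, so its trace is its own opposite. *)
have trJ : \tr J = 0.
  have e : \tr J = - \tr J.
    rewrite -[in LHS](mulmx1 J) -swap_mx_sqr mulmxA hJ mulNmx raddfN /=.
    by rewrite -mulmxA mxtrace_mulC -mulmxA swap_mx_sqr mulmx1 mxtrace_tr.
  have /eqP : \tr J + \tr J = 0 by rewrite {1}e addNr.
  by rewrite -mulr2n mulrn_eq0 /= => /eqP.
have -> : \tr p = m%:R.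
  rewrite /p linearZ /= linearB /= mxtrace1 linearZ /= trJ mulr0 subr0.
  by rewrite natrD; field.
by rewrite subr0 !scalerA; congr (_ *: _); ring.
Qed.

(** Contractions bring any nonzero form down to a nonzero scalar, and wedges then build every form
    from it. The subspace is a predicate, so that this also serves to extend operator identities
    from one vector. *)
Lemma ext_irreducible (P : ext R m -> Prop) w0 :
  (forall u w, P u -> P w -> P (u + w)) -> (forall (c : C) w, P w -> P (c *: w)) ->
  (forall v w, P w -> P (cl v w)) -> P w0 -> w0 <> 0 -> forall w, P w.
Proof.
move=> PD PZ Pcl Pw0 w0n0.
have Pco i w : P w -> P (contr i w).
  move=> /(Pcl (row_mx (delta_mx 0 i) 0)); rewrite cl.unlock /clifford.
  by rewrite row_mxKl row_mxKr wedge10l addr0 iprod_delta.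
have Pew i w : P w -> P (ewedge i w).
  move=> /(Pcl (row_mx 0 (delta_mx 0 i))); rewrite cl.unlock /clifford.
  by rewrite row_mxKl row_mxKr iprod0l add0r wedge1_delta.
suff P1 : P ext1 by apply: ext_ind => //.
have bd : forall S : {set 'I_m}, (m.+1 <= #|S|)%N -> w0 S = 0.
  by move=> S; rewrite ltnNge; have := max_card (mem S); rewrite card_ord => ->.
(* Induction on a strict bound for the degrees present: a nonzero contraction lowers it, and a form
   with no nonzero contraction is a multiple of [ext1]. *)
elim: m.+1 w0 Pw0 w0n0 bd => [|k IH] w Pw wn0 bd.
  by case: wn0; apply: extP => S; rewrite bd ?ext0E.
have [/forallP all0|] := boolP [forall i, contr i w == 0].
  have ws : w = w finset.set0 *: ext1 by apply: ext_scalar => i; apply/eqP.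
  have c0 : w finset.set0 != 0 by apply/eqP => c0; apply: wn0; rewrite ws c0 scale0r.
  have -> : ext1 = (w finset.set0)^-1 *: w by rewrite {2}ws scalerA mulVf // scale1r.
  exact: PZ.
move=> /forallPn[i /eqP ci]; apply: IH (Pco i w Pw) ci _ => S kS.
rewrite ffunE; case: ifPn => // iS; rewrite bd ?mulr0 //.
by rewrite finset.cardsU1 iS.
Qed.

(** Pullback intertwines Clifford multiplication by [v] and by [v *m G], and [G] preserves the form,
    so the quadratic expressions correspond. *)
Lemma spinop_pullback (J J' : 'M[C]_(m + m)) (A : 'M[R]_m) w : A \in unitmx ->
  J' *m toC (gen_tangent_mx A) = toC (gen_tangent_mx A) *m J ->
  spinop J' (pullback A w) = pullback A (spinop J w).
Proof.
move=> uA hJ; set G := toC (gen_tangent_mx A).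
have GE : G = block_mx (toC A) 0 0 (toC (invmx A))^T.
  by rewrite /G /gen_tangent_mx map_block_mx !raddf0 map_trmx.
have clpb v u : cl v (pullback A u) = pullback A (cl (v *m G) u).
  rewrite !cl.unlock /clifford pullbackD iprod_pullback GE -{3 4}(hsubmxK v).
  rewrite mul_row_block !mulmx0 addr0 add0r row_mxKl row_mxKr.
  rewrite pullback_wedge1 -mulmxA -trmx_mul -toCM mulmxV // map_mx1 trmx1 mulmx1.
  by [].
have GHG : G^T *m H *m G = H.
  rewrite GE /swap_mx tr_block_mx !trmx0 trmxK !mulmx_block.
  rewrite !(mulmx0, mul0mx, mulmx1, addr0, add0r) -trmx_mul -!toCM.
  by rewrite mulVmx // map_mx1 trmx1.
have e : \sum_a cl (row a J') (cl (row a H) (pullback A w))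
    = pullback A (qop ((J' *m G)^T *m (H *m G)) w).
  by rewrite -qop_mul pullback_sum; apply: eq_bigr => a _; rewrite !clpb !row_mul.
rewrite !spinop.unlock pullbackZ e qop_mul.
suff -> : (J' *m G)^T *m (H *m G) = J^T *m H by [].
by rewrite hJ trmx_mul -!mulmxA (mulmxA _ H) GHG.
Qed.
End Spinors.

Section ConjMatrix.
Variable R : realType.
Local Notation C := R[i].

Lemma mul_Ci : 'i%C * 'i%C = -1 :> C.
Proof. by apply/eqP; simpc. Qed.

Lemma conjC_i : conjc 'i%C = - 'i%C :> C.
Proof. by apply/eqP; simpc. Qed.

Lemma Ci_neq0 : 'i%C != 0 :> C.
Proof. by apply/eqP => /(congr1 (fun z => z * z)); rewrite mul_Ci mul0r => /eqP;
  rewrite oppr_eq0 oner_eq0. Qed.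

Lemma Ci_int_inj : injective (fun j : int => 'i%C * j%:~R : C).
Proof. by move=> a b /(mulfI Ci_neq0) /eqP; rewrite eqr_int => /eqP. Qed.

Lemma conj_toC n m (A : 'M[R]_(n, m)) : map_mx (@conjc R) (toC A) = toC A.
Proof. by apply/matrixP => i j; rewrite !mxE; exact: conjc_real. Qed.

Lemma conj_mulmx n m p (A : 'M[C]_(n, m)) (B : 'M[C]_(m, p)) :
  map_mx (@conjc R) (A *m B) = map_mx (@conjc R) A *m map_mx (@conjc R) B.
Proof. exact: map_mxM. Qed.

Lemma conj_scale n m (c : C) (A : 'M[C]_(n, m)) :
  map_mx (@conjc R) (c *: A) = conjc c *: map_mx (@conjc R) A.
Proof. exact: map_mxZ. Qed.

Lemma conj_mxK n m : involutive (map_mx (@conjc R) : 'M[C]_(n, m) -> 'M[C]_(n, m)).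
Proof. by move=> A; apply/matrixP => i j; rewrite !mxE conjcK. Qed.

Lemma conj_i_eigenspaceP m (J : 'M[R]_(m + m)) b :
  conj_i_eigenspace J b <-> b *m toC J = - 'i%C *: b.
Proof.
split=> [[v vL <-]|bL].
  by rewrite -[toC J]conj_toC -conj_mulmx vL conj_scale conjC_i.
exists (map_mx (@conjc R) b); last exact: conj_mxK.
rewrite /i_eigenspace /= -[toC J]conj_toC -conj_mulmx bL conj_scale.
by rewrite -conjC_i conjcK.
Qed.
End ConjMatrix.

(** * The levels of the spinor line as eigenspaces of the spin action *)

Section SpinorLevels.
Variables (R : realType) (q : nat).
Local Notation m := (2 * q)%N.
Local Notation C := R[i].
Variables (J : 'M[R]_(m + m)) (Phi : set (ext R m)) (s : ext R m).
Hypotheses (hJ : so_mx (toC J)) (J2 : toC J *m toC J = - 1%:M).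
Hypotheses (s_neq0 : s <> 0) (PhiE : Phi = [set c *: s | c in [set: C]]).
Hypothesis LE : i_eigenspace J = [set v | forall phi, Phi phi -> clifford v phi = 0].

Local Notation clf := (@clifford R m).
Local Notation lev := (spinor_level J Phi).

Lemma cliffordE k (v : 'rV[C]_(k + k)) w : clifford v w = cl v w.
Proof. by rewrite cl.unlock. Qed.

Let Phi_s : Phi s.
Proof. by rewrite PhiE; exists 1 => //; rewrite scale1r. Qed.

Let PhiZ (c : C) phi : Phi phi -> Phi (c *: phi).
Proof. by rewrite PhiE => -[d _ <-]; exists (c * d) => //; rewrite scalerA. Qed.

Lemma L_Phi v phi : v *m toC J = 'i%C *: v -> Phi phi -> cl v phi = 0.
Proof.
move=> vL Pphi; have : i_eigenspace J v by [].
by rewrite LE -cliffordE => /(_ _ Pphi).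
Qed.

Lemma lev_gen k (t : k.-tuple 'rV[C]_(m + m)) phi : Phi phi ->
  (forall b, conj_i_eigenspace J (tnth t b)) -> lev k (foldr clf phi t).
Proof.
move=> Pphi tL; exists 1%N, (fun=> t), (fun=> phi); split=> //.
by rewrite big_ord_recl big_ord0 addr0.
Qed.

Lemma lev_add k u w : lev k u -> lev k w -> lev k (u + w).
Proof.
move=> [N1 [v1 [p1 [L1 P1 ->]]]] [N2 [v2 [p2 [L2 P2 ->]]]].
exists (N1 + N2)%N, (fun a => match fintype.split a with inl a => v1 a | inr a => v2 a end),
  (fun a => match fintype.split a with inl a => p1 a | inr a => p2 a end).
split=> [a b|a|]; try by case: fintype.split.
rewrite big_split_ord /=; congr (_ + _); apply: eq_bigr => a _.
  by rewrite -[lshift _ _]/(unsplit (inl a)) unsplitK.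
by rewrite -[rshift _ _]/(unsplit (inr a)) unsplitK.
Qed.

Lemma lev0 k : lev k 0.
Proof.
exists 0%N, (fun=> [tuple of nseq k 0]), (fun=> s); split=> [[]|[]|] //.
by rewrite big_ord0.
Qed.

Lemma foldr_cliffordZ (r : seq 'rV[C]_(m + m)) (c : C) phi :
  foldr clf (c *: phi) r = c *: foldr clf phi r.
Proof. by elim: r => //= v r ->; rewrite !cliffordE clZ. Qed.

Lemma levZ k (c : C) w : lev k w -> lev k (c *: w).
Proof.
move=> [N [v [p [L P ->]]]]; exists N, v, (fun a => c *: p a); split=> // [a|].
  exact: PhiZ.
by rewrite scaler_sumr; apply: eq_bigr => a _; rewrite foldr_cliffordZ.
Qed.

Lemma lev_sum k (I : Type) (r : seq I) (F : I -> ext R m) :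
  (forall i, lev k (F i)) -> lev k (\sum_(i <- r) F i).
Proof.
move=> FL; apply: (big_ind (lev k)) => //; first exact: lev0.
by move=> u w; exact: lev_add.
Qed.

Lemma lev_raise k b w : conj_i_eigenspace J b -> lev k w -> lev k.+1 (cl b w).
Proof.
move=> bL [N [v [p [L P ->]]]].
exists N, (fun a => [tuple of b :: v a]), p; split=> // [a i|].
  by case: (unliftP ord0 i) => [j|] ->; rewrite ?tnthS ?tnth0.
by rewrite cl_sum; apply: eq_bigr => a _; rewrite /= cliffordE.
Qed.

(** The factor [v] is carried to the right by the Clifford relation; each crossing removes one
    factor of Lbar, and [phi] is finally annihilated. *)
Lemma lev_lower_gen (v : 'rV[C]_(m + m)) (r : seq 'rV[C]_(m + m)) phi :
  v *m toC J = 'i%C *: v ->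
  Phi phi -> (forall b, b \in r -> conj_i_eigenspace J b) ->
  lev (size r).-1 (cl v (foldr clf phi r)).
Proof.
move=> vL Pphi; elim: r => [|b r IH] rL /=.
  by rewrite (L_Phi vL Pphi); exact: lev0.
have bL : conj_i_eigenspace J b by apply: rL; rewrite inE eqxx.
have rL' c : c \in r -> conj_i_eigenspace J c by move=> cr; apply: rL; rewrite inE cr orbT.
rewrite cliffordE clC -scaleN1r; apply: lev_add.
  apply/levZ/(lev_gen (t := in_tuple r)) => // i.
  by apply: rL'; rewrite mem_tnth.
apply: levZ; have := lev_raise bL (IH rL').
(* For empty [r] the truncated predecessor makes raising overshoot to level 1; the term is then 0,
   because [v] kills [phi]. *)
case: r {IH rL rL'} => //= _; rewrite (L_Phi vL Pphi) cl0; exact: lev0.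
Qed.

Lemma lev_lower k (v : 'rV[C]_(m + m)) w :
  v *m toC J = 'i%C *: v -> lev k w -> lev k.-1 (cl v w).
Proof.
move=> vL [N [t [p [L P ->]]]]; rewrite cl_sum; apply: lev_sum => a.
rewrite -{1}(size_tuple (t a)); apply: lev_lower_gen => // b /tnthP[i ->].
exact: L.
Qed.

Lemma spinop_Phi phi : Phi phi -> spinop (toC J) phi = ('i%C * q%:R) *: phi.
Proof.
move=> Pphi; rewrite (@spinop_vacuum _ _ _ 'i%C) ?mul_Ci //; last first.
  by move=> v vL; exact: L_Phi.
by congr (_ *: _); rewrite natrM; field.
Qed.

(** The spinor line has eigenvalue i q, and every factor from Lbar, the eigenspace of [J] for -i,
    lowers it by i. *)
Lemma lev_eigen k w : lev k w ->
  spinop (toC J) w = ('i%C * (q%:Z - k%:Z)%:~R) *: w.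
Proof.
move=> [N [t [p [L P ->]]]]; rewrite spinop_sum scaler_sumr; apply: eq_bigr => a _.
have : forall b, b \in (t a : seq _) -> conj_i_eigenspace J b.
  by move=> b /tnthP[i ->].
suff H (r : seq 'rV[C]_(m + m)) : (forall b, b \in r -> conj_i_eigenspace J b) ->
    spinop (toC J) (foldr clf (p a) r)
    = ('i%C * (q%:Z - (size r)%:Z)%:~R) *: foldr clf (p a) r.
  by move=> /H ->; rewrite size_tuple.
elim: r => /= [_|b r IH rL]; first by rewrite spinop_Phi // subr0.
have /conj_i_eigenspaceP bL : conj_i_eigenspace J b by apply: rL; rewrite inE eqxx.
rewrite cliffordE spinop_cl // IH; last by move=> c cr; apply: rL; rewrite inE cr orbT.
rewrite bL clZ clZl -scalerDl; congr (_ *: _).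
rewrite (_ : q%:Z - (size r).+1%:Z = q%:Z - (size r)%:Z - 1); last by lia.
by rewrite [in RHS]rmorphB /=; ring.
Qed.

(** L and Lbar play symmetric roles: the first level is killed by L and has eigenvalue i q, the last
    nonzero one is killed by Lbar and has eigenvalue -i q. Steps of i leave room for 2q + 1
    levels. *)
Let lev_nonzero_bounded k w : lev k w -> w <> 0 -> (k <= m)%N.
Proof.
move=> wk w0.
(* A last nonzero level exists: otherwise an operator on a finite-dimensional space would have
   infinitely many eigenvalues. *)
have [K [u [kK uK u0 uS]]] : exists K u, [/\ (k <= K)%N, lev K u, u <> 0
    & forall v, lev K.+1 v -> v = 0].
  apply: contrapT => noK.
  have H : forall i, exists u, lev (k + i)%N u /\ u <> 0.
    elim=> [|i [u [uL u0]]]; first by exists w; rewrite addn0.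
    apply: contrapT => nou; apply: noK; exists (k + i)%N, u; split=> //.
      exact: leq_addr.
    move=> v vL; apply: contrapT => v0; apply: nou; exists v; rewrite addnS.
    by split.
  have /choice[c cP] := H.
  have [i _ ci0] := @eigenvalues_bounded C {ffun {set 'I_m} -> C^o}
    (spinop (toC J)) (fun i => 'i%C * (q%:Z - (k + i)%:Z)%:~R) c
    (@spinop_linear _ _ _)
    (fun a b e => ltac:(have := Ci_int_inj e; lia)) (fun i => lev_eigen (cP i).1).
  by case: (cP i).
have uv : spinop (toC J) u = (- 'i%C * q%:R) *: u.
  rewrite (@spinop_vacuum _ _ _ (- 'i%C)) ?mulrNN ?mul_Ci //.
    by congr (_ *: _); rewrite natrM; field.
  by move=> b bL; apply: uS; apply: lev_raise => //; apply/conj_i_eigenspaceP.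
have : ('i%C * (q%:Z - K%:Z)%:~R - (- 'i%C * q%:R)) *: u = 0.
  by rewrite scalerBl -lev_eigen // uv subrr.
move/eqP; rewrite scaler_eq0; case/orP => [|/eqP //].
rewrite mulNr opprK -mulrDr mulf_eq0 (negPf (Ci_neq0 _)) /=.
rewrite -[q%:R]/(q%:Z%:~R) -rmorphD /= intr_eq0 => /eqP e.
lia.
Qed.

Let decomposed (w : ext R m) := exists c : nat -> ext R m,
  (forall k, lev k (c k)) /\ w = \sum_(k < m.+1) c k.

Let decomposed_add u w : decomposed u -> decomposed w -> decomposed (u + w).
Proof.
move=> [c [cL ->]] [d [dL ->]]; exists (fun k => c k + d k).
by split=> [k|]; [exact: lev_add|rewrite big_split].
Qed.

Let decomposed_lev k w : lev k w -> decomposed w.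
Proof.
move=> wL; have [km|mk] := leqP k m; last first.
  exists (fun=> 0); split=> [i|]; first exact: lev0.
  rewrite big1 //; apply: contrapT => w0.
  by have := lev_nonzero_bounded wL w0; rewrite leqNgt mk.
exists (fun i => if i == k then w else 0); split=> [i|].
  by case: eqP => [->//|_]; exact: lev0.
have km1 : (k < m.+1)%N by [].
rewrite (bigD1 (Ordinal km1)) //= eqxx big1 ?addr0 // => i.
by rewrite -val_eqE /= => /negPf ->.
Qed.

(** The sums of levels contain [s] and are stable under Clifford multiplication, so irreducibility
    gives everything. *)
Lemma spinor_decomposition w : decomposed w.
Proof.
apply: (@ext_irreducible _ _ decomposed s) => //.
- move=> a u [c [cL ->]]; exists (fun k => a *: c k).
  by split=> [k|]; [exact: levZ|rewrite scaler_sumr].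
- move=> v u [c [cL ->]]; rewrite cl_sum; apply: (big_ind decomposed).
  + exact: (decomposed_lev (lev0 0)).
  + exact: decomposed_add.
  (* The two halves of [v] lie in the eigenspaces for i and -i: the first lowers the level, the
     second raises it. *)
  move=> k _; pose vL := 2^-1 *: (v - 'i%C *: (v *m toC J)).
  pose vb := 2^-1 *: (v + 'i%C *: (v *m toC J)).
  have -> : v = vL + vb.
    rewrite /vL /vb -scalerDr addrACA addNr addr0; exact: esym (scaler_half v).
  rewrite clDl; apply: decomposed_add.
    apply: (@decomposed_lev k.-1); apply: lev_lower (cL k).
    rewrite /vL -scalemxAl mulmxBl -scalemxAl -mulmxA J2 mulmxN mulmx1.
    rewrite [RHS]scalerA [_ * 2^-1]mulrC -scalerA; congr (_ *: _).
    by rewrite scalerBr scalerA mul_Ci scaleN1r scalerN !opprK addrC.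
  apply: (@decomposed_lev k.+1); apply: lev_raise (cL k).
  apply/conj_i_eigenspaceP.
  rewrite /vb -scalemxAl mulmxDl -scalemxAl -mulmxA J2 mulmxN mulmx1.
  rewrite [RHS]scalerA [_ * 2^-1]mulrC -scalerA; congr (_ *: _).
  by rewrite scalerDr scalerA mulNr mul_Ci opprK scale1r scalerN scaleNr addrC.
- apply: (@decomposed_lev 0).
  by apply: (lev_gen (t := [tuple])) => // -[].
Qed.

(** Subtracting the eigenvalue equation from the decomposition gives a relation between eigenvectors
    with distinct eigenvalues; every term of it vanishes, and so do the components of the wrong
    level. *)
Lemma spinor_eigen (j : int) w : spinop (toC J) w = ('i%C * j%:~R) *: w ->
  exists2 c : nat -> ext R m, (forall k, lev k (c k)) &
    w = \sum_(k < m.+1 | q%:Z - (k : nat)%:Z == j) c k.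
Proof.
move=> wj; have [c [cL we]] := spinor_decomposition w; exists c => //.
rewrite we [RHS]big_mkcond; apply: eq_bigr => k _; case: eqP => // kj.
pose lam (k : nat) : C := 'i%C * (q%:Z - k%:Z)%:~R.
have lam_inj : injective lam by move=> a b /Ci_int_inj; lia.
pose b k := (lam k - 'i%C * j%:~R) *: c k.
have : b k = 0.
  rewrite -(eigproj_sum (@spinop_linear _ _ (toC J)) lam_inj (s := iota 0 m.+1)
    (j := k) (c := b)).
  - rewrite -[iota _ _]/(index_iota 0 m.+1) big_mkord.
    rewrite (_ : \sum_(i < m.+1) b i = 0).
      exact: eigproj0 (@spinop_linear _ _ (toC J)) _ _.
    under eq_bigr do rewrite /b scalerBl -(lev_eigen (cL _)).
    by rewrite sumrB -spinop_sum -scaler_sumr -we wj subrr.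
  - exact: iota_uniq.
  - by rewrite mem_iota /= add0n ltn_ord.
  - by move=> i; rewrite /b spinopZ (lev_eigen (cL i)) !scalerA mulrC.
move=> /eqP; rewrite scaler_eq0 => /orP[|/eqP //].
by rewrite /lam -mulrBr -rmorphB mulf_eq0 (negPf (Ci_neq0 _)) intr_eq0 /= subr_eq0 => /eqP.
Qed.

(** From here on U^j is a linear equation in terms of [J] alone, which is transported by pullbacks
    and by conjugation without reference to spinors or frames. *)
Lemma Ufiber_spinop (j : int) :
  Ufiber J Phi j = [set w | spinop (toC J) w = ('i%C * j%:~R) *: w].
Proof.
apply/seteqP; split=> w.
  rewrite /Ufiber; case: ifP => jq; last first.
    by move=> ->; rewrite /= scaler0 -[X in spinop _ X](scale0r 0) spinopZ scale0r.
  move=> /lev_eigen e /=; rewrite e; congr (('i%C * _%:~R) *: _).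
  by move: jq; lia.
move=> /spinor_eigen[c cL ->]; rewrite /Ufiber; case: ifP => jq.
  apply: (big_ind (lev `|(q%:Z - j)%R|%N)) => [||k /eqP <-]; first exact: lev0.
    by move=> u v; exact: lev_add.
  by rewrite opprB addrC subrK absz_nat.
rewrite /= big_pred0 // => k; apply/negP => /eqP kj.
by have := ltn_ord k; move: jq; lia.
Qed.

End SpinorLevels.

(** Clifford terms become variables, so that [ring], applied to each coefficient, treats them as
    atoms. *)
Ltac gen_atoms := repeat match goal with
  | |- context [cl ?v ?w] => let y := fresh in generalize (cl v w); intro y
  | |- context [spinop ?v ?w] => let y := fresh in generalize (spinop v w); intro y
  | |- context [hform ?v ?w] => let y := fresh in generalize (hform v w); intro y
  end.

Ltac ext_ring := gen_atoms; apply: extP => ?; rewrite ?(extDE, extNE, extZE); ring.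

(** * From the vanishing of the Nijenhuis tensor to the bigrading of d *)

Section Parity.
Variables (R : realType) (m : nat).
Local Notation C := R[i].

(** The grading modulo 2, for which Clifford multiplication is odd and the spin action even. It
    excludes a scalar ambiguity that Schur's argument leaves open. *)
Definition has_parity (b : bool) (w : ext R m) :=
  forall S : {set 'I_m}, odd #|S| != b -> w S = 0.

Lemma has_parityD b u w : has_parity b u -> has_parity b w -> has_parity b (u + w).
Proof. by move=> hu hw S hS; rewrite extDE hu ?hw ?addr0. Qed.

Lemma has_parityZ b (c : C) w : has_parity b w -> has_parity b (c *: w).
Proof. by move=> hw S hS; rewrite extZE hw ?mulr0. Qed.

Lemma has_parity0 b : has_parity b 0.
Proof. by move=> S _; rewrite ext0E. Qed.

Lemma has_parity_sum b (I : Type) (r : seq I) (F : I -> ext R m) :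
  (forall i, has_parity b (F i)) -> has_parity b (\sum_(i <- r) F i).
Proof.
move=> hF; apply: (big_ind (has_parity b)) => //; first exact: has_parity0.
by move=> u w; exact: has_parityD.
Qed.

Lemma has_parity_cl b v w : has_parity b w -> has_parity (~~ b) (cl v w).
Proof.
move=> hw; rewrite cl.unlock /clifford; apply: has_parityD.
  rewrite iprodE; apply: has_parity_sum => i; apply: has_parityZ => S hS.
  rewrite ffunE; case: ifPn => // iS; rewrite hw ?mulr0 //.
  by rewrite finset.cardsU1 iS /=; case: (odd _) b hS {hw} => -[].
rewrite wedge1E; apply: has_parity_sum => i; apply: has_parityZ => S hS.
rewrite ffunE; case: ifPn => // iS; rewrite hw ?mulr0 //.
by move: hS; rewrite (finset.cardsD1 i) iS /=; case: (odd _) b {hw} => -[].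
Qed.

Lemma has_parity_spinop b J w : has_parity b w -> has_parity b (spinop J w).
Proof.
move=> hw; rewrite spinop.unlock; apply: has_parityZ; apply: has_parity_sum => a.
by rewrite -(negbK b); do 2! apply: has_parity_cl.
Qed.

Lemma has_parity_ext1 : has_parity false ext1.
Proof.
move=> S; rewrite ffunE; have [->|//] := eqVneq S finset.set0.
by rewrite finset.cards0.
Qed.

End Parity.

Section Integrability.
Variables (R : realType) (m : nat).
Local Notation C := R[i].
Variables (J : 'M[C]_(m + m)) (D : 'I_m -> 'M[C]_(m + m)).
Hypotheses (hJ : so_mx J) (J2 : J *m J = - 1%:M).
Hypotheses (hD : forall i, so_mx (D i)) (DJ : forall i, D i *m J = - (J *m D i)).

Let dx i : 'rV[C]_(m + m) := row_mx 0 (delta_mx 0 i).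
Local Notation T := (spinop J).
Local Notation Ti i := (spinop (D i)).

(* The Nijenhuis tensor of [J] on the constant sections [a] and [b], in terms of
   the partial derivatives [D] of [J]. *)
Definition nijenhuis_const (a b : 'rV[C]_(m + m)) : 'rV[C]_(m + m) :=
  \sum_i (hform (dx i) (a *m J) *: (b *m D i) - hform (dx i) (b *m J) *: (a *m D i)
    + hform (a *m D i) (b *m J) *: dx i
    - (hform (dx i) a *: (b *m D i) - hform (dx i) b *: (a *m D i)
       + hform (a *m D i) b *: dx i) *m J).

Hypothesis hN : forall a b, nijenhuis_const (delta_mx 0 a) (delta_mx 0 b) = 0.

(** Minus the operator [T, [T, d]] + d. With [T, dx_i] = dx_i J and [T, d/dx_i] = - T_i, the terms
    containing d/dx_i cancel because [J *m J = - 1], and what is left involves only [J] and its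
    first derivatives. *)
Let P x := \sum_i (2 *: cl (dx i *m J) (Ti i x) + cl (dx i) (T (Ti i x) - Ti i (T x))).

Let PD x y : P (x + y) = P x + P y.
Proof.
rewrite /P -big_split; apply: eq_bigr => i _ /=.
rewrite !(spinopD, clD, clN); ext_ring.
Qed.

Let PZ (c : C) x : P (c *: x) = c *: P x.
Proof.
rewrite /P scaler_sumr; apply: eq_bigr => i _ /=.
rewrite !(spinopZ, clD, clZ, clN); ext_ring.
Qed.

Lemma hform_so A (u v : 'rV[C]_(m + m)) : so_mx A -> hform (u *m A) v = - hform u (v *m A).
Proof.
move=> hA; rewrite !hformE -(mulmxA u) hA mulmxN mulNmx trmx_mul !mulmxA.
by rewrite [LHS]mxE.
Qed.

(** The anticommutator of the odd operator [P] with [cl a]; it would be scalar if [P] were Clifford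
    multiplication, and this is the criterion used in the opposite direction. *)
Let Q a x := P (cl a x) + cl a (P x).

Let QE a x : Q a x = \sum_i ((2 * hform (dx i *m J) a) *: Ti i x
   + 2 *: cl (dx i *m J) (cl (a *m D i) x)
   + hform (dx i) a *: (T (Ti i x) - Ti i (T x))
   - 2 *: cl (dx i) (cl (a *m J *m D i) x)).
Proof.
rewrite /Q /P cl_sum -big_split; apply: eq_bigr => i _ /=.
rewrite !spinop_cl // !spinopD !spinop_cl //.
rewrite !(clD, clZ, clN) !(clC a (dx i *m J)) !(clC a (dx i)).
rewrite -(mulmxA a) DJ mulmxN (mulmxA a) -[- (a *m J *m D i)]scaleN1r clZl clZ.
rewrite (hformC a (dx i *m J)) (hformC a (dx i)).
ext_ring.
Qed.

(** Expanding both sides, their difference is Clifford multiplication by -2 times the Nijenhuis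
    tensor; this is where integrability enters. *)
Let Q_cl a b x : Q (delta_mx 0 a) (cl (delta_mx 0 b) x)
  = cl (delta_mx 0 b) (Q (delta_mx 0 a) x).
Proof.
set va := delta_mx 0 a; set vb := delta_mx 0 b.
suff e : Q va (cl vb x) - cl vb (Q va x) = cl (- 2 *: nijenhuis_const va vb) x.
  by apply/eqP; rewrite -subr_eq0 e hN scaler0 cl0l.
rewrite !QE cl_sum -sumrB /nijenhuis_const scaler_sumr cl_suml.
apply: eq_bigr => i _ /=.
rewrite !spinop_cl // !spinopD !spinop_cl //.
rewrite !(clD, clZ, clN) !(clC (va *m D i) vb) !(clC (va *m J *m D i) vb).
rewrite !(clD, clZ, clN) !(clC (dx i *m J) vb) !(clC (dx i) vb).
rewrite mulmxDl mulmxBl -!scalemxAl -(mulmxA vb (D i)) -(mulmxA va (D i)) !DJ.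
rewrite !mulmxN !(mulmxA _ J).
rewrite !(clZl, clDl, clBl, clNl).
have e1 : hform (va *m D i) (vb *m J) = hform (va *m J *m D i) vb.
  rewrite (hform_so _ _ (hD i)) (hform_so _ _ (hD i)) (hform_so _ _ hJ) opprK.
  by rewrite -!mulmxA DJ mulmxN hformNr.
rewrite e1 !(hform_so (dx i)) //.
ext_ring.
Qed.

Lemma contr_cl i (u : ext R m) : contr i u = cl (delta_mx 0 (lshift m i)) u.
Proof.
rewrite cl.unlock /clifford -iprod_delta.
rewrite (_ : lsubmx _ = delta_mx 0 i); last first.
  by apply/rowP => k; rewrite !mxE eq_lshift.
rewrite (_ : rsubmx _ = 0) ?wedge10l ?addr0 //.
by apply/rowP => k; rewrite !mxE eq_rlshift.
Qed.

Lemma ext1_neq0 : (ext1 : ext R m) <> 0.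
Proof.
move/(congr1 (fun u : ext R m => u finset.set0)); rewrite ffunE ext0E eqxx.
by move/eqP; rewrite oner_eq0.
Qed.

(** Schur's lemma: the operator commutes with Clifford multiplication, so it is determined by its
    value on [ext1], and that value, killed by all contractions, is a scalar. *)
Let Q_scalar a : exists c : C, forall x, Q (delta_mx 0 a) x = c *: x.
Proof.
pose c := Q (delta_mx 0 a) ext1 finset.set0; exists c.
have QD u w : Q (delta_mx 0 a) (u + w) = Q (delta_mx 0 a) u + Q (delta_mx 0 a) w.
  by rewrite /Q clD !PD clD addrACA.
have QZ (k : C) w : Q (delta_mx 0 a) (k *: w) = k *: Q (delta_mx 0 a) w.
  by rewrite /Q clZ !PZ clZ scalerDr.
apply: (@ext_irreducible _ _ _ ext1).
- by move=> u w; rewrite QD scalerDr => -> ->.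
- by move=> k w; rewrite QZ => ->; rewrite !scalerA mulrC.
- move=> v w Qw; rewrite [v]row_sum_delta cl_suml.
  apply: (big_ind (fun u => Q _ u = c *: u)).
  + by rewrite -(scale0r ext1) QZ !scale0r scaler0.
  + by move=> u u' hu hu'; rewrite QD hu hu' scalerDr.
  + by move=> b _; rewrite clZl QZ Q_cl Qw clZ !scalerA mulrC.
- apply: ext_scalar => i.
  have Q0 : Q (delta_mx 0 a) 0 = 0 by have := QZ 0 0; rewrite !scale0r.
  by rewrite contr_cl -Q_cl -contr_cl contr_ext1 Q0.
- exact: ext1_neq0.
Qed.

Let P_parity : has_parity true (P ext1).
Proof.
have T1 : has_parity true (P ext1).
  have h1 := @has_parity_ext1 R m.
  apply: has_parity_sum => i; apply: has_parityD.
    by apply: has_parityZ; apply: (@has_parity_cl _ _ false); exact: has_parity_spinop.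
  apply: (@has_parity_cl _ _ false); rewrite -scaleN1r; apply: has_parityD.
    by do 2! apply: has_parity_spinop.
  by apply: has_parityZ; do 2! apply: has_parity_spinop.
by [].
Qed.

(** The scalars [c a] are the values of a linear form, represented through [hform] by [v]. Then [P]
    minus [cl v] anticommutes with all Clifford multiplications, so it is 0 as soon as it kills
    [ext1]. *)
Let P_clifford : exists v, forall x, P x = cl v x.
Proof.
have /choice[c cP] := Q_scalar.
pose v := (\row_a c a) *m swap_mx R m; exists v.
have hv a : hform v (delta_mx 0 a) = c a.
  by rewrite hformE /v -(mulmxA (\row_b c b)) swap_mx_sqr mulmx1 trmx_delta
    -colE !mxE.
pose N x := P x - cl v x.
have NP a x : N (cl (delta_mx 0 a) x) = - cl (delta_mx 0 a) (N x).
  rewrite /N clD clN opprD opprK (clC v) hv.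
  by have := cP a x; rewrite /Q => /(canRL (addrK _)) ->; ext_ring.
have ND x y : N (x + y) = N x + N y by rewrite /N PD clD opprD addrACA.
have NZ (k : C) x : N (k *: x) = k *: N x by rewrite /N PZ clZ -scalerBr.
have N0 : N 0 = 0 by have := NZ 0 0; rewrite !scale0r.
suff H x : N x = 0 by move=> x; apply/eqP; rewrite -subr_eq0; apply/eqP/H.
move: x; apply: (@ext_irreducible _ _ _ ext1).
- by move=> u w; rewrite ND => -> ->; rewrite addr0.
- by move=> k w; rewrite NZ => ->; rewrite scaler0.
- move=> u w Nw; rewrite [u]row_sum_delta cl_suml.
  apply: (big_ind (fun x => N x = 0)).
  + exact: N0.
  + by move=> y y' hy hy'; rewrite ND hy hy' addr0.
  + by move=> b _; rewrite clZl NZ NP Nw cl0 oppr0 scaler0.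
(* Killed by all contractions, [N ext1] is a scalar; but [P ext1] and [cl v ext1] are odd. *)
- rewrite [N ext1]ext_scalar.
    rewrite /N extDE extNE P_parity ?finset.cards0 //.
    rewrite (@has_parity_cl _ _ false v _ (@has_parity_ext1 _ _)) ?finset.cards0 //.
    by rewrite subr0 scale0r.
  by move=> i; rewrite contr_cl -[LHS]opprK -NP -contr_cl contr_ext1 N0 oppr0.
- exact: ext1_neq0.
Qed.

(** [t] and [dt] are the value and the partial derivatives at a point of a section of eigenvalue
    [lam]; the second hypothesis is the derivative of the eigenvalue equation, and [u] is the
    exterior derivative. The witness is [- P t], and [P] being Clifford multiplication by a vector
    gives its equation from [J *m J = - 1]. *)
Lemma nijenhuis_bigrading (lam : C) t (dt : 'I_m -> ext R m) :
  T t = lam *: t -> (forall i, Ti i t + T (dt i) = lam *: dt i) ->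
  let u := \sum_i wedge1 (delta_mx 0 i) (dt i) in
  let f x := T x - lam *: x in
  exists2 p, f (f u) + u = p & f (f p) = - p.
Proof.
move=> Tt Tdt u f.
have wE i x : wedge1 (delta_mx 0 i) x = cl (dx i) x.
  by rewrite cl.unlock /clifford row_mxKl row_mxKr iprod0l add0r.
have [v vP] := P_clifford.
have uE : u = \sum_i cl (dx i) (dt i) by apply: eq_bigr => i _; rewrite wE.
have TD x y : f (x + y) = f x + f y by rewrite /f spinopD scalerDr opprD addrACA.
have f_sum (F : 'I_m -> ext R m) : f (\sum_i F i) = \sum_i f (F i).
  by rewrite /f spinop_sum scaler_sumr sumrB.
have fcl a x : f (cl a x) = cl a (f x) + cl (a *m J) x.
  by rewrite /f spinop_cl // clD clN clZ; ext_ring.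
have fdt i : f (dt i) = - Ti i t by rewrite /f -Tdt opprD addrCA subrr addr0.
have fTi i : f (Ti i t) = T (Ti i t) - Ti i (T t).
  by rewrite /f Tt spinopZ.
exists (- P t).
  rewrite {1}uE !f_sum uE /P -sumrN -big_split; apply: eq_bigr => i _ /=.
  rewrite !fcl fdt TD !fcl clN.
  have fN x : f (- x) = - f x by rewrite /f -scaleN1r spinopZ; ext_ring.
  rewrite fN fdt fTi clN -mulmxA J2 mulmxN mulmx1 clNl.
  by rewrite clN; ext_ring.
have ft : f t = 0 by rewrite /f Tt subrr.
by rewrite vP -clNl fcl ft cl0 add0r fcl ft cl0 add0r -mulmxA J2 mulmxN mulmx1 !clNl.
Qed.

End Integrability.

(** * Smooth functions on open subsets of R^n *)

Section Differentiability.
Variables (R : realType) (V W : normedModType R).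

(** The difference [g - f] vanishes near [x], hence is differentiable there with zero
    differential. *)
Lemma differentiable_near_eq (f g : V -> W) x :
  (\near x, f x = g x) -> differentiable f x -> differentiable g x.
Proof.
move=> fg df; rewrite (_ : g = f + (g - f)); last by apply/funext => y; rewrite !fctE addrC subrK.
apply: differentiableD => //.
have h0 : \near x, (g - f) x = 0.
  by near=> y; rewrite !fctE (_ : f y = g y) ?subrr //; near: y.
suff [c e] : continuous (0 : V -> W) /\
    (g - f) \o shift x = cst ((g - f) x) + \0 +o_ 0 id.
  by apply/diff_locallyP; rewrite (diff_unique c e).
split; first exact: cst_continuous.
apply/eqaddoP => e e0; near=> z.
rewrite !fctE /= (_ : g (z + x) - f (z + x) = 0); last first.
  near: z; move: h0; rewrite (near_shift (0 : V)) subr0; apply: filterS => z.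
  by rewrite /= !fctE.
have := nbhs_singleton h0; rewrite !fctE => ->.
by rewrite !addr0 subrr normr0 mulr_ge0 // ltW.
Unshelve. all: by end_near. Qed.

End Differentiability.

Section Smooth.
Variables (R : realType) (n : nat).
Implicit Types (W : set 'rV[R]_n) (u : 'rV[R]_n) (f g : 'rV[R]_n -> R).

Lemma pderiv_near_eq i f g u : (\near u, f u = g u) -> pderiv i f u = pderiv i g u.
Proof. exact: near_eq_derive. Qed.

Lemma open_near_eq (T : Type) W (f g : 'rV[R]_n -> T) u : open W -> W u -> (forall v, W v -> f v = g v) ->
  \near u, f u = g u.
Proof. by move=> oW Wu fg; apply: filterS fg _; exact: open_nbhs_nbhs. Qed.

Lemma diff_pderiv f u v : differentiable f u ->
  'd f u v = \sum_i v 0 i * pderiv i f u.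
Proof.
move=> df; rewrite {1}[v]row_sum_delta linear_sum; apply: eq_bigr => i _.
by rewrite linearZ /= /pderiv deriveE.
Qed.

Lemma iter_pderiv_rcons s i f : iter_pderiv (rcons s i) f = iter_pderiv s (pderiv i f).
Proof. by elim: s => //= j s ->. Qed.

(** Derivatives are peeled from the inside, whereas [iter_pderiv] adds them on the outside: the
    order can then serve as induction parameter in the rules for products, inverses and
    composites. *)
Fixpoint ck (k : nat) W g : Prop :=
  (forall u, W u -> differentiable g u) /\
  (if k is k'.+1 then forall i, ck k' W (pderiv i g) else True).

Lemma ckP k W g : ck k W g -> forall u, W u -> differentiable g u.
Proof. by case: k => [|k] []. Qed.

Lemma ckS k W g : ck k.+1 W g -> ck k W g.
Proof.
elim: k g => [|k IH] g [dg h]; split=> // i; apply: IH; exact: h.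
Qed.

Lemma smooth_onP W g : smooth_on W g <-> forall k, ck k W g.
Proof.
split=> [sg k|cg s u Wu].
  elim: k g sg => [|k IH] g sg; split=> [u Wu|]; rewrite ?[if _ is _ then _ else _]/=.
  - exact: (sg [::]).
  - by [].
  - exact: (sg [::]).
  - move=> i; apply: IH => s u Wu; rewrite -iter_pderiv_rcons; exact: sg.
elim/last_ind: s g cg => [|s i IH] g cg; first exact: ckP (cg 0%N) _ Wu.
by rewrite iter_pderiv_rcons; apply: IH => k; have [_ h] := cg k.+1; exact: h.
Qed.

Lemma smooth_on_diff W g u : smooth_on W g -> W u -> differentiable g u.
Proof. by move=> sg; exact: (sg [::]). Qed.

Lemma smooth_on_pderiv W g i : smooth_on W g -> smooth_on W (pderiv i g).
Proof. by move=> sg s u Wu; rewrite -iter_pderiv_rcons; exact: sg. Qed.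

Lemma smooth_on_sub W W' g : W' `<=` W -> smooth_on W g -> smooth_on W' g.
Proof. by move=> WW sg s u Wu; apply/sg/WW. Qed.

Lemma smooth_on_local W g :
  (forall u, W u -> exists2 W', W' u & smooth_on W' g) -> smooth_on W g.
Proof. by move=> h s u Wu; have [W' Wu' sg] := h u Wu; exact: sg. Qed.

Lemma ck_ext k W f g : ck k W f -> open W -> (forall u, W u -> f u = g u) -> ck k W g.
Proof.
move=> + oW; elim: k f g => [|k IH] f g [df h] fg.
  by split=> // u Wu; exact: differentiable_near_eq (open_near_eq oW Wu fg) (df u Wu).
split=> [u Wu|i].
  exact: differentiable_near_eq (open_near_eq oW Wu fg) (df u Wu).
apply: IH (h i) _ => u Wu; apply: pderiv_near_eq; exact: open_near_eq oW Wu fg.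
Qed.

Lemma smooth_on_ext W f g : smooth_on W f -> open W ->
  (forall u, W u -> f u = g u) -> smooth_on W g.
Proof. by move=> /smooth_onP sf oW fg; apply/smooth_onP => k; exact: ck_ext (sf k) oW fg. Qed.

Lemma pderiv_cst i (c : R) u : pderiv i (fun=> c) u = 0.
Proof. exact: derive_cst. Qed.

Lemma ck_cst k W (c : R) : ck k W (fun=> c).
Proof.
elim: k c => [|k IH] c; first by split=> // u _; exact: differentiable_cst.
split=> [u _|i]; first exact: differentiable_cst.
by rewrite (_ : pderiv i _ = fun=> 0) //; apply/funext => u; exact: pderiv_cst.
Qed.

Lemma smooth_on_cst W (c : R) : smooth_on W (fun=> c).
Proof. by apply/smooth_onP => k; exact: ck_cst. Qed.

Lemma diff_coord i u : differentiable (fun v : 'rV[R]_n => v 0 i) u.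
Proof. exact: differentiable_coord. Qed.

Lemma pderiv_coord i j u : pderiv i (fun v : 'rV[R]_n => v 0 j) u = (i == j)%:R.
Proof.
have di := @derivable_id R 'rV[R]_n u (delta_mx 0 i).
have /matrixP/(_ 0 j) := derive_mx di.
by rewrite derive_id !mxE eqxx /= eq_sym => ->.
Qed.

Lemma ck_coord k W j : ck k W (fun v => v 0 j).
Proof.
case: k => [|k]; first by split=> // u _; exact: diff_coord.
split=> [u _|i]; first exact: diff_coord.
rewrite (_ : pderiv i _ = fun=> (i == j)%:R); first exact: ck_cst.
by apply/funext => u; exact: pderiv_coord.
Qed.

Lemma smooth_on_coord W j : smooth_on W (fun v => v 0 j).
Proof. by apply/smooth_onP => k; exact: ck_coord. Qed.

Lemma pderivD i f g u : differentiable f u -> differentiable g u ->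
  pderiv i (fun v => f v + g v) u = pderiv i f u + pderiv i g u.
Proof. by move=> df dg; apply: deriveD; exact: diff_derivable. Qed.

Lemma pderivM i f g u : differentiable f u -> differentiable g u ->
  pderiv i (fun v => f v * g v) u = pderiv i f u * g u + f u * pderiv i g u.
Proof.
move=> df dg; have df' : derivable f u (delta_mx 0 i) by exact: diff_derivable.
have dg' : derivable g u (delta_mx 0 i) by exact: diff_derivable.
have := deriveM df' dg'; rewrite /pderiv (_ : f * g = fun v => f v * g v) // => ->.
by rewrite addrC /GRing.scale /= mulrC [X in _ + X]mulrC.
Qed.

Lemma ckD k W f g : open W -> ck k W f -> ck k W g -> ck k W (fun u => f u + g u).
Proof.
move=> oW; elim: k f g => [|k IH] f g [df hf] [dg hg].
  by split=> // u Wu; apply: differentiableD; [exact: df|exact: dg].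
split=> [u Wu|i]; first by apply: differentiableD; [exact: df|exact: dg].
apply: ck_ext (IH _ _ (hf i) (hg i)) oW _ => u Wu.
by rewrite pderivD //; [exact: df|exact: dg].
Qed.

Lemma ckM k W f g : open W -> ck k W f -> ck k W g -> ck k W (fun u => f u * g u).
Proof.
move=> oW; elim: k f g => [|k IH] f g cf cg; have [df hf] := cf; have [dg hg] := cg.
  by split=> // u Wu; apply: differentiableM; [exact: df|exact: dg].
split=> [u Wu|i]; first by apply: differentiableM; [exact: df|exact: dg].
apply: ck_ext (ckD oW (IH _ _ (hf i) (ckS cg)) (IH _ _ (ckS cf) (hg i))) oW _ => u Wu.
by rewrite pderivM //; [exact: df|exact: dg].
Qed.

Lemma smooth_onD W f g : open W -> smooth_on W f -> smooth_on W g ->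
  smooth_on W (fun u => f u + g u).
Proof. by move=> oW /smooth_onP sf /smooth_onP sg; apply/smooth_onP => k; exact: ckD. Qed.

Lemma smooth_onM W f g : open W -> smooth_on W f -> smooth_on W g ->
  smooth_on W (fun u => f u * g u).
Proof. by move=> oW /smooth_onP sf /smooth_onP sg; apply/smooth_onP => k; exact: ckM. Qed.

Lemma smooth_onN W f : open W -> smooth_on W f -> smooth_on W (fun u => - f u).
Proof.
move=> oW sf; apply: smooth_on_ext (smooth_onM oW (smooth_on_cst (-1)) sf) oW _.
by move=> u _; rewrite mulN1r.
Qed.

Lemma smooth_on_sum W (I : Type) (r : seq I) (P : pred I) (F : I -> 'rV[R]_n -> R) :
  open W -> (forall i, P i -> smooth_on W (F i)) ->
  smooth_on W (fun u => \sum_(i <- r | P i) F i u).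
Proof.
move=> oW sF; elim: r => [|i r IH].
  by apply: smooth_on_ext (smooth_on_cst 0) oW _ => u _; rewrite big_nil.
apply: (@smooth_on_ext _ (fun u => (if P i then F i u else 0) +
    \sum_(i <- r | P i) F i u)) => //; last first.
  by move=> u _; rewrite big_cons; case: ifP; rewrite ?add0r.
apply: smooth_onD => //; case Pi : (P i); first exact: sF.
exact: smooth_on_cst.
Qed.

Lemma smooth_on_prod W (I : Type) (r : seq I) (P : pred I) (F : I -> 'rV[R]_n -> R) :
  open W -> (forall i, P i -> smooth_on W (F i)) ->
  smooth_on W (fun u => \prod_(i <- r | P i) F i u).
Proof.
move=> oW sF; elim: r => [|i r IH].
  by apply: smooth_on_ext (smooth_on_cst 1) oW _ => u _; rewrite big_nil.
apply: (@smooth_on_ext _ (fun u => (if P i then F i u else 1) *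
    \prod_(i <- r | P i) F i u)) => //; last first.
  by move=> u _; rewrite big_cons; case: ifP; rewrite ?mul1r.
apply: smooth_onM => //; case Pi : (P i); first exact: sF.
exact: smooth_on_cst.
Qed.

Lemma pderivV i f u : differentiable f u -> f u != 0 ->
  pderiv i (fun v => (f v)^-1) u = - pderiv i f u * ((f u)^-1 * (f u)^-1).
Proof.
move=> df fu; have df' : derivable f u (delta_mx 0 i) by exact: diff_derivable.
have := deriveV fu df'; rewrite /pderiv => ->.
by rewrite /GRing.scale /= expr2 invfM mulNr mulrC mulNr.
Qed.

Lemma ckV k W f : open W -> (forall u, W u -> f u != 0) -> ck k W f ->
  ck k W (fun u => (f u)^-1).
Proof.
move=> oW f0; elim: k => [|k IH] cf; have [df hf] := cf.
  by split=> // u Wu; apply: differentiableV; [exact: df|exact: f0].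
split=> [u Wu|i]; first by apply: differentiableV; [exact: df|exact: f0].
have cV := IH (ckS cf).
apply: (@ck_ext _ _ (fun u => (-1 * pderiv i f u) * ((f u)^-1 * (f u)^-1))) => //; last first.
  by move=> u Wu; rewrite pderivV ?mulN1r //; [exact: df|exact: f0].
by apply: ckM => //; apply: ckM => //; [exact: ck_cst|exact: hf].
Qed.

Lemma smooth_onV W f : open W -> (forall u, W u -> f u != 0) -> smooth_on W f ->
  smooth_on W (fun u => (f u)^-1).
Proof. by move=> oW f0 /smooth_onP sf; apply/smooth_onP => k; exact: ckV. Qed.

End Smooth.

Section Composition.
Variables (R : realType) (n m : nat).
Implicit Types (W : set 'rV[R]_n) (Z : set 'rV[R]_m).

Lemma differentiable_mx p r (f : 'rV[R]_n -> 'M[R]_(p, r)) u :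
  (forall i j, differentiable (fun v => f v i j) u) -> differentiable f u.
Proof.
move=> df; rewrite (_ : f = \sum_i \sum_j (fun v => f v i j *: delta_mx i j)).
  apply: differentiable_sum => i; apply: differentiable_sum => j.
  exact: differentiableZl.
apply/funext => v; rewrite {1}[f v]matrix_sum_delta fct_sumE.
by apply: eq_bigr => i _; rewrite fct_sumE.
Qed.

Lemma differentiable_row_coord (f : 'rV[R]_n -> 'rV[R]_m) u j :
  differentiable f u -> differentiable (fun v => f v 0 j) u.
Proof.
by move=> df; apply: (@differentiable_comp _ _ _ _ f (fun v => v 0 j)) => //;
  exact: differentiable_coord.
Qed.

Lemma jacobianE (f : 'rV[R]_n -> 'rV[R]_m) u i j : differentiable f u ->
  jacobian f u i j = pderiv i (fun v => f v 0 j) u.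
Proof.
move=> df; have := deriveEjacobian (delta_mx 0 i) df.
rewrite -rowE => /matrixP/(_ 0 j); rewrite [RHS]mxE => <-.
by rewrite derive_mx ?mxE //; exact: diff_derivable.
Qed.

Lemma pderiv_comp (f : 'rV[R]_n -> 'rV[R]_m) (g : 'rV[R]_m -> R) u i :
  differentiable f u -> differentiable g (f u) ->
  pderiv i (fun v => g (f v)) u
  = \sum_j pderiv i (fun v => f v 0 j) u * pderiv j g (f u).
Proof.
move=> df dg; rewrite {1}/pderiv (_ : (fun v => g (f v)) = g \o f) //.
rewrite deriveE; last exact: differentiable_comp.
rewrite diff_comp //= diff_pderiv //; apply: eq_bigr => j _; congr (_ * _).
by rewrite -jacobianE // /jacobian mxE.
Qed.

Lemma ck_comp k W Z (f : 'rV[R]_n -> 'rV[R]_m) (g : 'rV[R]_m -> R) :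
  open W -> (forall u, W u -> Z (f u)) -> (forall j, ck k W (fun v => f v 0 j)) ->
  ck k Z g -> ck k W (fun v => g (f v)).
Proof.
move=> oW fW; elim: k g => [|k IH] g cf cg.
  split=> // u Wu; apply: (@differentiable_comp _ _ _ _ f g).
    by apply: differentiable_mx => i j; rewrite ord1; exact: (ckP (cf j) Wu).
  exact: ckP cg _ (fW u Wu).
have df u : W u -> differentiable f u.
  by move=> Wu; apply: differentiable_mx => i j; rewrite ord1; exact: (ckP (cf j) Wu).
split=> [u Wu|i].
  by apply: (@differentiable_comp _ _ _ _ f g); [exact: df|exact: ckP cg _ (fW u Wu)].
(* The chain rule expresses the derivative by products of functions of order [k], within reach of
   the induction hypothesis. *)
apply: (@ck_ext _ _ _ _ (fun u => \sum_(j <- index_enum 'I_m)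
    pderiv i (fun v => f v 0 j) u * pderiv j g (f u))) => //; last first.
  by move=> u Wu; rewrite pderiv_comp //; [exact: df|exact: ckP cg _ (fW u Wu)].
elim: (index_enum _) => [|j r IHr].
  by apply: ck_ext (ck_cst k W 0) oW _ => u _; rewrite big_nil.
apply: ck_ext (ckD oW (ckM oW ((cf j).2 i) (IH _ (fun j => ckS (cf j)) (cg.2 j))) IHr) oW _.
by move=> u _; rewrite big_cons.
Qed.

Lemma smooth_on_comp W Z (f : 'rV[R]_n -> 'rV[R]_m) (g : 'rV[R]_m -> R) :
  open W -> (forall u, W u -> Z (f u)) -> smooth_mx_on W f ->
  smooth_on Z g -> smooth_on W (fun v => g (f v)).
Proof.
move=> oW fW sf /smooth_onP sg; apply/smooth_onP => k.
by apply: ck_comp (sg k) => // j; have /smooth_onP := sf 0 j; apply.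
Qed.

Lemma smooth_mx_diff W p r (f : 'rV[R]_n -> 'M[R]_(p, r)) u :
  smooth_mx_on W f -> W u -> differentiable f u.
Proof.
by move=> sf Wu; apply: differentiable_mx => i j; exact: smooth_on_diff (sf i j) Wu.
Qed.

End Composition.

Section SmoothMatrix.
Variables (R : realType) (n : nat).
Implicit Types W : set 'rV[R]_n.

Lemma smooth_mx_ext p r W (f g : 'rV[R]_n -> 'M[R]_(p, r)) : smooth_mx_on W f ->
  open W -> (forall u, W u -> f u = g u) -> smooth_mx_on W g.
Proof.
by move=> sf oW fg i j; apply: smooth_on_ext (sf i j) oW _ => u Wu; rewrite fg.
Qed.

Lemma smooth_mx_sub p r W W' (f : 'rV[R]_n -> 'M[R]_(p, r)) :
  W' `<=` W -> smooth_mx_on W f -> smooth_mx_on W' f.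
Proof. by move=> WW sf i j; exact: smooth_on_sub (sf i j). Qed.

Lemma smooth_mx_cst p r W (A : 'M[R]_(p, r)) : smooth_mx_on W (fun=> A).
Proof. by move=> i j; exact: smooth_on_cst. Qed.

Lemma smooth_mx_id W : smooth_mx_on W (fun u => u).
Proof. by move=> i j; rewrite ord1; exact: smooth_on_coord. Qed.

Lemma smooth_mxD p r W (f g : 'rV[R]_n -> 'M[R]_(p, r)) : open W ->
  smooth_mx_on W f -> smooth_mx_on W g -> smooth_mx_on W (fun u => f u + g u).
Proof.
move=> oW sf sg i j; apply: smooth_on_ext (smooth_onD oW (sf i j) (sg i j)) oW _.
by move=> u _; rewrite mxE.
Qed.

Lemma smooth_mxN p r W (f : 'rV[R]_n -> 'M[R]_(p, r)) : open W ->
  smooth_mx_on W f -> smooth_mx_on W (fun u => - f u).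
Proof.
move=> oW sf i j; apply: smooth_on_ext (smooth_onN oW (sf i j)) oW _.
by move=> u _; rewrite mxE.
Qed.

Lemma smooth_mulmx p r t W (f : 'rV[R]_n -> 'M[R]_(p, r)) (g : 'rV[R]_n -> 'M[R]_(r, t)) :
  open W -> smooth_mx_on W f -> smooth_mx_on W g -> smooth_mx_on W (fun u => f u *m g u).
Proof.
move=> oW sf sg i j.
apply: smooth_on_ext (smooth_on_sum (index_enum _) (P := xpredT) oW
  (fun k _ => smooth_onM oW (sf i k) (sg k j))) oW _.
by move=> u _; rewrite mxE.
Qed.

Lemma smooth_det p W (f : 'rV[R]_n -> 'M[R]_p) : open W -> smooth_mx_on W f ->
  smooth_on W (fun u => \det (f u)).
Proof.
move=> oW sf; apply: smooth_on_sum => // s _; apply: smooth_onM => //.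
  exact: smooth_on_cst.
by apply: smooth_on_prod => // i _; exact: sf.
Qed.

Lemma smooth_invmx p W (f : 'rV[R]_n -> 'M[R]_p) : open W ->
  (forall u, W u -> f u \in unitmx) -> smooth_mx_on W f ->
  smooth_mx_on W (fun u => invmx (f u)).
Proof.
move=> oW uf sf i j.
apply: (@smooth_on_ext _ _ _ (fun u => (\det (f u))^-1 *
    ((-1) ^+ (j + i) * \det (row' j (col' i (f u)))))) => //; last first.
  by move=> u Wu; rewrite /invmx uf // !mxE.
apply: smooth_onM => //.
  apply: smooth_onV => // [u Wu|]; last exact: smooth_det.
  by have := uf u Wu; rewrite unitmxE unitfE.
apply: smooth_onM => //; first exact: smooth_on_cst.
apply: smooth_det => // k l.
by apply: smooth_on_ext (sf (lift j k) (lift i l)) oW _ => u _; rewrite !mxE.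
Qed.

Lemma smooth_jacobian m W (f : 'rV[R]_n -> 'rV[R]_m) : open W ->
  smooth_mx_on W f -> smooth_mx_on W (jacobian f).
Proof.
move=> oW sf i j; apply: smooth_on_ext (smooth_on_pderiv i (sf 0 j)) oW _.
by move=> u Wu; rewrite jacobianE //; exact: smooth_mx_diff sf Wu.
Qed.

Lemma smooth_trmx p r W (f : 'rV[R]_n -> 'M[R]_(p, r)) : open W ->
  smooth_mx_on W f -> smooth_mx_on W (fun u => (f u)^T).
Proof. by move=> oW sf i j; apply: smooth_on_ext (sf j i) oW _ => u _; rewrite mxE. Qed.

Lemma smooth_block_mx p r s t W (a : 'rV[R]_n -> 'M[R]_(p, s)) b c
    (d : 'rV[R]_n -> 'M[R]_(r, t)) : open W ->
  smooth_mx_on W a -> smooth_mx_on W b -> smooth_mx_on W c -> smooth_mx_on W d ->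
  smooth_mx_on W (fun u => block_mx (a u) (b u) (c u) (d u)).
Proof.
move=> oW sa sb sc sd i j.
have [i'|i'] := split_ordP i => ->; have [j'|j'] := split_ordP j => ->.
- by apply: smooth_on_ext (sa i' j') oW _ => u _; rewrite block_mxEul.
- by apply: smooth_on_ext (sb i' j') oW _ => u _; rewrite block_mxEur.
- by apply: smooth_on_ext (sc i' j') oW _ => u _; rewrite block_mxEdl.
- by apply: smooth_on_ext (sd i' j') oW _ => u _; rewrite block_mxEdr.
Qed.

End SmoothMatrix.

Lemma smooth_mx_comp (R : realType) n m p r (W : set 'rV[R]_n) (Z : set 'rV[R]_m)
    (f : 'rV[R]_n -> 'rV[R]_m) (g : 'rV[R]_m -> 'M[R]_(p, r)) :
  open W -> (forall u, W u -> Z (f u)) -> smooth_mx_on W f -> smooth_mx_on Z g ->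
  smooth_mx_on W (fun u => g (f u)).
Proof.
by move=> oW fZ sf sg i j; apply: smooth_on_comp fZ sf (sg i j).
Qed.

Lemma diff_jacobian (R : realType) n m (f : 'rV[R]_n -> 'rV[R]_m) u v :
  'd f u v = v *m jacobian f u.
Proof. by rewrite /jacobian mul_rV_lin1. Qed.

Lemma jacobian_comp (R : realType) n m p (f : 'rV[R]_n -> 'rV[R]_m)
    (g : 'rV[R]_m -> 'rV[R]_p) u :
  differentiable f u -> differentiable g (f u) ->
  jacobian (g \o f) u = jacobian f u *m jacobian g (f u).
Proof.
move=> df dg; apply/row_matrixP => i; rewrite !rowE mulmxA.
by rewrite -[LHS]diff_jacobian diff_comp //= -!diff_jacobian.
Qed.

Lemma jacobian_near_eq (R : realType) n m (f g : 'rV[R]_n -> 'rV[R]_m) u :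
  differentiable f u -> (\near u, f u = g u) -> jacobian f u = jacobian g u.
Proof.
move=> df fg; have dg := differentiable_near_eq fg df.
apply/matrixP => i j; rewrite [LHS](jacobianE _ _ df) [RHS](jacobianE _ _ dg).
apply: (@pderiv_near_eq _ _ i (fun v => f v 0 j) (fun v => g v 0 j)).
by apply: filterS fg => v ->.
Qed.

Lemma jacobian_id (R : realType) n (u : 'rV[R]_n) : jacobian id u = 1%:M.
Proof.
apply/matrixP => i j; rewrite jacobianE; last by apply: differentiable_mx => k l; rewrite ord1; exact: diff_coord.
by rewrite pderiv_coord mxE.
Qed.

Lemma jacobian_mulmxr (R : realType) n m (A : 'M[R]_(n, m)) (b : 'rV[R]_m) u :
  differentiable (fun v : 'rV[R]_n => b + v *m A) u /\
  jacobian (fun v : 'rV[R]_n => b + v *m A) u = A.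
Proof.
have df : differentiable (fun v : 'rV[R]_n => b + v *m A) u.
  have sm : smooth_mx_on setT (fun v : 'rV[R]_n => b + v *m A).
    apply: smooth_mxD => //; [exact: openT|exact: smooth_mx_cst|].
    apply: smooth_mulmx => //; [exact: openT|exact: smooth_mx_id|exact: smooth_mx_cst].
  exact: smooth_mx_diff sm _.
split=> //; apply/matrixP => i j; rewrite jacobianE //.
rewrite (_ : (fun v => _) = fun v : 'rV[R]_n => b 0 j + \sum_k v 0 k * A k j); last first.
  by apply/funext => v; rewrite !mxE.
have sk k : smooth_on setT (fun v : 'rV[R]_n => v 0 k * A k j).
  by apply: smooth_onM; [exact: openT|exact: smooth_on_coord|exact: smooth_on_cst].
have pk k v : pderiv i (fun v : 'rV[R]_n => v 0 k * A k j) v = (i == k)%:R * A k j.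
  rewrite pderivM; [|exact: diff_coord|exact: differentiable_cst].
  by rewrite pderiv_coord pderiv_cst mulr0 addr0.
rewrite pderivD ?pderiv_cst ?add0r; first last.
- apply: (smooth_on_diff (W := setT)) => //; apply: smooth_on_sum => //; exact: openT.
- exact: differentiable_cst.
rewrite /pderiv (_ : (fun v => _) = \sum_k (fun v : 'rV[R]_n => v 0 k * A k j)); last first.
  by apply/funext => v; rewrite fct_sumE.
rewrite derive_sum; last by move=> k; apply: diff_derivable; exact: smooth_on_diff (sk k) _.
rewrite (bigD1 i) //= [X in X + _]pk eqxx mul1r big1 ?addr0 // => k /negPf ki.
by rewrite [LHS]pk eq_sym ki mul0r.
Qed.

(** * Mean value inequalities, mixed derivatives and local inverses *)

Lemma diff_eps (R : realType) (V W : normedModType R) (f : V -> W) u (e : R) :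
  differentiable f u -> 0 < e ->
  \forall h \near 0, `|f (h + u) - f u - 'd f u h| <= e * `|h|.
Proof.
move=> /diff_locallyP[_ /eqaddoP dfu] e0; have := dfu e e0.
by apply: filterS => h; rewrite !fctE /= opprD addrA.
Qed.

Lemma eps_diff (R : realType) (V W : normedModType R) (f : V -> W)
    (L : {linear V -> W}) u : continuous L ->
  (forall e : R, 0 < e -> \forall h \near 0, `|f (h + u) - f u - L h| <= e * `|h|) ->
  differentiable f u /\ 'd f u = L :> (V -> W).
Proof.
move=> cL fL; have e : f \o shift u = cst (f u) + L +o_ 0 id.
  apply/eqaddoP => e e0; have := fL e e0.
  by apply: filterS => h; rewrite !fctE /= opprD addrA.
have dL := diff_unique cL e; split=> //.
by apply/diff_locallyP; rewrite dL.
Qed.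

Lemma eps_jacobian (R : realType) n m (f : 'rV[R]_n -> 'rV[R]_m) (u : 'rV[R]_n) A :
  (forall e : R, 0 < e -> \forall h \near (0 : 'rV[R]_n), `|f (h + u) - f u - h *m A| <= e * `|h|) ->
  differentiable f u /\ jacobian f u = A.
Proof.
move=> fA; have cA : continuous (mulmxr A : 'rV[R]_n -> 'rV[R]_m).
  move=> v; apply: differentiable_continuous.
  have [+ _] := jacobian_mulmxr A 0 v.
  by rewrite (_ : (fun v => _) = mulmxr A) //; apply/funext => w; rewrite add0r.
have [df dE] := eps_diff cA fA; split=> //.
by apply/row_matrixP => i; rewrite !rowE -diff_jacobian dE.
Qed.

Lemma diff_eps_ball_mx (R : realType) n m (f : 'rV[R]_n -> 'rV[R]_m) u (e : R) :
  differentiable f u -> 0 < e -> exists2 r : R, 0 < r & forall h, `|h| < r ->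
    `|f (u + h) - f u - h *m jacobian f u| <= e * `|h|.
Proof.
move=> df e0; have /nbhs_ballP[r /= r0 H] := diff_eps df e0; exists r => // h hr.
have := H h; rewrite -ball_normE /= sub0r normrN [h + u]addrC -diff_jacobian.
exact.
Qed.

Section MeanValue.
Variables (R : realType) (n : nat).
Implicit Types (u v x y : 'rV[R]_n) (f g : 'rV[R]_n -> R).

Lemma unit_mean_value (f df : R -> R) :
  (forall s : R, 0 <= s <= 1 -> is_derive s 1 f (df s)) ->
  exists2 s : R, 0 <= s <= 1 & f 1 - f 0 = df s.
Proof.
move=> fd; have [||s] := @MVT_segment R f df 0 1 ler01.
- by move=> s; rewrite in_itv /= => /andP[/ltW ? /ltW ?]; apply: fd; apply/andP.
- apply: derivable_within_continuous => s; rewrite in_itv /= => s01.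
  by case: (fd s s01).
by rewrite in_itv /= subr0 mulr1 => s01 e; exists s.
Qed.

Lemma is_derive_line f u v (s : R) : differentiable f (u + s *: v) ->
  is_derive s 1 (fun s : R => f (u + s *: v)) ('d f (u + s *: v) v).
Proof.
move=> df.
have d1 : is_diff s (cst u : R -> 'rV[R]_n) 0 by exact: is_diff_cst.
have [dl dlE] := is_diffD d1 (is_diff_scalel s v).
have dfl : differentiable (f \o (cst u + ( *:%R^~ v))) s.
  exact: differentiable_comp.
apply: DeriveDef; first exact: (diff_derivable dfl).
rewrite -[LHS]/('D_1 (f \o (cst u + ( *:%R^~ v))) s) deriveE // diff_comp //.
by rewrite /= dlE /= !fctE scale1r add0r.
Qed.

Lemma is_derive_coord f u (h : R) i (s : R) (v := h *: delta_mx 0 i : 'rV[R]_n) :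
  differentiable f (u + s *: v) ->
  is_derive s 1 (fun s : R => f (u + s *: v)) (h * pderiv i f (u + s *: v)).
Proof.
move=> df; have := is_derive_line df.
suff -> : 'd f (u + s *: v) v = h * pderiv i f (u + s *: v) by [].
by rewrite linearZ /= /pderiv deriveE.
Qed.

Lemma mean_value f x v : (forall s : R, 0 <= s <= 1 -> differentiable f (x + s *: v)) ->
  exists2 s : R, 0 <= s <= 1 & f (x + v) - f x = 'd f (x + s *: v) v.
Proof.
move=> df; have [s s01] := unit_mean_value (fun s s01 => is_derive_line (df s s01)).
by rewrite scale1r scale0r addr0 => e; exists s.
Qed.

Lemma ler_coord_norm v j : `|v 0 j| <= `|v|.
Proof.
rewrite [leRHS]/Num.Def.normr /= mx_normrE.
exact: (le_bigmax _ (fun i => `|v i.1 i.2|) (0, j)).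
Qed.

Lemma row_norm_le v (c : R) : 0 <= c -> (forall j, `|v 0 j| <= c) -> `|v| <= c.
Proof.
move=> c0 h; rewrite [leLHS]/Num.Def.normr /= mx_normrE.
by apply: bigmax_le => //= -[i j] _; rewrite ord1.
Qed.

Lemma norm_delta i : `|delta_mx 0 i : 'rV[R]_n| <= 1.
Proof.
apply: row_norm_le => // j; rewrite mxE eqxx /=.
by case: (j == i); rewrite ?normr1 ?normr0.
Qed.

Lemma norm_diff_le f u v (c : R) : differentiable f u ->
  (forall i, `|pderiv i f u| <= c) -> `|'d f u v| <= n%:R * c * `|v|.
Proof.
move=> df fc; rewrite diff_pderiv //; apply: le_trans (ler_norm_sum _ _ _) _.
rewrite -mulrA -[X in X%:R](card_ord n) -sum1_card natr_sum mulr_suml.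
apply: ler_sum => i _; rewrite normrM mul1r mulrC.
by apply: ler_pM => //; exact: ler_coord_norm.
Qed.

Lemma ball_segment u0 (r : R) x v (s : R) : ball u0 r x -> ball u0 r (x + v) ->
  0 <= s <= 1 -> ball u0 r (x + s *: v).
Proof.
rewrite -!ball_normE /= => bx bv /andP[s0 s1].
have -> : u0 - (x + s *: v) = (1 - s) *: (u0 - x) + s *: (u0 - (x + v)).
  by apply/rowP => j; rewrite !mxE; ring.
apply: le_lt_trans (ler_normD _ _) _; rewrite !normrZ.
rewrite !ger0_norm ?subr_ge0 //.
have [->|s0'] := eqVneq s 0; first by rewrite mul0r addr0 subr0 mul1r.
rewrite (_ : r = (1 - s) * r + s * r); last by ring.
apply: ler_ltD; first by apply: ler_wpM2l; rewrite ?subr_ge0 // ltW.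
by rewrite ltr_pM2l // lt_neqAle eq_sym s0'.
Qed.

Lemma mean_value_ball f u0 (r c : R) x y :
  (forall u, ball u0 r u -> differentiable f u /\ forall i, `|pderiv i f u| <= c) ->
  ball u0 r x -> ball u0 r y -> `|f y - f x| <= n%:R * c * `|y - x|.
Proof.
move=> fd bx by_; have by' : ball u0 r (x + (y - x)) by rewrite addrC subrK.
have [|s s01] := @mean_value f x (y - x).
  by move=> s s01; have [] := fd _ (ball_segment bx by' s01).
rewrite [x + _]addrC subrK => ->; have [df fc] := fd _ (ball_segment bx by' s01).
exact: norm_diff_le.
Qed.

Lemma const_along f u0 (r : R) x v :
  (forall u, ball u0 r u -> differentiable f u /\ 'd f u v = 0) ->
  ball u0 r x -> ball u0 r (x + v) -> f (x + v) = f x.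
Proof.
move=> fd bx bv; have [|s s01] := @mean_value f x v.
  by move=> s s01; have [] := fd _ (ball_segment bx bv s01).
by have [_ ->] := fd _ (ball_segment bx bv s01) => /eqP; rewrite subr_eq0 => /eqP.
Qed.

Lemma diff_eps_ball f u (e : R) : differentiable f u -> 0 < e ->
  exists2 r : R, 0 < r & forall h, `|h| < r ->
    `|f (u + h) - f u - 'd f u h| <= e * `|h|.
Proof.
move=> df e0; have /nbhs_ballP[r /= r0 H] := diff_eps df e0; exists r => // h hr.
by have := H h; rewrite -ball_normE /= sub0r normrN [h + u]addrC; apply.
Qed.

(** The mean value theorem in direction [i], applied to the increment in direction [j], reduces the
    second difference to two values of [pderiv i f], which are expanded to first order at [u]. *)
Lemma mixed_difference f i j u (r e : R) : 0 < r ->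
  (forall v, ball u r v -> differentiable f v) -> differentiable (pderiv i f) u ->
  0 < e -> exists2 d : R, 0 < d & forall h : R, 0 < h < d ->
   `|f (u + h *: delta_mx 0 j + h *: delta_mx 0 i)
    - f (u + h *: delta_mx 0 i) - f (u + h *: delta_mx 0 j) + f u
    - h * (h * pderiv j (pderiv i f) u)| <= e * (h * h).
Proof.
(* Two errors occur, each at distance at most [2 * h] from [u]: hence [e / 4], and below half of the
   smaller radius. *)
move=> r0 nf df e0; have e30 : 0 < e / 4 by rewrite divr_gt0.
have [r2 r20 dfe] := diff_eps_ball df e30.
exists (Num.min r r2 / 2); first by rewrite divr_gt0 // lt_min r0.
move=> h /andP[h0]; rewrite ltr_pdivlMr // mulrC lt_min => /andP[hr hr2].
pose vi : 'rV[R]_n := h *: delta_mx 0 i; pose vj : 'rV[R]_n := h *: delta_mx 0 j.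
have kh (s t : R) : 0 <= s <= 1 -> 0 <= t <= 1 -> `|s *: vi + t *: vj| <= 2 * h.
  move=> /andP[s0 s1] /andP[t0 t1].
  have dh (a : R) k : 0 <= a <= 1 -> `|a *: (h *: delta_mx 0 k : 'rV[R]_n)| <= h.
    move=> /andP[a0 a1]; rewrite scalerA normrZ normrM (gtr0_norm h0) (ger0_norm a0).
    rewrite -[leRHS]mul1r -[leRHS]mulr1; apply: ler_pM => //.
    - by rewrite mulr_ge0 // ltW.
    - by apply: ler_pM => //; exact: ltW.
    - exact: norm_delta.
  by apply: le_trans (ler_normD _ _) _; rewrite mulrDl mul1r; apply: lerD;
    apply: dh; apply/andP.
have in_r (s t : R) : 0 <= s <= 1 -> 0 <= t <= 1 ->
    differentiable f (u + (s *: vi + t *: vj)).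
  move=> s01 t01; apply: nf; rewrite -ball_normE /= opprD addrA subrr sub0r normrN.
  by apply: le_lt_trans hr; exact: kh.
have l01 : 0 <= (0 : R) <= 1 by apply/andP; split; [exact: lexx|exact: ler01].
have l11 : 0 <= (1 : R) <= 1 by apply/andP; split; [exact: ler01|exact: lexx].
(* The increment across the square in direction [j], as a function of the position [s] along
   direction [i]. *)
pose psi (s : R) := f ((u + vj) + s *: vi) - f (u + s *: vi).
have D1 s : 0 <= s <= 1 -> differentiable f (u + vj + s *: vi).
  by move=> s01; have := in_r s 1 s01 l11; rewrite scale1r [s *: vi + _]addrC addrA.
have D2 s : 0 <= s <= 1 -> differentiable f (u + s *: vi).
  by move=> s01; have := in_r s 0 s01 l01; rewrite scale0r addr0.
have [s s01|s s01] := @unit_mean_value psi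
    (fun s => h * pderiv i f ((u + vj) + s *: vi) - h * pderiv i f (u + s *: vi)).
  by apply: is_deriveB; apply: is_derive_coord; [exact: D1|exact: D2].
rewrite /psi !scale1r !scale0r !addr0.
set a := pderiv i f _; set b := pderiv i f _ => ep.
have -> : f (u + vj + vi) - f (u + vi) - f (u + vj) + f u = h * a - h * b.
  by rewrite -ep; move: (f _) (f _) (f _) (f _) => *; ring.
have -> : h * pderiv j (pderiv i f) u = 'd (pderiv i f) u vj.
  by rewrite linearZ /= {1}/pderiv deriveE.
have ea := dfe (s *: vi + vj); have eb := dfe (s *: vi).
have k1 : `|s *: vi + vj| <= 2 * h by rewrite -[vj]scale1r; exact: kh.
have k2 : `|s *: vi| <= 2 * h.
  by have := kh s 0 s01 l01; rewrite scale0r addr0.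
have {}ea := ea (le_lt_trans k1 hr2); have {}eb := eb (le_lt_trans k2 hr2).
have {}ea : `|a - pderiv i f u - 'd (pderiv i f) u (s *: vi + vj)| <= e / 4 * (2 * h).
  rewrite /a (_ : u + vj + s *: vi = u + (s *: vi + vj)); last first.
    by rewrite -addrA [vj + _]addrC.
  apply: le_trans ea _.
  by apply: ler_wpM2l => //; exact: ltW.
have {}eb : `|b - pderiv i f u - 'd (pderiv i f) u (s *: vi)| <= e / 4 * (2 * h).
  apply: le_trans eb _; apply: ler_wpM2l => //; exact: ltW.
rewrite -!mulrBr normrM gtr0_norm // mulrCA; apply: ler_wpM2l; first exact: ltW.
have -> : a - b - 'd (pderiv i f) u vj = (a - pderiv i f u
    - 'd (pderiv i f) u (s *: vi + vj)) - (b - pderiv i f u - 'd (pderiv i f) u (s *: vi)).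
  rewrite linearD /=; move: ('d _ _ _) ('d _ _ _) (pderiv i f u) => A B D.
  ring.
apply: le_trans (ler_normB _ _) _; apply: le_trans (lerD ea eb) _.
by rewrite (_ : e / 4 * (2 * h) + e / 4 * (2 * h) = e * h) //; field.
Qed.

(** The second difference is symmetric in the two directions, and approximates [h * h] times either
    mixed derivative. *)
Lemma schwarz W f i j u : open W -> smooth_on W f -> W u ->
  pderiv i (pderiv j f) u = pderiv j (pderiv i f) u.
Proof.
move=> oW sf Wu; have /nbhs_ballP[r /= r0 rW] : nbhs u W by exact: open_nbhs_nbhs.
have df v : ball u r v -> differentiable f v.
  by move=> /rW Wv; exact: smooth_on_diff sf Wv.
have dpf k : differentiable (pderiv k f) u.
  by apply: smooth_on_diff Wu; exact: smooth_on_pderiv.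
apply/eqP; rewrite -subr_eq0 -normr_le0; apply/ler_addgt0Pr => e e0.
have e20 : 0 < e / 2 by rewrite divr_gt0.
have [d1 d10 h1] := mixed_difference j r0 df (dpf i) e20.
have [d2 d20 h2] := mixed_difference i r0 df (dpf j) e20.
pose h := Num.min d1 d2 / 2.
have h0 : 0 < h by rewrite divr_gt0 // lt_min d10.
have hd : h < Num.min d1 d2 by rewrite ltr_pdivrMr // ltr_pMr ?ltr1n // lt_min d10.
move: hd; rewrite lt_min => /andP[hd1 hd2].
have {h1} := h1 h; rewrite h0 hd1 => /(_ isT).
have {h2} := h2 h; rewrite h0 hd2 => /(_ isT).
rewrite [u + _ + h *: delta_mx 0 i]addrAC.
move: (f (_ + _ + _)) (f (u + _)) (f (u + _)) (f u) => X Y Z U.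
move: (pderiv i (pderiv j f) u) (pderiv j (pderiv i f) u) => p p' h2 h1.
rewrite add0r -(ler_pM2r (mulr_gt0 h0 h0)).
rewrite -{1}(gtr0_norm (mulr_gt0 h0 h0)) -normrM.
have -> : (p - p') * (h * h) = (X - Y - Z + U - h * (h * p'))
    - (X - Z - Y + U - h * (h * p)) by ring.
apply: le_trans (ler_normB _ _) _; apply: le_trans (lerD h1 h2) _.
by rewrite -mulrDl -splitr.
Qed.

End MeanValue.

(** Completeness of the matrix spaces, for the contraction principle below. *)
HB.instance Definition _ (R : realType) m n := Complete.on 'M[R]_(m, n).

(** * The inverse function theorem at a point with identity Jacobian *)

Section InverseFunction.
Variables (R : realType) (n : nat).
Variables (W : set 'rV[R]_n) (G : 'rV[R]_n -> 'rV[R]_n) (u0 : 'rV[R]_n).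
Hypotheses (oW : open W) (Wu0 : W u0) (sG : smooth_mx_on W G).
Hypothesis G1 : jacobian G u0 = 1%:M.

(** The differential of this map is 0 at [u0], so it contracts near [u0]; solving [G u = v] amounts
    to finding a fixed point of [Hf + v]. *)
Let Hf (u : 'rV[R]_n) := u - G u.

Let sH : smooth_mx_on W Hf.
Proof. by apply: smooth_mxD => //; [exact: smooth_mx_id|exact: smooth_mxN]. Qed.

(** A bound on partial derivatives costs a factor [n] in the mean value inequality, and
    [n * c <= 1/2]; the successor avoids dividing by 0. *)
Let c : R := (2 * n.+1%:R)^-1.

Let c_gt0 : 0 < c.
Proof. by rewrite invr_gt0 mulr_gt0. Qed.

Let nc : n%:R * c <= 2^-1.
Proof.
rewrite /c invfM mulrCA -[leRHS]mulr1 ler_wpM2l // ler_pdivrMr // mul1r.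
by rewrite ler_nat.
Qed.

Let pderivH u i j : W u ->
  pderiv i (fun v => Hf v 0 j) u = (i == j)%:R - jacobian G u i j.
Proof.
move=> Wu; have dG := smooth_mx_diff sG Wu.
rewrite [jacobian _ _ _ _](jacobianE i j dG).
rewrite (_ : (fun v => _) = fun v : 'rV[R]_n => v 0 j + - (G v 0 j)); last first.
  by apply/funext => v; rewrite /Hf !mxE.
rewrite pderivD; first last.
- by apply: differentiableN; exact: smooth_on_diff (sG 0 j) Wu.
- exact: diff_coord.
rewrite pderiv_coord; congr (_ + _).
by apply: deriveN; apply: diff_derivable; exact: smooth_on_diff (sG 0 j) Wu.
Qed.

Lemma pderiv_id_sub_small : exists2 r : R, 0 < r & ball u0 r `<=` W /\
  forall u, ball u0 r u -> forall i j, `|pderiv i (fun v => Hf v 0 j) u| <= c.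
Proof.
have nearH : \forall u \near u0, forall ij : 'I_n * 'I_n,
    `|pderiv ij.1 (fun v => Hf v 0 ij.2) u| <= c.
  apply: (@filter_forall 'rV[R]_n ('I_n * 'I_n)%type
    (fun ij u => `|pderiv ij.1 (fun v => Hf v 0 ij.2) u| <= c) (nbhs u0)).
  move=> -[i j] /=.
  have cont : {for u0, continuous (pderiv i (fun v => Hf v 0 j))}.
    apply: differentiable_continuous.
    exact: smooth_on_diff (smooth_on_pderiv i (sH 0 j)) Wu0.
  have p0 : pderiv i (fun v => Hf v 0 j) u0 = 0.
    by rewrite pderivH // G1 mxE subrr.
  have /cvgrPdist_le/(_ c c_gt0) := cont.
  by apply: filterS => u; rewrite p0 sub0r normrN.
have /nbhs_ballP[r1 /= r10 b1] := nearH.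
have /nbhs_ballP[r2 /= r20 b2] : nbhs u0 W by exact: open_nbhs_nbhs.
exists (Num.min r1 r2); first by rewrite lt_min r10.
split=> [u bu|u bu i j].
  by apply: b2; apply: le_ball bu; rewrite ge_min lexx orbT.
by apply: (b1 u _ (i, j)); apply: le_ball bu; rewrite ge_min lexx.
Qed.

Lemma mulmx_bounded m p (B : 'M[R]_(m, p)) :
  exists2 C : R, 0 <= C & forall x : 'rV[R]_m, `|x *m B| <= C * `|x|.
Proof.
exists (\sum_i \sum_j `|B i j|) => [|x].
  by apply: sumr_ge0 => i _; apply: sumr_ge0.
apply: row_norm_le => [|j].
  by rewrite mulr_ge0 //; apply: sumr_ge0 => i _; apply: sumr_ge0.
rewrite mxE; apply: le_trans (ler_norm_sum _ _ _) _; rewrite mulr_suml.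
apply: ler_sum => i _; rewrite normrM mulrC.
apply: ler_pM => //; last exact: ler_coord_norm.
by rewrite (bigD1 j) //= lerDl; apply: sumr_ge0.
Qed.

Theorem local_inverse : exists (r : R) (B : set 'rV[R]_n) (g : 'rV[R]_n -> 'rV[R]_n),
  [/\ 0 < r, open B, B u0, B `<=` W &
   [/\ smooth_mx_on (ball (G u0) r) g,
       forall v, ball (G u0) r v -> B (g v) /\ G (g v) = v,
       forall u, B u -> ball (G u0) r (G u) /\ g (G u) = u
     & forall u, B u -> jacobian G u \in unitmx]].
Proof.
have [r r0 [rW dH]] := pderiv_id_sub_small.
have half x y : ball u0 r x -> ball u0 r y -> `|Hf y - Hf x| <= 2^-1 * `|y - x|.
  move=> bx by_; apply: row_norm_le => [|j]; first by rewrite mulr_ge0.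
  apply: le_trans (_ : n%:R * c * `|y - x| <= _); last by apply: ler_wpM2r.
  have -> : (Hf y - Hf x) 0 j = Hf y 0 j - Hf x 0 j by rewrite !mxE.
  apply: (@mean_value_ball _ _ (fun v => Hf v 0 j) u0 r c x y _ bx by_) => u bu.
  split=> [|i]; last exact: dH.
  by apply: smooth_on_diff (sH 0 j) _; exact: rW.
(* From [half]: [G] contracts distances by at most 2, which gives injectivity and a Lipschitz
   inverse. *)
have lipG x y : ball u0 r x -> ball u0 r y -> `|y - x| <= 2 * `|G y - G x|.
  move=> bx by_; have := half x y bx by_.
  have -> : Hf y - Hf x = (y - x) - (G y - G x).
    by rewrite /Hf; move: (G y) (G x) => *; apply/rowP => k; rewrite !mxE; ring.
  move=> h; have := lerB_dist (y - x) (G y - G x).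
  lra.
(* On the closed ball of radius [r / 2] the map [Hf + v] moves points by at most r/4 + r/4 from
   [u0], so it preserves this ball. *)
pose rho := r / 4; have rho0 : 0 < rho by rewrite divr_gt0.
have solve v : ball (G u0) rho v -> exists u, ball u0 r u /\ G u = v.
  move=> bv; pose U := closed_ball_ (@Num.norm _ _) u0 (r / 2).
  have Ur u : U u -> ball u0 r u.
    by rewrite /U -ball_normE /= => h; apply: le_lt_trans h _; rewrite ltr_pdivrMr // ltr_pMr ?ltr1n.
  have U0 : U u0 by rewrite /U /closed_ball_ /= subrr normr0 divr_ge0 // ltW.
  pose T u := Hf u + v.
  have TU : set_fun U U T.
    move=> u Uu; rewrite /U /closed_ball_ /= /T.
    have -> : u0 - (Hf u + v) = (Hf u0 - Hf u) + (G u0 - v).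
      by rewrite /Hf; apply/rowP => j; rewrite !mxE; ring.
    have h1 := half _ _ (Ur _ Uu) (Ur _ U0).
    move: bv Uu; rewrite -ball_normE /U /closed_ball_ /= /rho => h2 h3.
    have := ler_normD (Hf u0 - Hf u) (G u0 - v).
    lra.
  pose F : {fun U >-> U} := mkfun TU.
  have Fc : is_contraction F.
    exists (2^-1)%:nng; split=> /=; first by rewrite invf_lt1 // ltr1n.
    move=> [x y] /= [Ux Uy]; rewrite /T opprD addrACA subrr addr0.
    exact: half (Ur _ Uy) (Ur _ Ux).
  have [||p Up pE] := banach_fixed_point Fc.
  - exact: closed_closed_ball_.
  - by exists u0.
  exists p; split; first exact: Ur.
  have {}pE : p = p - G p + v := pE.
  apply/eqP; rewrite eq_sym -subr_eq0 addrC; apply/eqP.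
  by apply: (@addrI _ p); rewrite addr0 addrA; exact: esym.
have /choice[g gP] : forall v, exists u, ball (G u0) rho v -> ball u0 r u /\ G u = v.
  by move=> v; have [/solve[u uP]|nv] := pselect (ball (G u0) rho v); [exists u|exists 0].
(* A row vector in the kernel of the Jacobian is fixed by the differential of [Hf], which halves
   norms. *)
have uJ u : ball u0 r u -> jacobian G u \in unitmx.
  move=> bu; rewrite -row_free_unit -kermx_eq0; apply/eqP/row_matrixP => k; rewrite row0.
  set x := row k _; have xA : x *m jacobian G u = 0 by rewrite -row_mul mulmx_ker row0.
  have : `|x| <= 2^-1 * `|x|.
    apply: row_norm_le => [|j]; first by rewrite mulr_ge0.
    have xE : x 0 j = 'd (fun v => Hf v 0 j) u x.
      rewrite diff_pderiv; last by apply: smooth_on_diff (sH 0 j) _; exact: rW.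
      rewrite (eq_bigr (fun i => x 0 i * (i == j)%:R - x 0 i * jacobian G u i j)); last first.
        by move=> i _; rewrite pderivH ?mulrBr //; exact: rW.
      rewrite sumrB (bigD1 j) //= eqxx mulr1 big1 ?addr0.
        by have /matrixP/(_ 0 j) := xA; rewrite !mxE => ->; rewrite subr0.
      by move=> i /negPf ij; rewrite ij mulr0.
    rewrite xE; apply: le_trans (norm_diff_le (c := c) _ _ _) _.
    - by apply: smooth_on_diff (sH 0 j) _; exact: rW.
    - by move=> i; exact: dH.
    by apply: ler_wpM2r.
  move=> h; apply/eqP; rewrite -normr_le0; lra.
exists rho, (ball u0 r `&` G @^-1` ball (G u0) rho), g; split=> //.
- rewrite openE => u [bu bGu]; apply: filterI.
    by apply: open_nbhs_nbhs; split => //; exact: ball_open.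
  have := differentiable_continuous (smooth_mx_diff sG (rW _ bu)).
  by apply; apply: open_nbhs_nbhs; split=> //; exact: ball_open.
- by split; exact: ballxx.
- by move=> u [/rW].
split.
- have dg v : ball (G u0) rho v ->
      differentiable g v /\ jacobian g v = invmx (jacobian G (g v)).
    move=> bv; have [bg Gg] := gP v bv; have uA := uJ _ bg.
    have [C C0 hC] := mulmx_bounded (invmx (jacobian G (g v))).
    have dG := smooth_mx_diff sG (rW _ bg).
    apply: eps_jacobian => e e0.
    (* [C] bounds the inverse Jacobian and 2 is the Lipschitz constant of [g]; [C + 1] keeps the
       denominator positive. *)
    have e'0 : 0 < e / (2 * (C + 1)) by rewrite divr_gt0 // mulr_gt0 // ltr_wpDl.
    have [d d0 hd] := diff_eps_ball_mx dG e'0.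
    have nb : \forall h \near (0 : 'rV[R]_n), ball (G u0) rho (h + v).
      have /nbhs_ballP[d1 /= d10 b1] : nbhs v (ball (G u0) rho).
        by apply: open_nbhs_nbhs; split=> //; exact: ball_open.
      apply/nbhs_ballP; exists d1 => //= h bh; apply: b1; move: bh.
      by rewrite -!ball_normE /= sub0r normrN opprD addrCA subrr addr0 normrN.
    near=> h; have bh : ball (G u0) rho (h + v) by near: h.
    have [bgh Ggh] := gP _ bh.
    have hl : `|g (h + v) - g v| <= 2 * `|h|.
      by have := lipG _ _ bg bgh; rewrite Gg Ggh addrK.
    have hh : `|h| < d / 2.
      near: h; apply/nbhs_ballP; exists (d / 2) => /=; first by rewrite divr_gt0.
      by move=> h; rewrite -ball_normE /= sub0r normrN.
    have {}hd := hd (g (h + v) - g v).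
    rewrite [g v + _]addrC subrK Gg Ggh addrK in hd.
    have {}hd := hd (le_lt_trans hl _).
    rewrite mulrC -ltr_pdivlMr // in hd; have {}hd := hd hh.
    have -> : g (h + v) - g v - h *m invmx (jacobian G (g v))
        = - ((h - (g (h + v) - g v) *m jacobian G (g v)) *m invmx (jacobian G (g v))).
      by rewrite mulmxBl -mulmxA mulmxV // mulmx1 opprB.
    rewrite normrN; apply: le_trans (hC _) _.
    apply: le_trans (ler_wpM2l C0 hd) _.
    apply: le_trans (_ : C * (e / (2 * (C + 1)) * (2 * `|h|)) <= _).
      by apply: ler_wpM2l => //; apply: ler_wpM2l => //; exact: ltW.
    have -> : C * (e / (2 * (C + 1)) * (2 * `|h|)) = C / (C + 1) * (e * `|h|).
      by field; rewrite gt_eqF // ltr_wpDl.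
    rewrite -[leRHS]mul1r; apply: ler_wpM2r; first by rewrite mulr_ge0 // ltW.
    by rewrite ler_pdivrMr ?mul1r ?lerDl // ltr_wpDl.
  (* Bootstrap: the derivative of [g] is the inverse Jacobian of [G] composed with [g], so each
     order of regularity of [g] yields the next. *)
  have cg k : forall j, ck k (ball (G u0) rho) (fun v => g v 0 j).
    elim: k => [|k IH] j; split=> //.
    - by move=> v bv; apply: differentiable_row_coord; case: (dg v bv).
    - by move=> v bv; apply: differentiable_row_coord; case: (dg v bv).
    move=> i; apply: (@ck_ext _ _ _ _ (fun v => invmx (jacobian G (g v)) i j)).
    + apply: (@ck_comp _ _ _ _ _ (ball u0 r) g (fun u => invmx (jacobian G u) i j)).
      * exact: ball_open.
      * by move=> v bv; have [] := gP v bv.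
      * exact: IH.
      have sJ : smooth_mx_on (ball u0 r) (fun u => invmx (jacobian G u)).
        apply: smooth_invmx; [exact: ball_open|exact: uJ|].
        by apply: smooth_jacobian; [exact: ball_open|exact: smooth_mx_sub sG].
      by have /smooth_onP := sJ i j; apply.
    + exact: ball_open.
    move=> v bv; have [dgv Jv] := dg v bv; rewrite -Jv.
    exact: jacobianE.
  by move=> i j; rewrite ord1; apply/smooth_onP => k; exact: cg.
- by move=> v bv; have [bg Gg] := gP v bv; rewrite /= Gg.
- move=> u [bu bGu]; split=> //; have [bg Gg] := gP _ bGu.
  have := lipG _ _ bu bg; rewrite Gg subrr normr0 mulr0 normr_le0 subr_eq0.
  by move=> /eqP.
- by move=> u [bu _]; exact: uJ.
Unshelve. all: by end_near. Qed.

End InverseFunction.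

(** * Calculus with values in the exterior algebra *)

Section ComplexCalculus.
Variables (R : realType) (n : nat).
Local Notation C := R[i].
Implicit Types (W : set 'rV[R]_n) (u : 'rV[R]_n) (f g : 'rV[R]_n -> C).

Definition cpd (i : 'I_n) f u : C :=
  (pderiv i (fun v => complex.Re (f v)) u +i* pderiv i (fun v => complex.Im (f v)) u)%C.

Definition csmooth W f : Prop :=
  smooth_on W (fun u => complex.Re (f u)) /\ smooth_on W (fun u => complex.Im (f u)).

Definition cdiff f u : Prop :=
  differentiable (fun u => complex.Re (f u)) u /\
  differentiable (fun u => complex.Im (f u)) u.

Lemma ReD (a b : C) : complex.Re (a + b) = complex.Re a + complex.Re b.
Proof. by case: a; case: b. Qed.

Lemma ImD (a b : C) : complex.Im (a + b) = complex.Im a + complex.Im b.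
Proof. by case: a; case: b. Qed.

Lemma ReM (a b : C) :
  complex.Re (a * b) = complex.Re a * complex.Re b - complex.Im a * complex.Im b.
Proof. by case: a; case: b. Qed.

Lemma ImM (a b : C) :
  complex.Im (a * b) = complex.Re a * complex.Im b + complex.Im a * complex.Re b.
Proof. by case: a; case: b. Qed.

Lemma complex_eq (a b : C) :
  complex.Re a = complex.Re b -> complex.Im a = complex.Im b -> a = b.
Proof. by case: a; case: b => /= ? ? ? ? -> ->. Qed.

Lemma csmooth_diff W f u : csmooth W f -> W u -> cdiff f u.
Proof. by move=> [sf sf'] Wu; split; [exact: smooth_on_diff sf Wu|exact: smooth_on_diff sf' Wu]. Qed.

Lemma csmooth_pd W f i : csmooth W f -> csmooth W (cpd i f).
Proof. by move=> [sf sf']; split; exact: smooth_on_pderiv. Qed.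

Lemma csmooth_sub W W' f : W' `<=` W -> csmooth W f -> csmooth W' f.
Proof. by move=> WW [sf sf']; split; exact: smooth_on_sub WW _. Qed.

Lemma csmooth_ext W f g : csmooth W f -> open W -> (forall u, W u -> f u = g u) ->
  csmooth W g.
Proof.
by move=> [sf sf'] oW fg; split;
  [apply: smooth_on_ext sf oW _|apply: smooth_on_ext sf' oW _] => u Wu; rewrite fg.
Qed.

Lemma csmooth_local W f :
  (forall u, W u -> exists2 W', W' u & csmooth W' f) -> csmooth W f.
Proof.
move=> h; split; apply: smooth_on_local => u Wu; have [W' Wu' [? ?]] := h u Wu;
  by exists W'.
Qed.

Lemma csmooth_cst W (c : C) : csmooth W (fun=> c).
Proof. by split; exact: smooth_on_cst. Qed.

Lemma csmooth_real W (f : 'rV[R]_n -> R) : smooth_on W f -> csmooth W (fun u => real_complex R (f u)).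
Proof. by move=> sf; split=> //; exact: smooth_on_cst. Qed.

Lemma csmoothD W f g : open W -> csmooth W f -> csmooth W g -> csmooth W (fun u => f u + g u).
Proof.
move=> oW [sf sf'] [sg sg']; split.
  by apply: smooth_on_ext (smooth_onD oW sf sg) oW _ => u _; rewrite ReD.
by apply: smooth_on_ext (smooth_onD oW sf' sg') oW _ => u _; rewrite ImD.
Qed.

Lemma csmoothM W f g : open W -> csmooth W f -> csmooth W g -> csmooth W (fun u => f u * g u).
Proof.
move=> oW [sf sf'] [sg sg']; split.
  apply: smooth_on_ext (smooth_onD oW (smooth_onM oW sf sg)
    (smooth_onN oW (smooth_onM oW sf' sg'))) oW _ => u _; by rewrite ReM.
apply: smooth_on_ext (smooth_onD oW (smooth_onM oW sf sg') (smooth_onM oW sf' sg)) oW _.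
by move=> u _; rewrite ImM.
Qed.

Lemma csmooth_sum W (I : Type) (r : seq I) (F : I -> 'rV[R]_n -> C) :
  open W -> (forall i, csmooth W (F i)) -> csmooth W (fun u => \sum_(i <- r) F i u).
Proof.
move=> oW sF; elim: r => [|i r IH].
  by apply: csmooth_ext (csmooth_cst W 0) oW _ => u _; rewrite big_nil.
by apply: csmooth_ext (csmoothD oW (sF i) IH) oW _ => u _; rewrite big_cons.
Qed.

Lemma cpd_near_eq i f g u : (\near u, f u = g u) -> cpd i f u = cpd i g u.
Proof.
move=> fg; congr (_ +i* _)%C; apply: pderiv_near_eq; apply: filterS fg => v -> //.
Qed.

Lemma cpd_cst i (c : C) u : cpd i (fun=> c) u = 0.
Proof. by rewrite /cpd !pderiv_cst. Qed.

Lemma cpd_real i (f : 'rV[R]_n -> R) u :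
  cpd i (fun v => real_complex R (f v)) u = real_complex R (pderiv i f u).
Proof. by rewrite /cpd /= pderiv_cst. Qed.

Lemma cdiff_cst (c : C) u : cdiff (fun=> c) u.
Proof. by split; exact: differentiable_cst. Qed.

Lemma cdiff_real (f : 'rV[R]_n -> R) u : differentiable f u ->
  cdiff (fun v => real_complex R (f v)) u.
Proof. by split=> //; exact: differentiable_cst. Qed.

Lemma cdiffD f g u : cdiff f u -> cdiff g u -> cdiff (fun v => f v + g v) u.
Proof.
move=> [df df'] [dg dg']; split.
  rewrite (_ : (fun v => _) = (fun v => complex.Re (f v) + complex.Re (g v))).
    exact: differentiableD.
  by apply/funext => v; rewrite ReD.
rewrite (_ : (fun v => _) = (fun v => complex.Im (f v) + complex.Im (g v))).
  exact: differentiableD.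
by apply/funext => v; rewrite ImD.
Qed.

Lemma cdiffM f g u : cdiff f u -> cdiff g u -> cdiff (fun v => f v * g v) u.
Proof.
move=> [df df'] [dg dg']; split.
  rewrite (_ : (fun v => _) = (fun v => complex.Re (f v) * complex.Re (g v)
     - complex.Im (f v) * complex.Im (g v))).
    by apply: differentiableB; exact: differentiableM.
  by apply/funext => v; rewrite ReM.
rewrite (_ : (fun v => _) = (fun v => complex.Re (f v) * complex.Im (g v)
   + complex.Im (f v) * complex.Re (g v))).
  by apply: differentiableD; exact: differentiableM.
by apply/funext => v; rewrite ImM.
Qed.

Lemma pderiv_ext i (f g : 'rV[R]_n -> R) u : f =1 g -> pderiv i f u = pderiv i g u.
Proof. by move=> /funext ->. Qed.

Lemma cpd_ext i f g u : f =1 g -> cpd i f u = cpd i g u.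
Proof. by move=> /funext ->. Qed.

Lemma cpdD i f g u : cdiff f u -> cdiff g u ->
  cpd i (fun v => f v + g v) u = cpd i f u + cpd i g u.
Proof.
move=> [df df'] [dg dg']; apply: complex_eq; rewrite ?ReD ?ImD /=.
  by rewrite -(pderivD i df dg); apply: pderiv_ext => v; rewrite ReD.
by rewrite -(pderivD i df' dg'); apply: pderiv_ext => v; rewrite ImD.
Qed.

Lemma pderivB i (f g : 'rV[R]_n -> R) u : differentiable f u -> differentiable g u ->
  pderiv i (fun v => f v - g v) u = pderiv i f u - pderiv i g u.
Proof. by move=> df dg; apply: deriveB; exact: diff_derivable. Qed.

Lemma cpdM i f g u : cdiff f u -> cdiff g u ->
  cpd i (fun v => f v * g v) u = cpd i f u * g u + f u * cpd i g u.
Proof.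
move=> [df df'] [dg dg']; apply: complex_eq.
  rewrite ReD !ReM /=.
  rewrite (_ : (fun v => complex.Re (f v * g v)) = (fun v => complex.Re (f v) * complex.Re (g v)
     - complex.Im (f v) * complex.Im (g v))); last by apply/funext => v; rewrite ReM.
  rewrite pderivB; [|exact: differentiableM|exact: differentiableM].
  rewrite !pderivM //; move: (pderiv _ _ _) (pderiv _ _ _) (pderiv _ _ _) (pderiv _ _ _).
  by move: (f u) (g u) => [a b] [c d] * /=; ring.
rewrite ImD !ImM /=.
rewrite (_ : (fun v => complex.Im (f v * g v)) = (fun v => complex.Re (f v) * complex.Im (g v)
   + complex.Im (f v) * complex.Re (g v))); last by apply/funext => v; rewrite ImM.
rewrite pderivD; [|exact: differentiableM|exact: differentiableM].
rewrite !pderivM //; move: (pderiv _ _ _) (pderiv _ _ _) (pderiv _ _ _) (pderiv _ _ _).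
by move: (f u) (g u) => [a b] [c d] * /=; ring.
Qed.

Lemma cdiff_sum u (I : Type) (r : seq I) (F : I -> 'rV[R]_n -> C) :
  (forall i, cdiff (F i) u) -> cdiff (fun v => \sum_(i <- r) F i v) u.
Proof.
move=> dF; elim: r => [|i r IH].
  rewrite (_ : (fun v => _) = fun=> 0); first exact: cdiff_cst.
  by apply/funext => v; rewrite big_nil.
rewrite (_ : (fun v => _) = fun v => F i v + \sum_(j <- r) F j v); first exact: cdiffD.
by apply/funext => v; rewrite big_cons.
Qed.

Lemma cpd_sum k u (I : Type) (r : seq I) (F : I -> 'rV[R]_n -> C) :
  (forall i, cdiff (F i) u) ->
  cpd k (fun v => \sum_(i <- r) F i v) u = \sum_(i <- r) cpd k (F i) u.
Proof.
move=> dF; elim: r => [|i r IH].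
  rewrite big_nil (_ : (fun v => _) = fun=> 0); first exact: cpd_cst.
  by apply/funext => v; rewrite big_nil.
rewrite big_cons -IH -(cpdD k (dF i) (cdiff_sum r dF)).
by apply: cpd_ext => v; rewrite big_cons.
Qed.

Lemma cschwarz W f i j u : open W -> csmooth W f -> W u ->
  cpd i (cpd j f) u = cpd j (cpd i f) u.
Proof.
move=> oW [sf sf'] Wu; apply: complex_eq.
  exact: (schwarz i j oW sf Wu).
exact: (schwarz i j oW sf' Wu).
Qed.

End ComplexCalculus.

Section ComplexComposition.
Variables (R : realType) (n m : nat).
Local Notation C := R[i].

Lemma cpd_comp (f : 'rV[R]_n -> 'rV[R]_m) (g : 'rV[R]_m -> C) u i :
  differentiable f u -> cdiff g (f u) ->
  cpd i (fun v => g (f v)) u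
  = \sum_j real_complex R (pderiv i (fun v => f v 0 j) u) * cpd j g (f u).
Proof.
move=> df [dg dg']; apply: complex_eq.
  rewrite /= (pderiv_comp i df dg) raddf_sum /=; apply: eq_bigr => j _.
  by rewrite mul0r subr0.
rewrite /= (pderiv_comp i df dg') raddf_sum /=; apply: eq_bigr => j _.
by rewrite mul0r addr0.
Qed.

Lemma csmooth_comp W Z (f : 'rV[R]_n -> 'rV[R]_m) (g : 'rV[R]_m -> C) :
  open W -> (forall u, W u -> Z (f u)) -> smooth_mx_on W f ->
  csmooth Z g -> csmooth W (fun v => g (f v)).
Proof.
by move=> oW fW sf [sg sg']; split; [exact: smooth_on_comp sg|exact: smooth_on_comp sg'].
Qed.

End ComplexComposition.

Section ExtCalculus.
Variables (R : realType) (n : nat).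
Local Notation C := R[i].
Implicit Types (W : set 'rV[R]_n) (u : 'rV[R]_n).

Definition epd m (i : 'I_n) (g : 'rV[R]_n -> ext R m) u : ext R m :=
  [ffun S => cpd i (fun v => g v S) u].

Definition esmooth m W (g : 'rV[R]_n -> ext R m) : Prop :=
  forall S, csmooth W (fun u => g u S).

Definition ediff m (g : 'rV[R]_n -> ext R m) u : Prop := forall S, cdiff (fun u => g u S) u.

Lemma epdE m i (g : 'rV[R]_n -> ext R m) u S : epd i g u S = cpd i (fun v => g v S) u.
Proof. exact: ffunE. Qed.

Lemma d_coordE (g : 'rV[R]_n -> ext R n) u :
  d_coord g u = \sum_i wedge1 (delta_mx 0 i) (epd i g u).
Proof. by []. Qed.

Section Fixed.
Variable m : nat.
Implicit Types (g h : 'rV[R]_n -> ext R m) (L : ext R m -> ext R m).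

Lemma esmooth_diff W g u : esmooth W g -> W u -> ediff g u.
Proof. by move=> sg Wu S; exact: csmooth_diff (sg S) Wu. Qed.

Lemma esmooth_pd W g i : esmooth W g -> esmooth W (epd i g).
Proof.
move=> sg S; have [a b] := csmooth_pd i (sg S).
by split; [move: a|move: b]; congr (smooth_on W _); apply/funext => v; rewrite ffunE.
Qed.

Lemma esmooth_sub W W' g : W' `<=` W -> esmooth W g -> esmooth W' g.
Proof. by move=> WW sg S; exact: csmooth_sub (sg S). Qed.

Lemma esmooth_ext W g h : esmooth W g -> open W -> (forall u, W u -> g u = h u) -> esmooth W h.
Proof. by move=> sg oW gh S; apply: csmooth_ext (sg S) oW _ => u Wu; rewrite gh. Qed.

Lemma esmooth_local W g :
  (forall u, W u -> exists2 W', W' u & esmooth W' g) -> esmooth W g.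
Proof.
move=> h S; apply: csmooth_local => u Wu; have [W' Wu' sg] := h u Wu.
by exists W' => //; exact: sg.
Qed.

Lemma esmooth_cst W (c : ext R m) : esmooth W (fun=> c).
Proof. by move=> S; exact: csmooth_cst. Qed.

Lemma epd_near_eq i g h u : (\near u, g u = h u) -> epd i g u = epd i h u.
Proof.
by move=> gh; apply: extP => S; rewrite !epdE; apply: cpd_near_eq; apply: filterS gh => v ->.
Qed.

Lemma epd_cst i (c : ext R m) u : epd i (fun=> c) u = 0.
Proof. by apply: extP => S; rewrite epdE cpd_cst ext0E. Qed.

Lemma esmoothD W g h : open W -> esmooth W g -> esmooth W h -> esmooth W (fun u => g u + h u).
Proof.
move=> oW sg sh S; apply: csmooth_ext (csmoothD oW (sg S) (sh S)) oW _ => u _.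
by rewrite extDE.
Qed.

Lemma esmoothZ W (a : 'rV[R]_n -> C) g : open W -> csmooth W a -> esmooth W g ->
  esmooth W (fun u => a u *: g u).
Proof.
move=> oW sa sg S; apply: csmooth_ext (csmoothM oW sa (sg S)) oW _ => u _.
by rewrite extZE.
Qed.

Lemma esmooth_sum W (I : Type) (r : seq I) (F : I -> 'rV[R]_n -> ext R m) :
  open W -> (forall i, esmooth W (F i)) -> esmooth W (fun u => \sum_(i <- r) F i u).
Proof.
move=> oW sF S; apply: csmooth_ext (csmooth_sum r oW (fun i => sF i S)) oW _ => u _.
by rewrite ext_sumE.
Qed.

Lemma ediffZ (a : 'rV[R]_n -> C) g u : cdiff a u -> ediff g u -> ediff (fun v => a v *: g v) u.
Proof.
move=> da dg S; rewrite (_ : (fun v => _) = (fun v => a v * g v S)).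
  exact: cdiffM.
by apply/funext => v; rewrite extZE.
Qed.

Lemma epdD i g h u : ediff g u -> ediff h u ->
  epd i (fun v => g v + h v) u = epd i g u + epd i h u.
Proof.
move=> dg dh; apply: extP => S; rewrite extDE !epdE -(cpdD i (dg S) (dh S)).
by apply: cpd_ext => v; rewrite extDE.
Qed.

Lemma epdZ i (a : 'rV[R]_n -> C) g u : cdiff a u -> ediff g u ->
  epd i (fun v => a v *: g v) u = cpd i a u *: g u + a u *: epd i g u.
Proof.
move=> da dg; apply: extP => S; rewrite extDE !extZE !epdE -(cpdM i da (dg S)).
by apply: cpd_ext => v; rewrite extZE.
Qed.

Lemma ediff_sum u (I : Type) (r : seq I) (F : I -> 'rV[R]_n -> ext R m) :
  (forall i, ediff (F i) u) -> ediff (fun v => \sum_(i <- r) F i v) u.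
Proof.
move=> dF S; rewrite (_ : (fun v => _) = fun v => \sum_(i <- r) F i v S).
  by apply: cdiff_sum => i; exact: dF.
by apply/funext => v; rewrite ext_sumE.
Qed.

Lemma epd_sum k u (I : Type) (r : seq I) (F : I -> 'rV[R]_n -> ext R m) :
  (forall i, ediff (F i) u) ->
  epd k (fun v => \sum_(i <- r) F i v) u = \sum_(i <- r) epd k (F i) u.
Proof.
move=> dF; apply: extP => S; rewrite ext_sumE epdE.
rewrite (cpd_ext k u (g := fun v => \sum_(i <- r) F i v S)); last by move=> v; rewrite ext_sumE.
rewrite (cpd_sum k r (fun i => dF i S)).
by apply: eq_bigr => i _; rewrite epdE.
Qed.

Lemma eschwarz W g i j u : open W -> esmooth W g -> W u ->
  epd i (epd j g) u = epd j (epd i g) u.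
Proof.
move=> oW sg Wu; apply: extP => S; rewrite [LHS]epdE [RHS]epdE.
rewrite (cpd_ext i u (fun v => epdE j g v S)) (cpd_ext j u (fun v => epdE i g v S)).
exact: (cschwarz i j oW (sg S) Wu).
Qed.

End Fixed.

Section Linear.
Variables (m p : nat).
Implicit Types (g h : 'rV[R]_n -> ext R m).

Lemma linear_coord (L : ext R m -> ext R p) (w : ext R m) : linear L ->
  L w = \sum_S w S *: L (basis_form R S).
Proof.
move=> hL; pose Lb := GRing.isLinear.Build C (ext R m) (ext R p) _ L hL.
pose L' : {linear ext R m -> ext R p} := HB.pack L Lb.
by rewrite -[LHS]/(L' w) [in LHS](ext_basis w) linear_sum; apply: eq_bigr => S _; rewrite linearZ.
Qed.

Lemma ediff_lin (L : ext R m -> ext R p) g u : linear L -> ediff g u ->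
  ediff (fun v => L (g v)) u.
Proof.
move=> hL dg; rewrite (_ : (fun v => _) = fun v => \sum_S g v S *: L (basis_form R S)).
  apply: ediff_sum => S; apply: ediffZ; first exact: dg.
  by move=> T; exact: cdiff_cst.
by apply/funext => v; exact: linear_coord.
Qed.

Lemma epd_lin i (L : ext R m -> ext R p) g u : linear L -> ediff g u ->
  epd i (fun v => L (g v)) u = L (epd i g u).
Proof.
move=> hL dg; rewrite (_ : (fun v => _) = fun v => \sum_S g v S *: L (basis_form R S)); last first.
  by apply/funext => v; exact: linear_coord.
have dc (w : ext R p) : ediff (fun=> w) u by move=> S; exact: cdiff_cst.
rewrite epd_sum; last by move=> S; apply: ediffZ; [exact: (dg S)|exact: dc].
rewrite [RHS](linear_coord _ hL); apply: eq_bigr => S _.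
by rewrite (epdZ i (dg S) (dc _)) epd_cst scaler0 addr0 epdE.
Qed.

Lemma esmooth_lin W (L : ext R m -> ext R p) g : linear L -> open W -> esmooth W g ->
  esmooth W (fun v => L (g v)).
Proof.
move=> hL oW sg; apply: (@esmooth_ext _ _ (fun v => \sum_S g v S *: L (basis_form R S))) => //.
  apply: esmooth_sum => // S; apply: esmoothZ => //.
  exact: esmooth_cst.
by move=> v _; rewrite [RHS](linear_coord _ hL).
Qed.

Section Family.
Variables (I : finType) (a : I -> 'rV[R]_n -> C) (L : I -> ext R m -> ext R p).
Hypothesis hL : forall k, linear (L k).

(** Leibniz rule for an operator with variable coefficients on fixed linear maps. Pullback by a
    matrix and the spin action are both expanded in this way. *)
Lemma epd_lincomb i g u : (forall k, cdiff (a k) u) -> ediff g u ->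
  epd i (fun v => \sum_k a k v *: L k (g v)) u
  = \sum_k cpd i (a k) u *: L k (g u) + \sum_k a k u *: L k (epd i g u).
Proof.
move=> da dg; have dL k := ediff_lin (hL k) dg.
rewrite epd_sum; last by move=> k; exact: ediffZ.
rewrite -big_split; apply: eq_bigr => k _ /=.
by rewrite (epdZ i (da k) (dL k)) (epd_lin i (hL k) dg).
Qed.

Lemma esmooth_lincomb W g : open W -> (forall k, csmooth W (a k)) -> esmooth W g ->
  esmooth W (fun v => \sum_k a k v *: L k (g v)).
Proof.
move=> oW sa sg; apply: esmooth_sum => // k; apply: esmoothZ => //.
exact: esmooth_lin.
Qed.

End Family.
End Linear.

Lemma esmooth_comp m p W Z (f : 'rV[R]_n -> 'rV[R]_m) (g : 'rV[R]_m -> ext R p) :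
  open W -> (forall u, W u -> Z (f u)) -> smooth_mx_on W f ->
  (forall S, csmooth Z (fun v => g v S)) -> esmooth W (fun v => g (f v)).
Proof. by move=> oW fW sf sg S; exact: csmooth_comp sf (sg S). Qed.

(** Exchanging the summation indices changes the sign of the wedges and nothing else, so the sum is
    its own opposite. *)
Lemma wedge_sym0 (T : 'I_n -> 'I_n -> ext R n) : (forall i j, T i j = T j i) ->
  \sum_i wedge1 (delta_mx 0 i) (\sum_j wedge1 (delta_mx 0 j) (T i j)) = 0.
Proof.
move=> hT; set s := LHS; suff : s + s = 0.
  move/eqP; rewrite -mulr2n -scaler_nat scaler_eq0 pnatr_eq0 /=.
  by move/eqP.
rewrite {2}/s; under [X in s + X]eq_bigr do rewrite wedge1_sum.
rewrite exchange_big /= /s -big_split big1 // => i _ /=.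
rewrite wedge1_sum -big_split big1 // => j _ /=.
by rewrite (hT j i) wedge1_anticomm.
Qed.

Lemma d_coord_near_eq (g h : 'rV[R]_n -> ext R n) u : (\near u, g u = h u) ->
  d_coord g u = d_coord h u.
Proof. by move=> gh; rewrite !d_coordE; apply: eq_bigr => i _; rewrite (epd_near_eq i gh). Qed.

Lemma esmooth_d W (g : 'rV[R]_n -> ext R n) : open W -> esmooth W g -> esmooth W (d_coord g).
Proof.
move=> oW sg; apply: (esmooth_ext (esmooth_sum (index_enum _) oW _) oW (fun u _ => esym (d_coordE g u))).
by move=> i; apply: (esmooth_lin (wedge1_linear _) oW); exact: esmooth_pd.
Qed.

Lemma d_coord_sqr W (g : 'rV[R]_n -> ext R n) u : open W -> esmooth W g -> W u ->
  d_coord (d_coord g) u = 0.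
Proof.
move=> oW sg Wu; rewrite d_coordE.
rewrite (eq_bigr (fun i => wedge1 (delta_mx 0 i)
   (\sum_j wedge1 (delta_mx 0 j) (epd i (epd j g) u)))).
  by apply: wedge_sym0 => i j; exact: eschwarz sg Wu.
move=> i _; congr wedge1.
have dw j : ediff (fun v => wedge1 (delta_mx 0 j) (epd j g v)) u.
  apply: ediff_lin; first exact: wedge1_linear.
  exact: esmooth_diff (esmooth_pd j sg) Wu.
rewrite [LHS](epd_sum i (index_enum _) dw).
apply: eq_bigr => j _; apply: epd_lin; first exact: wedge1_linear.
exact: esmooth_diff (esmooth_pd j sg) Wu.
Qed.

Lemma d_coordD (g h : 'rV[R]_n -> ext R n) u : ediff g u -> ediff h u ->
  d_coord (fun v => g v + h v) u = d_coord g u + d_coord h u.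
Proof.
move=> dg dh; rewrite !d_coordE -big_split; apply: eq_bigr => i _ /=.
by rewrite (epdD i dg dh) wedge1D.
Qed.

Lemma d_coordZ (c : C) (g : 'rV[R]_n -> ext R n) u : ediff g u ->
  d_coord (fun v => c *: g v) u = c *: d_coord g u.
Proof.
move=> dg; rewrite !d_coordE scaler_sumr; apply: eq_bigr => i _ /=.
by rewrite (epdZ i (cdiff_cst c u) dg) cpd_cst scale0r add0r wedge1Z.
Qed.

End ExtCalculus.

Section PullbackCalculus.
Variables (R : realType) (n m : nat).
Local Notation C := R[i].
Implicit Types (W : set 'rV[R]_n) (u : 'rV[R]_n).
Variables (W : set 'rV[R]_n) (A : 'rV[R]_n -> 'M[R]_(n, m)).
Hypotheses (oW : open W) (sA : smooth_mx_on W A).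

Let pb_step (j : 'I_m) w u : pullback (A u) (ewedge j w)
  = \sum_k real_complex R (A u k j) *: wedge1 (delta_mx 0 k) (pullback (A u) w).
Proof.
rewrite -wedge1_delta pullback_wedge1 [X in wedge1 X]row_sum_delta wedge1_suml.
apply: eq_bigr => k _; rewrite wedge1Zl; congr (_ *: _).
by rewrite -rowE !mxE.
Qed.

Lemma esmooth_pullback_cst w : esmooth W (fun u => pullback (A u) w).
Proof.
elim/ext_ind: w => [u w su sw|c w sw||j w sw].
- by apply: esmooth_ext (esmoothD oW su sw) oW _ => v _; rewrite pullbackD.
- apply: esmooth_ext (esmoothZ oW (csmooth_cst W c) sw) oW _ => v _.
  by rewrite pullbackZ.
- apply: esmooth_ext (esmooth_cst W ext1) oW _ => v _; by rewrite pullback_ext1.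
apply: (esmooth_ext (esmooth_lincomb (I := 'I_n)
  (a := fun k u => real_complex R (A u k j)) (fun k => wedge1_linear _) oW _ sw) oW).
  by move=> k; apply: csmooth_real; exact: (sA k j).
by move=> u _; rewrite pb_step.
Qed.

Lemma esmooth_pullback (g : 'rV[R]_n -> ext R m) : esmooth W g ->
  esmooth W (fun u => pullback (A u) (g u)).
Proof.
move=> sg; apply: (@esmooth_ext _ _ _ _ (fun u => \sum_S g u S *: pullback (A u) (basis_form R S))) => //.
  apply: esmooth_sum => // S; apply: esmoothZ => //.
  exact: esmooth_pullback_cst.
by move=> v _; rewrite [RHS](linear_coord _ (@pullback_linear _ _ _ (A v))).
Qed.

(** The hypothesis says that the columns of [A] are closed 1-forms; the pullback of a constant form
    is a combination of products of these, hence closed. *)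
Lemma d_coord_pullback_cst w :
  (forall j u, W u -> forall i k, pderiv i (fun v => A v k j) u = pderiv k (fun v => A v i j) u) ->
  forall u, W u -> d_coord (fun v => pullback (A v) w) u = 0.
Proof.
move=> sym; elim/ext_ind: w => [x w IHx IHw|c w IH||j w IH] u Wu.
- rewrite (_ : (fun v => _) = fun v => pullback (A v) x + pullback (A v) w); last first.
    by apply/funext => v; rewrite pullbackD.
  have dx := esmooth_diff (esmooth_pullback_cst x) Wu.
  have dw := esmooth_diff (esmooth_pullback_cst w) Wu.
  by rewrite (d_coordD dx dw) IHx // IHw // addr0.
- rewrite (_ : (fun v => _) = fun v => c *: pullback (A v) w); last first.
    by apply/funext => v; rewrite pullbackZ.
  by rewrite (d_coordZ c (esmooth_diff (esmooth_pullback_cst w) Wu)) IH // scaler0.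
- rewrite d_coordE big1 // => i _.
  rewrite (_ : (fun v => _) = fun=> ext1); last first.
    by apply/funext => v; rewrite pullback_ext1.
  by rewrite epd_cst wedge10.
rewrite (_ : (fun v => _) = (fun v => \sum_k real_complex R (A v k j) *:
    wedge1 (delta_mx 0 k) (pullback (A v) w))); last by apply/funext => v; rewrite pb_step.
have dw := esmooth_diff (esmooth_pullback_cst w) Wu.
have da k : cdiff (fun v => real_complex R (A v k j)) u.
  by apply: cdiff_real; exact: smooth_on_diff (sA k j) Wu.
rewrite d_coordE.
pose T i k := real_complex R (pderiv i (fun v => A v k j) u) *: pullback (A u) w.
pose D := d_coord (fun v => pullback (A v) w) u.
have wsum : \sum_i wedge1 (delta_mx 0 i) (\sum_k wedge1 (delta_mx 0 k) (T i k)) = 0.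
  by apply: wedge_sym0 => i k; rewrite /T sym.
rewrite (eq_bigr (fun i => wedge1 (delta_mx 0 i) (\sum_k wedge1 (delta_mx 0 k) (T i k)) +
  wedge1 (delta_mx 0 i) (\sum_k real_complex R (A u k j) *:
     wedge1 (delta_mx 0 k) (epd i (fun v => pullback (A v) w) u)))); last first.
  move=> i _; rewrite (epd_lincomb (fun k => wedge1_linear _) i da dw) wedge1D.
  congr (wedge1 _ _ + _); apply: eq_bigr => k _.
  by rewrite (cpd_real i (fun v => A v k j)) /T wedge1Z.
rewrite big_split /= wsum add0r.
rewrite (eq_bigr (fun i => \sum_k - (real_complex R (A u k j) *: wedge1 (delta_mx 0 k)
   (wedge1 (delta_mx 0 i) (epd i (fun v => pullback (A v) w) u))))); last first.
  move=> i _; rewrite wedge1_sum; apply: eq_bigr => k _; rewrite wedge1Z -scalerN.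
  by congr (_ *: _); apply/eqP; rewrite -addr_eq0 wedge1_anticomm.
rewrite exchange_big big1 //= => k _; rewrite sumrN -scaler_sumr -wedge1_sum.
by rewrite -d_coordE IH // wedge10 scaler0 oppr0.
Qed.

End PullbackCalculus.

(** Expand [g] in basis forms. Their pullbacks are closed, since the columns of a Jacobian are
    gradients and mixed derivatives agree; only the coefficients are differentiated, by the chain
    rule. *)
Lemma d_coord_pullback (R : realType) n m (W : set 'rV[R]_n) (Z : set 'rV[R]_m)
    (phi : 'rV[R]_n -> 'rV[R]_m) (g : 'rV[R]_m -> ext R m) u :
  open W -> smooth_mx_on W phi -> (forall u, W u -> Z (phi u)) -> esmooth Z g -> W u ->
  d_coord (fun v => pullback (jacobian phi v) (g (phi v))) u
  = pullback (jacobian phi u) (d_coord g (phi u)).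
Proof.
move=> oW sphi WZ sg Wu; pose A := jacobian phi.
have sA : smooth_mx_on W A by exact: smooth_jacobian.
have dphi := smooth_mx_diff sphi Wu.
have sym j v : W v -> forall i k,
    pderiv i (fun v => A v k j) v = pderiv k (fun v => A v i j) v.
  move=> Wv i k.
  have AE l : \near v, A v l j = pderiv l (fun v => phi v 0 j) v.
    apply: (open_near_eq oW Wv) => x Wx; apply: jacobianE.
    exact: smooth_mx_diff sphi Wx.
  rewrite (pderiv_near_eq i (AE k)) (pderiv_near_eq k (AE i)).
  exact: schwarz (sphi 0 j) Wv.
rewrite (_ : (fun v => _) = (fun v => \sum_S g (phi v) S *: pullback (A v) (basis_form R S))); last first.
  by apply/funext => v; rewrite [LHS](linear_coord _ (@pullback_linear _ _ _ (A v))).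
have dg S : cdiff (fun v => g (phi v) S) u.
  exact: csmooth_diff (csmooth_comp oW WZ sphi (sg S)) Wu.
have dP S := esmooth_diff (esmooth_pullback_cst oW sA (basis_form R S)) Wu.
rewrite d_coordE.
rewrite (eq_bigr (fun i => \sum_S wedge1 (delta_mx 0 i)
    (cpd i (fun v => g (phi v) S) u *: pullback (A u) (basis_form R S))
  + \sum_S g (phi u) S *: wedge1 (delta_mx 0 i)
     (epd i (fun v => pullback (A v) (basis_form R S)) u))); last first.
  move=> i _; rewrite (epd_sum i); last by move=> S; exact: ediffZ (dg S) (dP S).
  rewrite wedge1_sum -big_split; apply: eq_bigr => S _ /=.
  by rewrite (epdZ i (dg S) (dP S)) wedge1D [X in _ + X]wedge1Z.
rewrite big_split /= [X in _ + X]exchange_big [X in _ + X]big1 ?addr0; last first.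
  move=> S _; rewrite -scaler_sumr -d_coordE.
  by rewrite (d_coord_pullback_cst oW sA _ sym Wu) scaler0.
rewrite d_coordE pullback_sum exchange_big /=.
rewrite (eq_bigr (fun S => \sum_j \sum_i (cpd j (fun v => g v S) (phi u) *
   real_complex R (A u i j)) *: wedge1 (delta_mx 0 i) (pullback (A u) (basis_form R S)))); last first.
  move=> S _; rewrite exchange_big; apply: eq_bigr => i _ /=.
  rewrite (cpd_comp i dphi (csmooth_diff (sg S) (WZ u Wu))) scaler_suml wedge1_sum.
  apply: eq_bigr => j _; rewrite wedge1Z mulrC; congr (_ * _ *: _).
  by rewrite /A (jacobianE i j dphi).
rewrite exchange_big; apply: eq_bigr => j _ /=.
rewrite pullback_wedge1 [X in wedge1 X]row_sum_delta wedge1_suml exchange_big.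
apply: eq_bigr => i _ /=; rewrite wedge1Zl.
rewrite [pullback _ (epd j g (phi u))](linear_coord _ (@pullback_linear _ _ _ _)) wedge1_sum.
rewrite scaler_sumr; apply: eq_bigr => S _; rewrite wedge1Z scalerA mulrC epdE.
by congr (_ * _ *: _); rewrite -rowE !mxE.
Qed.

Lemma esmooth_pullback_map (R : realType) n m (W : set 'rV[R]_n) (Z : set 'rV[R]_m)
    (phi : 'rV[R]_n -> 'rV[R]_m) (g : 'rV[R]_m -> ext R m) :
  open W -> smooth_mx_on W phi -> (forall u, W u -> Z (phi u)) -> esmooth Z g ->
  esmooth W (fun v => pullback (jacobian phi v) (g (phi v))).
Proof.
move=> oW sphi WZ sg; apply: (esmooth_pullback oW (smooth_jacobian oW sphi)).
exact: esmooth_comp WZ sphi sg.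
Qed.

(** * Horizontal forms descend locally along a submersion *)

Section LocalDescent.
Variables (R : realType) (n m : nat).
Local Notation C := R[i].

Lemma open_preimage p (W : set 'rV[R]_n) (F : 'rV[R]_n -> 'rV[R]_p) (Z : set 'rV[R]_p) :
  open W -> smooth_mx_on W F -> open Z -> open (W `&` F @^-1` Z).
Proof.
move=> oW sF oZ; rewrite openE => u [Wu Zu]; apply: filterI.
  exact: open_nbhs_nbhs.
have := differentiable_continuous (smooth_mx_diff sF Wu).
by apply; exact: open_nbhs_nbhs.
Qed.

Lemma jacobianD p (f g : 'rV[R]_n -> 'rV[R]_p) u : differentiable f u -> differentiable g u ->
  jacobian (fun v => f v + g v) u = jacobian f u + jacobian g u.
Proof.
move=> df dg; have ds : differentiable (fun v => f v + g v) u by exact: differentiableD.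
apply/matrixP => i j; rewrite [LHS](jacobianE i j ds).
rewrite (pderiv_ext i u (g := fun v => f v 0 j + g v 0 j)); last by move=> v; rewrite mxE.
rewrite (pderivD i (differentiable_row_coord j df) (differentiable_row_coord j dg)).
have := jacobianE i j df; have := jacobianE i j dg.
move: (jacobian f u) (jacobian g u) (pderiv _ _ _) (pderiv _ _ _) => P Q a c <- <-.
by rewrite mxE.
Qed.

(** Cartan's formula for a constant field that annihilates the form: the contraction of the exterior
    derivative is the Lie derivative, here the directional derivative of the coefficients. *)
Lemma iprod_d_coord (om : 'rV[R]_n -> ext R n) (W : set 'rV[R]_n) X u : open W -> esmooth W om ->
  W u -> (forall v, W v -> iprod X (om v) = 0) ->
  iprod X (d_coord om u) = \sum_i X 0 i *: epd i om u.
Proof.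
move=> oW so Wu Xo; rewrite d_coordE iprod_sum; apply: eq_bigr => i _.
have Xo' : iprod X (epd i om u) = 0.
  rewrite -(epd_lin i (iprod_linear X) (esmooth_diff so Wu)).
  rewrite (@epd_near_eq _ _ _ _ _ (fun=> 0)) ?epd_cst //.
  exact: open_near_eq oW Wu Xo.
have := iprod_wedge1 X (delta_mx 0 i) (epd i om u).
rewrite Xo' wedge10 addr0 => ->.
by congr (_ *: _); rewrite (bigD1 i) //= big1 ?mxE ?eqxx ?mulr1 ?addr0 // => j /negPf ji;
  rewrite mxE ji mulr0.
Qed.

Lemma esmooth_const_along (om : 'rV[R]_n -> ext R n) u0 (r : R) (X : 'rV[R]_n) v :
  esmooth (ball u0 r) om ->
  (forall u, ball u0 r u -> \sum_i real_complex R (X 0 i) *: epd i om u = 0) ->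
  ball u0 r v -> ball u0 r (v + X) -> om (v + X) = om v.
Proof.
move=> so h bv bX; apply: extP => S; have [sr si] := so S.
have dX u : ball u0 r u -> \sum_i X 0 i * pderiv i (fun v => complex.Re (om v S)) u = 0 /\
    \sum_i X 0 i * pderiv i (fun v => complex.Im (om v S)) u = 0.
  move=> bu; have := congr1 (fun w : ext R n => w S) (h u bu).
  rewrite ext_sumE ext0E => e; split.
    have := congr1 (@complex.Re R) e; rewrite raddf_sum /=; apply: etrans.
    by apply: eq_bigr => i _; rewrite extZE epdE /= mul0r subr0.
  have := congr1 (@complex.Im R) e; rewrite raddf_sum /=; apply: etrans.
  by apply: eq_bigr => i _; rewrite extZE epdE /= mul0r addr0.
apply: complex_eq.
  apply: (@const_along _ _ (fun v => complex.Re (om v S)) u0 r) => // u bu.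
  have df := smooth_on_diff sr bu; split => //.
  by rewrite diff_pderiv //; case: (dX u bu).
apply: (@const_along _ _ (fun v => complex.Im (om v S)) u0 r) => // u bu.
have df := smooth_on_diff si bu; split => //.
by rewrite diff_pderiv //; case: (dX u bu).
Qed.

Variables (W : set 'rV[R]_n) (F : 'rV[R]_n -> 'rV[R]_m) (om : 'rV[R]_n -> ext R n) (u0 : 'rV[R]_n).
Hypotheses (oW : open W) (Wu0 : W u0) (sF : smooth_mx_on W F).
Hypotheses (full : row_full (jacobian F u0)) (so : esmooth W om).
Hypothesis hor : forall u, W u -> forall X : 'rV[C]_n, X *m toC (jacobian F u) = 0 ->
  iprod X (om u) = 0 /\ iprod X (d_coord om u) = 0.

(** In coordinates that make [F] linear, horizontality of the form and of its derivative means that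
    the coefficients are constant along the kernel of the linear map. On a ball, which is convex,
    the form then depends on the value of [F] only. *)
Theorem local_descent : exists (B : set 'rV[R]_n) (Z : set 'rV[R]_m) (tau : 'rV[R]_m -> ext R m),
  [/\ open B, B u0, B `<=` W, open Z &
   [/\ Z `<=` F @` B, forall u, B u -> Z (F u), esmooth Z tau
     & forall u, B u -> om u = pullback (jacobian F u) (tau (F u))]].
Proof.
pose A := jacobian F u0; have /row_fullP[B BA] := full.
(* This change of coordinates has Jacobian 1 at [u0] because the two summands contribute [A *m B]
   and its complement, and it straightens the submersion: [G u *m A = F u]. *)
pose G (u : 'rV[R]_n) := F u *m B + u *m (1%:M - A *m B).
have sG : smooth_mx_on W G.
  apply: smooth_mxD => //; apply: smooth_mulmx => //.
  - exact: smooth_mx_cst.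
  - exact: smooth_mx_id.
  - exact: smooth_mx_cst.
have GA u : G u *m A = F u.
  by rewrite /G mulmxDl -!mulmxA BA mulmx1 mulmxBl mul1mx -mulmxA BA mulmx1 subrr mulmx0 addr0.
have G1 : jacobian G u0 = 1%:M.
  have dF := smooth_mx_diff sF Wu0.
  have [d1 j1] := jacobian_mulmxr B 0 (F u0).
  have [d2 j2] := jacobian_mulmxr (1%:M - A *m B) 0 u0.
  pose f1 := (fun y : 'rV[R]_m => 0 + y *m B) \o F.
  pose f2 := (fun y : 'rV[R]_n => 0 + y *m (1%:M - A *m B)).
  have -> : G = fun v => f1 v + f2 v by apply/funext => v; rewrite /f1 /f2 /= !add0r.
  have df1 : differentiable f1 u0 by exact: differentiable_comp.
  rewrite (jacobianD df1 d2) /f2 j2 (jacobian_comp dF d1) j1.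
  by rewrite addrC subrK.
have [r [B0 [g [r0 oB0 B0u0 B0W [sg gB Gg uG]]]]] := local_inverse oW Wu0 sG G1.
set v0 := G u0 in sg gB Gg; set b := ball v0 r in sg gB Gg.
have ob : open b by exact: ball_open.
have gW v : b v -> W (g v) by move=> bv; apply: B0W; case: (gB v bv).
pose wt v := pullback (jacobian g v) (om (g v)).
have swt : esmooth b wt by exact: esmooth_pullback_map so.
have JF u : W u -> jacobian F u = jacobian G u *m A.
  move=> Wu; have dG := smooth_mx_diff sG Wu.
  have [d1 j1] := jacobian_mulmxr A 0 (G u).
  have FE : (fun v => 0 + v *m A) \o G = F by apply/funext => v; rewrite /= add0r GA.
  by have := jacobian_comp dG d1; rewrite j1 FE.
have JgG v : b v -> jacobian g v *m jacobian G (g v) = 1%:M.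
  move=> bv; have dg := smooth_mx_diff sg bv; have dG := smooth_mx_diff sG (gW v bv).
  have near_id : \near v, (G \o g) v = id v.
    by apply: (open_near_eq ob bv) => v' bv'; case: (gB _ bv').
  have := jacobian_near_eq (differentiable_comp dg dG) near_id.
  by rewrite (jacobian_comp dg dG) jacobian_id.
have JgF v : b v -> jacobian g v *m jacobian F (g v) = A.
  by move=> bv; rewrite JF; [rewrite mulmxA JgG ?mul1mx|exact: gW].
have horw v : b v -> forall X : 'rV[C]_n, X *m toC A = 0 ->
    iprod X (wt v) = 0 /\ iprod X (d_coord wt v) = 0.
  move=> bv X XA; have XJ : X *m toC (jacobian g v) *m toC (jacobian F (g v)) = 0.
    by rewrite -mulmxA -toCM JgF.
  have [h1 h2] := hor (gW v bv) XJ.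
  rewrite (d_coord_pullback ob sg gW so bv) /wt !iprod_pullback h1 h2.
  by rewrite pullback0.
have wt_const v (X : 'rV[R]_n) : X *m A = 0 -> b v -> b (v + X) -> wt (v + X) = wt v.
  move=> XA bv bX; apply: (esmooth_const_along swt _ bv bX) => u bu.
  have XA' : toC X *m toC A = 0 by rewrite -toCM XA map_mx0.
  have := iprod_d_coord ob swt bu (fun v bv => (horw v bv _ XA').1).
  rewrite (horw u bu _ XA').2 => /esym e; rewrite -[RHS]e.
  by apply: eq_bigr => i _; rewrite mxE.
pose y0 := F u0.
have v0A : v0 *m A = y0 by exact: GA.
(* The affine section of the linearised submersion through [v0]; pulling back along it defines the
   descended form, on the set [Z] of points whose lift stays in the ball. *)
pose lft (y : 'rV[R]_m) := v0 + (y - y0) *m B.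
have slft : smooth_mx_on setT lft.
  have oT := @openT 'rV[R]_m.
  apply: (smooth_mxD oT); first exact: smooth_mx_cst.
  apply: (smooth_mulmx oT); last exact: smooth_mx_cst.
  by apply: (smooth_mxD oT); [exact: smooth_mx_id|exact: smooth_mx_cst].
pose Z := setT `&` lft @^-1` b.
have oZ : open Z.
  have := differentiable_continuous (smooth_mx_diff slft _).
  rewrite openE => c y [_ by_]; apply: filterI; first exact: filterT.
  by apply: c => //; exact: open_nbhs_nbhs.
pose tau y := pullback B (wt (lft y)).
exists (B0 `&` F @^-1` Z), Z, tau; split=> //.
- apply: open_preimage => //; exact: smooth_mx_sub B0W sF.
- by split=> //; split=> //; rewrite /lft /= subrr mul0mx addr0; exact: ballxx.
- by move=> u [/B0W].
split.
- move=> y [_ by_]; have [B0g Ggy] := gB _ by_.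
  have Fg : F (g (lft y)) = y.
    by rewrite -GA Ggy /lft mulmxDl v0A -mulmxA BA mulmx1 addrC subrK.
  by exists (g (lft y)) => //; split=> //; rewrite /= Fg.
- by move=> u [].
- apply: (esmooth_lin (@pullback_linear _ _ _ B) oZ).
  by apply: (esmooth_comp oZ _ (smooth_mx_sub _ slft) swt) => // y [].
move=> u [B0u [_ bF]]; have [bG gG] := Gg u B0u; have Wu := B0W _ B0u.
have JGg : jacobian G u *m jacobian g (G u) = 1%:M.
  by apply: mulmx1C; rewrite -{2}gG JgG.
rewrite (JF u Wu) pullback_mulmx /tau -(pullback_mulmx A B).
(* The two points have the same image under [A], so they differ by a vector of its kernel, along
   which [wt] is constant. *)
have -> : wt (lft (F u)) = wt (G u).
  have -> : lft (F u) = G u + (lft (F u) - G u) by rewrite addrC subrK.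
  apply: wt_const => //; last by rewrite addrC subrK.
  by rewrite mulmxBl GA /lft mulmxDl v0A -mulmxA BA mulmx1 [y0 + _]addrC subrK subrr.
rewrite (pullback_horizontal BA); last by move=> X XA; case: (horw _ bG X XA).
by rewrite /wt -pullback_mulmx JGg gG pullback1.
Qed.

End LocalDescent.

(** * Forms on manifolds in charts *)

Lemma jacobian_comp_near (R : realType) n m p (f : 'rV[R]_n -> 'rV[R]_m)
    (g : 'rV[R]_m -> 'rV[R]_p) h u v :
  differentiable f u -> f u = v -> differentiable g v ->
  (\forall u' \near u, g (f u') = h u') ->
  differentiable h u /\ jacobian h u = jacobian f u *m jacobian g v.
Proof.
move=> df fv dg gfh; rewrite -fv in dg *.
have dd := differentiable_comp df dg; split; first exact: differentiable_near_eq gfh dd.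
by rewrite -(jacobian_comp df dg); apply/esym/jacobian_near_eq.
Qed.

Opaque pullback iprod wedge1 jacobian pderiv d_coord.

Section Charts.
Variables (R : realType) (n : nat) (X : manifold R n).
Implicit Types (x y z : X) (O : set X).

(** Coordinate expressions of maps and forms agree only as germs; this moves a condition valid near
    a point into a chart. *)
Lemma near_param x z (P : X -> Prop) : mdom x z -> (\forall z' \near z, P z') ->
  \forall u \near chart x z,
    [/\ P (param x u), mdom x (param x u) & chart x (param x u) = u].
Proof.
move=> xz nP; have im : (chart x @` mdom x) (chart x z) by exists z.
have c := @param_continuous _ _ X x _ im.
have cP : \forall u \near chart x z, P (param x u).
  by apply: c; rewrite chartK.
have : \forall u \near chart x z, (chart x @` mdom x) u.
  by apply: open_nbhs_nbhs; split=> //; exact: chart_open.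
apply: filterS2 cP => u Pu [z' xz' zu]; rewrite -zu chartK //.
by split=> //; rewrite -(chartK xz') zu.
Qed.

Lemma near_chart x z (P : 'rV[R]_n -> Prop) : mdom x z -> (\forall u \near chart x z, P u) ->
  \forall z' \near z, P (chart x z').
Proof. by move=> xz nP; have := @chart_continuous _ _ X x z xz; apply. Qed.

Lemma near_open O z : open O -> O z -> \forall z' \near z, O z'.
Proof. by move=> oO Oz; exact: open_nbhs_nbhs. Qed.

Lemma near_mdom x z : mdom x z -> \forall z' \near z, mdom x z'.
Proof. by apply: near_open; exact: mdom_open. Qed.

Lemma chart_img_open O : open O -> forall x, open (chart x @` (mdom x `&` O)).
Proof.
move=> oO x; rewrite openE => _ [z [xz Oz] <-].
have := near_param xz (near_open oO Oz).
by apply: filterS => u [Ou xu uE]; exists (param x u).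
Qed.

Lemma transition_diff x y z : mdom x z -> mdom y z ->
  differentiable (chart y \o param x) (chart x z).
Proof. by move=> xz yz; apply: smooth_mx_diff (@chart_smooth _ _ X x y) _; exists z. Qed.

Lemma transition_cocycle x y y' z : mdom x z -> mdom y z -> mdom y' z ->
  transition_mx x y' (chart x z)
  = transition_mx x y (chart x z) *m transition_mx y y' (chart y z).
Proof.
move=> xz yz y'z.
have e : (chart y \o param x) (chart x z) = chart y z by rewrite /= chartK.
have ne : \forall u \near chart x z,
    (chart y' \o param y) ((chart y \o param x) u) = (chart y' \o param x) u.
  by apply: filterS (near_param xz (near_mdom yz)) => u [yu _ _] /=; rewrite chartK.
by case: (jacobian_comp_near (transition_diff xz yz) e (transition_diff yz y'z) ne).
Qed.

Lemma transition_id x z : mdom x z -> transition_mx x x (chart x z) = 1%:M.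
Proof.
move=> xz; rewrite -(jacobian_id (chart x z)); apply: jacobian_near_eq.
  exact: transition_diff.
by apply: filterS (near_param xz (near_mdom xz)) => u [].
Qed.

Lemma transitionK x y z : mdom x z -> mdom y z ->
  transition_mx x y (chart x z) *m transition_mx y x (chart y z) = 1%:M.
Proof. by move=> xz yz; rewrite -transition_cocycle // transition_id. Qed.

Lemma transition_unit x y z : mdom x z -> mdom y z ->
  transition_mx x y (chart x z) \in unitmx.
Proof. by move=> xz yz; have [u _] := mulmx1_unit (transitionK xz yz); exact: u. Qed.

Lemma smooth_transition x y : smooth_mx_on (chart x @` (mdom x `&` mdom y)) (transition_mx x y).
Proof.
apply: smooth_jacobian; first by apply: chart_img_open; exact: mdom_open.
exact: chart_smooth.
Qed.

End Charts.

Arguments chart_img_open {R n X O} oO x.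

Section MapsInCharts.
Variables (R : realType) (n m : nat) (X : manifold R n) (Y : manifold R m).
Implicit Types (f g : X -> Y) (x z : X) (y : Y).

Definition diff_map_at f x : Prop :=
  {for x, continuous f} /\ differentiable (chart (f x) \o f \o param x) (chart x x).

Lemma near_cont f x (P : Y -> Prop) : {for x, continuous f} ->
  (\forall y \near f x, P y) -> \forall z \near x, P (f z).
Proof. by move=> cf nP; exact: cf. Qed.

Lemma jacobian_chart_change f x y z : diff_map_at f z -> mdom x z -> mdom y (f z) ->
  differentiable (chart y \o f \o param x) (chart x z) /\
  jacobian (chart y \o f \o param x) (chart x z) =
  transition_mx x z (chart x z) *m tangent_mx f z *m transition_mx (f z) y (chart (f z) (f z)).
Proof.
move=> [cf df] xz yz; have zz := mdom_center z; have fzz := mdom_center (f z).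
have e1 : (chart z \o param x) (chart x z) = chart z z by rewrite /= chartK.
have ne1 : \forall u \near chart x z, (chart (f z) \o f \o param z) ((chart z \o param x) u)
    = (chart (f z) \o f \o param x) u.
  by apply: filterS (near_param xz (near_mdom zz)) => u [h _ _] /=; rewrite chartK.
have [d1 j1] := jacobian_comp_near (transition_diff xz zz) e1 df ne1.
have e2 : (chart (f z) \o f \o param x) (chart x z) = chart (f z) (f z).
  by rewrite /= chartK.
have ne2 : \forall u \near chart x z, (chart y \o param (f z)) ((chart (f z) \o f \o param x) u)
    = (chart y \o f \o param x) u.
  have := near_param xz (near_cont cf (near_mdom fzz)).
  by apply: filterS => u [h _ _] /=; rewrite chartK.
have [d2 j2] := jacobian_comp_near d1 e2 (transition_diff fzz yz) ne2.
by split=> //; rewrite j2 j1.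
Qed.

Lemma tangent_mx_near_eq f g x : diff_map_at f x -> (\near x, f x = g x) ->
  diff_map_at g x /\ tangent_mx f x = tangent_mx g x.
Proof.
move=> [cf df] fg; have fgx : f x = g x := nbhs_singleton fg.
have ne : \forall u \near chart x x, (chart (f x) \o f \o param x) u
   = (chart (g x) \o g \o param x) u.
  by apply: filterS (near_param (mdom_center x) fg) => u [h _ _]; rewrite /= h fgx.
split; last exact: jacobian_near_eq df ne.
split; last exact: differentiable_near_eq ne df.
move=> A nA; have fA : nbhs (f x) A by rewrite fgx.
have nf : \forall z \near x, A (f z) := cf A fA.
suff : \forall z \near x, A (g z) by [].
by apply: filterS2 nf fg => z h e; rewrite -e.
Qed.

Lemma smooth_map_diff W f x : smooth_map_on W f -> W x -> diff_map_at f x.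
Proof.
move=> [cf sf] Wx; split; first exact: cf.
apply: smooth_mx_diff (sf x (f x)) _; exists x => //.
by do ?split=> //; exact: mdom_center.
Qed.

End MapsInCharts.

Section ChainRule.
Variables (R : realType) (n m p : nat).
Variables (X : manifold R n) (Y : manifold R m) (Z : manifold R p).

Lemma tangent_mx_comp (f : X -> Y) (g : Y -> Z) x : diff_map_at f x -> diff_map_at g (f x) ->
  diff_map_at (g \o f) x /\ tangent_mx (g \o f) x = tangent_mx f x *m tangent_mx g (f x).
Proof.
move=> [cf df] [cg dg].
have e : (chart (f x) \o f \o param x) (chart x x) = chart (f x) (f x).
  by rewrite /= chartK //; exact: mdom_center.
have ne : \forall u \near chart x x, (chart (g (f x)) \o g \o param (f x))
    ((chart (f x) \o f \o param x) u) = (chart ((g \o f) x) \o (g \o f) \o param x) u.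
  have := near_param (mdom_center x) (near_cont cf (near_mdom (mdom_center (f x)))).
  by apply: filterS => u [h _ _] /=; rewrite chartK.
have [dd j] := jacobian_comp_near df e dg ne.
by split=> //; split=> //; exact: continuous_comp.
Qed.

Lemma tangent_mx_id x : diff_map_at (@id X) x /\ tangent_mx (@id X) x = 1%:M.
Proof.
have xx := mdom_center x.
split; last exact: transition_id.
by split; [exact: cvg_id|exact: transition_diff].
Qed.

End ChainRule.

Section FormsInCharts.
Variables (R : realType) (n : nat) (X : manifold R n).
Implicit Types (x y z : X) (O : set X) (w t : X -> ext R n).

Lemma form_rep_chart x w z : mdom x z ->
  form_rep x w (chart x z) = pullback (transition_mx x z (chart x z)) (w z).
Proof. by move=> xz; rewrite /form_rep chartK. Qed.

Lemma form_rep_center x w : form_rep x w (chart x x) = w x.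
Proof.
by have xx := mdom_center x; rewrite (form_rep_chart w xx) (transition_id xx) pullback1.
Qed.

Lemma form_rep_change x y w z : mdom x z -> mdom y z -> form_rep x w (chart x z)
  = pullback (transition_mx x y (chart x z)) (form_rep y w (chart y z)).
Proof.
move=> xz yz; apply: (etrans (form_rep_chart w xz)).
rewrite (transition_cocycle xz yz (mdom_center z)) pullback_mulmx.
exact: congr1 (esym (form_rep_chart w yz)).
Qed.

Lemma smooth_formP O w :
  smooth_form_on O w <-> forall x, esmooth (chart x @` (mdom x `&` O)) (form_rep x w).
Proof. by split=> h x S; exact: h. Qed.

(** One chart around each point suffices, because the expressions in two charts differ by the
    pullback along a smooth transition map. *)
Lemma smooth_form_local O w :
  (forall z, O z -> exists y U, [/\ mdom y z, open U, U z &
     esmooth (chart y @` (mdom y `&` U)) (form_rep y w)]) -> smooth_form_on O w.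
Proof.
move=> h; apply/smooth_formP => x; apply: esmooth_local => _ [z [xz Oz] <-].
have [y [U [yz oU Uz sw]]] := h z Oz.
have oyO : open (mdom y `&` U) by apply: openI => //; exact: mdom_open.
exists (chart x @` (mdom x `&` (mdom y `&` U))); first by exists z.
have oE := chart_img_open oyO x.
have sphi : smooth_mx_on (chart x @` (mdom x `&` (mdom y `&` U))) (chart y \o param x).
  apply: smooth_mx_sub (@chart_smooth _ _ X x y) => _ [z' [xz' [yz' _]] <-].
  by exists z'.
apply: (esmooth_ext (esmooth_pullback_map oE sphi _ sw) oE).
  move=> _ [z' [xz' [yz' Uz']] <-]; exists z' => //=.
  by rewrite chartK.
move=> _ [z' [xz' [yz' Uz']] <-]; rewrite (form_rep_change w xz' yz').
by rewrite /= chartK.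
Qed.

Lemma smooth_form_sub O U w : U `<=` O -> smooth_form_on O w -> smooth_form_on U w.
Proof.
move=> OO /smooth_formP sw; apply/smooth_formP => x; apply: esmooth_sub (sw x).
by move=> _ [z [xz Uz] <-]; exists z => //; split=> //; exact: OO.
Qed.

Lemma smooth_form_near O w :
  (forall z, O z -> exists U, [/\ open U, U z & smooth_form_on U w]) -> smooth_form_on O w.
Proof.
move=> h; apply: smooth_form_local => z Oz; have [U [oU Uz sw]] := h z Oz.
exists z, U; split=> //; first exact: mdom_center.
exact: (smooth_formP _ _).1 sw z.
Qed.

Lemma smooth_form_eq O w t : open O -> (forall z, O z -> w z = t z) ->
  smooth_form_on O w -> smooth_form_on O t.
Proof.
move=> oO wt /smooth_formP sw; apply/smooth_formP => x.
apply: (esmooth_ext (sw x) (chart_img_open oO x)) => _ [z [xz Oz] <-].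
by rewrite (form_rep_chart w xz) (form_rep_chart t xz) wt.
Qed.

(** [ext_d] uses a different chart at each point. Naturality of the coordinate derivative under
    transition maps shows that any single chart computes it. *)
Lemma ext_d_rep O x w z : open O -> O z -> smooth_form_on O w -> mdom x z ->
  form_rep x (ext_d w) (chart x z) = d_coord (form_rep x w) (chart x z).
Proof.
move=> oO Oz /smooth_formP sw xz; rewrite form_rep_chart // /ext_d.
have zz := mdom_center z.
pose E := chart x @` (mdom x `&` (mdom z `&` O)).
have oE : open E by apply: chart_img_open; apply: openI => //; exact: mdom_open.
have Ez : E (chart x z) by exists z.
have sphi : smooth_mx_on E (chart z \o param x).
  apply: smooth_mx_sub (@chart_smooth _ _ X x z) => _ [z' [xz' [yz' _]] <-].
  by exists z'.
have Ephi u : E u -> (chart z @` (mdom z `&` O)) ((chart z \o param x) u).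
  by move=> [z' [xz' [zz' Oz']] <-]; exists z' => //=; rewrite chartK.
have := d_coord_pullback oE sphi Ephi (sw z) Ez.
have e : (chart z \o param x) (chart x z) = chart z z by rewrite /= chartK.
rewrite e => /esym jc; apply: (etrans jc); apply: d_coord_near_eq.
apply: (open_near_eq oE Ez) => _ [z' [xz' [zz' Oz']] <-].
have e' : (chart z \o param x) (chart x z') = chart z z' by rewrite /= chartK.
by rewrite e'; exact: esym (form_rep_change w xz' zz').
Qed.

Lemma smooth_ext_d O w : open O -> smooth_form_on O w -> smooth_form_on O (ext_d w).
Proof.
move=> oO sw; apply/smooth_formP => x; have oE := chart_img_open oO x.
apply: (esmooth_ext (esmooth_d oE ((smooth_formP _ _).1 sw x)) oE).
by move=> _ [z [xz Oz] <-]; rewrite (ext_d_rep oO Oz sw xz).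
Qed.

Lemma ext_d_near_eq O w t z : open O -> O z -> (forall z, O z -> w z = t z) ->
  ext_d w z = ext_d t z.
Proof.
move=> oO Oz wt; apply: d_coord_near_eq.
apply: filterS (near_param (mdom_center z) (near_open oO Oz)) => u [Ou _ _].
by rewrite /form_rep wt.
Qed.

Lemma ext_d_sqr O w z : open O -> O z -> smooth_form_on O w -> ext_d (ext_d w) z = 0.
Proof.
move=> oO Oz sw; have zz := mdom_center z; have oE := chart_img_open oO z.
have Ez : (chart z @` (mdom z `&` O)) (chart z z) by exists z.
rewrite -(d_coord_sqr oE ((smooth_formP _ _).1 sw z) Ez).
apply: d_coord_near_eq; apply: (open_near_eq oE Ez) => _ [z' [xz' Oz'] <-].
exact: ext_d_rep Oz' sw xz'.
Qed.

Lemma ediff_form_rep O w z : O z -> smooth_form_on O w -> ediff (form_rep z w) (chart z z).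
Proof.
move=> Oz /smooth_formP sw; apply: esmooth_diff (sw z) _.
by exists z => //; split=> //; exact: mdom_center.
Qed.

Lemma ext_dD O w t z : O z -> smooth_form_on O w -> smooth_form_on O t ->
  ext_d (w + t) z = ext_d w z + ext_d t z.
Proof.
move=> Oz sw st; rewrite /ext_d.
rewrite -(d_coordD (ediff_form_rep Oz sw) (ediff_form_rep Oz st)).
suff -> : form_rep z (w + t) = fun u => form_rep z w u + form_rep z t u by [].
by apply/funext => u; exact: pullbackD.
Qed.

Lemma ext_dZ O (c : R[i]) w z : O z -> smooth_form_on O w ->
  ext_d (c *: w) z = c *: ext_d w z.
Proof.
move=> Oz sw; rewrite /ext_d -(d_coordZ c (ediff_form_rep Oz sw)).
suff -> : form_rep z (c *: w) = fun u => c *: form_rep z w u by [].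
by apply/funext => u; exact: pullbackZ.
Qed.

Lemma smooth_formD O w t : open O -> smooth_form_on O w -> smooth_form_on O t ->
  smooth_form_on O (w + t).
Proof.
move=> oO /smooth_formP sw /smooth_formP st; apply/smooth_formP => x.
have oE := chart_img_open oO x.
apply: (esmooth_ext (esmoothD oE (sw x) (st x)) oE) => u _.
exact: esym (pullbackD _ _ _).
Qed.

Lemma smooth_formZ O (c : R[i]) w : open O -> smooth_form_on O w ->
  smooth_form_on O (c *: w).
Proof.
move=> oO /smooth_formP sw; apply/smooth_formP => x; have oE := chart_img_open oO x.
apply: (esmooth_ext (esmoothZ oE (csmooth_cst _ c) (sw x)) oE) => u _.
exact: esym (pullbackZ _ _ _).
Qed.

End FormsInCharts.

Section PullbackForms.
Variables (R : realType) (n m : nat) (X : manifold R n) (Y : manifold R m).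
Variables (O : set X) (N : set Y) (f : X -> Y) (t : Y -> ext R m).
Hypotheses (oO : open O) (oN : open N) (sf : smooth_map_on O f).
Hypotheses (fN : forall z, O z -> N (f z)) (st : smooth_form_on N t).

Lemma form_pullback_rep x y z : O z -> mdom x z -> mdom y (f z) ->
  form_rep x (form_pullback f t) (chart x z)
  = pullback (jacobian (chart y \o f \o param x) (chart x z)) (form_rep y t (chart y (f z))).
Proof.
move=> Oz xz yz; have [_ ->] := jacobian_chart_change (smooth_map_diff sf Oz) xz yz.
rewrite (form_rep_chart _ xz) (form_rep_chart t yz) /form_pullback !pullback_mulmx.
congr (pullback _ (pullback _ _)).
by rewrite -pullback_mulmx (transitionK (mdom_center (f z)) yz) pullback1.
Qed.

Let E x y := chart x @` (mdom x `&` (O `&` f @^-1` mdom y)).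

Let oE x y : open (E x y).
Proof.
apply: chart_img_open; rewrite openE => z [Oz yz]; apply: filterI.
  exact: near_open.
by apply: near_cont; [exact: sf.1|exact: near_mdom].
Qed.

Let sphi x y : smooth_mx_on (E x y) (chart y \o f \o param x).
Proof.
apply: smooth_mx_sub (sf.2 x y) => _ [z [xz [Oz yz]] <-].
by exists z.
Qed.

Let Ephi x y u : E x y u -> (chart y @` (mdom y `&` N)) ((chart y \o f \o param x) u).
Proof.
move=> [z [xz [Oz yz]] <-]; exists (f z); last by rewrite /= chartK.
by split=> //; exact: fN.
Qed.

Let rep_eq x y u : E x y u -> pullback (jacobian (chart y \o f \o param x) u)
    (form_rep y t ((chart y \o f \o param x) u)) = form_rep x (form_pullback f t) u.
Proof.
by move=> [z [xz [Oz yz]] <-]; rewrite (form_pullback_rep Oz xz yz) /= chartK.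
Qed.

Lemma smooth_form_pullback : smooth_form_on O (form_pullback f t).
Proof.
apply: smooth_form_local => z Oz; exists z, (O `&` f @^-1` mdom (f z)).
have zz := mdom_center z; have fz := mdom_center (f z).
split=> //.
  rewrite openE => z' [Oz' yz]; apply: filterI; first exact: near_open.
  by apply: near_cont; [exact: sf.1|exact: near_mdom].
have sphi' := @sphi z (f z).
exact: (esmooth_ext (esmooth_pullback_map (@oE _ _) sphi' (@Ephi _ _)
  ((smooth_formP _ _).1 st (f z))) (@oE _ _) (@rep_eq _ _)).
Qed.

Lemma ext_d_pullback z : O z -> ext_d (form_pullback f t) z = form_pullback f (ext_d t) z.
Proof.
move=> Oz; have zz := mdom_center z; have fz := mdom_center (f z).
have Ez : E z (f z) (chart z z) by exists z.
have := d_coord_pullback (@oE _ _) (@sphi _ _) (@Ephi _ _) ((smooth_formP _ _).1 st (f z)) Ez.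
have e : (chart (f z) \o f \o param z) (chart z z) = chart (f z) (f z).
  by rewrite /= chartK.
rewrite e => jc; apply: etrans jc.
apply: d_coord_near_eq; apply: (open_near_eq (@oE _ _) Ez) => u Eu.
exact: esym (rep_eq Eu).
Qed.

End PullbackForms.

(** * Integrability in coordinates *)

Section MatrixDerivative.
Variables (R : realType) (n : nat) (W : set 'rV[R]_n) (u : 'rV[R]_n).
Hypotheses (oW : open W) (Wu : W u).

Definition mxpd p r (i : 'I_n) (F : 'rV[R]_n -> 'M[R]_(p, r)) v : 'M[R]_(p, r) :=
  \matrix_(k, l) pderiv i (fun v => F v k l) v.

Lemma pderiv_sum i (I : Type) (s : seq I) (F : I -> 'rV[R]_n -> R) :
  (forall k, differentiable (F k) u) ->
  pderiv i (fun v => \sum_(k <- s) F k v) u = \sum_(k <- s) pderiv i (F k) u.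
Proof.
move=> dF; have h : differentiable (fun v => \sum_(k <- s) F k v) u /\
    pderiv i (fun v => \sum_(k <- s) F k v) u = \sum_(k <- s) pderiv i (F k) u.
  elim: s => [|k s [ds es]].
    have -> : (fun v => \sum_(k <- [::]) F k v) = fun=> 0.
      by apply/funext => v; rewrite big_nil.
    by rewrite big_nil pderiv_cst; split=> //; exact: differentiable_cst.
  have -> : (fun v => \sum_(l <- k :: s) F l v) = fun v => F k v + \sum_(l <- s) F l v.
    by apply/funext => v; rewrite big_cons.
  rewrite big_cons (pderivD i (dF k) ds) es; split=> //.
  exact: differentiableD.
by case: h.
Qed.

Lemma mxpd_cst p r i (A : 'M[R]_(p, r)) : mxpd i (fun=> A) u = 0.
Proof. by apply/matrixP => k l; rewrite !mxE pderiv_cst. Qed.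

Lemma mxpd_eq p r i (F G : 'rV[R]_n -> 'M[R]_(p, r)) : (forall v, W v -> F v = G v) ->
  mxpd i F u = mxpd i G u.
Proof.
move=> FG; apply/matrixP => k l; rewrite [LHS]mxE [RHS]mxE.
by apply: pderiv_near_eq; apply: (open_near_eq oW Wu) => v Wv; rewrite FG.
Qed.

Lemma mxpdD p r i (F G : 'rV[R]_n -> 'M[R]_(p, r)) : smooth_mx_on W F -> smooth_mx_on W G ->
  mxpd i (fun v => F v + G v) u = mxpd i F u + mxpd i G u.
Proof.
move=> sF sG; apply/matrixP => k l; rewrite [LHS]mxE [RHS]mxE.
rewrite (pderiv_ext i u (g := fun v => F v k l + G v k l)); last by move=> v; rewrite mxE.
rewrite (pderivD i (smooth_on_diff (sF k l) Wu) (smooth_on_diff (sG k l) Wu)).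
by rewrite [mxpd i F u k l]mxE [mxpd i G u k l]mxE.
Qed.

Lemma mxpdM p r t i (F : 'rV[R]_n -> 'M[R]_(p, r)) (G : 'rV[R]_n -> 'M[R]_(r, t)) :
  smooth_mx_on W F -> smooth_mx_on W G ->
  mxpd i (fun v => F v *m G v) u = mxpd i F u *m G u + F u *m mxpd i G u.
Proof.
move=> sF sG; apply/matrixP => k l; rewrite [LHS]mxE.
rewrite (pderiv_ext i u (g := fun v => \sum_c F v k c * G v c l)); last by move=> v; rewrite mxE.
have dF c := smooth_on_diff (sF k c) Wu; have dG c := smooth_on_diff (sG c l) Wu.
have dFG c : differentiable (fun v => F v k c * G v c l) u := differentiableM (dF c) (dG c).
rewrite (pderiv_sum i (index_enum _) dFG) [RHS]mxE.
rewrite (eq_bigr (fun c => mxpd i F u k c * G u c l + F u k c * mxpd i G u c l)); last first.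
  by move=> c _; rewrite (pderivM i (dF c) (dG c)) [mxpd i F u k c]mxE [mxpd i G u c l]mxE.
by move: (mxpd i F u) (mxpd i G u) => A B; rewrite big_split !mxE.
Qed.

Lemma mxpd_tr p r i (F : 'rV[R]_n -> 'M[R]_(p, r)) : mxpd i (fun v => (F v)^T) u = (mxpd i F u)^T.
Proof.
apply/matrixP => k l; rewrite [LHS]mxE [RHS]mxE [RHS]mxE.
by apply: pderiv_ext => v; rewrite mxE.
Qed.

Lemma mxpdMl p r t i (A : 'M[R]_(p, r)) (G : 'rV[R]_n -> 'M[R]_(r, t)) :
  smooth_mx_on W G -> mxpd i (fun v => A *m G v) u = A *m mxpd i G u.
Proof.
move=> sG; rewrite (mxpdM i (@smooth_mx_cst _ _ _ _ W A) sG) mxpd_cst mul0mx add0r.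
by [].
Qed.

Lemma mxpdMr p r t i (F : 'rV[R]_n -> 'M[R]_(p, r)) (A : 'M[R]_(r, t)) :
  smooth_mx_on W F -> mxpd i (fun v => F v *m A) u = mxpd i F u *m A.
Proof.
move=> sF; rewrite (mxpdM i sF (@smooth_mx_cst _ _ _ _ W A)) mxpd_cst mulmx0 addr0.
by [].
Qed.

End MatrixDerivative.

(** * The Courant bracket in terms of first jets *)

Section Pairing.
Variables (R : realType) (m : nat).
Implicit Types (v w : 'rV[R]_(m + m)) (J : 'M[R]_(m + m)).

Definition swapR : 'M[R]_(m + m) := block_mx 0 1%:M 1%:M 0.

Definition pairR v w : R := (v *m swapR *m w^T) 0 0.

Lemma toC_swapR : toC swapR = swap_mx R m.
Proof. by rewrite map_block_mx !map_mx0 !map_mx1. Qed.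

Lemma pairRE v w :
  pairR v w = \sum_i (lsubmx v 0 i * rsubmx w 0 i + rsubmx v 0 i * lsubmx w 0 i).
Proof.
rewrite /pairR -{1}(hsubmxK v) mul_row_block !mulmx0 !mulmx1 add0r addr0.
rewrite -{1}(hsubmxK w) tr_row_mx mul_row_col.
rewrite [LHS]mxE [X in X + _]mxE [X in _ + X]mxE big_split addrC /=.
by congr (_ + _); apply: eq_bigr => i _; rewrite !mxE.
Qed.

Lemma gen_pairingE v w : gen_pairing v w = 2^-1 * pairR v w.
Proof.
rewrite pairRE big_split /gen_pairing; congr (_ * _); rewrite addrC /=.
by congr (_ + _); rewrite mxE; apply: eq_bigr => i _; rewrite !mxE // mulrC.
Qed.

Lemma hform_toC v w : hform (toC v) (toC w) = real_complex R (pairR v w).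
Proof.
rewrite pairRE raddf_sum; apply: eq_bigr => i _.
by rewrite raddfD /= !rmorphM !mxE.
Qed.

Lemma pairR_eq0 (A : 'M[R]_(m + m)) : (forall v w, (v *m A *m w^T) 0 0 = 0) -> A = 0.
Proof.
move=> h; apply/matrixP => i j; have := h (delta_mx 0 i) (delta_mx 0 j).
by rewrite -rowE trmx_delta -colE !mxE.
Qed.

(** Orthogonality says that [J] preserves the form matrix; a further multiplication by [J], with
    [J *m J = - 1], makes this linear in [J], so that it can be differentiated. *)
Lemma orthogonal_so J : J *m J = - 1%:M ->
  (forall v w, gen_pairing (v *m J) (w *m J) = gen_pairing v w) ->
  J *m swapR + swapR *m J^T = 0.
Proof.
move=> J2 orth; have JHJ : J *m swapR *m J^T = swapR.
  apply/eqP; rewrite -subr_eq0; apply/eqP/pairR_eq0 => v w.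
  have := orth v w; rewrite !gen_pairingE => /mulfI e; rewrite mulmxBr mulmxBl mxE.
  have /= := e (invr_neq0 _); rewrite pnatr_eq0 => /(_ isT).
  by rewrite /pairR trmx_mul !mulmxA => ->; rewrite [X in _ + X]mxE subrr.
by rewrite -{1}JHJ !mulmxA J2 mulNmx mul1mx mulNmx addNr.
Qed.

Lemma pairR_skew J v w : J *m swapR + swapR *m J^T = 0 ->
  pairR (v *m J) w = - pairR v (w *m J).
Proof.
move=> /eqP; rewrite addr_eq0 => /eqP e.
rewrite /pairR -(mulmxA v) e mulmxN mulNmx mxE; congr (- _).
by rewrite trmx_mul !mulmxA.
Qed.

Lemma so_toC J : J *m swapR + swapR *m J^T = 0 -> so_mx (toC J).
Proof.
move=> /eqP; rewrite addr_eq0 => /eqP e.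
by rewrite /so_mx -toC_swapR -toCM e map_mxN toCM map_trmx.
Qed.

Lemma pairRDr v w1 w2 : pairR v (w1 + w2) = pairR v w1 + pairR v w2.
Proof. by rewrite /pairR linearD mulmxDr mxE. Qed.

Lemma pairR0l w : pairR 0 w = 0.
Proof. by rewrite /pairR !mul0mx mxE. Qed.

Lemma pairR0r v : pairR v 0 = 0.
Proof. by rewrite /pairR trmx0 mulmx0 mxE. Qed.

End Pairing.

Section Courant.
Variables (R : realType) (n : nat) (W : set 'rV[R]_n) (u : 'rV[R]_n).
Hypotheses (oW : open W) (Wu : W u).
Implicit Types (y : 'rV[R]_(n + n)) (d : 'I_n -> 'rV[R]_(n + n)).

Let dxR i : 'rV[R]_(n + n) := row_mx 0 (delta_mx 0 i).

(* the Courant bracket at a point, as the Dorfman bracket corrected by the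
   differential of the pairing; [y1], [y2] are the values of the two sections
   and [d1], [d2] their partial derivatives *)
Definition courant_jet y1 d1 y2 d2 : 'rV[R]_(n + n) :=
  \sum_i (lsubmx y1 0 i *: d2 i - lsubmx y2 0 i *: d1 i + pairR (d1 i) y2 *: dxR i
     - (2^-1 * (pairR (d1 i) y2 + pairR y1 (d2 i))) *: dxR i).

Lemma courant_coordE (Y1 Y2 : 'rV[R]_n -> 'rV[R]_(n + n)) :
  smooth_mx_on W Y1 -> smooth_mx_on W Y2 ->
  courant_coord Y1 Y2 u
  = courant_jet (Y1 u) (fun i => mxpd i Y1 u) (Y2 u) (fun i => mxpd i Y2 u).
Proof.
move=> s1 s2; have dY (Y : 'rV[R]_n -> 'rV[R]_(n + n)) : smooth_mx_on W Y -> forall k, differentiable (fun v => Y v 0 k) u.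
  by move=> sY k; exact: smooth_on_diff (sY 0 k) Wu.
have dl (Y : 'rV[R]_n -> 'rV[R]_(n + n)) : smooth_mx_on W Y -> forall k, differentiable (fun v => lsubmx (Y v) 0 k) u.
  move=> sY k; rewrite (_ : (fun v => _) = fun v => Y v 0 (lshift n k)); first exact: dY.
  by apply/funext => v; rewrite mxE.
have dr (Y : 'rV[R]_n -> 'rV[R]_(n + n)) : smooth_mx_on W Y -> forall k, differentiable (fun v => rsubmx (Y v) 0 k) u.
  move=> sY k; rewrite (_ : (fun v => _) = fun v => Y v 0 (rshift n k)); first exact: dY.
  by apply/funext => v; rewrite mxE.
have pl i (Y : 'rV[R]_n -> 'rV[R]_(n + n)) j :
    pderiv i (fun v => lsubmx (Y v) 0 j) u = lsubmx (mxpd i Y u) 0 j.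
  by rewrite [RHS]mxE [RHS]mxE; apply: pderiv_ext => v; rewrite mxE.
have pr i (Y : 'rV[R]_n -> 'rV[R]_(n + n)) j :
    pderiv i (fun v => rsubmx (Y v) 0 j) u = rsubmx (mxpd i Y u) 0 j.
  by rewrite [RHS]mxE [RHS]mxE; apply: pderiv_ext => v; rewrite mxE.
have entryE (a b c d : R) (A B V : 'rV[R]_(n + n)) k :
    (a *: A - b *: B + c *: V - d *: V) 0 k = a * A 0 k - b * B 0 k + c * V 0 k - d * V 0 k.
  by rewrite !mxE.
have dxl i j : dxR i 0 (lshift n j) = 0 by rewrite row_mxEl mxE.
have dxr i j : dxR i 0 (rshift n j) = (i == j)%:R by rewrite row_mxEr mxE eqxx eq_sym.
have lE (A : 'rV[R]_(n + n)) k : lsubmx A 0 k = A 0 (lshift n k) by rewrite mxE.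
have rE (A : 'rV[R]_(n + n)) k : rsubmx A 0 k = A 0 (rshift n k) by rewrite mxE.
have sumE (F : 'I_n -> 'rV[R]_(n + n)) : \sum_i F i =
    row_mx (\sum_i lsubmx (F i)) (\sum_i rsubmx (F i)).
  by rewrite -[LHS]hsubmxK !linear_sum.
rewrite /courant_jet sumE /courant_coord; congr row_mx; apply/rowP => j.
  rewrite [LHS]mxE summxE; apply: eq_bigr => i _; rewrite !pl.
  move: (mxpd i Y1 u) (mxpd i Y2 u) => D1 D2.
  by rewrite !lE entryE dxl !mulr0 subr0 addr0.
rewrite [LHS]mxE summxE.
have pdj k : pderiv j (fun v => rsubmx (Y2 v) 0 k * lsubmx (Y1 v) 0 k -
    rsubmx (Y1 v) 0 k * lsubmx (Y2 v) 0 k) u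
  = rsubmx (mxpd j Y2 u) 0 k * lsubmx (Y1 u) 0 k + rsubmx (Y2 u) 0 k * lsubmx (mxpd j Y1 u) 0 k
  - (rsubmx (mxpd j Y1 u) 0 k * lsubmx (Y2 u) 0 k + rsubmx (Y1 u) 0 k * lsubmx (mxpd j Y2 u) 0 k).
  rewrite (pderivB j (differentiableM (dr _ s2 k) (dl _ s1 k)) (differentiableM (dr _ s1 k) (dl _ s2 k))).
  by rewrite (pderivM j (dr _ s2 k) (dl _ s1 k)) (pderivM j (dr _ s1 k) (dl _ s2 k)) !pl !pr.
have dsum k : differentiable (fun v => rsubmx (Y2 v) 0 k * lsubmx (Y1 v) 0 k -
    rsubmx (Y1 v) 0 k * lsubmx (Y2 v) 0 k) u.
  exact: (differentiableB (differentiableM (dr _ s2 k) (dl _ s1 k))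
    (differentiableM (dr _ s1 k) (dl _ s2 k))).
rewrite (pderiv_sum j (index_enum _) dsum).
rewrite (eq_bigr _ (fun k _ => pdj k)).
rewrite (eq_bigr (fun i => lsubmx (Y1 u) 0 i * (rsubmx (mxpd i Y2 u) 0 j - rsubmx (mxpd j Y2 u) 0 i)));
  last by move=> i _; rewrite !pr.
rewrite [X in _ - X](eq_bigr (fun i => lsubmx (Y2 u) 0 i * (rsubmx (mxpd i Y1 u) 0 j
   - rsubmx (mxpd j Y1 u) 0 i))); last by move=> i _; rewrite !pr.
have {pdj} -> : \sum_i rsubmx (lsubmx (Y1 u) 0 i *: mxpd i Y2 u - lsubmx (Y2 u) 0 i *: mxpd i Y1 u
      + pairR (mxpd i Y1 u) (Y2 u) *: dxR i
      - (2^-1 * (pairR (mxpd i Y1 u) (Y2 u) + pairR (Y1 u) (mxpd i Y2 u))) *: dxR i) 0 j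
    = \sum_i (lsubmx (Y1 u) 0 i * rsubmx (mxpd i Y2 u) 0 j - lsubmx (Y2 u) 0 i * rsubmx (mxpd i Y1 u) 0 j)
      + (2^-1 * (pairR (mxpd j Y1 u) (Y2 u) - pairR (Y1 u) (mxpd j Y2 u))).
  rewrite (eq_bigr (fun i => (lsubmx (Y1 u) 0 i * rsubmx (mxpd i Y2 u) 0 j
     - lsubmx (Y2 u) 0 i * rsubmx (mxpd i Y1 u) 0 j)
     + (i == j)%:R * (2^-1 * (pairR (mxpd i Y1 u) (Y2 u) - pairR (Y1 u) (mxpd i Y2 u))))).
    rewrite big_split /= [X in _ + X](bigD1 j) //= eqxx mul1r
      [X in _ + (_ + X)]big1 ?addr0 // => i /negPf ij.
    by rewrite ij mul0r.
  move=> i _; move: (mxpd i Y1 u) (mxpd i Y2 u) => D1 D2.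
  move: (pairR D1 _) (pairR _ D2) => p q.
  rewrite !rE entryE dxr !lE.
  move: (Y1 u 0 _) (Y2 u 0 _) (D1 0 _) (D2 0 _) ((i == j)%:R) => *.
  by field.
rewrite !pairRE -!sumrB !mulr_sumr -!big_split; apply: eq_bigr => i _ /=.
move: (mxpd i Y1 u) (mxpd i Y2 u) (mxpd j Y1 u) (mxpd j Y2 u) => D1 D2 E1 E2.
move: (lsubmx (Y1 u) 0 i) (lsubmx (Y2 u) 0 i) (rsubmx (Y1 u) 0 i) (rsubmx (Y2 u) 0 i).
move: (rsubmx D2 0 j) (rsubmx E2 0 i) (rsubmx D1 0 j) (rsubmx E1 0 i) (lsubmx E2 0 i) (lsubmx E1 0 i).
by move=> *; field.
Qed.

End Courant.

(** Exhibits the action as linear in the entries of the matrix, with fixed operators: its derivative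
    along a family of matrices is the action of the derivative. *)
Lemma spinop_mx (R : realType) n (M : 'M[R]_(n + n)) w : spinop (toC M) w =
  \sum_(ab : 'I_(n + n) * 'I_(n + n)) real_complex R (M ab.1 ab.2) *:
    (2^-1 *: cl (delta_mx 0 ab.2) (cl (row ab.1 (swap_mx R n)) w)).
Proof.
rewrite spinop.unlock scaler_sumr -(pair_big xpredT xpredT (fun a b =>
  real_complex R (M a b) *: (2^-1 *: cl (delta_mx 0 b) (cl (row a (swap_mx R n)) w)))) /=.
apply: eq_bigr => a _; rewrite [X in cl X _]row_sum_delta cl_suml scaler_sumr.
apply: eq_bigr => b _; rewrite clZl !scalerA mulrC; congr (_ * _ *: _).
by rewrite !mxE.
Qed.

Lemma cl2_linear (R : realType) n (a b : 'rV[R[i]]_(n + n)) :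
  linear (fun w : ext R n => 2^-1 *: cl a (cl b w)).
Proof.
move=> c x y; rewrite (cl_linear _ c x y) (cl_linear _ c (cl _ x) (cl _ y)).
by rewrite scalerDr !scalerA [2^-1 * c]mulrC.
Qed.

Lemma esmooth_spinop (R : realType) n (W : set 'rV[R]_n) (J : 'rV[R]_n -> 'M[R]_(n + n))
    (t : 'rV[R]_n -> ext R n) : open W -> smooth_mx_on W J -> esmooth W t ->
  esmooth W (fun u => spinop (toC (J u)) (t u)).
Proof.
move=> oW sJ st.
apply: (esmooth_ext (esmooth_lincomb (I := ('I_(n + n) * 'I_(n + n))%type)
  (a := fun ab u => real_complex R (J u ab.1 ab.2)) (fun ab => cl2_linear (delta_mx 0 ab.2) (row ab.1 (swap_mx R n))) oW _ st) oW).
  by move=> ab; apply: csmooth_real; exact: sJ.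
by move=> u _; exact: esym (spinop_mx _ _).
Qed.

Section CoordinateIntegrability.
Variables (R : realType) (n : nat) (W : set 'rV[R]_n) (u0 : 'rV[R]_n).
Variable J : 'rV[R]_n -> 'M[R]_(n + n).
Local Notation C := R[i].
Hypotheses (oW : open W) (Wu0 : W u0) (sJ : smooth_mx_on W J).
Hypothesis J2 : forall u, W u -> J u *m J u = - 1%:M.
Hypothesis orth : forall u, W u -> forall v w,
  gen_pairing (v *m J u) (w *m J u) = gen_pairing v w.
Hypothesis integrable : forall a b : 'rV[R]_(n + n),
  courant_coord (fun u => a *m J u) (fun u => b *m J u) u0
  - courant_coord (fun=> a) (fun u => b *m J u) u0 *m J u0
  - courant_coord (fun u => a *m J u) (fun=> b) u0 *m J u0
  + courant_coord (fun=> a) (fun=> b) u0 *m J u0 *m J u0 = 0.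

Let D i : 'M[R]_(n + n) := mxpd i J u0.

Let so_J u : W u -> J u *m swapR R n + swapR R n *m (J u)^T = 0.
Proof. by move=> Wu; exact: orthogonal_so (J2 Wu) (orth Wu). Qed.

Let so_D i : D i *m swapR R n + swapR R n *m (D i)^T = 0.
Proof.
have sH : smooth_mx_on W (fun=> swapR R n) := @smooth_mx_cst _ _ _ _ W (swapR R n).
have sT := smooth_trmx oW sJ.
have := mxpd_eq oW Wu0 i so_J; rewrite mxpd_cst.
rewrite (mxpdD Wu0 i (smooth_mulmx oW sJ sH) (smooth_mulmx oW sH sT)).
by rewrite (mxpdMr Wu0 i _ sJ) (mxpdMl Wu0 i _ sT) mxpd_tr.
Qed.

Let DJ i : D i *m J u0 = - (J u0 *m D i).
Proof.
apply/eqP; rewrite -addr_eq0; apply/eqP.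
have := mxpd_eq oW Wu0 i (F := fun u => J u *m J u) (G := fun=> - 1%:M) J2.
by rewrite mxpd_cst (mxpdM Wu0 i sJ sJ).
Qed.

Let dxR i : 'rV[R]_(n + n) := row_mx 0 (delta_mx 0 i).
Let dx i : 'rV[C]_(n + n) := row_mx 0 (delta_mx 0 i).

(** Integrability on constant sections, for which only derivatives of [J] appear. The exact
    corrections of the Courant bracket disappear: the one for [a *m J, b *m J] is 0 by
    orthogonality, those of the two mixed brackets cancel, and the bracket of the constants is 0. *)
Let nijR a b : \sum_i (lsubmx (a *m J u0) 0 i *: (b *m D i)
    - lsubmx (b *m J u0) 0 i *: (a *m D i)
    + pairR (a *m D i) (b *m J u0) *: dxR i
  - (lsubmx a 0 i *: (b *m D i) - lsubmx b 0 i *: (a *m D i)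
     + pairR (a *m D i) b *: dxR i) *m J u0) = 0.
Proof.
have sc c : smooth_mx_on W (fun=> c : 'rV[R]_(n + n)) := @smooth_mx_cst _ _ _ _ W c.
have sm (c : 'rV[R]_(n + n)) := smooth_mulmx oW (sc c) sJ.
have := integrable a b.
rewrite (courant_coordE Wu0 (sm a) (sm b)) (courant_coordE Wu0 (sc a) (sm b)).
rewrite (courant_coordE Wu0 (sm a) (sc b)) (courant_coordE Wu0 (sc a) (sc b)).
have mE c : (fun i => mxpd i (fun u => c *m J u) u0) = fun i => c *m D i.
  by apply/funext => i; rewrite (mxpdMl Wu0 i _ sJ).
have c0 (c : 'rV[R]_(n + n)) : (fun i => mxpd i (fun=> c) u0) = fun=> 0.
  by apply/funext => i; exact: mxpd_cst.
have soJ := so_J Wu0; rewrite !mE !c0.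
(* Derivative of the pairing of [a *m J] with [b *m J], which is constant. *)
have e1 i : pairR (a *m D i) (b *m J u0) + pairR (a *m J u0) (b *m D i) = 0.
  rewrite (pairR_skew _ _ (so_D i)) (pairR_skew _ _ soJ) -!mulmxA DJ.
  by rewrite mulmxN -opprD -pairRDr subrr pairR0r oppr0.
have e2 i : pairR a (b *m D i) = - pairR (a *m D i) b.
  by rewrite (pairR_skew _ _ (so_D i)) opprK.
move=> e; apply: etrans e; rewrite /courant_jet !mulmx_suml -!sumrB -big_split /=.
apply: eq_bigr => i _; rewrite -[row_mx 0 (delta_mx 0 i)]/(dxR i) e1 e2 !pairR0l !pairR0r.
move: (a *m D i) (b *m D i) (pairR _ _) (pairR _ _) (dxR i) => x y p p' V.
rewrite [X in _ = _ + X *m _ *m _](_ : _ = 0) ?mul0mx ?addr0; last first.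
  by rewrite !(scaler0, scale0r, mulr0, addr0, subr0).
have dist (A B E : 'rV[R]_(n + n)) M : A - B *m M - E *m M = A - (B + E) *m M.
  by rewrite mulmxDl opprD addrA.
rewrite dist; apply: (f_equal2 (fun A B => A - B *m J u0)).
  by rewrite mulr0 scale0r subr0.
rewrite !(scaler0, scale0r, addr0, add0r, subr0).
move: (lsubmx a 0 i) (lsubmx b 0 i) => k l.
by apply/rowP => c; rewrite !mxE; field.
Qed.

Let so_JC u : W u -> so_mx (toC (J u)).
Proof. by move=> Wu; apply: so_toC; exact: so_J. Qed.

Let J2C u : W u -> toC (J u) *m toC (J u) = - 1%:M.
Proof. by move=> Wu; rewrite -toCM J2 // map_mxN map_mx1. Qed.

Let DJC i : toC (D i) *m toC (J u0) = - (toC (J u0) *m toC (D i)).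
Proof. by rewrite -!toCM DJ map_mxN. Qed.

Let nijC a b : nijenhuis_const (toC (J u0)) (fun i => toC (D i)) (delta_mx 0 a) (delta_mx 0 b) = 0.
Proof.
have := congr1 (map_mx (real_complex R)) (nijR (delta_mx 0 a) (delta_mx 0 b)).
rewrite map_mx0 raddf_sum /= => e; apply: etrans e; apply: eq_bigr => i _.
have dE k : delta_mx 0 k = toC (delta_mx 0 k) :> 'rV[C]_(n + n) by rewrite map_delta_mx.
have dxE : dx i = toC (dxR i) by rewrite map_row_mx map_mx0 map_delta_mx.
have lE (v : 'rV[R]_(n + n)) : pairR (dxR i) v = lsubmx v 0 i.
  rewrite pairRE (bigD1 i) //= big1 ?addr0 => [|k ki].
    by rewrite row_mxKl row_mxKr [X in X * _]mxE mul0r add0r mxE !eqxx mul1r.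
  by rewrite row_mxKl row_mxKr [X in X * _]mxE mul0r add0r [X in X * _]mxE (negPf ki) andbF mul0r.
rewrite -[row_mx 0 (delta_mx 0 i)]/(dx i) !dE dxE -!toCM !hform_toC !lE.
have tD (x y : 'rV[R]_(n + n)) : toC (x + y) = toC x + toC y by rewrite map_mxD.
have tB (x y : 'rV[R]_(n + n)) : toC (x - y) = toC x - toC y by rewrite map_mxB.
have tZ c (x : 'rV[R]_(n + n)) : toC (c *: x) = real_complex R c *: toC x by rewrite map_mxZ.
by rewrite !(tB, tD, tZ, toCM).
Qed.

(* Where [lam - 1] is not an eigenvalue of the spin action of [J], [p = 0] and
   [d t] is a sum of eigenvectors for [lam + i] and [lam - i]. *)
Lemma d_eigen_bigrading (lam : C) (t : 'rV[R]_n -> ext R n) : esmooth W t ->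
  (forall u, W u -> spinop (toC (J u)) (t u) = lam *: t u) ->
  let f x := spinop (toC (J u0)) x - lam *: x in
  exists2 p, f (f (d_coord t u0)) + d_coord t u0 = p & f (f p) = - p.
Proof.
move=> st Jt; apply: (@nijenhuis_bigrading R n (toC (J u0)) (fun i => toC (D i)) _ _ _ DJC nijC
  lam (t u0) (fun i => epd i t u0)).
- exact: so_JC.
- exact: J2C.
- by move=> i; apply: so_toC; exact: so_D.
- exact: Jt.
move=> i; have dt := esmooth_diff st Wu0.
pose L (ab : 'I_(n + n) * 'I_(n + n)) (w : ext R n) : ext R n :=
  2^-1 *: cl (delta_mx 0 ab.2) (cl (row ab.1 (swap_mx R n)) w).
have hL ab : linear (L ab) := cl2_linear _ _.
pose a (ab : 'I_(n + n) * 'I_(n + n)) u := real_complex R (J u ab.1 ab.2).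
have da ab : cdiff (a ab) u0 by apply: cdiff_real; exact: smooth_on_diff (sJ _ _) Wu0.
have := epd_lincomb hL i da dt.
rewrite (@epd_near_eq _ _ _ i _ (fun u => lam *: t u)); last first.
  by apply: (open_near_eq oW Wu0) => u Wu; rewrite -Jt // spinop_mx.
rewrite (epdZ i (cdiff_cst lam u0) dt) cpd_cst scale0r add0r => ->.
rewrite !spinop_mx; congr (_ + _); apply: eq_bigr => ab _.
by rewrite /a (cpd_real i (fun v => J v ab.1 ab.2)) /D [mxpd i J u0 _ _]mxE.
Qed.

End CoordinateIntegrability.

Section GenTangent.
Variables (R : realType) (n : nat).
Implicit Types A B : 'M[R]_n.

Lemma gen_tangent_mxM A B : A \in unitmx -> B \in unitmx ->
  gen_tangent_mx (A *m B) = gen_tangent_mx A *m gen_tangent_mx B.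
Proof.
move=> uA uB; rewrite /gen_tangent_mx mulmx_block !mulmx0 !mul0mx !add0r !addr0.
have -> : invmx (A *m B) = invmx B *m invmx A.
  have uAB : A *m B \in unitmx by rewrite unitmx_mul uA.
  have h : A *m B *m (invmx B *m invmx A) = 1%:M by rewrite mulmxA mulmxK // mulmxV.
  by rewrite -[LHS]mulmx1 -h mulKmx.
by rewrite trmx_mul.
Qed.

Lemma conj_sqr m (P Q K : 'M[R]_m) : P *m Q = 1%:M -> Q *m P = 1%:M -> K *m K = - 1%:M ->
  (P *m K *m Q) *m (P *m K *m Q) = - 1%:M.
Proof.
move=> PQ QP K2; rewrite !mulmxA -(mulmxA _ Q P) QP mulmx1 -(mulmxA P) K2.
by rewrite mulmxN mulmx1 mulNmx PQ.
Qed.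

Lemma conj_mulr m (P Q K : 'M[R]_m) : Q *m P = 1%:M -> P *m K *m Q *m P = P *m K.
Proof. by move=> QP; rewrite -mulmxA QP mulmx1. Qed.

Lemma gen_tangent_mx1 : gen_tangent_mx (1%:M : 'M[R]_n) = 1%:M.
Proof. by rewrite /gen_tangent_mx invmx1 trmx1 -scalar_mx_block. Qed.

Lemma gen_tangent_pairR A v w : A \in unitmx ->
  pairR (v *m gen_tangent_mx A) (w *m gen_tangent_mx A) = pairR v w.
Proof.
move=> uA; rewrite /pairR trmx_mul !mulmxA -(mulmxA v) -(mulmxA v).
suff -> : gen_tangent_mx A *m swapR R n *m (gen_tangent_mx A)^T = swapR R n by [].
rewrite /gen_tangent_mx /swapR tr_block_mx !trmx0 trmxK !mulmx_block.
rewrite !(mulmx0, mul0mx, mulmx1, addr0, add0r) mulmxV //.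
by rewrite -trmx_mul mulmxV // trmx1.
Qed.

End GenTangent.

(** * Generalized complex structures read in charts *)

Section GenComplex.
Variables (R : realType) (n : nat) (X : manifold R n) (W : set X).
Variable J : X -> 'M[R]_(n + n).
Hypotheses (oW : open W) (gJ : gen_complex_on W J).
Implicit Types (x y z : X) (w : X -> ext R n).

Let trans_GT x y z : mdom x z -> mdom y z ->
  gen_tangent_mx (transition_mx x y (chart x z)) *m gen_tangent_mx (transition_mx y x (chart y z))
  = 1%:M.
Proof.
move=> xz yz; rewrite -gen_tangent_mxM; [|exact: transition_unit|exact: transition_unit].
by rewrite (transitionK xz yz) gen_tangent_mx1.
Qed.

Lemma gen_endo_rep_chart x z : mdom x z -> gen_endo_rep x J (chart x z)
  = gen_tangent_mx (transition_mx x z (chart x z)) *m J z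
    *m gen_tangent_mx (transition_mx z x (chart z z)).
Proof.
move=> xz; rewrite /gen_endo_rep chartK //; congr (_ *m _ *m _).
have e := trans_GT xz (mdom_center z); have [_ u] := mulmx1_unit e.
by rewrite -[LHS]mul1mx -e mulmxK.
Qed.

Lemma gen_endo_rep_center x : gen_endo_rep x J (chart x x) = J x.
Proof.
have xx := mdom_center x; rewrite (gen_endo_rep_chart xx) (transition_id xx).
by rewrite gen_tangent_mx1 mul1mx mulmx1.
Qed.

Lemma endo_rep_sqr x z : mdom x z -> W z ->
  gen_endo_rep x J (chart x z) *m gen_endo_rep x J (chart x z) = - 1%:M.
Proof.
move=> xz Wz; have [_ J2 _ _] := gJ; rewrite (gen_endo_rep_chart xz).
exact: conj_sqr (trans_GT xz (mdom_center z)) (trans_GT (mdom_center z) xz) (J2 z Wz).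
Qed.

Lemma endo_rep_orth x z : mdom x z -> W z -> forall a b,
  gen_pairing (a *m gen_endo_rep x J (chart x z)) (b *m gen_endo_rep x J (chart x z))
  = gen_pairing a b.
Proof.
move=> xz Wz a b; have [_ _ orth _] := gJ; rewrite (gen_endo_rep_chart xz) !mulmxA.
have u1 := transition_unit xz (mdom_center z); have u2 := transition_unit (mdom_center z) xz.
rewrite [LHS]gen_pairingE (gen_tangent_pairR _ _ u2) -gen_pairingE orth //.
by rewrite [LHS]gen_pairingE (gen_tangent_pairR _ _ u1) -gen_pairingE.
Qed.

Lemma spinop_form_rep x w z : mdom x z ->
  spinop (toC (gen_endo_rep x J (chart x z))) (form_rep x w (chart x z))
  = form_rep x (fun z => spinop (toC (J z)) (w z)) (chart x z).
Proof.
move=> xz; rewrite !(form_rep_chart _ xz).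
apply: spinop_pullback; first exact: transition_unit (mdom_center z).
rewrite (gen_endo_rep_chart xz) -[LHS]toCM -[RHS]toCM.
by rewrite (conj_mulr _ (trans_GT (mdom_center z) xz)).
Qed.

Lemma smooth_spinop w : smooth_form_on W w ->
  smooth_form_on W (fun z => spinop (toC (J z)) (w z)).
Proof.
move=> /smooth_formP sw; apply/smooth_formP => x; have oE := chart_img_open oW x.
have [sJ _ _ _] := gJ.
apply: (esmooth_ext (esmooth_spinop oE (sJ x) (sw x)) oE) => _ [z [xz Wz] <-].
exact: spinop_form_rep.
Qed.

Lemma smooth_eigproj (I : eqType) (lam : I -> R[i]) s j w : smooth_form_on W w ->
  smooth_form_on W (fun z => eigproj (spinop (toC (J z))) lam s j (w z)).
Proof.
move=> sw; rewrite /eigproj; elim: [seq l <- s | l != j] => [|l r IH] //=.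
set t := (fun z => foldr _ _ r) in IH.
have st := smooth_spinop IH.
have s1 := smooth_formZ (lam j - lam l)^-1 oW (smooth_formD oW st (smooth_formZ (- lam l) oW IH)).
apply: (smooth_form_eq oW _ s1) => z _.
rewrite -[LHS]/((lam j - lam l)^-1 *: (spinop (toC (J z)) (t z) + (- lam l) *: t z)) scaleNr.
by [].
Qed.

Let cst_sec x (a : 'rV[R]_(n + n)) z : 'rV[R]_(n + n) :=
  a *m gen_tangent_mx (transition_mx x z (chart x z)).

Let cst_sec_rep x a y z : mdom x z -> mdom y z ->
  gen_rep y (cst_sec x a) (chart y z) = a *m gen_tangent_mx (transition_mx x y (chart x z)).
Proof.
move=> xz yz; have u1 := transition_unit xz (mdom_center z).
have u2 := transition_unit (mdom_center z) yz.
rewrite /gen_rep (chartK yz) /cst_sec -mulmxA -(gen_tangent_mxM u1 u2).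
by rewrite -(transition_cocycle xz (mdom_center z) yz).
Qed.

Let smooth_GT V (A : 'rV[R]_n -> 'M[R]_n) : open V -> (forall u, V u -> A u \in unitmx) ->
  smooth_mx_on V A -> smooth_mx_on V (fun u => gen_tangent_mx (A u)).
Proof.
move=> oV uA sA; apply: smooth_block_mx => //; [exact: smooth_mx_cst|exact: smooth_mx_cst|].
by apply: smooth_trmx => //; exact: smooth_invmx.
Qed.

Let smooth_cst_sec x a : smooth_gen_section_on (mdom x `&` W) (cst_sec x a).
Proof.
move=> y; pose V := chart y @` (mdom y `&` (mdom x `&` W)).
have oV : open V by apply: chart_img_open; apply: openI => //; exact: mdom_open.
have sphi : smooth_mx_on V (chart x \o param y).
  by apply: smooth_mx_sub (@chart_smooth _ _ X y x) => _ [z [yz [xz _]] <-]; exists z.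
have sT := @smooth_transition _ _ X x y.
have sT' : smooth_mx_on V (fun u => transition_mx x y ((chart x \o param y) u)).
  apply: (smooth_mx_comp oV _ sphi sT) => _ [z [yz [xz _]] <-].
  by exists z => //=; rewrite chartK.
have sG := smooth_GT oV _ sT'.
apply: (smooth_mx_ext (smooth_mulmx oV (@smooth_mx_cst _ _ _ _ V a) (sG _)) oV).
  by move=> _ [z [yz [xz _]] <-]; rewrite /= chartK //; exact: transition_unit.
by move=> _ [z [yz [xz _]] <-]; rewrite (cst_sec_rep _ xz yz) /= chartK.
Qed.

Let courant_eq x (Y1 Y2 : X -> 'rV[R]_(n + n)) (Z1 Z2 : 'rV[R]_n -> 'rV[R]_(n + n)) :
  let V := chart x @` (mdom x `&` W) in W x ->
  smooth_mx_on V Z1 -> smooth_mx_on V Z2 ->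
  (forall u, V u -> Z1 u = gen_rep x Y1 u) -> (forall u, V u -> Z2 u = gen_rep x Y2 u) ->
  courant Y1 Y2 x = courant_coord Z1 Z2 (chart x x).
Proof.
move=> V Wx s1 s2 e1 e2; have oV : open V by exact: chart_img_open.
have Vx : V (chart x x) by exists x => //; split=> //; exact: mdom_center.
have s1' := smooth_mx_ext s1 oV e1; have s2' := smooth_mx_ext s2 oV e2.
have d1 : (fun i => mxpd i (gen_rep x Y1) (chart x x)) = fun i => mxpd i Z1 (chart x x).
  by apply/funext => i; exact: esym (mxpd_eq oV Vx i e1).
have d2 : (fun i => mxpd i (gen_rep x Y2) (chart x x)) = fun i => mxpd i Z2 (chart x x).
  by apply/funext => i; exact: esym (mxpd_eq oV Vx i e2).
apply: (etrans (courant_coordE Vx s1' s2')); rewrite (courant_coordE Vx s1 s2) d1 d2.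
by rewrite -(e1 _ Vx) -(e2 _ Vx).
Qed.

Lemma endo_rep_integrable x (a b : 'rV[R]_(n + n)) : W x ->
  let Jr := gen_endo_rep x J in let u0 := chart x x in
  courant_coord (fun u => a *m Jr u) (fun u => b *m Jr u) u0
  - courant_coord (fun=> a) (fun u => b *m Jr u) u0 *m Jr u0
  - courant_coord (fun u => a *m Jr u) (fun=> b) u0 *m Jr u0
  + courant_coord (fun=> a) (fun=> b) u0 *m Jr u0 *m Jr u0 = 0.
Proof.
move=> Wx Jr u0; pose V := chart x @` (mdom x `&` W).
have xx := mdom_center x; have [sJ _ _ int] := gJ; have oV : open V by exact: chart_img_open.
have oW' : open (mdom x `&` W) by apply: openI => //; exact: mdom_open.
have sub : mdom x `&` W `<=` W by move=> z [].
have := int _ oW' sub _ _ (@smooth_cst_sec x a) (@smooth_cst_sec x b) x (conj xx Wx).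
have sc c : smooth_mx_on V (fun=> c : 'rV[R]_(n + n)) := @smooth_mx_cst _ _ _ _ V c.
have sm (c : 'rV[R]_(n + n)) := smooth_mulmx oV (sc c) (sJ x).
have ec c u : V u -> c = gen_rep x (cst_sec x c) u.
  by move=> [z [xz Wz] <-]; rewrite (cst_sec_rep c xz xz) (transition_id xz) gen_tangent_mx1 mulmx1.
have em c u : V u -> c *m Jr u = gen_rep x (gen_act J (cst_sec x c)) u.
  move=> [z [xz Wz] <-]; rewrite /Jr (gen_endo_rep_chart xz) /gen_rep (chartK xz).
  by rewrite /gen_act /cst_sec !mulmxA.
rewrite (courant_eq Wx (sm a) (sm b) (em a) (em b)) /gen_act.
rewrite (courant_eq Wx (sc a) (sm b) (ec a) (em b)).
rewrite (courant_eq Wx (sm a) (sc b) (em a) (ec b)).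
rewrite (courant_eq Wx (sc a) (sc b) (ec a) (ec b)).
by rewrite /Jr gen_endo_rep_center.
Qed.

Lemma ext_d_eigen (lam : R[i]) w x : smooth_form_on W w ->
  (forall z, W z -> spinop (toC (J z)) (w z) = lam *: w z) -> W x ->
  let f (e : ext R n) := spinop (toC (J x)) e - lam *: e in
  exists2 p, f (f (ext_d w x)) + ext_d w x = p & f (f p) = - p.
Proof.
move=> /smooth_formP sw wJ Wx; pose V := chart x @` (mdom x `&` W).
have xx := mdom_center x; have [sJ _ _ _] := gJ; have oV : open V by exact: chart_img_open.
have Vx : V (chart x x) by exists x.
have := @d_eigen_bigrading R n V (chart x x) (gen_endo_rep x J) oV Vx (sJ x) _ _ _ lam
  (form_rep x w) (sw x) _.
rewrite gen_endo_rep_center; apply.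
- by move=> _ [z [xz Wz] <-]; exact: endo_rep_sqr.
- by move=> _ [z [xz Wz] <-]; exact: endo_rep_orth.
- by move=> a b; rewrite -gen_endo_rep_center; exact: endo_rep_integrable.
- move=> _ [z [xz Wz] <-]; rewrite (spinop_form_rep w xz).
  by rewrite !(form_rep_chart _ xz) -pullbackZ wJ.
Qed.

End GenComplex.

(** * Submersions and basic forms *)

Section FormFromCoordinates.
Variables (R : realType) (n : nat) (X : manifold R n).

Definition form_of (y0 : X) (g : 'rV[R]_n -> ext R n) : X -> ext R n :=
  fun y => pullback (transition_mx y y0 (chart y y)) (g (chart y0 y)).

Lemma form_rep_form_of y0 g y : mdom y0 y ->
  form_rep y0 (form_of y0 g) (chart y0 y) = g (chart y0 y).
Proof.
move=> y0y; rewrite (form_rep_chart _ y0y) -pullback_mulmx.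
by rewrite (transitionK y0y (mdom_center y)) pullback1.
Qed.

Lemma smooth_form_of y0 g (Z : set 'rV[R]_n) : open Z -> esmooth Z g ->
  smooth_form_on (mdom y0 `&` chart y0 @^-1` Z) (form_of y0 g).
Proof.
move=> oZ sg; pose N := mdom y0 `&` chart y0 @^-1` Z.
have oN : open N.
  rewrite openE => y [y0y Zy]; apply: filterI; first exact: near_mdom.
  by apply: near_chart => //; exact: open_nbhs_nbhs.
apply: smooth_form_local => y [y0y Zy]; exists y0, N; split=> //.
have oE := chart_img_open oN y0.
have sg' : esmooth (chart y0 @` (mdom y0 `&` N)) g.
  by apply: esmooth_sub sg => _ [z [_ [_ Zz]] <-].
apply: (esmooth_ext sg' oE) => _ [z [y0z _] <-].
by rewrite form_rep_form_of.
Qed.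

Lemma smooth_form0 (O : set X) : smooth_form_on O (0 : X -> ext R n).
Proof.
apply/smooth_formP => x; rewrite (_ : form_rep x 0 = fun=> 0); first exact: esmooth_cst.
by apply/funext => u; exact: pullback0.
Qed.

Lemma ext_d0 (x : X) : ext_d (0 : X -> ext R n) x = 0.
Proof.
rewrite /ext_d (_ : form_rep x 0 = fun=> 0); last by apply/funext => u; exact: pullback0.
by rewrite d_coordE big1 // => i _; rewrite epd_cst wedge10.
Qed.

End FormFromCoordinates.

Section Submersion.
Variables (R : realType) (n m : nat) (X : manifold R n) (Y : manifold R m).
Variables (W : set X) (f : X -> Y).
Hypotheses (oW : open W) (sub : submersion_on W f).
Local Notation C := R[i].

Lemma submersion_descent (O1 : set X) (w : X -> ext R n) x :
  open O1 -> O1 `<=` W -> smooth_form_on O1 w ->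
  (forall z, O1 z -> forall V : 'rV[C]_n, V *m toC (tangent_mx f z) = 0 ->
     iprod V (w z) = 0 /\ iprod V (ext_d w z) = 0) -> O1 x ->
  exists (O : set X) (N : set Y) (tau : Y -> ext R m),
    [/\ open O, O x, O `<=` O1, open N &
     [/\ N `<=` f @` O, forall z, O z -> N (f z), smooth_form_on N tau
       & forall z, O z -> w z = form_pullback f tau z]].
Proof.
move=> oO1 O1W sw hor O1x; have [sf full] := sub.
have df z : O1 z -> diff_map_at f z by move=> /O1W; exact: smooth_map_diff.
have xx := mdom_center x; pose y0 := f x; have yy : mdom y0 y0 := mdom_center y0.
pose D := O1 `&` f @^-1` mdom y0.
have oD : open D.
  rewrite openE => z [ O1z yz]; apply: filterI; first exact: near_open.
  by apply: near_cont; [case: (df z O1z)|exact: near_mdom].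
pose V0 := chart x @` (mdom x `&` D).
have oV0 : open V0 by exact: chart_img_open.
pose Fc := chart y0 \o f \o param x.
have sF : smooth_mx_on V0 Fc.
  apply: smooth_mx_sub (sf.2 x y0) => _ [z [xz [ O1z yz]] <-].
  by exists z => //; split=> //; split=> //; exact: O1W.
have V0x : V0 (chart x x) by exists x.
have so : esmooth V0 (form_rep x w).
  by apply: esmooth_sub ((smooth_formP _ _).1 sw x) => _ [z [xz [ O1z _]] <-]; exists z.
have jF z : mdom x z -> D z -> jacobian Fc (chart x z)
    = transition_mx x z (chart x z) *m tangent_mx f z
      *m transition_mx (f z) y0 (chart (f z) (f z)).
  by move=> xz [ O1z yz]; have [_ ->] := jacobian_chart_change (df z O1z) xz yz.
have hor' u : V0 u -> forall V : 'rV[C]_n, V *m toC (jacobian Fc u) = 0 ->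
    iprod V (form_rep x w u) = 0 /\ iprod V (d_coord (form_rep x w) u) = 0.
  move=> [z [xz Dz] <-] V; rewrite (jF z xz Dz) !toCM !mulmxA => VJ.
  have [ O1z yz] := Dz.
  have VT : V *m toC (transition_mx x z (chart x z)) *m toC (tangent_mx f z) = 0.
    have k := transitionK (mdom_center (f z)) yz.
    by rewrite -[LHS]mulmx1 -(map_mx1 (real_complex R)) -k toCM mulmxA VJ mul0mx.
  have [h1 h2] := hor z O1z _ VT.
  rewrite -(ext_d_rep oO1 O1z sw xz) !(form_rep_chart _ xz).
  by rewrite !iprod_pullback h1 h2 pullback0.
have [B [Z [tau [oB Bx BV0 oZ [ZB BZ stau wB]]]]] :=
  local_descent oV0 V0x sF (full x (O1W _ O1x)) so hor'.
pose N := mdom y0 `&` chart y0 @^-1` Z.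
pose O := (mdom x `&` D) `&` (chart x @^-1` B).
exists O, N, (form_of y0 tau).
have OB z : O z -> B (chart x z) by case.
have FcE z : mdom x z -> Fc (chart x z) = chart y0 (f z).
  by move=> xz; rewrite /Fc /= chartK.
split=> //.
- rewrite openE => z [[xz Dz] Bz]; apply: filterI.
    by apply: filterI; [exact: near_mdom|exact: near_open].
  by apply: near_chart => //; exact: open_nbhs_nbhs.
- by move=> z [[_ [ O1z _]] _].
- rewrite openE => y [y0y Zy]; apply: filterI; first exact: near_mdom.
  by apply: near_chart => //; exact: open_nbhs_nbhs.
split.
- move=> y [y0y Zy]; have [u Bu Fu] := ZB _ Zy; have [z [xz Dz] zu] := BV0 _ Bu.
  exists z; first by split=> //; rewrite /= zu.
  have [_ yz] := Dz; rewrite -(chartK yz) -(chartK y0y); congr (param y0 _).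
  by rewrite -Fu -zu FcE.
- move=> z Oz; have [[xz [ O1z yz]] Bz] := Oz; split=> //.
  by rewrite /= -FcE //; exact: BZ.
- exact: smooth_form_of.
move=> z Oz; have [[xz Dz] Bz] := Oz; have [ O1z yz] := Dz.
have zz := mdom_center z.
have -> : w z = pullback (transition_mx z x (chart z z)) (form_rep x w (chart x z)).
  by rewrite -(form_rep_change w zz xz) form_rep_center.
rewrite (wB _ Bz) (jF z xz Dz) FcE // -mulmxA -pullback_mulmx mulmxA.
by rewrite (transitionK zz xz) mul1mx pullback_mulmx.
Qed.

(** Descent of the zero form already provides an open set around [f x] contained in the image. *)
Lemma submersion_open O : open O -> O `<=` W -> open (f @` O).
Proof.
move=> oO OW; rewrite openE => _ [x Ox <-].
have [|O2 [N [tau [oO2 O2x O2O oN [NO ON _ _]]]]] :=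
  @submersion_descent O 0 x oO OW (@smooth_form0 _ _ _ _) _ Ox.
  by move=> z _ V _; rewrite ext_d0 iprod0.
apply: (@filterS _ _ _ N); last by apply: open_nbhs_nbhs; split=> //; exact: ON.
by move=> y /NO[z O2z <-]; exists z => //; exact: O2O.
Qed.

End Submersion.

Section LocallyConstant.
Variables (T : topologicalType) (P : set T) (Q : T -> Prop).

Lemma connected_locally_constant : connected P ->
  (forall x, P x -> exists O, [/\ open O, O x & forall z, O z -> P z -> (Q z <-> Q x)]) ->
  forall x y, P x -> P y -> Q x -> Q y.
Proof.
move=> cP loc x y Px Py Qx.
suff : P `&` Q = P by move=> e; have := Py; rewrite -e => -[].
have loc' z : P z -> exists O, [/\ open O, O z & forall z', O z' -> P z' -> (Q z' <-> Q z)].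
  exact: loc.
apply: cP; first by exists x.
- exists (\bigcup_(O in [set O : set T | open O /\ forall z, O z -> P z -> Q z]) O).
    by apply: bigcup_open => O [].
  apply/seteqP; split=> z [Pz].
    move=> Qz; split=> //; have [U [oU Uz UQ]] := loc z Pz; exists U => //.
    by split=> // z' Uz' Pz'; apply/(UQ z' Uz' Pz').
  by move=> [U [oU UQ] Uz]; split=> //; exact: UQ.
exists (~` \bigcup_(O in [set O : set T | open O /\ forall z, O z -> P z -> ~ Q z]) O).
  by apply: open_closedC; apply: bigcup_open => O [].
apply/seteqP; split=> z [Pz].
  by move=> Qz; split=> // -[U [oU UQ] Uz]; exact: UQ Uz Pz Qz.
move=> nU; split=> //; apply: contrapT => nQ; apply: nU.
have [U [oU Uz UQ]] := loc z Pz; exists U => //; split=> // z' Uz' Pz' Qz'.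
by apply: nQ; apply/(UQ z' Uz' Pz').
Qed.

End LocallyConstant.

Section LeafwiseVectors.
Variables (R : realType) (n m : nat) (X : manifold R n) (Y : manifold R m).
Variables (W : set X) (f : X -> Y) (x : X) (a : 'rV[R]_n).
Hypotheses (oW : open W) (Wx : W x) (sub : submersion_on W f).
Hypothesis af : a *m tangent_mx f x = 0.

(** A kernel vector at one point is extended by projecting it, in a chart, onto the kernel of the
    differential at nearby points. *)
Lemma fibre_vector_field : exists (V : set X) (v : X -> 'rV[R]_n),
  [/\ open V, V x, V `<=` W, smooth_vector_field_on V v &
      v x = a /\ forall z, V z -> v z *m tangent_mx f z = 0].
Proof.
have [sf full] := sub; have xx := mdom_center x; pose y0 := f x.
have df z : W z -> diff_map_at f z by exact: smooth_map_diff.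
pose D := W `&` f @^-1` mdom y0.
have oD : open D.
  rewrite openE => z [Wz yz]; apply: filterI; first exact: near_open.
  by apply: near_cont; [case: (df z Wz)|exact: near_mdom].
have Dx : D x by split=> //; exact: mdom_center.
pose V0 := chart x @` (mdom x `&` D).
have oV0 : open V0 by exact: chart_img_open.
have V0x : V0 (chart x x) by exists x.
pose A := jacobian (chart y0 \o f \o param x).
have sA : smooth_mx_on V0 A.
  apply: smooth_jacobian => //.
  by apply: smooth_mx_sub (sf.2 x y0) => _ [z [xz [Wz yz]] <-]; exists z.
have /row_fullP[B BA] : row_full (A (chart x x)) by exact: full.
have sc p r (K : 'M[R]_(p, r)) : smooth_mx_on V0 (fun=> K) := @smooth_mx_cst _ _ _ _ V0 K.
have sBA := smooth_mulmx oV0 (sc _ _ B) sA.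
pose V1 := [set u | V0 u /\ B *m A u \in unitmx].
have V1V0 : V1 `<=` V0 by move=> u [].
have oV1 : open V1.
  rewrite openE => u [V0u uu]; apply: filterI; first exact: open_nbhs_nbhs.
  have c : {for u, continuous (fun u => \det (B *m A u))}.
    by apply: differentiable_continuous; exact: smooth_on_diff (smooth_det oV0 sBA) V0u.
  have d0 : \det (B *m A u) != 0 by move: uu; rewrite unitmxE unitfE.
  have nz : \forall t \near u, \det (B *m A t) != 0 by apply: (cvgr_neq0 _ c d0).
  by apply: filterS nz => v dv; rewrite /= unitmxE unitfE.
(* The projection of [a] onto the kernel of [A u]. As [B] is a left inverse of [A] at the centre,
   [B *m A u] is invertible nearby; at the centre the value is [a], which already lies in the
   kernel. *)
pose K u := a *m (1%:M - A u *m (invmx (B *m A u) *m B)).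
have sK : smooth_mx_on V1 K.
  have s1 := smooth_mx_sub V1V0 sBA; have s2 := smooth_mx_sub V1V0 sA.
  have sc' p r (L : 'M[R]_(p, r)) : smooth_mx_on V1 (fun=> L) := @smooth_mx_cst _ _ _ _ V1 L.
  have s3 := smooth_mulmx oV1 (smooth_invmx oV1 (fun u (h : V1 u) => h.2) s1) (sc' _ _ B).
  exact: smooth_mulmx oV1 (sc' _ _ a) (smooth_mxD oV1 (sc' _ _ _)
    (smooth_mxN oV1 (smooth_mulmx oV1 s2 s3))).
have KA u : V1 u -> K u *m A u = 0.
  move=> [_ uu]; rewrite /K -mulmxA mulmxBl mul1mx -!mulmxA mulVmx // mulmx1.
  by rewrite subrr mulmx0.
pose v z := K (chart x z) *m transition_mx x z (chart x z).
pose V := (mdom x `&` D) `&` chart x @^-1` V1.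
have oV : open V.
  rewrite openE => z [[xz Dz] Bz]; apply: filterI.
    by apply: filterI; [exact: near_mdom|exact: near_open].
  by apply: near_chart => //; exact: open_nbhs_nbhs.
exists V, v; split.
- exact: oV.
- by split; [split|split=> //; rewrite BA; exact: unitmx1].
- by move=> z [[_ []]].
- move=> y; pose E := chart y @` (mdom y `&` V).
  have oE : open E by exact: chart_img_open.
  have sphi : smooth_mx_on E (chart x \o param y).
    by apply: smooth_mx_sub (@chart_smooth _ _ X y x) => _ [z [yz [[xz _] _]] <-]; exists z.
  have sT : smooth_mx_on E (fun u => transition_mx x y ((chart x \o param y) u)).
    apply: (smooth_mx_comp oE _ sphi (@smooth_transition _ _ X x y)).
    by move=> _ [z [yz [[xz _] _]] <-]; exists z => //=; rewrite chartK.
  have sK' : smooth_mx_on E (fun u => K ((chart x \o param y) u)).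
    apply: (smooth_mx_comp oE _ sphi sK).
    by move=> _ [z [yz [_ V1z]] <-] /=; rewrite chartK.
  apply: (smooth_mx_ext (smooth_mulmx oE sK' sT) oE) => _ [z [yz [[xz _] _]] <-].
  rewrite /vector_rep /v /= (chartK yz) -mulmxA.
  by rewrite -(transition_cocycle xz (mdom_center z) yz).
split.
  rewrite /v (transition_id xx) mulmx1 /K mulmxBr mulmx1 mulmxA.
  by rewrite (_ : a *m A (chart x x) = 0) ?mul0mx ?subr0.
move=> z [[xz [Wz yz]] V1z]; rewrite /v.
have [_ e] := jacobian_chart_change (df z Wz) xz yz.
have k := transitionK (mdom_center (f z)) yz.
have := KA _ V1z; rewrite /A e !mulmxA => h.
by rewrite -[LHS]mulmx1 -k mulmxA h mul0mx.
Qed.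

End LeafwiseVectors.

(** * Basic forms of a foliation and invariant transverse forms *)

Lemma complex_kernel (R : realType) n m (V : 'rV[R[i]]_n) (A : 'M[R]_(n, m)) :
  V *m toC A = 0 -> exists a b : 'rV[R]_n,
    [/\ V = toC a + 'i%C *: toC b, a *m A = 0 & b *m A = 0].
Proof.
move=> VA; exists (\row_k complex.Re (V 0 k)), (\row_k complex.Im (V 0 k)).
have e k : \sum_j V 0 j * real_complex R (A j k) = 0.
  have := congr1 (fun z : 'rV[R[i]]_m => z 0 k) VA; rewrite !mxE => e0; apply: etrans e0.
  by apply: eq_bigr => j _; rewrite mxE.
split; apply/rowP => k; rewrite !mxE.
- by case: (V 0 k) => p q; simpc.
- have e' := congr1 (@complex.Re R) (e k); rewrite raddf_sum /= in e'; apply: etrans e'.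
  by apply: eq_bigr => j _; rewrite mxE; case: (V 0 j) => p q /=; ring.
- have e' := congr1 (@complex.Im R) (e k); rewrite raddf_sum /= in e'; apply: etrans e'.
  by apply: eq_bigr => j _; rewrite mxE; case: (V 0 j) => p q /=; ring.
Qed.

Section BasicForms.
Variables (R : realType) (n m : nat) (M : manifold R n) (T0 : manifold R m).
Variable F : foliation M T0.
Local Notation C := R[i].
Local Notation f := (@fsub _ _ _ _ _ F).
Implicit Types (w : M -> ext R n) (t : fidx F -> T0 -> ext R m) (i j : fidx F).

Lemma fsub_diff i x : fopen i x -> diff_map_at (f i) x.
Proof. by move=> ix; apply: smooth_map_diff ix; case: (fsub_submersion i). Qed.

Lemma fsub_full i x : fopen i x -> row_full (tangent_mx (f i) x).
Proof. by have [_ h] := fsub_submersion i; exact: h. Qed.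

Lemma fopenI_open i j : open (fopen i `&` fopen j : set M).
Proof. by apply: openI; exact: fopen_open. Qed.

Lemma transv_open i : open (transv (F := F) i).
Proof. exact: (submersion_open (fsub_submersion i) (fopen_open i) (@subset_refl _ _)). Qed.

Lemma fgamma_diff i j x : fopen i x -> fopen j x -> diff_map_at (@fgamma _ _ _ _ _ F i j) (f i x).
Proof.
move=> ix jx; have [|W [g [_ Wx _ _ [sh _ _]]]] := @fgamma_diffeo _ _ _ _ _ F i j (f i x).
  by exists x.
exact: smooth_map_diff sh Wx.
Qed.

Lemma tangent_fgamma i j x : fopen i x -> fopen j x ->
  tangent_mx (f j) x = tangent_mx (f i) x *m tangent_mx (@fgamma _ _ _ _ _ F i j) (f i x).
Proof.
move=> ix jx; have [d e] := tangent_mx_comp (fsub_diff ix) (fgamma_diff ix jx).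
have ne : \forall z \near x, (@fgamma _ _ _ _ _ F i j \o f i) z = f j z.
  have := near_open (fopenI_open i j) (conj ix jx).
  by apply: filterS => z [iz jz]; rewrite /= (fgammaE iz jz).
by have [_ <-] := tangent_mx_near_eq d ne.
Qed.

Lemma tangent_kerR i j x (v : 'rV[R]_n) : fopen i x -> fopen j x ->
  v *m tangent_mx (f i) x = 0 -> v *m tangent_mx (f j) x = 0.
Proof.
by move=> ix jx Vi; rewrite (tangent_fgamma ix jx) mulmxA Vi mul0mx.
Qed.

(** Leafwise vector fields are replaced by single complex vectors: every real kernel vector is the
    value of a local leafwise field, and the differential being real, a complex kernel vector has
    real and imaginary parts in the kernel. By the transition maps the condition does not depend on
    [i]. *)
Lemma basic_formP w : basic_form F w <-> smooth_form_on setT w /\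
  forall i x, fopen i x -> forall V : 'rV[C]_n, V *m toC (tangent_mx (f i) x) = 0 ->
    iprod V (w x) = 0 /\ iprod V (ext_d w x) = 0.
Proof.
split=> [[sw h]|[sw h]]; split=> //.
  move=> i x ix V VT; set A := tangent_mx (f i) x in VT.
  have real (a : 'rV[R]_n) : a *m A = 0 -> iprod (toC a) (w x) = 0 /\ iprod (toC a) (ext_d w x) = 0.
    move=> aA; have [U [v [oU Ux UW sv [<- vT]]]] :=
      fibre_vector_field (fopen_open i) ix (fsub_submersion i) aA.
    apply: (h U v oU sv _ x Ux) => j z Uz jz.
    exact: tangent_kerR (UW _ Uz) jz (vT z Uz).
  have [a [b [VE aA bA]]] := complex_kernel VT.
  have [a1 a2] := real a aA; have [b1 b2] := real b bA.
  by rewrite VE !iprodDl !iprodZl a1 a2 b1 b2 scaler0 addr0.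
move=> W v oW sv vT x Wx; have [i ix] := fopen_cover F x.
by apply: (h i x ix); rewrite -toCM (vT i x Wx ix) map_mx0.
Qed.

Lemma basic_form_smooth w : basic_form F w -> smooth_form_on setT w.
Proof. by case. Qed.

Lemma basic_form_d w : basic_form F w -> basic_form F (ext_d w).
Proof.
move=> /basic_formP[sw h]; apply/basic_formP; have oT := @openT M.
split; first exact: smooth_ext_d.
move=> i x ix V VT; have [_ h2] := h i x ix V VT; split; first exact: h2.
have xT : [set: M] x by [].
by rewrite (ext_d_sqr oT xT sw) iprod0.
Qed.

Lemma basic_formD w w' : basic_form F w -> basic_form F w' -> basic_form F (w + w').
Proof.
move=> /basic_formP[sw h] /basic_formP[sw' h']; apply/basic_formP; have oT := @openT M.
split=> [|i x ix V VT]; first exact: smooth_formD.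
have [h1 h2] := h i x ix V VT; have [h1' h2'] := h' i x ix V VT.
have xT : [set: M] x by [].
split; first by apply: etrans (iprodD V (w x) (w' x)) _; rewrite h1 h1' addr0.
apply: etrans (congr1 (iprod V) (ext_dD xT sw sw')) _.
exact: etrans (iprodD V _ _) (etrans (congr2 +%R h2 h2') (addr0 0)).
Qed.

Lemma basic_formZ (c : C) w : basic_form F w -> basic_form F (c *: w).
Proof.
move=> /basic_formP[sw h]; apply/basic_formP; have oT := @openT M.
split=> [|i x ix V VT]; first exact: smooth_formZ.
have [h1 h2] := h i x ix V VT; have xT : [set: M] x by [].
rewrite (ext_dZ c xT sw) (iprodZ V c (ext_d w x)) h2 scaler0; split=> //.
by apply: etrans (iprodZ V c (w x)) _; rewrite h1 scaler0.
Qed.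

Lemma corresponds_basic w t : (forall i, smooth_form_on (transv i) (t i)) -> corresponds w t ->
  basic_form F w /\ corresponds (ext_d w) (fun i => ext_d (t i)).
Proof.
move=> st c.
have dw : corresponds (ext_d w) (fun i => ext_d (t i)).
  move=> i x ix; rewrite -(ext_d_pullback (fopen_open i)
    (fsub_submersion i).1 _ (st i) ix); last by move=> z iz; exists z.
  by apply: (ext_d_near_eq (fopen_open i) ix) => z iz; exact: c.
split=> //; apply/basic_formP; split.
  apply: smooth_form_near => x _; have [i ix] := fopen_cover F x; exists (fopen i).
  split=> //; first exact: fopen_open.
  apply: (@smooth_form_eq _ _ _ _ (form_pullback (f i) (t i))); first exact: fopen_open.
    by move=> z iz; rewrite (c i z iz).
  apply: (smooth_form_pullback (fopen_open i) (fsub_submersion i).1 _ (st i)).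
  by move=> z iz; exists z.
move=> i x ix V VT; rewrite (c i x ix) (dw i x ix) /form_pullback !iprod_pullback VT.
by rewrite !iprod0l !pullback0.
Qed.

Section Descent.
Variable w : M -> ext R n.
Hypothesis bw : basic_form F w.

Let loc i x : fopen i x -> exists (O : set M) (N : set T0) (tau : T0 -> ext R m),
    [/\ open O, O x, O `<=` fopen i, open N &
     [/\ N `<=` f i @` O, forall z, O z -> N (f i z), smooth_form_on N tau
       & forall z, O z -> w z = form_pullback (f i) tau z]].
Proof.
move=> ix; have /basic_formP[sw h] := bw.
apply: (submersion_descent (fsub_submersion i) (fopen_open i) _ _ _ ix) => //.
  exact: smooth_form_sub sw.
by move=> z iz; exact: h.
Qed.

(** The transverse value given by local descent is locally constant along a fibre, and fibres are
    connected. *)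
Let fibre_const i y : exists s, forall x, fopen i x -> f i x = y ->
  w x = pullback (tangent_mx (f i) x) s.
Proof.
pose P := fopen i `&` f i @^-1` [set y] : set M.
have [[x0 Px0]|nP] := pselect (exists x, P x); last first.
  by exists 0 => x ix xy; case: nP; exists x.
have [ix0 x0y] := Px0.
have [ O [N [tau [_ Ox0 _ _ [_ _ _ wO]]]]] := loc ix0.
exists (tau y) => x ix xy; pose Q z := w z = pullback (tangent_mx (f i) z) (tau y).
suff : Q x by [].
have Px : P x by [].
suff locQ z : P z -> exists O, [/\ open O, O z & forall z', O z' -> P z' -> (Q z' <-> Q z)].
  apply: (connected_locally_constant (@fsub_connected _ _ _ _ _ F i y) locQ Px0 Px).
  by rewrite /Q (wO x0 Ox0) /form_pullback x0y.
move=> [iz zy]; have [U [N' [tau' [oU Uz UW _ [_ _ _ wU]]]]] := loc iz.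
(* Injectivity of the pullback turns the condition at [z'] into an equality of two values at [y], in
   which [z'] does not occur. *)
have Q' z' : U z' -> P z' -> (Q z' <-> tau' y = tau y).
  move=> Uz' [iz' z'y]; rewrite /Q (wU _ Uz') /form_pullback z'y; split=> [|-> //].
  by move=> e; apply: (pullback_inj (fsub_full iz') e).
exists U; split; [exact: oU|exact: Uz|move=> z' Uz' Pz'].
exact: iff_trans (Q' z' Uz' Pz') (iff_sym (Q' z Uz (conj iz zy))).
Qed.

Lemma basic_form_descends :
  exists2 t, (forall i, smooth_form_on (transv i) (t i)) & corresponds w t.
Proof.
have /choice[t0 t0P] : forall iy : fidx F * T0, exists s, forall x, fopen iy.1 x ->
    f iy.1 x = iy.2 -> w x = pullback (tangent_mx (f iy.1) x) s.
  by move=> [i y]; exact: fibre_const.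
pose t i y := t0 (i, y); have ct : corresponds w t.
  by move=> i x ix; exact: (t0P (i, f i x) x ix).
(* Smoothness: injectivity of the pullback identifies [t i] near each point with the smooth form
   obtained by local descent. *)
exists t => // i; apply: smooth_form_near => _ [x ix <-].
have [ O [N [tau [oO Ox OW oN [NO ON stau wO]]]]] := loc ix.
exists N; split=> //; first exact: ON.
apply: (smooth_form_eq oN _ stau) => _ /NO[z Oz <-].
apply: (pullback_inj (fsub_full (OW _ Oz))).
by have := wO z Oz; rewrite (ct i z (OW _ Oz)) /form_pullback.
Qed.

End Descent.
End BasicForms.

(** * Holonomy maps and invariance of transverse forms *)

Section Holonomy.
Variables (R : realType) (n m : nat) (M : manifold R n) (T0 : manifold R m).
Variable F : foliation M T0.
Local Notation f := (@fsub _ _ _ _ _ F).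
Implicit Types (h g : T0 -> T0) (D : set T0) (i j : fidx F).

(* the regularity of holonomy maps which survives composition, inversion and
   gluing, and is enough for the chain rule *)
Definition local_diff D h : Prop :=
  [/\ open D, forall O, open O -> O `<=` D -> open (h @` O) &
   forall y, D y -> diff_map_at h y /\ exists W g,
     [/\ open W, W y, W `<=` D & (forall z, W z -> g (h z) = z) /\ diff_map_at g (h y)]].

Lemma local_diffeo_local_diff D h : open D -> local_diffeo_on D h -> local_diff D h.
Proof.
move=> oD ld; split=> // [ O oO OD|y Dy].
  rewrite openE => _ [y Oy <-].
  have [W [g [oW Wy WD ohW [sh sg gh]]]] := ld y (OD y Oy).
  have hWy : (h @` W) (h y) by exists y.
  have [cg _] := smooth_map_diff sg hWy.
  have nO : \forall z \near g (h y), O z by rewrite gh //; exact: near_open.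
  have nO' := near_cont cg nO; have nW := near_open ohW hWy.
  apply: filterS2 nO' nW => y' Oy' [z Wz zy]; exists z => //.
  by move: Oy'; rewrite -zy (gh z Wz).
have [W [g [oW Wy WD ohW [sh sg gh]]]] := ld y Dy.
split; first exact: smooth_map_diff sh Wy.
exists W, g; split=> //; split=> //.
by apply: (smooth_map_diff sg); exists y.
Qed.

Lemma local_diff_id D : open D -> local_diff D id.
Proof.
move=> oD; split=> // [ O oO _|y Dy]; first by rewrite image_id.
have [d _] := tangent_mx_id y; split=> //.
by exists D, id; split.
Qed.

Lemma local_diff_restrict D D' h : local_diff D h -> open D' -> D' `<=` D -> local_diff D' h.
Proof.
move=> [oD oh dh] oD' D'D; split=> // [ O oO OD'|y D'y].
  by apply: oh => //; exact: subset_trans D'D.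
have [d [W [g [oW Wy WD [gh dg]]]]] := dh y (D'D y D'y); split=> //.
exists (W `&` D'), g; split; [exact: openI|by []|by move=> z []|].
by split=> // z [Wz _]; exact: gh.
Qed.

Lemma local_diff_comp D D' h h' : local_diff D h -> local_diff D' h' ->
  local_diff (D `&` h @^-1` D') (h' \o h).
Proof.
move=> [oD oh dh] [oD' oh' dh'].
have ch y (P : T0 -> Prop) : D y -> (\forall z \near h y, P z) -> \forall z \near y, P (h z).
  by move=> Dy; apply: near_cont; case: (dh y Dy) => -[].
have oI (V : set T0) : open V -> V `<=` D -> open (V `&` h @^-1` D').
  move=> oV VD; rewrite openE => y [Vy D'y]; apply: filterI; first exact: near_open.
  by apply: ch; [exact: VD|exact: near_open].
split; first exact: oI.
  move=> O oO OD; rewrite -image_comp.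
  apply: oh' => [|_ [z /OD[_ D'z] <-] //]; apply: oh => // z /OD[] //.
move=> y [Dy D'y]; have [d [W [g [oW Wy WD [gh dg]]]]] := dh y Dy.
have [d' [W' [g' [oW' Wy' WD' [gh' dg']]]]] := dh' (h y) D'y.
have [dc _] := tangent_mx_comp d d'; split=> //.
have dg2 : diff_map_at g (g' ((h' \o h) y)) by rewrite /= gh'.
have [dc' _] := tangent_mx_comp dg' dg2.
exists (W `&` h @^-1` W'), (g \o g'); split=> //.
- rewrite openE => z [Wz Wz']; apply: filterI; first exact: near_open.
  by apply: ch; [exact: WD|exact: near_open].
- by move=> z [/WD Dz /WD' D'z].
by split=> // z [Wz Wz'] /=; rewrite gh' // gh.
Qed.

Lemma local_diff_inv D h g : local_diff D h -> (forall y, D y -> g (h y) = y) ->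
  local_diff (h @` D) g.
Proof.
move=> [oD oh dh] gh; have ohD : open (h @` D) by exact: oh.
split=> // [ O oO OD|_ [y Dy <-]].
  have -> : g @` O = D `&` h @^-1` O.
    apply/seteqP; split=> [_ [z Oz <-]|z [Dz Oz]].
      by have [z' Dz' zE] := OD z Oz; rewrite -zE gh //; split=> //=; rewrite zE.
    by exists (h z) => //; exact: gh.
  rewrite openE => y [Dy Oy]; apply: filterI; first exact: near_open.
  by apply: near_cont; [case: (dh y Dy) => -[]|exact: near_open].
have [d [W [g' [oW Wy WD [gh' dg]]]]] := dh y Dy.
have hWy : (h @` W) (h y) by exists y.
have ne : \forall z \near h y, g' z = g z.
  have := near_open (oh W oW WD) hWy; apply: filterS => _ [z Wz <-].
  by rewrite gh' // gh //; exact: WD.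
have [dg2 _] := tangent_mx_near_eq dg ne; split=> //.
exists (h @` D), h; split; [exact: ohD|by exists y|by []|].
split=> [_ [z Dz <-]|]; first by rewrite (gh z Dz).
by rewrite (gh y Dy).
Qed.

Lemma local_diff_glue (K : Type) (D : K -> set T0) (hK : K -> T0 -> T0) h :
  (forall k, local_diff (D k) (hK k)) -> (forall k y, D k y -> h y = hK k y) ->
  local_diff (\bigcup_k D k) h.
Proof.
move=> ld hE; split.
- by apply: bigcup_open => k _; case: (ld k).
- move=> O oO OD; rewrite openE => _ [y Oy <-]; have [k _ Dy] := OD y Oy.
  have [oDk ohk _] := ld k.
  have o1 : open (hK k @` (O `&` D k)) by apply: ohk => [|z []//]; exact: openI.
  have o2 : (hK k @` (O `&` D k)) (h y) by exists y => //; rewrite (hE k).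
  have := near_open o1 o2; apply: filterS => _ [z [Oz Dz] <-].
  by exists z => //; rewrite (hE k).
move=> y [k _ Dy]; have [oDk ohk dk] := ld k.
have [d [W [g [oW Wy WD [gh dg]]]]] := dk y Dy.
have ne : \forall z \near y, hK k z = h z.
  by have := near_open oDk Dy; apply: filterS => z Dz; rewrite (hE k).
have [dh _] := tangent_mx_near_eq d ne; split=> //.
exists W, g; split=> //; first by move=> z /WD Dz; exists k.
split; last by rewrite (hE k).
by move=> z Wz; rewrite (hE k) ?gh //; exact: WD.
Qed.

Lemma holonomy_local_diff i j D h : holonomy (F := F) i j D h -> local_diff D h.
Proof.
elim=> {i j D h}.
- move=> i j; apply: local_diffeo_local_diff; last exact: fgamma_diffeo.
  apply: (submersion_open (fsub_submersion i)); last by move=> z [].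
  exact: fopenI_open.
- by move=> i; apply: local_diff_id; exact: transv_open.
- by move=> i j D D' h _ ld oD' D'D; exact: local_diff_restrict ld oD' D'D.
- by move=> i j k D D' h h' _ ld _ ld'; exact: local_diff_comp.
- by move=> i j D h g _ ld gh; exact: local_diff_inv.
by move=> i j K D hK h _ ld hE _; exact: (local_diff_glue ld hE).
Qed.

Lemma local_diff_unit D h y : local_diff D h -> D y -> tangent_mx h y \in unitmx.
Proof.
move=> [oD oh dh] Dy; have [d [W [g [oW Wy WD [gh dg]]]]] := dh y Dy.
have [dc e] := tangent_mx_comp d dg.
have ne : \forall z \near y, (g \o h) z = id z.
  by have := near_open oW Wy; apply: filterS => z Wz /=; rewrite gh.
have [_ e'] := tangent_mx_near_eq dc ne; have [_ e2] := tangent_mx_id y.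
have k : tangent_mx h y *m tangent_mx g (h y) = 1%:M by rewrite -e e' e2.
by have [u _] := mulmx1_unit k; exact: u.
Qed.

Lemma local_diff_inv_tangent D h g y : local_diff D h -> (forall y, D y -> g (h y) = y) ->
  D y -> tangent_mx g (h y) *m tangent_mx h y = 1%:M.
Proof.
move=> ld gh Dy; have [oD oh dh] := ld; have [d _] := dh y Dy.
have [ohD _ dg] := local_diff_inv ld gh.
have hDy : (h @` D) (h y) by exists y.
have [dgy _] := dg _ hDy.
have d' : diff_map_at h (g (h y)) by rewrite gh.
have [dc e] := tangent_mx_comp dgy d'; rewrite (gh y Dy) in e.
have ne : \forall z \near h y, (h \o g) z = id z.
  by have := near_open ohD hDy; apply: filterS => _ [z Dz <-] /=; rewrite gh.
have [_ e'] := tangent_mx_near_eq dc ne; have [_ e2] := tangent_mx_id (h y).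
exact: etrans (esym e) (etrans e' e2).
Qed.

Lemma form_pullback_fgamma (s : T0 -> ext R m) i j x : fopen i x -> fopen j x ->
  form_pullback (f i) (form_pullback (@fgamma _ _ _ _ _ F i j) s) x = form_pullback (f j) s x.
Proof.
move=> ix jx; apply: etrans (esym (pullback_mulmx _ _ _)) _.
rewrite -[_ *m _](tangent_fgamma ix jx); apply: congr1.
by rewrite -(fgammaE ix jx).
Qed.

(** On a generator, both sides have the same pullback to M, and pullback by a submersion is
    injective. The other ways to build holonomy maps follow from the chain rule. *)
Lemma corresponds_invariant (w : M -> ext R n) t : corresponds w t -> invariant_form (F := F) t.
Proof.
move=> c i j D h; elim=> {i j D h}.
- move=> i j _ [x [ix jx] <-]; apply: (pullback_inj (fsub_full ix)).
  exact: etrans (form_pullback_fgamma _ ix jx) (etrans (esym (c j x jx)) (c i x ix)).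
- by move=> i y _; have [_ e] := tangent_mx_id y; rewrite /form_pullback e pullback1.
- by move=> i j D D' h _ IH _ D'D y D'y; apply: IH; exact: D'D.
- move=> i j k D D' h h' H IH H' IH' y [Dy D'y].
  have [_ _ dh] := holonomy_local_diff H; have [_ _ dh'] := holonomy_local_diff H'.
  have [d _] := dh y Dy; have [d' _] := dh' (h y) D'y.
  have [_ e] := tangent_mx_comp d d'.
  rewrite /form_pullback e pullback_mulmx.
  have e1 := IH' _ D'y; have e2 := IH _ Dy.
  by rewrite /form_pullback in e1 e2; rewrite -[RHS]e2 -e1.
- move=> i j D h g H IH gh _ [y Dy <-].
  rewrite /form_pullback (gh y Dy) -(IH y Dy) /form_pullback -pullback_mulmx.
  by rewrite (local_diff_inv_tangent (holonomy_local_diff H) gh Dy) pullback1.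
move=> i j K D hK h H IH hE _ y [k _ Dy].
have [oD _ dh] := holonomy_local_diff (H k); have [d _] := dh y Dy.
have ne : \forall z \near y, hK k z = h z.
  by have := near_open oD Dy; apply: filterS => z Dz; rewrite (hE k).
have [_ e] := tangent_mx_near_eq d ne.
by rewrite -(IH k y Dy) /form_pullback e (hE k).
Qed.

(** Each point of M uses one index whose open set contains it; compatibility under the transition
    maps makes the value independent of this choice. *)
Lemma form_of_transverse t : (forall i j x, fopen i x -> fopen j x ->
    form_pullback (@fgamma _ _ _ _ _ F i j) (t j) (f i x) = t i (f i x)) ->
  exists w : M -> ext R n, corresponds w t.
Proof.
move=> ht; have /choice[i0 i0P] := fopen_cover F.
exists (fun x => form_pullback (f (i0 x)) (t (i0 x)) x) => i x ix.
apply: etrans (form_pullback_fgamma _ (i0P x) ix).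
by rewrite /form_pullback -(ht _ _ _ (i0P x) ix).
Qed.

End Holonomy.

(** * The decomposition of basic forms *)

Section ExtConj.
Variables (R : realType) (m : nat).
Local Notation C := R[i].
Implicit Types (w u : ext R m).

Definition extconj w : ext R m := [ffun S => conjc (w S)].

Lemma extconjE w S : extconj w S = conjc (w S).
Proof. exact: ffunE. Qed.

Lemma extconjK : involutive extconj.
Proof. by move=> w; apply: extP => S; rewrite !extconjE conjcK. Qed.

Lemma extconjD u w : extconj (u + w) = extconj u + extconj w.
Proof. by apply: extP => S; rewrite extDE !extconjE extDE rmorphD. Qed.

Lemma extconjZ (c : C) w : extconj (c *: w) = conjc c *: extconj w.
Proof. by apply: extP => S; rewrite extZE !extconjE extZE rmorphM. Qed.

Lemma extconj0 : extconj 0 = 0.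
Proof. by apply: extP => S; rewrite extconjE ext0E rmorph0. Qed.

Lemma extconj_sum (I : Type) (r : seq I) (P : pred I) (G : I -> ext R m) :
  extconj (\sum_(i <- r | P i) G i) = \sum_(i <- r | P i) extconj (G i).
Proof. exact: (big_morph _ extconjD extconj0). Qed.

Lemma extconj_ext1 : extconj ext1 = ext1.
Proof. by apply: extP => S; rewrite extconjE !ffunE rmorph_nat. Qed.

Lemma conjc_sign i (S : {set 'I_m}) : conjc (ext_sign R i S) = ext_sign R i S.
Proof. by rewrite /ext_sign rmorph_sign. Qed.

Lemma conjcM (a b : C) : conjc (a * b) = conjc a * conjc b.
Proof. exact: rmorphM. Qed.

Lemma extconj_contr i w : extconj (contr i w) = contr i (extconj w).
Proof.
apply: extP => S; rewrite extconjE [contr i w S]ffunE [RHS]ffunE.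
case: ifP => _; first exact: conjc0.
by rewrite conjcM conjc_sign extconjE.
Qed.

Lemma extconj_ewedge i w : extconj (ewedge i w) = ewedge i (extconj w).
Proof.
apply: extP => S; rewrite extconjE [ewedge i w S]ffunE [RHS]ffunE.
case: ifP => _; last exact: conjc0.
by rewrite conjcM conjc_sign extconjE.
Qed.

Lemma extconj_iprod (X : 'rV[C]_m) w :
  extconj (iprod X w) = iprod (map_mx (@conjc R) X) (extconj w).
Proof.
rewrite !iprodE extconj_sum; apply: eq_bigr => i _.
by rewrite extconjZ extconj_contr mxE.
Qed.

Lemma extconj_wedge1 (a : 'rV[C]_m) w :
  extconj (wedge1 a w) = wedge1 (map_mx (@conjc R) a) (extconj w).
Proof.
rewrite !wedge1E extconj_sum; apply: eq_bigr => i _.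
by rewrite extconjZ extconj_ewedge mxE.
Qed.

Lemma extconj_cl (v : 'rV[C]_(m + m)) w :
  extconj (cl v w) = cl (map_mx (@conjc R) v) (extconj w).
Proof.
rewrite !cl.unlock /clifford extconjD extconj_iprod extconj_wedge1.
by rewrite map_lsubmx map_rsubmx.
Qed.

Lemma extconj_spinop (J : 'M[R]_(m + m)) w :
  extconj (spinop (toC J) w) = spinop (toC J) (extconj w).
Proof.
rewrite !spinop.unlock extconjZ extconj_sum fmorphV rmorph_nat; congr (_ *: _).
apply: eq_bigr => a _; rewrite !extconj_cl !map_row conj_toC.
by rewrite -toC_swapR conj_toC.
Qed.

End ExtConj.

Lemma extconj_pullback (R : realType) n m (A : 'M[R]_(n, m)) w :
  extconj (pullback A w) = pullback A (extconj w).
Proof.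
elim/ext_ind: w => [u w IHu IHw|c w IH||j w IH].
- by rewrite extconjD !pullbackD extconjD IHu IHw.
- by rewrite extconjZ !pullbackZ extconjZ IH.
- by rewrite extconj_ext1 !pullback_ext1 extconj_ext1.
rewrite extconj_ewedge -!wedge1_delta !pullback_wedge1 extconj_wedge1 IH.
by rewrite conj_mulmx -!map_trmx conj_toC map_delta_mx.
Qed.

Section ConjCalculus.
Variables (R : realType) (n : nat).
Implicit Types (W : set 'rV[R]_n).

Lemma csmooth_conj W (g : 'rV[R]_n -> R[i]) : open W -> csmooth W g ->
  csmooth W (fun u => conjc (g u)).
Proof.
move=> oW [sr si]; split.
  by apply: (smooth_on_ext sr oW) => u _; case: (g u).
by apply: (smooth_on_ext (smooth_onN oW si) oW) => u _; case: (g u).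
Qed.

Lemma cpd_conj i (g : 'rV[R]_n -> R[i]) u : cdiff g u ->
  cpd i (fun v => conjc (g v)) u = conjc (cpd i g u).
Proof.
move=> [dr di]; apply: complex_eq.
  by apply: pderiv_ext => v; case: (g v).
rewrite [LHS](@pderiv_ext _ _ i _ (fun v => 0 - complex.Im (g v))); last first.
  by move=> v; rewrite sub0r; case: (g v).
by rewrite (pderivB i (differentiable_cst (0 : R) u) di) pderiv_cst sub0r.
Qed.

Lemma esmooth_conj m W (g : 'rV[R]_n -> ext R m) : open W -> esmooth W g ->
  esmooth W (fun u => extconj (g u)).
Proof.
move=> oW sg S; apply: (csmooth_ext (csmooth_conj oW (sg S)) oW) => u _.
by rewrite extconjE.
Qed.

Lemma epd_conj m i (g : 'rV[R]_n -> ext R m) u : ediff g u ->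
  epd i (fun v => extconj (g v)) u = extconj (epd i g u).
Proof.
move=> dg; apply: extP => S; rewrite extconjE !epdE -(cpd_conj i (dg S)).
by apply: cpd_ext => v; rewrite extconjE.
Qed.

Lemma d_coord_conj (g : 'rV[R]_n -> ext R n) u : ediff g u ->
  d_coord (fun v => extconj (g v)) u = extconj (d_coord g u).
Proof.
move=> dg; rewrite !d_coordE extconj_sum; apply: eq_bigr => i _.
by rewrite (epd_conj i dg) extconj_wedge1 map_delta_mx.
Qed.

End ConjCalculus.

Section ConjForms.
Variables (R : realType) (n : nat) (X : manifold R n).
Implicit Types (w : X -> ext R n).

Definition formconj w : X -> ext R n := fun x => extconj (w x).

Lemma form_rep_conj x w u : form_rep x (formconj w) u = extconj (form_rep x w u).
Proof. by rewrite /form_rep extconj_pullback. Qed.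

Lemma smooth_form_conj (O : set X) w : open O -> smooth_form_on O w ->
  smooth_form_on O (formconj w).
Proof.
move=> oO /smooth_formP sw; apply/smooth_formP => x; have oE := chart_img_open oO x.
by apply: (esmooth_ext (esmooth_conj oE (sw x)) oE) => u _; rewrite form_rep_conj.
Qed.

Lemma ext_d_conj (O : set X) w x : O x -> smooth_form_on O w ->
  ext_d (formconj w) x = extconj (ext_d w x).
Proof.
move=> Ox sw; rewrite /ext_d -(d_coord_conj (ediff_form_rep Ox sw)).
suff -> : form_rep x (formconj w) = fun u => extconj (form_rep x w u) by [].
by apply/funext => u; exact: form_rep_conj.
Qed.

End ConjForms.

Section EigenQuadratic.
Variables (R : realType) (V : lmodType R[i]) (T : V -> V) (s : seq int).
Local Notation C := R[i].
Hypotheses (Tl : linear T) (us : uniq s).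
Let lam (k : int) : C := 'i%C * k%:~R.

(** The two equations say that (f^2 + 1)^2 kills [u]. On the component of index [k], f is
    multiplication by i (k - j), so f^2 + 1 is 1 - (k - j)^2, which vanishes only for k = j + 1 and
    k = j - 1. *)
Lemma eigen_quadratic (j : int) (c : int -> V) p :
  (forall k, T (c k) = lam k *: c k) ->
  let f x := T x - lam j *: x in let u := \sum_(k <- s) c k in
  f (f u) + u = p -> f (f p) = - p ->
  forall k, k \in s -> k != j + 1 -> k != j - 1 -> c k = 0.
Proof.
move=> Tc f u up pp k ks kj1 kj2.
have TZ := linear_scale Tl.
have TD x y : T (x + y) = T x + T y by have := Tl 1 x y; rewrite !scale1r.
have T0 : T 0 = 0 by have := TZ 0 0; rewrite !scale0r.
have fsum (b : int -> V) : (forall k, T (b k) = lam k *: b k) ->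
    f (\sum_(k <- s) b k) = \sum_(k <- s) (lam k - lam j) *: b k.
  move=> Tb; rewrite /f (big_morph T TD T0) scaler_sumr -sumrB.
  by apply: eq_bigr => l _; rewrite Tb scalerBl.
have quad (b : int -> V) : (forall k, T (b k) = lam k *: b k) ->
    f (f (\sum_(k <- s) b k)) + \sum_(k <- s) b k
    = \sum_(k <- s) ((lam k - lam j) ^+ 2 + 1) *: b k.
  move=> Tb; rewrite fsum // fsum; last by move=> l; rewrite TZ Tb !scalerA mulrC.
  rewrite -big_split; apply: eq_bigr => l _ /=.
  by rewrite scalerA -expr2 scalerDl scale1r.
pose N l : C := (lam l - lam j) ^+ 2 + 1.
(* f^2 + 1 applied twice: the first time gives [p], the second time 0. *)
pose b l := N l *: (N l *: c l).
have TN (x : int -> V) : (forall l, T (x l) = lam l *: x l) ->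
    forall l, T (N l *: x l) = lam l *: (N l *: x l).
  by move=> Tx l; rewrite TZ Tx !scalerA mulrC.
have b0 : \sum_(l <- s) b l = 0.
  rewrite -(quad (fun l => N l *: c l)); last exact: TN.
  by rewrite -(quad c Tc) up pp addNr.
have lam_inj : injective lam by exact: Ci_int_inj.
have := eigproj_sum Tl lam_inj us ks (TN _ (TN _ Tc)).
rewrite -/b b0 (eigproj0 lam Tl) => /esym/eqP.
rewrite scalerA scaler_eq0 mulf_eq0 orbb => /orP[|/eqP //].
have -> : N k = (1 - (k - j) ^+ 2)%:~R.
  rewrite /N /lam -mulrBr exprMn (expr2 'i%C) mul_Ci mulN1r -rmorphB -rmorphXn.
  by rewrite addrC rmorphB.
rewrite intr_eq0 subr_eq0 => /eqP e; exfalso.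
move: kj1 kj2 e; rewrite expr2; move=> /eqP h1 /eqP h2 e.
have : (k - j - 1) * (k - j + 1) = 0 by rewrite mulrDr mulrBl; lia.
by move/eqP; rewrite mulf_eq0 => /orP[] /eqP; lia.
Qed.

End EigenQuadratic.

Lemma eigproj_pullback (R : realType) (V W : lmodType R[i]) (I : eqType) (lam : I -> R[i])
    (T : V -> V) (T' : W -> W) (P : W -> V) s j w :
  linear P -> (forall u, T (P u) = P (T' u)) ->
  eigproj T lam s j (P w) = P (eigproj T' lam s j w).
Proof.
move=> Pl TP; have PZ := linear_scale Pl; rewrite /eigproj.
elim: [seq l <- s | l != j] => //= l r ->.
have PB a (x y : W) : P (x - a *: y) = P x - a *: P y.
  by rewrite [x - _]addrC -scaleNr Pl scaleNr addrC.
by rewrite PZ PB TP.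
Qed.

(** * Basic sections of the eigenbundles *)

Section BasicU.
Variables (R : realType) (n q : nat) (M : manifold R n).
Variables (T0 : manifold R (2 * q)) (F : foliation M T0).
Variables (J : transverse_gen_complex F).
Variable Phi : fidx F -> T0 -> set (ext R (2 * q)).
Hypothesis hPhi : is_spinor_line J Phi.
Local Notation C := R[i].
Local Notation f := (@fsub _ _ _ _ _ F).
Local Notation E i y := (spinop (toC (J i y))).
Implicit Types (w : M -> ext R n) (t : fidx F -> T0 -> ext R (2 * q)) (i : fidx F) (j k : int).

Definition lam (k : int) : C := 'i%C * k%:~R.

Lemma lam_inj : injective lam.
Proof. exact: Ci_int_inj. Qed.

Definition degrees : seq int := [seq a%:Z - q%:Z | a <- iota 0 (2 * q).+1].

Lemma degrees_uniq : uniq degrees.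
Proof. by rewrite map_inj_uniq ?iota_uniq // => a b; lia. Qed.

Lemma mem_degrees k : (k \in degrees) = (`|k| <= q%:Z)%R.
Proof.
apply/mapP/idP => [[a]|kq]; first by rewrite mem_iota; lia.
by exists `|(k + q%:Z)%R|%N; [rewrite mem_iota|]; lia.
Qed.

Lemma sum_degrees (V : nmodType) (c : int -> V) :
  \sum_(k <- degrees) c k = \sum_(a < (2 * q).+1) c (a%:Z - q%:Z).
Proof. by rewrite big_map -[iota _ _]/(index_iota 0 (2 * q).+1) big_mkord. Qed.

Lemma sumUE (c : int -> M -> ext R n) : sumU q c = \sum_(k <- degrees) c k.
Proof. by rewrite sum_degrees. Qed.

Section Fibre.
Variables (i : fidx F) (y : T0).
Hypothesis iy : transv i y.

Let so : so_mx (toC (J i y)).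
Proof.
have [_ J2 orth _] := tgc_gen_complex J i.
exact: so_toC (orthogonal_so (J2 y iy) (orth y iy)).
Qed.

Let J2 : toC (J i y) *m toC (J i y) = - 1%:M.
Proof.
have [_ J2 _ _] := tgc_gen_complex J i.
by rewrite -toCM J2 // map_mxN map_mx1.
Qed.

Let line : exists s, [/\ s <> 0, Phi i y = [set c *: s | c in [set: C]] &
  i_eigenspace (J i y) = [set v | forall phi, Phi i y phi -> clifford v phi = 0]].
Proof.
have [lb LE] := hPhi i; have [W [s [oW Wy _ sP]]] := lb y iy.
have [s0 PE] := sP y (conj Wy iy); exists (s y); split=> //.
exact: LE.
Qed.

Lemma Ufiber_eigen j x : Ufiber (J i y) (Phi i y) j x <-> E i y x = lam j *: x.
Proof. by have [s [s0 PE LE]] := line; rewrite (Ufiber_spinop so J2 s0 PE LE). Qed.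

Lemma eigen_out j x : j \notin degrees -> E i y x = lam j *: x -> x = 0.
Proof. by rewrite mem_degrees => /negPf jq /Ufiber_eigen; rewrite /Ufiber jq. Qed.

Lemma eigen_decomposition x : exists2 c : int -> ext R (2 * q),
  forall k, E i y (c k) = lam k *: c k & x = \sum_(k <- degrees) c k.
Proof.
have [s [s0 PE LE]] := line.
have [c [cL ->]] := spinor_decomposition so J2 s0 PE LE x.
exists (fun k => if k \in degrees then c `|(q%:Z - k)%R|%N else 0) => [k|].
  case: ifP => [kd|_]; last by rewrite (linear0 (spinop (toC (J i y)))) scaler0.
  rewrite (lev_eigen so J2 LE (cL _)) /lam; congr (('i%C * _%:~R) *: _).
  by move: kd; rewrite mem_degrees; lia.
rewrite sum_degrees (reindex_inj rev_ord_inj); apply: eq_bigr => a _ /=.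
have aq := ltn_ord a; rewrite mem_degrees ifT; last by lia.
by congr (c _); lia.
Qed.

Definition proj j (x : ext R (2 * q)) := eigproj (spinop (toC (J i y))) lam degrees j x.

Lemma proj_sum j (c : int -> ext R (2 * q)) : j \in degrees ->
  (forall k, E i y (c k) = lam k *: c k) -> proj j (\sum_(k <- degrees) c k) = c j.
Proof. exact: (eigproj_sum (@spinop_linear _ _ _) lam_inj degrees_uniq). Qed.

Lemma proj_eigen j x : j \in degrees -> E i y (proj j x) = lam j *: proj j x.
Proof.
by move=> jd; have [c cE ->] := eigen_decomposition x; rewrite (proj_sum jd cE) cE.
Qed.

Lemma sum_proj x : \sum_(j <- degrees) proj j x = x.
Proof.
have [c cE xE] := eigen_decomposition x; rewrite [RHS]xE big_seq [RHS]big_seq.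
by apply: eq_bigr => j jd; rewrite xE (proj_sum jd cE).
Qed.

End Fibre.

(** A family that corresponds to a form on M is automatically invariant, so U^j is tested by
    smoothness and an eigenvalue equation alone. *)
Lemma basicUP j w : basicU J Phi j w <-> basic_form F w /\ exists t,
  [/\ forall i, smooth_form_on (transv i) (t i), corresponds w t &
      forall i y, transv i y -> E i y (t i y) = lam j *: t i y].
Proof.
split=> [[bw [t [st it Ut ct]]]|[bw [t [st ct Et]]]]; split=> //; exists t; split=> //.
- by move=> i y iy; apply/(Ufiber_eigen iy); exact: Ut.
- exact: corresponds_invariant ct.
- by move=> i y iy; apply/(Ufiber_eigen iy); exact: Et.
Qed.

Lemma basicU_basic j w : basicU J Phi j w -> basic_form F w.
Proof. by case. Qed.

Lemma basicU_intro j w t : (forall i, smooth_form_on (transv i) (t i)) -> corresponds w t ->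
  (forall i y, transv i y -> E i y (t i y) = lam j *: t i y) -> basicU J Phi j w.
Proof.
move=> st ct Et; apply/basicUP; split; last by exists t.
by have [] := corresponds_basic st ct.
Qed.

Lemma basicUD j w w' : basicU J Phi j w -> basicU J Phi j w' -> basicU J Phi j (w + w').
Proof.
move=> /basicUP[_ [t [st ct Et]]] /basicUP[_ [t' [st' ct' Et']]].
apply: (@basicU_intro _ _ (fun i => t i + t' i)) => [i|i x ix|i y iy].
- by apply: smooth_formD; [exact: transv_open|exact: st|exact: st'].
- apply: etrans (congr2 +%R (ct i x ix) (ct' i x ix)) _.
  exact: esym (pullbackD _ _ _).
rewrite -[(t i + t' i) y]/(t i y + t' i y) spinopD scalerDr.
exact: (congr2 +%R (Et i y iy) (Et' i y iy)).
Qed.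

Lemma basicUZ j (a : C) w : basicU J Phi j w -> basicU J Phi j (a *: w).
Proof.
move=> /basicUP[_ [t [st ct Et]]].
apply: (@basicU_intro _ _ (fun i => a *: t i)) => [i|i x ix|i y iy].
- by apply: smooth_formZ; [exact: transv_open|exact: st].
- apply: etrans (congr1 (fun z => a *: z) (ct i x ix)) _.
  exact: esym (pullbackZ _ _ _).
rewrite -[(a *: t i) y]/(a *: t i y) spinopZ (Et i y iy).
by rewrite !scalerA mulrC.
Qed.

Lemma basicU0 j : basicU J Phi j 0.
Proof.
apply: (@basicU_intro _ _ (fun i => 0)) => [i|i x ix|i y iy].
- exact: smooth_form0.
- exact: esym (pullback0 _).
by rewrite -[(0 : T0 -> ext R (2 * q)) y]/(0 : ext R (2 * q)) linear0 scaler0.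
Qed.

Lemma basicU_out j w : j \notin degrees -> basicU J Phi j w -> w = 0.
Proof.
move=> jd /basicUP[_ [t [_ ct Et]]]; apply/funext => x; have [i ix] := fopen_cover F x.
have iy : transv i (f i x) by exists x.
rewrite (ct i x ix) /form_pullback (eigen_out iy jd (Et i _ iy)).
exact: pullback0.
Qed.

(** The spin action of a real [J] commutes with conjugation, which changes the eigenvalue i j into
    its conjugate -i j. *)
Lemma basicU_conj j w : basicU J Phi j w -> basicU J Phi (- j) (formconj w).
Proof.
move=> /basicUP[_ [t [st ct Et]]].
apply: (@basicU_intro _ _ (fun i => formconj (t i))) => [i|i x ix|i y iy].
- by apply: smooth_form_conj; [exact: transv_open|exact: st].
- by rewrite /formconj (ct i x ix); exact: extconj_pullback.
rewrite /formconj -extconj_spinop (Et i y iy) extconjZ; congr (_ *: _).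
by rewrite /lam conjcM conjC_i mulNr -mulrN rmorphN; congr (_ * - _); exact: rmorph_int.
Qed.

Lemma basicU_unique (c : int -> M -> ext R n) : (forall j, basicU J Phi j (c j)) ->
  \sum_(k <- degrees) c k = 0 -> forall j, c j = 0.
Proof.
move=> cU c0 j; have [jd|jd] := boolP (j \in degrees); last exact: basicU_out jd (cU j).
have /choice[t tP] : forall k, exists t, [/\ forall i, smooth_form_on (transv i) (t i),
    corresponds (c k) t & forall i y, transv i y -> E i y (t i y) = lam k *: t i y].
  by move=> k; have /basicUP[] := cU k.
apply/funext => x; have [i ix] := fopen_cover F x.
have iy : transv i (f i x) by exists x.
have s0 : \sum_(k <- degrees) t k i (f i x) = 0.
  apply: (pullback_inj (fsub_full ix)); rewrite pullback0 pullback_sum.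
  have := congr1 (fun w : M -> ext R n => w x) c0; rewrite fct_sumE => e.
  apply: etrans e; apply: eq_bigr => k _; have [_ ck _] := tP k.
  by rewrite (ck i x ix).
have tE k : E i (f i x) (t k i (f i x)) = lam k *: t k i (f i x).
  by have [_ _ Ek] := tP k; exact: Ek.
have e := proj_sum jd tE.
rewrite s0 /proj eigproj0 in e; last exact: spinop_linear.
by have [_ cj _] := tP j; rewrite (cj i x ix) /form_pullback -e; exact: pullback0.
Qed.

(** The components of the transverse form are polynomials in the spin action with constant
    coefficients: this keeps them smooth, and since [J] is invariant they stay compatible with the
    transition maps, so they come from forms on M. *)
Lemma basicU_decomposition w : basic_form F w -> exists2 c : int -> M -> ext R n,
  forall j, basicU J Phi j (c j) & w = \sum_(k <- degrees) c k.
Proof.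
move=> bw; have [t st ct] := basic_form_descends bw.
have inv := corresponds_invariant ct.
pose tc k i y := @proj i y k (t i y).
have stc k i : smooth_form_on (transv i) (tc k i).
  apply: (smooth_eigproj (W := transv i) (transv_open i) (tgc_gen_complex J i)).
  exact: st.
have tcw k : exists wk : M -> ext R n, corresponds wk (tc k).
  apply: form_of_transverse => i i' x ix ix'; rewrite /form_pullback /tc /proj.
  set y := f i x; set h := @fgamma _ _ _ _ _ F i i'.
  have yD : (f i @` (fopen i `&` fopen i')) y by exists x.
  have hg := @hol_gamma _ _ _ _ _ F i i'.
  have u : tangent_mx h y \in unitmx by exact: local_diff_unit (holonomy_local_diff hg) yD.
  have <- : pullback (tangent_mx h y) (t i' (h y)) = t i y by exact: inv hg y yD.
  apply/esym/eigproj_pullback; first exact: pullback_linear.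
  move=> v; apply: spinop_pullback; first exact: u.
  have e : J i y *m gen_tangent_mx (tangent_mx h y) = gen_tangent_mx (tangent_mx h y) *m J i' (h y).
    exact: (@tgc_invariant _ _ _ _ _ _ J i i' _ _ hg y yD).
  by rewrite -[LHS]toCM -[RHS]toCM e.
have /choice[c cP] := tcw.
(* Outside [degrees] the interpolation polynomial does not project onto an eigenspace, so 0 is used
   there. *)
exists (fun k => if k \in degrees then c k else 0) => [j|].
  case: ifP => jd; last exact: basicU0.
  apply: (basicU_intro (stc j) (cP j)) => i y iy.
  exact: proj_eigen.
apply/funext => x; have [i ix] := fopen_cover F x.
have iy : transv i (f i x) by exists x.
rewrite fct_sumE (ct i x ix) /form_pullback -(sum_proj iy (t i (f i x))) pullback_sum.
rewrite big_seq [RHS]big_seq; apply: eq_bigr => k kd; rewrite kd.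
by rewrite (cP k i x ix).
Qed.

Lemma basicU_d_degree j w (c : int -> M -> ext R n) : basicU J Phi j w ->
  (forall k, basicU J Phi k (c k)) -> ext_d w = \sum_(k <- degrees) c k ->
  forall k, k != j + 1 -> k != j - 1 -> c k = 0.
Proof.
move=> /basicUP[_ [t [st ct Et]]] cU dE k k1 k2.
have [kd|kd] := boolP (k \in degrees); last exact: basicU_out kd (cU k).
have [_ dt] := corresponds_basic st ct.
have /choice[s sP] : forall k, exists t, [/\ forall i, smooth_form_on (transv i) (t i),
    corresponds (c k) t & forall i y, transv i y -> E i y (t i y) = lam k *: t i y].
  by move=> l; have /basicUP[] := cU l.
apply/funext => x; have [i ix] := fopen_cover F x.
have iy : transv i (f i x) by exists x.
have sE : ext_d (t i) (f i x) = \sum_(l <- degrees) s l i (f i x).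
  apply: (pullback_inj (fsub_full ix)); rewrite pullback_sum.
  apply: etrans (esym (dt i x ix)) _; rewrite dE fct_sumE; apply: eq_bigr => l _.
  by have [_ cl _] := sP l; rewrite (cl i x ix).
have [p up pp] := ext_d_eigen (transv_open i) (tgc_gen_complex J i) (st i) (Et i) iy.
rewrite sE in up.
have sEl l : E i (f i x) (s l i (f i x)) = lam l *: s l i (f i x).
  by have [_ _ El] := sP l; exact: El.
have sk := eigen_quadratic (@spinop_linear _ _ (toC (J i (f i x)))) degrees_uniq
  sEl up pp kd k1 k2.
have [_ ck _] := sP k; rewrite (ck i x ix) /form_pullback sk.
exact: pullback0.
Qed.

End BasicU.

(** * The double complex *)

Section DoubleComplexTheorem.
Variables (R : realType) (V : lmodType R[i]) (q : nat).
Variables (A : set V) (B : int -> set V) (d cj : V -> V) (comp : V -> int -> V).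
Local Notation C := R[i].
Local Notation ds := (degrees q).
Implicit Types (x y w u v : V) (j k l : int) (c : int -> V).
Hypotheses (AD : forall x y, A x -> A y -> A (x + y)) (AZ : forall (a : C) x, A x -> A (a *: x)).
Hypotheses (BA : forall j x, B j x -> A x) (BD : forall j x y, B j x -> B j y -> B j (x + y)).
Hypotheses (BZ : forall j (a : C) x, B j x -> B j (a *: x)) (B0 : forall j, B j 0).
Hypothesis Bout : forall j x, j \notin ds -> B j x -> x = 0.
Hypothesis Buniq : forall c, (forall j, B j (c j)) -> \sum_(k <- ds) c k = 0 -> forall j, c j = 0.
Hypotheses (compB : forall w j, A w -> B j (comp w j)).
Hypothesis comp_sum : forall w, A w -> w = \sum_(k <- ds) comp w k.
Hypotheses (dA : forall w, A w -> A (d w)) (dZ : forall (a : C) w, A w -> d (a *: w) = a *: d w).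
Hypothesis dD : forall x y, A x -> A y -> d (x + y) = d x + d y.
Hypothesis dd : forall w, A w -> d (d w) = 0.
Hypothesis ddeg : forall j w k, B j w -> k != j + 1 -> k != j - 1 -> comp (d w) k = 0.
Hypotheses (cjB : forall j w, B j w -> B (- j) (cj w)) (cjD : {morph cj : x y / x + y}).
Hypotheses (cjK : involutive cj) (cjd : forall w, A w -> d (cj w) = cj (d w)).

(** Here [A] stands for the basic forms, [B j] for the basic sections of U^j and [cj] for
    conjugation; [d_up], [d_down] and [d_twist] are then del, delbar and d^J. *)
Definition d_up w : V := \sum_(k <- ds) comp (d (comp w k)) (k + 1).
Definition d_down w : V := \sum_(k <- ds) comp (d (comp w k)) (k - 1).
Definition d_twist w : V := 'i%C *: (d_down w - d_up w).

Let A0 : A 0. Proof. exact: BA (B0 0). Qed.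

Let AN x : A x -> A (- x). Proof. by move=> Ax; rewrite -scaleN1r; exact: AZ. Qed.

Let AB x y : A x -> A y -> A (x - y). Proof. by move=> Ax Ay; apply: AD => //; exact: AN. Qed.

Let BN j x : B j x -> B j (- x). Proof. by move=> Bx; rewrite -scaleN1r; exact: BZ. Qed.

Let A_sum (I : Type) (s : seq I) (G : I -> V) : (forall i, A (G i)) -> A (\sum_(i <- s) G i).
Proof. by move=> AG; apply: (big_ind A). Qed.

Let comp_uniq c : (forall j, B j (c j)) -> comp (\sum_(k <- ds) c k) = c.
Proof.
move=> cB; have Ac : A (\sum_(k <- ds) c k) by apply: A_sum => k; exact: BA (cB k).
have h : \sum_(k <- ds) (comp (\sum_(k <- ds) c k) k - c k) = 0.
  by rewrite sumrB -comp_sum // subrr.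
apply/funext => j; apply/eqP; rewrite -subr_eq0; apply/eqP.
apply: (Buniq (c := fun j => comp (\sum_(k <- ds) c k) j - c j) _ h) => k.
by apply: BD; [exact: compB|exact: BN].
Qed.

Let compD x y j : A x -> A y -> comp (x + y) j = comp x j + comp y j.
Proof.
move=> Ax Ay; rewrite {1}(comp_sum Ax) {1}(comp_sum Ay) -big_split.
by rewrite (comp_uniq (c := fun j => comp x j + comp y j)) // => k; apply: BD; exact: compB.
Qed.

Let compZ (a : C) x j : A x -> comp (a *: x) j = a *: comp x j.
Proof.
move=> Ax; rewrite {1}(comp_sum Ax) scaler_sumr.
by rewrite (comp_uniq (c := fun j => a *: comp x j)) // => k; apply: BZ; exact: compB.
Qed.

Let comp0 j : comp 0 j = 0.
Proof. by rewrite -{1}(scale0r 0) compZ // scale0r. Qed.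

Let compN x j : A x -> comp (- x) j = - comp x j.
Proof. by move=> Ax; rewrite -scaleN1r compZ // scaleN1r. Qed.

Let comp_out w j : A w -> j \notin ds -> comp w j = 0.
Proof. by move=> Aw jd; apply: Bout jd _; exact: compB. Qed.

Let comp_B j w k : B j w -> comp w k = if k == j then w else 0.
Proof.
move=> Bw; have [jd|jd] := boolP (j \in ds); last first.
  by rewrite (Bout jd Bw) comp0; case: ifP.
have {1}-> : w = \sum_(k <- ds) (if k == j then w else 0).
  rewrite (bigD1_seq j) ?degrees_uniq //= eqxx big1 ?addr0 // => l.
  by move=> /negPf ->.
rewrite (comp_uniq (c := fun k => if k == j then w else 0)) // => l.
by case: eqP => [->|_] //; exact: B0.
Qed.

Let comp_eq x y : A x -> A y -> (forall k, comp x k = comp y k) -> x = y.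
Proof.
by move=> Ax Ay e; rewrite (comp_sum Ax) (comp_sum Ay); apply: eq_bigr => k _; rewrite e.
Qed.

Let A_ind (P : V -> Prop) : (forall x y, A x -> A y -> P x -> P y -> P (x + y)) ->
  (forall j w, B j w -> P w) -> forall w, A w -> P w.
Proof.
move=> PD PB w Aw; suff [] : P w /\ A w by [].
rewrite (comp_sum Aw); apply: (big_ind (fun w => P w /\ A w)).
- by split=> //; exact: PB (B0 0).
- by move=> x y [Px Ax] [Py Ay]; split; [exact: PD|exact: AD].
by move=> k _; split; [apply: PB|apply: BA]; exact: compB.
Qed.

Let d0 : d 0 = 0.
Proof. by rewrite -{1}(scale0r 0) dZ // scale0r. Qed.

Let dcompA w k : A w -> A (d (comp w k)).
Proof. by move=> Aw; apply: dA; apply: BA; exact: compB. Qed.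

Let op_B (h : int -> int) j w : B j w ->
  \sum_(k <- ds) comp (d (comp w k)) (h k) = comp (d w) (h j).
Proof.
move=> Bw; have [jd|jd] := boolP (j \in ds); last first.
  rewrite (Bout jd Bw) d0 comp0 big1 // => k _; by rewrite comp0 d0 comp0.
rewrite (bigD1_seq j) ?degrees_uniq //= (comp_B j Bw) eqxx big1 ?addr0 // => l /negPf lj.
by rewrite (comp_B l Bw) lj d0 comp0.
Qed.

Let del_B j w : B j w -> d_up w = comp (d w) (j + 1).
Proof. exact: (op_B (fun k => k + 1)). Qed.

Let delbar_B j w : B j w -> d_down w = comp (d w) (j - 1).
Proof. exact: (op_B (fun k => k - 1)). Qed.

Let delB j w : B j w -> B (j + 1) (d_up w).
Proof. by move=> Bw; rewrite (del_B Bw); apply: compB; apply: dA; exact: BA Bw. Qed.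

Let delbarB j w : B j w -> B (j - 1) (d_down w).
Proof. by move=> Bw; rewrite (delbar_B Bw); apply: compB; apply: dA; exact: BA Bw. Qed.

Let opA (h : int -> int) w : A w -> A (\sum_(k <- ds) comp (d (comp w k)) (h k)).
Proof. by move=> Aw; apply: A_sum => k; apply: BA; apply: compB; exact: dcompA. Qed.

Let delA w : A w -> A (d_up w). Proof. exact: opA. Qed.
Let delbarA w : A w -> A (d_down w). Proof. exact: opA. Qed.

Let opD (h : int -> int) x y : A x -> A y ->
  \sum_(k <- ds) comp (d (comp (x + y) k)) (h k) = \sum_(k <- ds) comp (d (comp x k)) (h k)
  + \sum_(k <- ds) comp (d (comp y k)) (h k).
Proof.
move=> Ax Ay; rewrite -big_split; apply: eq_bigr => k _ /=.
rewrite compD // dD; [|exact: BA (compB k Ax)|exact: BA (compB k Ay)].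
by rewrite compD //; exact: dcompA.
Qed.

Let delD x y : A x -> A y -> d_up (x + y) = d_up x + d_up y.
Proof. exact: opD. Qed.
Let delbarD x y : A x -> A y -> d_down (x + y) = d_down x + d_down y.
Proof. exact: opD. Qed.

Let opZ (h : int -> int) (a : C) x : A x ->
  \sum_(k <- ds) comp (d (comp (a *: x) k)) (h k) = a *: \sum_(k <- ds) comp (d (comp x k)) (h k).
Proof.
move=> Ax; rewrite scaler_sumr; apply: eq_bigr => k _ /=.
by rewrite compZ // dZ ?compZ //; [exact: dcompA|exact: BA (compB k Ax)].
Qed.

Let delZ (a : C) x : A x -> d_up (a *: x) = a *: d_up x.
Proof. exact: opZ. Qed.
Let delbarZ (a : C) x : A x -> d_down (a *: x) = a *: d_down x.
Proof. exact: opZ. Qed.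

Let del0 : d_up 0 = 0. Proof. by rewrite -{1}(scale0r 0) delZ // scale0r. Qed.
Let delbar0 : d_down 0 = 0. Proof. by rewrite -{1}(scale0r 0) delbarZ // scale0r. Qed.
Let delN x : A x -> d_up (- x) = - d_up x.
Proof. by move=> Ax; rewrite -scaleN1r delZ // scaleN1r. Qed.
Let delbarN x : A x -> d_down (- x) = - d_down x.
Proof. by move=> Ax; rewrite -scaleN1r delbarZ // scaleN1r. Qed.
Let dN x : A x -> d (- x) = - d x.
Proof. by move=> Ax; rewrite -scaleN1r dZ // scaleN1r. Qed.

Let d_E w : A w -> d w = d_up w + d_down w.
Proof.
move: w; apply: A_ind => [x y Ax Ay ex ey|j w Bw].
  by rewrite dD // ex ey delD // delbarD // addrACA.
have Aw := BA Bw; apply: comp_eq => [||k]; first exact: dA.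
  by apply: AD; [exact: delA|exact: delbarA].
rewrite compD; [|exact: delA|exact: delbarA].
rewrite (comp_B k (delB Bw)) (comp_B k (delbarB Bw)).
have [->|k1] := eqVneq k (j + 1).
  by rewrite (del_B Bw) ifF ?addr0 //; apply/eqP; lia.
have [->|k2] := eqVneq k (j - 1); first by rewrite (delbar_B Bw) add0r.
by rewrite (ddeg Bw) // addr0.
Qed.

(** The equation [d (d w) = 0] is read in degrees [j + 2], [j - 2] and [j]. *)
Let dd_B j w : B j w ->
  [/\ d_up (d_up w) = 0, d_down (d_down w) = 0 & d_up (d_down w) + d_down (d_up w) = 0].
Proof.
move=> Bw; have Aw := BA Bw; have b1 := delB Bw; have b2 := delbarB Bw.
have b11 := delB b1; have b12 := delbarB b1; have b21 := delB b2; have b22 := delbarB b2.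
have e : d (d w) = d_up (d_up w) + d_down (d_up w) + (d_up (d_down w) + d_down (d_down w)).
  rewrite (d_E Aw) dD; [|exact: delA|exact: delbarA].
  by rewrite !d_E //; [exact: delbarA|exact: delA].
rewrite dd // in e.
have a1 := BA b11; have a2 := BA b12; have a3 := BA b21; have a4 := BA b22.
have cE k : 0 = (if k == j + 2 then d_up (d_up w) else 0) + (if k == j then d_down (d_up w) else 0)
    + ((if k == j then d_up (d_down w) else 0) + (if k == j - 2 then d_down (d_down w) else 0)).
  apply: etrans (esym (comp0 k)) _; rewrite [in LHS]e !compD //; try exact: AD.
  rewrite (comp_B k b11) (comp_B k b12) (comp_B k b21) (comp_B k b22).
  have -> : j + 1 + 1 = j + 2 by lia.
  have -> : j + 1 - 1 = j by lia.
  have -> : j - 1 + 1 = j by lia.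
  by have -> : j - 1 - 1 = j - 2 by lia.
have h2 : (j + 2 == j) = false by apply/eqP; lia.
have h3 : (j + 2 == j - 2) = false by apply/eqP; lia.
have h4 : (j - 2 == j) = false by apply/eqP; lia.
have h5 : (j - 2 == j + 2) = false by apply/eqP; lia.
have h6 : (j == j + 2) = false by apply/eqP; lia.
have h7 : (j == j - 2) = false by apply/eqP; lia.
split.
- by have := cE (j + 2); rewrite eqxx h2 h3 !addr0.
- by have := cE (j - 2); rewrite eqxx h4 h5 !add0r.
- by have := cE j; rewrite eqxx h6 h7 add0r addr0 addrC.
Qed.

Let deldel w : A w -> d_up (d_up w) = 0.
Proof.
move: w; apply: A_ind => [x y Ax Ay ex ey|j w Bw]; last by case: (dd_B Bw).
by rewrite delD // delD ?ex ?ey ?addr0 //; exact: delA.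
Qed.

Let dbardbar w : A w -> d_down (d_down w) = 0.
Proof.
move: w; apply: A_ind => [x y Ax Ay ex ey|j w Bw]; last by case: (dd_B Bw).
by rewrite delbarD // delbarD ?ex ?ey ?addr0 //; exact: delbarA.
Qed.

Let anti w : A w -> d_down (d_up w) = - d_up (d_down w).
Proof.
move: w; apply: A_ind => [x y Ax Ay ex ey|j w Bw].
  rewrite (delD Ax Ay) (delbarD (delA Ax) (delA Ay)) (delbarD Ax Ay).
  by rewrite (delD (delbarA Ax) (delbarA Ay)) ex ey opprD.
by have [_ _ /eqP] := dd_B Bw; rewrite addrC addr_eq0 => /eqP.
Qed.

Let comp_del w l : A w -> comp (d_up w) l = d_up (comp w (l - 1)).
Proof.
move: w; apply: A_ind => [x y Ax Ay ex ey|j w Bw].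
  rewrite delD // !compD ?ex ?ey ?delD //; try exact: delA.
    exact: BA (compB _ Ax).
  exact: BA (compB _ Ay).
rewrite (comp_B l (delB Bw)) (comp_B (l - 1) Bw).
have -> : (l == j + 1) = (l - 1 == j) by apply/eqP/eqP; lia.
by case: ifP.
Qed.

Let comp_delbar w l : A w -> comp (d_down w) l = d_down (comp w (l + 1)).
Proof.
move: w; apply: A_ind => [x y Ax Ay ex ey|j w Bw].
  rewrite delbarD // !compD ?ex ?ey ?delbarD //; try exact: delbarA.
    exact: BA (compB _ Ax).
  exact: BA (compB _ Ay).
rewrite (comp_B l (delbarB Bw)) (comp_B (l + 1) Bw).
have -> : (l == j - 1) = (l + 1 == j) by apply/eqP/eqP; lia.
by case: ifP.
Qed.

Let dJA w : A w -> A (d_twist w).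
Proof. by move=> Aw; apply: AZ; apply: AB; [exact: delbarA|exact: delA]. Qed.

Let ddJE w : A w -> d (d_twist w) = (2 * 'i%C) *: d_up (d_down w).
Proof.
move=> Aw; have a1 := delA Aw; have a2 := delbarA Aw.
rewrite /d_twist dZ; last exact: AB.
rewrite dD //; last exact: AN.
rewrite dN // !d_E // deldel // dbardbar // anti // addr0 add0r opprK.
by rewrite -mulr2n -scaler_nat scalerA mulrC.
Qed.

Let dJdE w : A w -> d_twist (d w) = - d (d_twist w).
Proof.
move=> Aw; rewrite ddJE // /d_twist d_E // delD; [|exact: delA|exact: delbarA].
rewrite delbarD; [|exact: delA|exact: delbarA].
rewrite deldel // dbardbar // anti // addr0 add0r -opprD -mulr2n.
by rewrite scalerN -scaler_nat scalerA mulrC.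
Qed.

Let dJdJ w : A w -> d_twist (d_twist w) = 0.
Proof.
move=> Aw; have a1 := delA Aw; have a2 := delbarA Aw; have a3 := AB a2 a1.
rewrite {1}/d_twist /d_twist delZ // delbarZ // delD ?delbarD //; try exact: AN.
rewrite delN // delbarN // deldel // dbardbar // anti // add0r oppr0 addr0 opprK.
by rewrite -scalerBr subrr !scaler0.
Qed.

Let dJN w : A w -> d_twist (- w) = - d_twist w.
Proof. by move=> Aw; rewrite /d_twist delN // delbarN // -opprD scalerN. Qed.

Let dJD x y : A x -> A y -> d_twist (x + y) = d_twist x + d_twist y.
Proof.
by move=> Ax Ay; rewrite /d_twist delD // delbarD // opprD addrACA scalerDr.
Qed.

(** Closedness for both d and d^J amounts to closedness for del and delbar, and these shift the
    degree, so they can be tested on one component at a time. *)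
Let closed_comp w j : A w -> d w = 0 -> d_twist w = 0 ->
  d_up (comp w j) = 0 /\ d_down (comp w j) = 0.
Proof.
move=> Aw dw dJw; have /eqP := dJw; rewrite scaler_eq0 (negPf (Ci_neq0 _)) /= subr_eq0.
move=> /eqP e; have dw0 : d_up w = 0.
  move: dw; rewrite d_E // e -mulr2n -scaler_nat => /eqP.
  by rewrite scaler_eq0 pnatr_eq0 /= => /eqP.
split.
  have := comp_del (j + 1) Aw; rewrite dw0 comp0.
  by have -> : j + 1 - 1 = j by lia.
have := comp_delbar (j - 1) Aw; rewrite e dw0 comp0.
by have -> : j - 1 + 1 = j by lia.
Qed.

Let closed_B j w : B j w -> d w = 0 -> d_up w = 0 /\ d_down w = 0.
Proof. by move=> Bw dw; rewrite (del_B Bw) (delbar_B Bw) dw !comp0. Qed.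

Let comp_d w l : A w -> comp (d w) l = d_up (comp w (l - 1)) + d_down (comp w (l + 1)).
Proof.
move=> Aw; rewrite d_E // compD; [|exact: delA|exact: delbarA].
by rewrite comp_del // comp_delbar.
Qed.

Let cj0 : cj 0 = 0.
Proof. by have /(congr1 (fun z => z - cj 0)) := cjD 0 0; rewrite addr0 subrr addrK. Qed.

Let cjA w : A w -> A (cj w).
Proof.
move: w; apply: A_ind => [x y _ _ ax ay|j w Bw]; first by rewrite cjD; exact: AD.
exact: BA (cjB Bw).
Qed.

Let comp_cj w l : A w -> comp (cj w) l = cj (comp w (- l)).
Proof.
move: w; apply: A_ind => [x y Ax Ay ex ey|j w Bw].
  rewrite cjD !compD //; [|exact: cjA|exact: cjA].
  by rewrite ex ey cjD.
rewrite (comp_B l (cjB Bw)) (comp_B (- l) Bw).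
have -> : (l == - j) = (- l == j) by apply/eqP/eqP; lia.
by case: ifP.
Qed.

Let K a b := B (a - b).
Local Notation D := (tot_d d_up d_down).

(** Finite support is automatic: a nonzero entry needs [k - b - b] between [-q] and [q]. *)
Let totP k (x : int -> V) : tot K k x <-> forall b, B (k - b - b) (x b).
Proof.
split=> [[]//|xB]; split=> //.
pose N := (`|k| + q)%N.
apply: (@sub_finite_set _ _ [set b | b \in [seq a%:Z - N%:Z | a <- iota 0 (2 * N).+1]]).
  move=> b /= /eqP xb.
  change (is_true (b \in [seq a%:Z - N%:Z | a <- iota 0 (2 * N).+1])).
  apply/mapP; exists `|(b + N%:Z)%R|%N; last first.
    have : k - b - b \in ds by apply: contrapT => /negP kd; apply: xb; exact: Bout (xB b).
    by rewrite mem_degrees /N; lia.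
  have : k - b - b \in ds by apply: contrapT => /negP kd; apply: xb; exact: Bout (xB b).
  by rewrite mem_degrees mem_iota /N; lia.
exact: finite_seq.
Qed.

Let tot_dB k (x : int -> V) : tot K k x -> forall b, B (k + 1 - b - b) (D x b).
Proof.
move=> /totP xB b; apply: BD.
  have -> : k + 1 - b - b = k - b - b + 1 by lia.
  exact: delB.
have -> : k + 1 - b - b = k - (b - 1) - (b - 1) - 1 by lia.
exact: delbarB.
Qed.

Let totB k (x z : int -> V) : tot K k x -> tot K k z -> tot K k (fun b => x b - z b).
Proof. by move=> /totP xB /totP zB; apply/totP => b; apply: BD => //; exact: BN. Qed.

Let tot_d_sub k (x z : int -> V) b : tot K k x -> tot K k z ->
  D (fun b => x b - z b) b = D x b - D z b.
Proof.
move=> /totP xB /totP zB; rewrite /tot_d.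
have Ax b' := BA (xB b'); have Az b' := BA (zB b').
rewrite delD // ?delbarD //; try exact: AN.
by rewrite delN // delbarN // addrACA opprD.
Qed.

(** * From degeneration and decomposition to the dd^J-lemma *)

Section Degenerate.
Hypothesis deg : degenerates_at_first_page K d_up d_down.

(** Degeneration at page [r] writes [D x] as y + D z with y of filtration [p + r + 1] and z of
    filtration [p + 1]; subtracting z improves the filtration of the differential by one. *)
Let deg_step (r : nat) p k (x : int -> V) : (0 < r)%N -> tot K k x ->
  (forall b, b < p -> x b = 0) -> (forall b, b < p + r%:Z -> D x b = 0) ->
  exists z, [/\ tot K k z, forall b, b < p + 1 -> z b = 0 &
    forall b, b < p + r%:Z + 1 -> D (fun b => x b - z b) b = 0].
Proof.
move=> r0 tx xp Dxp.
have cx : ss_cycle K d_up d_down r p k x.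
  split; first by split.
  split; last exact: Dxp.
  by apply/totP; exact: tot_dB.
have [y [[ty yp] _] [z [[tz zp] _]] e] := deg r0 cx.
rewrite !addrK in tz zp; exists z; split=> // b bp.
rewrite (tot_d_sub b tx tz) -(congr1 (fun g => g b) e).
by rewrite -[(y + D z) b]/(y b + D z b) addrK yp.
Qed.

(* Degeneration lets one trade a cochain for one with the same differential and
   higher filtration, one page at a time. *)
Let strict_upto (N : nat) (r : nat) p k (x : int -> V) : (0 < r)%N -> tot K k x ->
  (forall b, b < p -> x b = 0) -> (forall b, b < p + r%:Z -> D x b = 0) ->
  exists z, [/\ tot K k z, forall b, b < p + 1 -> z b = 0 &
    forall b, b < p + (r + N)%:Z -> D (fun b => x b - z b) b = 0].
Proof.
move=> r0 tx xp Dxp; elim: N => [|N [z [tz zp Dz]]].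
  exists (fun=> 0); split=> // [|b bp]; first by apply/totP => b; exact: B0.
  rewrite -[RHS](Dxp b); last by move: bp; lia.
  by congr (D _ b); apply/funext => b'; rewrite subr0.
have [||||z' [tz' zp' Dz']] := @deg_step (r + N) p k (fun b => x b - z b).
- by rewrite addn_gt0 r0.
- exact: totB.
- by move=> b bp; rewrite xp // zp ?subr0 //; move: bp; lia.
- exact: Dz.
exists (fun b => z b + z' b); split=> [|b bp|b bp].
- move: tz tz' => /totP zB /totP zB'; apply/totP => b; exact: BD.
- by rewrite zp // zp' // addr0.
rewrite -[RHS](Dz' b); last by move: bp; lia.
by congr (D _ b); apply/funext => b'; rewrite opprD addrA.
Qed.

Let strict (r : nat) p k (x : int -> V) : (0 < r)%N -> tot K k x ->
  (forall b, b < p -> x b = 0) -> (forall b, b < p + r%:Z -> D x b = 0) ->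
  exists z, [/\ tot K k z, forall b, b < p + 1 -> z b = 0 & forall b, D z b = D x b].
Proof.
(* Beyond filtration [p + r + N] the degree [k + 1 - b - b] is below [-q], so the remaining
   differential is 0. *)
move=> r0 tx xp Dxp; pose N := (`|p| + `|k| + q + 1)%N.
have [z [tz zp Dz]] := strict_upto N r0 tx xp Dxp; exists z; split=> // b.
apply/esym/eqP; rewrite -subr_eq0 -(tot_d_sub b tx tz); apply/eqP.
have [bp|bp] := ltP b (p + (r + N)%:Z); first exact: Dz.
apply: Bout (tot_dB (totB tx tz) b).
by rewrite mem_degrees /N in bp *; lia.
Qed.

(** The filtration of the cochain rises by one at a time, while that of its differential stays at 0
    or more; with lowest filtration [- M.+1] this puts it on page [M.+1]. *)
Let strict_iter (M : nat) k (x : int -> V) : tot K k x ->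
  (forall b, b < - M%:Z -> x b = 0) -> (forall b, b < 0 -> D x b = 0) ->
  exists z, [/\ tot K k z, forall b, b < 0 -> z b = 0 & forall b, D z b = D x b].
Proof.
elim: M x => [|M IH] x tx xM Dx0; first by exists x; split=> // b b0; apply: xM; lia.
have [|z [tz zM Dz]] := @strict M.+1 (- M.+1%:Z) k x (ltn0Sn _) tx xM.
  by move=> b bM; apply: Dx0; lia.
have [||z' [tz' z0 Dz']] := IH z tz.
- by move=> b bM; apply: zM; lia.
- by move=> b b0; rewrite Dz; exact: Dx0.
by exists z'; split=> // b; rewrite Dz'.
Qed.

(* A primitive [v] of [w] becomes the total cochain [b |-> v_(j - 1 - 2 b)] of
   degree [j - 1], whose differential is [w] placed in filtration [0]. *)
Let exact_below j w : B j w -> (d @` A) w ->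
  exists u, [/\ A u, d u = w & forall l, j <= l -> comp u l = 0].
Proof.
move=> Bw [v Av dv]; pose k := j - 1; pose x b := comp v (k - b - b).
have tx : tot K k x by apply/totP => b; exact: compB.
have Dx b : D x b = if b == 0 then w else 0.
  have -> : D x b = comp (d v) (k - b - b + 1).
    rewrite comp_d // /tot_d /x; congr (d_up (comp v _) + d_down (comp v _)); lia.
  rewrite dv (comp_B _ Bw); have -> : (k - b - b + 1 == j) = (b == 0) by apply/eqP/eqP; lia.
  by [].
(* Below filtration [- N] the degree exceeds [q]. *)
pose N := (`|k| + q + 1)%N.
have [||x' [tx' x'0 Dx']] := @strict_iter N k x tx.
- by move=> b bN; apply: comp_out => //; rewrite mem_degrees; lia.
- by move=> b b0; rewrite Dx ifF //; apply/eqP; lia.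
have /totP x'B := tx'.
(* Back from cochains to forms: degree [l] sits in filtration [(k - l) / 2], provided that [k - l]
   is even; [cu] is 0 in degrees of the other parity. *)
pose hf m : int := (m %/ 2)%Z.
have hfE b : hf (b + b) = b by rewrite /hf; lia.
pose cu l := if k - l == hf (k - l) + hf (k - l) then x' (hf (k - l)) else 0.
have cuB l : B l (cu l).
  rewrite /cu; case: eqP => [e|_]; last exact: B0.
  by have := x'B (hf (k - l)); have -> : k - hf (k - l) - hf (k - l) = l by lia.
pose u := \sum_(l <- ds) cu l; have cuE : comp u = cu by exact: comp_uniq.
have Au : A u by apply: A_sum => l; exact: BA (cuB l).
exists u; split=> // [|l jl]; last first.
  rewrite cuE /cu; case: eqP => // e; apply: x'0; lia.
have Aw := BA Bw; apply: comp_eq => // [|l]; first exact: dA.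
rewrite comp_d // cuE (comp_B l Bw).
have [[b e]|nb] := pselect (exists b, k - (l - 1) = b + b).
  have -> : cu (l - 1) = x' b by rewrite /cu e hfE eqxx.
  have -> : cu (l + 1) = x' (b - 1).
    by rewrite /cu (_ : k - (l + 1) = (b - 1) + (b - 1)) ?hfE ?eqxx //; lia.
  rewrite -[LHS]/(D x' b) Dx' Dx; have -> // : (b == 0) = (l == j).
  by apply/eqP/eqP; lia.
have -> : cu (l - 1) = 0.
  by rewrite /cu ifF //; apply/eqP => e; apply: nb; exists (hf (k - (l - 1))).
have -> : cu (l + 1) = 0.
  rewrite /cu ifF //; apply/eqP => e; apply: nb; exists (hf (k - (l + 1)) + 1).
  by move: e; move: (hf _) => b e; lia.
rewrite del0 delbar0 addr0 ifF //; apply/eqP => lj; apply: nb; exists 0.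
by lia.
Qed.

Hypothesis dec : forall w, A w -> d w = 0 ->
  exists2 c, forall j, B j (c j) /\ d (c j) = 0 & (d @` A) (w - \sum_(k <- ds) c k).

Let exact_deldelbar j w : B j w -> (d @` A) w -> exists2 v, B j v & w = d_up (d_down v).
Proof.
move=> Bw dw; have [u [Au du uj]] := exact_below Bw dw.
have dcw : (d @` A) (cj w).
  by have [v Av dv] := dw; exists (cj v); [exact: cjA|rewrite cjd // dv].
have [u' [Au' du' uj']] := exact_below (cjB Bw) dcw.
pose u2 := cj u'; have Au2 : A u2 by exact: cjA.
have du2 : d u2 = w by rewrite /u2 cjd // du' cjK.
have u20 : comp u2 (j - 1) = 0 by rewrite comp_cj // uj' ?cj0 //; lia.
have Ae : A (u - u2) by exact: AB.
have [|c cP [v Av dv]] := dec Ae.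
  by rewrite dD //; [rewrite dN // du du2 subrr|exact: AN].
exists (comp v j); first exact: compB.
have cB k : B k (c k) by case: (cP k).
have As : A (\sum_(k <- ds) c k) by apply: A_sum => k; exact: BA (cB k).
(* In degree [j - 1] the difference [u - u2] is that component of [u], because [u2] lives above [j].
   Applying del removes the closed component [c (j - 1)] and the del-exact part of [d v], leaving
   del delbar of the component [j] of [v]; on the other side del of the component of [u] is [w]. *)
have := congr1 (fun z => d_up (comp z (j - 1))) dv.
rewrite /= comp_d // compD //; last exact: AN.
rewrite compD //; last exact: AN.
rewrite !compN // u20 subr0 comp_uniq //.
have a1 l : A (comp v l) by exact: BA (compB l Av).
rewrite delD; [|exact: delA|exact: delbarA].
rewrite deldel // add0r delD; [|exact: BA (compB _ Au)|by apply: AN; exact: BA (cB _)].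
rewrite delN; last exact: BA (cB _).
have [-> _] := closed_B (cB (j - 1)) (cP (j - 1)).2; rewrite subr0.
have -> : j - 1 + 1 = j by lia.
move=> ->; have := comp_d j Au; rewrite du (comp_B j Bw) eqxx => {1}->.
by rewrite (uj (j + 1)) ?delbar0 ?addr0 //; lia.
Qed.

Hypothesis dec_uniq : forall c, (forall j, B j (c j) /\ d (c j) = 0) ->
  (d @` A) (\sum_(k <- ds) c k) -> forall j, (d @` A) (c j).

Let i_unit : ('i%C : C) != 0. Proof. exact: Ci_neq0. Qed.

Let sum_deldelbar (c : int -> V) : (forall j, exists2 v, B j v & c j = d_up (d_down v)) ->
  [set (d \o d_twist) x | x in A] (\sum_(k <- ds) c k).
Proof.
move=> /(fun h => @choice _ _ _ (fun j => let: ex_intro2 v Bv e := h j in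
  ex_intro (fun v => B j v /\ c j = d_up (d_down v)) v (conj Bv e)))[v vP].
have Av k : A (v k) by have [Bv _] := vP k; exact: BA Bv.
exists ((2 * 'i%C)^-1 *: \sum_(k <- ds) v k); first by apply: AZ; exact: A_sum.
have As : A (\sum_(k <- ds) v k) by exact: A_sum.
rewrite /= ddJE; last exact: AZ.
rewrite delbarZ // delZ; last exact: delbarA.
rewrite scalerA divff ?scale1r; last by rewrite mulf_neq0 // pnatr_eq0.
rewrite [RHS](eq_bigr (fun k => d_up (d_down (v k)))); last by move=> k _; case: (vP k).
suff h (s : seq int) : d_up (d_down (\sum_(k <- s) v k)) = \sum_(k <- s) d_up (d_down (v k)) by [].
elim: s => [|k s IH]; first by rewrite !big_nil delbar0 del0.
have a1 : A (\sum_(k <- s) v k) by exact: A_sum.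
by rewrite !big_cons delbarD // delD ?IH //; exact: delbarA.
Qed.

Lemma ddJ_of_degenerate :
  let Im op : set V := op @` A in
  let Ker op : set V := A `&` op @^-1` [set 0] in
  Im (d \o d_twist) = Im d `&` Ker d_twist /\ Im d `&` Ker d_twist = Ker d `&` Im d_twist.
Proof.
move=> Im Ker.
have s1 w : Im (d \o d_twist) w -> (Im d `&` Ker d_twist) w.
  move=> [u Au <-] /=; have a1 := dJA Au; split; first by exists (d_twist u).
  by split; [exact: dA|rewrite /Ker /= dJdE // dJdJ // d0 oppr0].
have s2 w : Im (d \o d_twist) w -> (Ker d `&` Im d_twist) w.
  move=> [u Au <-] /=; have a1 := dJA Au; split; first by split; [exact: dA|exact: dd].
  by exists (- d u); [apply: AN; exact: dA|rewrite dJN ?dJdE ?opprK //; exact: dA].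
have t1 w : (Im d `&` Ker d_twist) w -> Im (d \o d_twist) w.
  move=> [[v Av dv] [Aw dJw]]; have dw : d w = 0 by rewrite -dv dd.
  have cl j := closed_comp j Aw dw dJw.
  rewrite (comp_sum Aw); apply: sum_deldelbar => j.
  apply: exact_deldelbar; first exact: compB.
  apply: (dec_uniq (c := comp w)).
    move=> l; split; first exact: compB.
    by have [e1 e2] := cl l; rewrite d_E ?e1 ?e2 ?addr0 //; exact: BA (compB l Aw).
  by exists v => //; rewrite dv -comp_sum.
have t2 w : (Ker d `&` Im d_twist) w -> Im (d \o d_twist) w.
  move=> [[Aw dw] [v Av dJv]]; have dJw : d_twist w = 0 by rewrite -dJv dJdJ.
  have cl j := closed_comp j Aw dw dJw.
  rewrite (comp_sum Aw); apply: sum_deldelbar => j.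
  apply: exact_deldelbar; first exact: compB.
  (* Multiplying degree [l] by the power [-l] of i intertwines the two differentials up to sign:
     [a (l - 1)] and [a (l + 1)] are i and -i times [a l], so d of the rescaled [v] is minus the
     rescaled d^J v. A d^J-exact form thus becomes d-exact. *)
  pose a (l : int) : C := 'i%C ^ (- l).
  have a0 l : a l != 0 by exact: expfz_neq0.
  have aS l : a (l - 1) = 'i%C * a l.
    by rewrite /a (_ : - (l - 1) = 1 + - l) ?expfzDr //; lia.
  have aP l : a (l + 1) = - 'i%C * a l.
    apply: (mulfI i_unit); rewrite -aS addrK.
    by rewrite mulrA mulrN mul_Ci opprK mul1r.
  have e : (d @` A) (\sum_(l <- ds) a l *: comp w l).
    have Bu l : B l (a l *: comp v l) by apply: BZ; exact: compB.
    have Au : A (\sum_(l <- ds) a l *: comp v l) by apply: A_sum => l; exact: BA (Bu l).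
    have Bs l : B l (a l *: comp w l) by apply: BZ; exact: compB.
    have As : A (\sum_(l <- ds) a l *: comp w l) by apply: A_sum => l; exact: BA (Bs l).
    exists (- \sum_(l <- ds) a l *: comp v l); first exact: AN.
    apply: comp_eq => // [|l]; first by apply: dA; exact: AN.
    rewrite dN // compN; last exact: dA.
    rewrite comp_d // (comp_uniq Bu) (comp_uniq Bs) delZ; last exact: BA (compB _ Av).
    rewrite delbarZ; last exact: BA (compB _ Av).
    have a1 := delA Av; have a2 := delbarA Av.
    rewrite -dJv /d_twist compZ; last exact: AB.
    rewrite compD //; last exact: AN.
    rewrite compN // comp_del // comp_delbar // aS aP.
    rewrite scalerBr -scaleNr scalerDr !scalerA opprD -!scaleNr addrC.
    congr (_ *: _ + _ *: _); last by apply: etrans (mulrC _ _).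
    by apply: etrans (mulrC _ _); rewrite opprK.
  have cle l : B l (a l *: comp w l) /\ d (a l *: comp w l) = 0.
    have Al := BA (compB l Aw); split; first by apply: BZ; exact: compB.
    by have [e1 e2] := cl l; rewrite dZ // d_E // e1 e2 addr0 scaler0.
  have [u Au du] := dec_uniq cle e j.
  exists ((a j)^-1 *: u); first exact: AZ.
  by rewrite dZ // du scalerA mulVf ?scale1r.
split; apply/seteqP; split=> w h; [exact: s1|exact: t1|exact: s2 (t1 _ h)|exact: s1 (t2 _ h)].
Qed.

End Degenerate.

(** * From the dd^J-lemma to degeneration and decomposition *)

Section DdJ.
Hypothesis hdec : let Im op : set V := op @` A in
  let Ker op : set V := A `&` op @^-1` [set 0] in
  Im (d \o d_twist) = Im d `&` Ker d_twist /\ Im d `&` Ker d_twist = Ker d `&` Im d_twist.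

Let ddJ1 w : A w -> (d @` A) w -> d_twist w = 0 -> exists2 u, A u & w = (2 * 'i%C) *: d_up (d_down u).
Proof.
move=> Aw dw dJw; have [e _] := hdec.
have [u Au <-] : [set (d \o d_twist) x | x in A] w by rewrite e.
by exists u => //; rewrite /= ddJE.
Qed.

Let ddJ2 w : A w -> (d_twist @` A) w -> d w = 0 -> exists2 u, A u & w = d (d_twist u).
Proof.
move=> Aw dw dJw; have [e1 e2] := hdec.
have [u Au <-] : [set (d \o d_twist) x | x in A] w by rewrite e1 e2.
by exists u.
Qed.

Lemma degenerate_of_ddJ : degenerates_at_first_page K d_up d_down.
Proof.
move=> r p k r0 x [[tx xp] [tDx Dxp]].
have /totP xB := tx.
pose j := k - p - p.
have Axp : A (x p) by exact: BA (xB p).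
have xp1 : x (p - 1) = 0 by apply: xp; lia.
(* As [r > 0], the differential of [x] vanishes in filtration [p], where only del of the leading
   term contributes. *)
have Dp : d_up (x p) = 0.
  by have := Dxp p; rewrite /tot_d xp1 delbar0 addr0; apply; lia.
have e1 : d (x p) = d_down (x p) by rewrite d_E // Dp add0r.
have A1 := delbarA Axp.
have [||u Au eu] := ddJ1 A1.
- by exists (x p).
- by rewrite /d_twist dbardbar // -[d_up _]opprK -anti // Dp delbar0 oppr0 subrr scaler0.
(* Since d d^J = 2 i del delbar, this [v] satisfies del v = delbar (x p), and it is
   delbar-closed. *)
pose v := (2 * 'i%C) *: d_down (comp u (j - 1)).
have Bu := compB (j - 1) Au; have Auj := BA Bu; have Bv' := BZ (2 * 'i%C) (delbarB Bu).
have Bv : B (k - (p + 1) - (p + 1)) v.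
  by have -> // : k - (p + 1) - (p + 1) = j - 1 - 1 by rewrite /j; lia.
have Av := BA Bv.
have dv0 : d_down v = 0 by rewrite delbarZ ?dbardbar ?scaler0 //; exact: delbarA.
have dv1 : d_up v = d_down (x p).
  have Bx := delbarB (xB p).
  have := congr1 (fun z => comp z (j - 1)) eu; rewrite /= (comp_B _ Bx) eqxx => ->.
  have a1 := delbarA Au; have a2 := delA a1.
  rewrite compZ // comp_del // comp_delbar // delZ; last exact: delbarA.
  by have -> : j - 1 - 1 + 1 = j - 1 by lia.
(* A zigzag of length two: [- v] cancels delbar of the leading term, and nothing is left to cancel
   afterwards. Hence it is a total cycle with leading term [x p]. *)
pose x' b := if b == p then x p else if b == p + 1 then - v else 0.
have x'B b : B (k - b - b) (x' b).
  rewrite /x'; case: eqP => [->|_] //; case: eqP => [->|_]; [exact: BN|exact: B0].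
have tx' : tot K k x' by apply/totP.
have x'p : x' p = x p by rewrite /x' eqxx.
have x'p1 : x' (p + 1) = - v by rewrite /x' ifF ?eqxx //; apply/eqP; lia.
have x'0 b : b != p -> b != p + 1 -> x' b = 0 by rewrite /x' => /negPf -> /negPf ->.
have Dx' b : D x' b = 0.
  rewrite /tot_d; have [->|bp] := eqVneq b p.
    by rewrite x'p Dp add0r (x'0 (p - 1)) ?delbar0 //; apply/eqP; lia.
  have [->|bp1] := eqVneq b (p + 1).
    by rewrite x'p1 addrK x'p delN // dv1 addNr.
  rewrite (x'0 b) // del0 add0r.
  have [->|bp2] := eqVneq b (p + 2).
    have -> : p + 2 - 1 = p + 1 by lia.
    by rewrite x'p1 delbarN // dv0 oppr0.
  by rewrite x'0 ?delbar0 //; apply/eqP; move/eqP: bp bp1 bp2; lia.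
pose z b := x b - x' b; have tz : tot K k z by exact: totB.
have Dz b : D z b = D x b by rewrite (tot_d_sub b tx tx') Dx' subr0.
have z0 b : b < p + 1 -> z b = 0.
  move=> bp1; rewrite /z; have [->|bp] := eqVneq b p; first by rewrite x'p subrr.
  by rewrite xp ?x'0 ?subrr //; move: bp bp1; lia.
(* The boundary is [D z] with [z = x - x'] of filtration [p + 1]; the summand of higher filtration
   is 0. *)
exists (fun=> 0).
  split; first by split=> //; apply/totP => b; exact: B0.
  have D0 : D (fun=> 0) = fun=> 0 by apply/funext => b; rewrite /tot_d del0 delbar0 addr0.
  by rewrite D0; split=> //; apply/totP => b; exact: B0.
exists z; last by apply/funext => b; rewrite -[LHS]/(0 + D z b) add0r Dz.
split.
  split; first by have -> : k + 1 - 1 = k by lia.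
  by move=> b bp; apply: z0; lia.
split; first by apply/totP; apply: tot_dB; have -> : k + 1 - 1 = k by lia.
by move=> b bp; rewrite Dz; apply: Dxp; lia.
Qed.

Lemma decomposition_of_ddJ :
  (forall w, A w -> d w = 0 ->
    exists2 c, forall j, B j (c j) /\ d (c j) = 0 & (d @` A) (w - \sum_(k <- ds) c k)) /\
  (forall c, (forall j, B j (c j) /\ d (c j) = 0) ->
    (d @` A) (\sum_(k <- ds) c k) -> forall j, (d @` A) (c j)).
Proof.
split=> [w Aw dw|c cP dc j].
  (* As d and d^J anticommute, d^J w is closed, so it equals d d^J u; the same sign rule makes
     [w + d u] closed under d^J. *)
  have [||u Au eu] := ddJ2 (dJA Aw).
  - by exists w.
  - by rewrite -[LHS]opprK -dJdE // dw /d_twist del0 delbar0 subrr scaler0 oppr0.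
  have Adu := dA Au; pose w' := w + d u; have Aw' : A w' by exact: AD.
  have dw' : d w' = 0 by rewrite dD // dw dd // addr0.
  have dJw' : d_twist w' = 0.
    by rewrite dJD // dJdE // -eu subrr.
  exists (comp w').
    move=> j; split; first exact: compB.
    have [e1 e2] := closed_comp j Aw' dw' dJw'.
    by rewrite d_E ?e1 ?e2 ?addr0 //; exact: BA (compB j Aw').
  rewrite -comp_sum // /w' opprD addrA subrr add0r; exists (- u); [exact: AN|exact: dN].
have cB l : B l (c l) by case: (cP l).
have As : A (\sum_(k <- ds) c k) by apply: A_sum => l; exact: BA (cB l).
have [|u Au eu] := ddJ1 As dc.
  rewrite /d_twist; apply/eqP; rewrite scaler_eq0; apply/orP; right; rewrite subr_eq0; apply/eqP.
  have z l : d_up (c l) = 0 /\ d_down (c l) = 0 by apply: closed_B (cB l) (cP l).2.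
  apply: comp_eq => [||l]; [exact: delbarA|exact: delA|].
  by rewrite comp_del // comp_delbar // comp_uniq // (z _).1 (z _).2.
have Auj : A (comp u j) by exact: BA (compB j Au).
(* del delbar preserves the degree, so the component [j] of the identity for the sum is d d^J of the
   component [j] of [u]. *)
exists (d_twist (comp u j)); first exact: dJA.
have := congr1 (fun z => comp z j) eu; rewrite /= comp_uniq // => ->.
have a1 := delbarA Au; have a2 := delA a1.
rewrite ddJE // compZ // comp_del // comp_delbar //.
by have -> : j - 1 + 1 = j by lia.
Qed.

End DdJ.

End DoubleComplexTheorem.

(** * The equivalence for basic forms *)

Section FoliationTheorem.
Variables (R : realType) (n q : nat) (M : manifold R n).
Variables (T0 : manifold R (2 * q)) (F : foliation M T0).
Variables (J : transverse_gen_complex F).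
Variable Phi : fidx F -> T0 -> set (ext R (2 * q)).
Hypothesis hPhi : is_spinor_line J Phi.
Local Notation form := (M -> ext R n).
Local Notation comp := (components J Phi).

(** [components] is a choice with default 0; the existence of a decomposition makes the choice
    meaningful on basic forms. *)
Let componentsP (w : form) : basic_form F w ->
  (forall j, basicU J Phi j (comp w j)) /\ w = \sum_(k <- degrees q) comp w k.
Proof.
move=> /(basicU_decomposition hPhi)[c cU e].
have h : [set c | (forall j, basicU J Phi j (c j)) /\ w = sumU q c] c.
  by split=> //; rewrite sumUE.
have [cU' e'] := xgetPex (fun=> 0) (ex_intro _ c h).
by split; [exact: cU'|rewrite -sumUE; exact: e'].
Qed.

Let basic_dD (w t : form) : basic_form F w -> basic_form F t ->
  ext_d (w + t) = ext_d w + ext_d t.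
Proof.
move=> bw bt; apply/funext => x; have xT : [set: M] x by [].
exact: ext_dD xT (basic_form_smooth bw) (basic_form_smooth bt).
Qed.

Let basic_dZ (c : R[i]) (w : form) : basic_form F w -> ext_d (c *: w) = c *: ext_d w.
Proof.
move=> bw; apply/funext => x; have xT : [set: M] x by [].
have e := ext_dZ c xT (basic_form_smooth bw); exact: e.
Qed.

Let basic_dd (w : form) : basic_form F w -> ext_d (ext_d w) = 0.
Proof.
move=> bw; apply/funext => x; have xT : [set: M] x by [].
exact: ext_d_sqr openT xT (basic_form_smooth bw).
Qed.

Let basic_d_conj (w : form) : basic_form F w -> ext_d (formconj w) = formconj (ext_d w).
Proof.
move=> bw; apply/funext => x; have xT : [set: M] x by [].
exact: ext_d_conj xT (basic_form_smooth bw).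
Qed.

Let comp_degree (j : int) (w : form) (k : int) : basicU J Phi j w -> k != j + 1 -> k != j - 1 ->
  comp (ext_d w) k = 0.
Proof.
move=> Bw; have [cU e] := componentsP (basic_form_d (basicU_basic Bw)).
exact: (basicU_d_degree hPhi Bw cU e).
Qed.

Let delE : del J Phi = d_up q (@ext_d _ _ M) comp.
Proof. by apply/funext => w; exact: sumUE. Qed.

Let delbarE : delbar J Phi = d_down q (@ext_d _ _ M) comp.
Proof. by apply/funext => w; exact: sumUE. Qed.

Let dJE : dJ J Phi = d_twist q (@ext_d _ _ M) comp.
Proof. by apply/funext => w; rewrite /dJ delE delbarE. Qed.

Let cjD : {morph (@formconj R n M) : w t / w + t}.
Proof. by move=> w t; apply/funext => x; exact: extconjD. Qed.

Let cjK : involutive (@formconj R n M).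
Proof. by move=> w; apply/funext => x; exact: extconjK. Qed.

Let compB (w : form) j : basic_form F w -> basicU J Phi j (comp w j).
Proof. by move=> bw; exact: (componentsP bw).1. Qed.

Let comp_sum (w : form) : basic_form F w -> w = \sum_(k <- degrees q) comp w k.
Proof. by move=> bw; exact: (componentsP bw).2. Qed.

Lemma ddJ_lemma_iff : ddJ_lemma J Phi <->
  canonical_ss_degenerates J Phi /\ U_decomposes_cohomology J Phi.
Proof.
rewrite /ddJ_lemma /canonical_ss_degenerates /U_decomposes_cohomology delE delbarE dJE.
have AD := @basic_formD _ _ _ _ _ F; have AZ := @basic_formZ _ _ _ _ _ F.
have BA := @basicU_basic _ _ _ _ _ _ J Phi; have BD := basicUD hPhi.
have BZ := basicUZ hPhi; have B0 := basicU0 hPhi.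
have Bout := basicU_out hPhi; have Bu := basicU_unique hPhi.
have dA := @basic_form_d _ _ _ _ _ F.
split=> [h|[deg [dec uniq]]].
  split.
    exact: (degenerate_of_ddJ AD AZ BA BD BZ B0 Bout Bu compB comp_sum dA basic_dZ
      basic_dD basic_dd comp_degree h).
  have [dec uniq] := decomposition_of_ddJ AD AZ BA BD BZ B0 Bout Bu compB comp_sum dA
    basic_dZ basic_dD basic_dd comp_degree h.
  split=> [w bw dw|c cU].
    by have [c cU e] := dec w bw dw; exists c; [exact: cU|rewrite sumUE; exact: e].
  by rewrite sumUE; exact: uniq.
apply: (ddJ_of_degenerate AD AZ BA BD BZ B0 Bout Bu compB comp_sum dA basic_dZ
  basic_dD basic_dd comp_degree (basicU_conj hPhi) cjD cjK basic_d_conj deg).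
  by move=> w bw dw; have [c cU e] := dec w bw dw; exists c; [exact: cU|rewrite -sumUE; exact: e].
by move=> c cU; rewrite -sumUE; exact: uniq.
Qed.

End FoliationTheorem.

Theorem theorem4p3 (R : realType) (n q : nat) (M : manifold R n)
    (T0 : manifold R (2 * q)) (F : foliation M T0)
    (J : transverse_gen_complex F)
    (Phi : fidx F -> T0 -> set (ext R (2 * q))) (hPhi : is_spinor_line J Phi) :
  ddJ_lemma J Phi <->
  canonical_ss_degenerates J Phi /\ U_decomposes_cohomology J Phi.
Proof. exact: ddJ_lemma_iff. Qed.
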